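(* Let $s>2$ and, for $\alpha>0$, let $T^*_\alpha>0$ (possibly $+\infty$) be the maximal existence time of the solution $\omega^\alpha\in C([0,T];H^{s+1}(\mathbb{R}^2))$ of the generalized SQG equation with parameter $\alpha$, $$\omega^{\alpha}_t+u^{\alpha}\cdot\nabla\omega^{\alpha}=0,\qquad u^{\alpha}=\nabla^{\perp}(-\Delta)^{-1+\alpha}\omega^{\alpha},\qquad \omega^\alpha(\cdot,0)=\omega_0,$$ where the initial data $\omega_0$ is the same for all $\alpha$. Then $$\limsup_{\alpha\to0+}T^*_\alpha=+\infty.$$
   Context: The equation is posed for $(x,t)\in\mathbb{R}^2\times\mathbb{R}^+$ with parameter $0\le\alpha\le\frac12$, and $\omega$ is a scalar unknown; $\alpha=0$ is the two-dimensional incompressible Euler equation in vorticity form. $\nabla^\perp=(-\partial_{x_2},\partial_{x_1})$, and $(-\Delta)^{-1+\alpha}$ is the Fourier multiplier with symbol $|\xi|^{-2+2\alpha}$; up to an omitted multiplicative constant, $u(x)=\int_{\mathbb{R}^2}\frac{(x-y)^\perp}{|x-y|^{2+2\alpha}}\omega(y)\,dy$. $H^r=H^r(\mathbb{R}^2)$ has norm $\|f\|_{H^r}=\|(I-\Delta)^{r/2}f\|_{L^2}$. *)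

(* Defs.v *)
From HB Require Import structures.
From mathcomp Require Import all_boot all_order all_algebra.
From mathcomp Require Import all_classical all_reals all_analysis.
From mathcomp Require Import complex.

Set Implicit Arguments.
Unset Strict Implicit.
Unset Printing Implicit Defensive.
Import Order.TTheory GRing.Theory Num.Theory.
Import numFieldNormedType.Exports.

Local Open Scope classical_set_scope.
Local Open Scope complex_scope.
Local Open Scope ring_scope.

Section generalized_SQG.
Context {R : realType}.

Definition leb2 :
    {measure set (measurableTypeR R * measurableTypeR R) -> \bar R} :=
  (@lebesgue_measure R \x @lebesgue_measure R)%E.

Definition dot (x y : R * R) : R := x.1 * y.1 + x.2 * y.2.

(* The canonical norm of the product R * R is the sup norm; the Euclidean norm
   is needed here. *)
Definition enorm (x : R * R) : R := Num.sqrt (dot x x).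

Definition perp (x : R * R) : R * R := (- x.2, x.1).

Definition expi (t : R) : R[i] := cos t +i* sin t.

Definition Cintegral (D : set (R * R)) (h : R * R -> R[i]) : R[i] :=
  (\int[leb2]_(x in D) complex.Re (h x)) +i*
  (\int[leb2]_(x in D) complex.Im (h x)).

Definition L2 (f : R * R -> R) : Prop := f \in Lfun leb2 2%:E.

(* \int_{|x| <= n} f(x) e^{- i x.xi} dx *)
Definition truncated_fourier (f : R * R -> R) (n : nat) (xi : R * R) : R[i] :=
  Cintegral [set x | enorm x <= n%:R]
    (fun x => (f x)%:C * expi (- dot x xi)).

(* The Fourier transform on L^2, as the L^2 limit of the transforms of the
   truncations; it exists and is unique up to a null set when f is in L^2. *)
Definition is_fourier (f : R * R -> R) (g : R * R -> R[i]) : Prop :=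
  [/\ measurable_fun setT (fun xi => complex.Re (g xi)),
      measurable_fun setT (fun xi => complex.Im (g xi)) &
      (\int[leb2]_xi ((Normc.normc (g xi - truncated_fourier f n xi)) ^+ 2)%:E)%E
        @[n --> \oo] --> 0%E].

Definition fourier (f : R * R -> R) : R * R -> R[i] :=
  xget (fun=> 0) [set g | is_fourier f g].

(* g = (I - Laplacian)^(r/2) f, for f and g in L^2 *)
Definition bessel (r : R) (f g : R * R -> R) : Prop :=
  [/\ L2 f, L2 g &
      {ae leb2, forall xi,
        fourier g xi = ((1 + enorm xi ^+ 2) `^ (r / 2))%:C * fourier f xi}].

(* H^r(R^2), for r >= 0 *)
Definition sobolev (r : R) (f : R * R -> R) : Prop := exists g, bessel r f g.

(* The functions g below agree almost everywhere, so the infimum is over a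
   single value; it is +oo when f is not in H^r. *)
Definition sobolev_norm (r : R) (f : R * R -> R) : \bar R :=
  ereal_inf [set 'N[leb2]_2%:E[EFin \o g]%E | g in [set g | bessel r f g]].

(* The velocity grad^perp (-Laplacian)^(-1+a) w, i.e. the Fourier multiplier
   with symbol i xi^perp |xi|^(-2+2a) applied to w. The inverse Fourier integral
   converges absolutely for 0 < a <= 1/2 and w in H^r, r > 1; it is real since w
   is real. *)
Definition velocity (a : R) (w : R * R -> R) (x : R * R) : R * R :=
  let symbol (xi : R * R) : R := enorm xi `^ (- 2 + 2 * a) in
  let inverse (m : R * R -> R) : R :=
    (2 * pi) ^- 2 * complex.Re (Cintegral setT
      (fun xi => 'i * (m xi * symbol xi)%:C * fourier w xi
                 * expi (dot x xi))) in
  (inverse (fun xi => (perp xi).1), inverse (fun xi => (perp xi).2)).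

(* w is in C([0,T]; H^r) *)
Definition continuous_sobolev (r T : R) (w : R -> R * R -> R) : Prop :=
  forall t : R, t \in `[0, T] ->
    sobolev r (w t) /\
    sobolev_norm r (w t' \- w t) @[t' --> within [set` `[0, T]] (nbhs t)]
      --> 0%E.

(* The equation is required pointwise: for r > 2, elements of H^r have C^1
   representatives. Initial data are elements of H^r, hence the a.e. equality. *)
Definition gSQG_solution (a r T : R) (w0 : R * R -> R) (w : R -> R * R -> R) :
    Prop :=
  [/\ continuous_sobolev r T w,
      {ae leb2, forall x, w 0 x = w0 x} &
      forall (t : R) (x : R * R), t \in `]0, T[ ->
        [/\ derivable (w^~ x) t 1,
            differentiable (w t) x &
            'D_1 (w^~ x) t
            + (velocity a (w t) x).1 * 'D_((1, 0) : R * R) (w t) x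
            + (velocity a (w t) x).2 * 'D_((0, 1) : R * R) (w t) x = 0]].

Definition max_existence_time (r : R) (w0 : R * R -> R) (a : R) : \bar R :=
  ereal_sup [set T%:E | T in
    [set T : R | 0 < T /\ exists w, gSQG_solution a r T w0 w]].

End generalized_SQG.

(* Main.v *)
(* It suffices to build, for every fixed T, solutions on [0,T] for all small alpha.
   Everything is done on the frequency side with the Hartley transform (kernel
   cos + sin), which keeps real functions real; an explicit Euler scheme with the
   frequency cutoff |xi| <= L makes every iterate an elementary object, so that no
   local existence theory is needed. Along the scheme, up to errors that vanish
   with the step: the L^2 norm is conserved; the vorticity is transported by an
   almost Lipschitz flow, so its sup norm is conserved and its Lipschitz constant
   grows at most double exponentially, by the logarithmic estimate
     |grad u| <= C (|w|_2 + |w|_oo (1 + log (1 + |grad w|_oo)) + alpha |xi w^|_1 + ...);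
   hence |xi w^|_2 is controlled, hence |w^|_1 with only a logarithm of the H^r norm,
   and the H^r norm is controlled by a commutator estimate whose growth rate is
   |(1 + 2 alpha |xi|) w^|_1. The terms carrying alpha are bounded by alpha times the
   H^r norm, so on [0,T] they stay below 1 once alpha is small: this bootstrap gives an
   H^r bound uniform in the step, on an interval [0,T] chosen before alpha. Comparing
   consecutive dyadic refinements in L^2, and the tails of the H^r norm by the same
   commutator estimate with truncated weights, the iterates converge in C([0,T]; H^r),
   and the limit solves the equation pointwise. *)
From HB Require Import structures.
Require Import Defs.
From mathcomp Require Import all_boot all_order all_algebra.
From mathcomp Require Import all_classical all_reals all_analysis.
From mathcomp Require Import measurable_realfun complex ring lra.
Set Implicit Arguments.
Unset Strict Implicit.
Unset Printing Implicit Defensive.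
Import Order.TTheory GRing.Theory Num.Theory.
Import numFieldNormedType.Exports.
Local Open Scope classical_set_scope.
Local Open Scope ring_scope.

(** The obstacle is uniformity as alpha tends to 0. The velocity symbol has modulus |xi|^(-1 + 2
    alpha), whose square is integrable near the origin only for alpha > 0, with an integral that
    blows up in the limit. So every bound through the size of the velocity ([ca], [Cb]) is confined
    to discretization errors, which a smaller step absorbs once alpha is fixed. The growth is
    decided by what survives at alpha = 0: the antisymmetry of the kernel, the gradient of the
    velocity, and |xi|^(2 alpha) <= 1 + 2 alpha |xi|, which turns the extra 2 alpha derivatives into
    alpha times the L^1 norm of |xi| w^. The condition r = s + 1 > 3 makes (1 + |xi|)^2 w^
    integrable: that L^1 norm is then controlled by the H^r norm, and second order Taylor expansions
    hold pointwise. The a priori bounds form one predicate on a single iterate. Its validity at time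
    t + h follows from its validity at time t, so the continuity argument of a bootstrap becomes an
    induction on the steps. *)

Lemma eq_lexx (V : numDomainType) (x y : V) : x = y -> x <= y.
Proof. by move=> ->. Qed.

(** * Real-valued integrals *)

Section integrability.
Context d (T : measurableType d) (R : realType).
Variable mu : {measure set T -> \bar R}.
Implicit Types f g : T -> R.

Definition itg f := mu.-integrable setT (EFin \o f).
Definition Int f : R := \int[mu]_x f x.

Lemma itg_meas f : itg f -> measurable_fun setT f.
Proof. by move=> /measurable_int /measurable_EFinP. Qed.

Lemma itg_le f g : measurable_fun setT f -> (forall x, `|f x| <= g x) ->
  itg g -> itg f.
Proof.
move=> mf fg ig; apply: (le_integrable measurableT _ _ ig).
  exact/measurable_EFinP.
by move=> x _ /=; rewrite lee_fin (le_trans (fg x))// ler_norm.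
Qed.

Lemma itg0 : itg (fun=> 0).
Proof. exact: (@integrable0 _ _ _ mu setT). Qed.

Lemma itgD f g : itg f -> itg g -> itg (fun x => f x + g x).
Proof. by move=> If Ig; have := integrableD measurableT If Ig. Qed.

Lemma itgB f g : itg f -> itg g -> itg (fun x => f x - g x).
Proof. by move=> If Ig; have := integrableB measurableT If Ig. Qed.

Lemma itgN f : itg f -> itg (fun x => - f x).
Proof. by move=> If; have := integrableN If. Qed.

Lemma itgZ k f : itg f -> itg (fun x => k * f x).
Proof. by move=> If; have := integrableZl measurableT k If. Qed.

Lemma itgZr k f : itg f -> itg (fun x => f x * k).
Proof.
move=> If; have := itgZ k If; congr itg; apply/funext => x; exact: mulrC.
Qed.

Lemma itg_abs f : itg f -> itg (fun x => `|f x|).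
Proof. by move=> If; have := integrable_norm If. Qed.

Lemma IntE f : itg f -> (\int[mu]_x (f x)%:E)%E = (Int f)%:E.
Proof.
move=> If; rewrite /Int /Rintegral fineK//.
exact: (integrable_fin_num measurableT If).
Qed.

Lemma eq_Int f g : f =1 g -> Int f = Int g.
Proof. by move=> fg; apply: eq_Rintegral => x _; exact: fg. Qed.

Lemma IntD f g : itg f -> itg g -> Int (fun x => f x + g x) = Int f + Int g.
Proof. by move=> If Ig; apply: RintegralD. Qed.

Lemma IntB f g : itg f -> itg g -> Int (fun x => f x - g x) = Int f - Int g.
Proof. by move=> If Ig; apply: RintegralB. Qed.

Lemma IntZ k f : itg f -> Int (fun x => k * f x) = k * Int f.
Proof. by move=> If; apply: RintegralZl. Qed.

Lemma IntZr k f : itg f -> Int (fun x => f x * k) = Int f * k.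
Proof. by move=> If; apply: RintegralZr. Qed.

Lemma Int0 : Int (fun=> 0) = 0.
Proof. by rewrite /Int /Rintegral integral0. Qed.

Lemma IntN f : itg f -> Int (fun x => - f x) = - Int f.
Proof.
move=> If; rewrite -mulN1r -(IntZ _ If); apply: eq_Int => x.
by rewrite mulN1r.
Qed.

Lemma le_Int f g : itg f -> itg g -> (forall x, f x <= g x) -> Int f <= Int g.
Proof. by move=> If Ig fg; apply: le_Rintegral => // x _. Qed.

Lemma Int_ge0 f : (forall x, 0 <= f x) -> 0 <= Int f.
Proof. by move=> f0; apply: Rintegral_ge0. Qed.

Lemma normr_Int_le f : itg f -> `|Int f| <= Int (fun x => `|f x|).
Proof. by move=> If; apply: le_normr_Rintegral. Qed.

Lemma normr_Int_le2 f g : measurable_fun setT f -> itg g ->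
  (forall x, `|f x| <= g x) -> `|Int f| <= Int g.
Proof.
move=> mf Ig fg; have If := itg_le mf fg Ig.
by rewrite (le_trans (normr_Int_le If))// le_Int//; exact: itg_abs.
Qed.

Lemma itg_ltyP f : measurable_fun setT f -> (forall x, 0 <= f x) ->
  (\int[mu]_x (f x)%:E < +oo)%E -> itg f.
Proof.
move=> mf f0 fy; apply/integrableP; split; first exact/measurable_EFinP.
by under eq_integral do rewrite /= ger0_norm//.
Qed.

Lemma itg_lty f : itg f -> (forall x, 0 <= f x) ->
  (\int[mu]_x (f x)%:E < +oo)%E.
Proof. by move=> If f0; rewrite IntE// ltry. Qed.

Lemma Int_eq0 f : itg f -> (forall x, 0 <= f x) -> Int f = 0 ->
  {ae mu, forall x, f x = 0}.
Proof.
move=> If f0 If0.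
have mf : measurable_fun setT (EFin \o f) by exact/measurable_EFinP/itg_meas.
have := ae_eq_integral_abs mu measurableT mf.
move=> [+ _].
have -> : (\int[mu]_(x in [set: T]) `|(EFin \o f) x| = 0)%E.
  transitivity (\int[mu]_x (f x)%:E)%E.
    by apply: eq_integral => x _ /=; rewrite ger0_norm.
  by rewrite IntE// If0.
by move=> /(_ erefl); apply: filterS => x /(_ I)[].
Qed.

Lemma Int_ae_eq f g : measurable_fun setT f -> measurable_fun setT g ->
  {ae mu, forall x, f x = g x} -> Int f = Int g.
Proof.
move=> mf mg fg; rewrite /Int /Rintegral; congr fine.
apply: ae_eq_integral => //; try exact/measurable_EFinP.
by apply: filterS fg => x fgx _ /=; rewrite fgx.
Qed.

Lemma itg_ae_eq f g : measurable_fun setT g ->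
  {ae mu, forall x, f x = g x} -> itg f -> itg g.
Proof.
move=> mg fg If; have mf := itg_meas If.
apply/integrableP; split; first exact/measurable_EFinP.
move/integrableP: If => [_]; rewrite (_ : integral _ _ _ =
  (\int[mu]_x `|(g x)%:E|)%E)//.
apply: ae_eq_integral => //.
- by apply: measurableT_comp => //; exact/measurable_EFinP.
- by apply: measurableT_comp => //; exact/measurable_EFinP.
- by apply: filterS fg => x fgx _ /=; rewrite fgx.
Qed.

End integrability.

(** * Fubini for real-valued integrals *)

Section fubini.
Context d1 d2 (T1 : measurableType d1) (T2 : measurableType d2) (R : realType).
Variable m1 : {sigma_finite_measure set T1 -> \bar R}.
Variable m2 : {sigma_finite_measure set T2 -> \bar R}.
Implicit Types F : T1 * T2 -> R.

Lemma itg_prod_abs F : measurable_fun setT F ->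
  (\int[m1]_x \int[m2]_y (`|F (x, y)|)%:E < +oo)%E -> itg (m1 \x m2)%E F.
Proof.
move=> mF Fy; apply/(@integrable12ltyP _ _ _ _ _ m1 m2 (EFin \o F)) => //.
exact/measurable_EFinP.
Qed.

Lemma itg_prod_abs2 F : measurable_fun setT F ->
  (\int[m2]_y \int[m1]_x (`|F (x, y)|)%:E < +oo)%E -> itg (m1 \x m2)%E F.
Proof.
move=> mF Fy; apply/(@integrable21ltyP _ _ _ _ _ m1 m2 (EFin \o F)) => //.
exact/measurable_EFinP.
Qed.

Lemma measurable_Int1 F : itg (m1 \x m2)%E F ->
  measurable_fun setT (fun x => Int m2 (fun y => F (x, y))).
Proof.
by move=> /measurable_fubini_F mF; apply: measurableT_comp.
Qed.

Lemma measurable_Int2 F : itg (m1 \x m2)%E F ->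
  measurable_fun setT (fun y => Int m1 (fun x => F (x, y))).
Proof.
by move=> /measurable_fubini_G mF; apply: measurableT_comp.
Qed.

Lemma itg_ae1 F : itg (m1 \x m2)%E F ->
  {ae m1, forall x, itg m2 (fun y => F (x, y))}.
Proof. exact: ae_integrable1. Qed.

Lemma itg_ae2 F : itg (m1 \x m2)%E F ->
  {ae m2, forall y, itg m1 (fun x => F (x, y))}.
Proof. exact: ae_integrable2. Qed.

Lemma integrable_fubini_snd F : itg (m1 \x m2)%E F ->
  m2.-integrable setT (fun y => (\int[m1]_x (F (x, y))%:E)%E).
Proof.
move=> iF; have mF : measurable_fun setT (EFin \o F)  by move: iF => /measurable_int.
apply/integrableP; split; first exact: (measurable_fubini_G iF).
have hF : (\int[m2]_y \int[m1]_x `|(EFin \o F) (x, y)| < +oo)%E.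
  exact: (@integrable21ltyP _ _ _ _ _ m1 m2 _ mF).1 iF.
apply: le_lt_trans hF.
apply: ge0_le_integral => //.
- by apply: measurableT_comp => //; exact: (measurable_fubini_G iF).
- apply: (measurable_fun_fubini_tonelli_G (m1 := m1) (abse \o (EFin \o F))) => //=.
  exact: measurableT_comp.
- move=> y _; apply: le_abse_integral => //; exact: (measurableT_comp mF (pair2_measurable y)).
Qed.

(** The inner integral converges only for almost every x, and elsewhere [Int] takes a default value;
    integrability is therefore carried over almost everywhere from the extended-real marginal. *)
Lemma itg_Int1 F : itg (m1 \x m2)%E F ->
  itg m1 (fun x => Int m2 (fun y => F (x, y))).
Proof.
move=> iF; have iF1 := integrable_fubini_F iF.
apply/integrableP; split; first exact/measurable_EFinP/measurable_Int1.
move/integrableP: iF1 => [mF1]; rewrite (_ : integral _ _ _ =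
  (\int[m1]_x `|(Int m2 (fun y => F (x, y)))%:E|)%E)//.
apply: ae_eq_integral => //.
- by apply: measurableT_comp => //.
- by apply: measurableT_comp => //; exact/measurable_EFinP/measurable_Int1.
- apply: filterS (itg_ae1 iF) => x iFx _ /=.
  by have -> : fubini_F m2 (EFin \o F) x = (Int m2 (fun y => F (x, y)))%:E
    by exact: IntE.
Qed.

Lemma itg_Int2 F : itg (m1 \x m2)%E F ->
  itg m2 (fun y => Int m1 (fun x => F (x, y))).
Proof.
move=> iF; have iF1 := integrable_fubini_snd iF.
apply/integrableP; split; first exact/measurable_EFinP/measurable_Int2.
move/integrableP: iF1 => [mF1]; rewrite (_ : integral _ _ _ =
  (\int[m2]_x `|(Int m1 (fun y => F (y, x)))%:E|)%E)//.
apply: ae_eq_integral => //.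
- by apply: measurableT_comp => //.
- by apply: measurableT_comp => //; exact/measurable_EFinP/measurable_Int2.
- apply: filterS (itg_ae2 iF) => x iFx _ /=.
  by have -> : (\int[m1]_z (F (z, x))%:E = (Int m1 (fun y => F (y, x)))%:E)%E
    by exact: IntE.
Qed.

Lemma Int_prod1 F : itg (m1 \x m2)%E F ->
  Int (m1 \x m2)%E F = Int m1 (fun x => Int m2 (fun y => F (x, y))).
Proof.
move=> iF; apply: EFin_inj; rewrite -!IntE//; last exact: itg_Int1.
have := integral12_prod_meas1 iF => /= <-.
apply: ae_eq_integral => //.
- exact: (measurable_fubini_F iF).
- exact/measurable_EFinP/measurable_Int1.
- by apply: filterS (itg_ae1 iF) => x iFx _; exact: (IntE iFx).
Qed.

Lemma Int_prod2 F : itg (m1 \x m2)%E F ->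
  Int (m1 \x m2)%E F = Int m2 (fun y => Int m1 (fun x => F (x, y))).
Proof.
move=> iF; apply: EFin_inj; rewrite -!IntE//; last exact: itg_Int2.
have := integral21_prod_meas1 iF => /= <-.
apply: ae_eq_integral => //.
- exact: (measurable_fubini_G iF).
- exact/measurable_EFinP/measurable_Int2.
- by apply: filterS (itg_ae2 iF) => x iFx _; exact: (IntE iFx).
Qed.

Lemma Int_swap F : itg (m1 \x m2)%E F ->
  Int m1 (fun x => Int m2 (fun y => F (x, y))) =
  Int m2 (fun y => Int m1 (fun x => F (x, y))).
Proof. by move=> iF; rewrite -Int_prod1// -Int_prod2. Qed.

Lemma itg_tensor (f : T1 -> R) (g : T2 -> R) : itg m1 f -> itg m2 g ->
  itg (m1 \x m2)%E (fun z => f z.1 * g z.2).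
Proof.
move=> If Ig; apply: itg_prod_abs.
  apply: measurable_funM.
    exact: (measurableT_comp (itg_meas If) measurable_fst).
  exact: (measurableT_comp (itg_meas Ig) measurable_snd).
rewrite (_ : integral _ _ _ =
   (\int[m1]_x (`|f x| * Int m2 (fun y => `|g y|))%:E)%E).
  apply: itg_lty; first by apply: itgZr; exact: itg_abs.
  by move=> x; rewrite mulr_ge0// Int_ge0.
apply: eq_integral => x _; rewrite -IntZ; last exact: itg_abs.
rewrite -IntE; first by apply: eq_integral => y _ /=; rewrite normrM.
by apply: itgZ; exact: itg_abs.
Qed.

Lemma Int_tensor (f : T1 -> R) (g : T2 -> R) : itg m1 f -> itg m2 g ->
  Int (m1 \x m2)%E (fun z => f z.1 * g z.2) = Int m1 f * Int m2 g.
Proof.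
move=> If Ig; rewrite Int_prod1; last exact: itg_tensor.
by rewrite -IntZr//; apply: eq_Int => x /=; rewrite IntZ.
Qed.

End fubini.

(** * The L^2 seminorm and dominated convergence *)

Section square_integrable.
Context d (T : measurableType d) (R : realType).
Variable mu : {measure set T -> \bar R}.
Implicit Types f g h : T -> R.

Definition sq f := measurable_fun setT f /\ itg mu (fun x => f x ^+ 2).
Definition nrm f := Num.sqrt (Int mu (fun x => f x ^+ 2)).

Lemma nrm_ge0 f : 0 <= nrm f. Proof. exact: sqrtr_ge0. Qed.

Lemma sqr_nrm f : nrm f ^+ 2 = Int mu (fun x => f x ^+ 2).
Proof. by rewrite sqr_sqrtr// Int_ge0// => x; exact: sqr_ge0. Qed.

Lemma eq_nrm f g : f =1 g -> nrm f = nrm g.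
Proof. by move=> fg; congr Num.sqrt; apply: eq_Int => x; rewrite fg. Qed.

Lemma sqM_itg f g : sq f -> sq g -> itg mu (fun x => f x * g x).
Proof.
move=> [mf If] [mg Ig]; apply: itg_le (itgD If Ig).
  exact: measurable_funM.
move=> x /=; rewrite normrM -(real_normK (num_real (f x))).
rewrite -(real_normK (num_real (g x))).
have := sqr_ge0 (`|f x| - `|g x|); have := normr_ge0 (f x).
have := normr_ge0 (g x); nra.
Qed.

Lemma sqD f g : sq f -> sq g -> sq (fun x => f x + g x).
Proof.
move=> sf sg; have [mf If] := sf; have [mg Ig] := sg; split.
  exact: measurable_funD.
have -> : (fun x => (f x + g x) ^+ 2) =
    (fun x => f x ^+ 2 + 2 * (f x * g x) + g x ^+ 2).
  by apply/funext => x; ring.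
by apply: itgD => //; apply: itgD => //; apply: itgZ; exact: sqM_itg.
Qed.

Lemma sqZ k f : sq f -> sq (fun x => k * f x).
Proof.
move=> [mf If]; split; first exact: measurable_funM.
under eq_fun do rewrite exprMn.
exact: itgZ.
Qed.

Lemma sqN f : sq f -> sq (fun x => - f x).
Proof.
move=> /(sqZ (-1)); under eq_fun do rewrite mulN1r; exact.
Qed.

Lemma sqB f g : sq f -> sq g -> sq (fun x => f x - g x).
Proof. by move=> sf /sqN sg; exact: sqD. Qed.

Lemma sq_abs f : sq f -> sq (fun x => `|f x|).
Proof.
move=> [mf If]; split; first exact: measurableT_comp.
by under eq_fun do rewrite real_normK ?num_real//.
Qed.

Lemma sq0 : sq (fun=> 0).
Proof.
split => //; under eq_fun do rewrite expr0n/=; exact: itg0.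
Qed.

Lemma sq_le f g : measurable_fun setT f -> (forall x, `|f x| <= g x) -> sq g ->
  sq f.
Proof.
move=> mf fg [mg Ig]; split => //; apply: itg_le Ig.
  exact: measurable_funX.
move=> x; rewrite normrX ler_pXn2r ?nnegrE//.
by rewrite (le_trans _ (fg x)).
Qed.

Lemma nrmN f : nrm (fun x => - f x) = nrm f.
Proof. by congr Num.sqrt; apply: eq_Int => x; rewrite sqrrN. Qed.

Lemma nrm_abs f : nrm (fun x => `|f x|) = nrm f.
Proof.
by congr Num.sqrt; apply: eq_Int => x; rewrite real_normK// num_real.
Qed.

Lemma nrmZ k f : sq f -> nrm (fun x => k * f x) = `|k| * nrm f.
Proof.
move=> [mf If]; rewrite /nrm; under eq_Int do rewrite exprMn.
by rewrite IntZ// sqrtrM ?sqr_ge0// sqrtr_sqr.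
Qed.

Lemma le_nrm f g : measurable_fun setT f -> (forall x, `|f x| <= `|g x|) ->
  sq g -> nrm f <= nrm g.
Proof.
move=> mf fg sg; have [mg Ig] := sg.
have [_ If] : sq f by apply: (sq_le mf fg); exact: sq_abs.
apply: ler_wsqrtr; apply: le_Int => // x.
by rewrite -(real_normK (num_real (f x))) -(real_normK (num_real (g x)))
  ler_pXn2r ?nnegrE.
Qed.

(** Evaluate at the minimizer - b / c. If c = 0 the expression is affine in t, and for b <> 0 it
    takes the value -1 somewhere. *)
Lemma discriminant_le (a b c : R) : 0 <= c ->
  (forall t, 0 <= a + 2 * t * b + t ^+ 2 * c) -> b ^+ 2 <= a * c.
Proof.
move=> c0 H; have [c1|cle] := ltP 0 c.
  have := H (- b / c).
  have -> : a + 2 * (- b / c) * b + (- b / c) ^+ 2 * c = (a * c - b ^+ 2) / c.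
    by field; rewrite gt_eqF.
  by rewrite pmulr_lge0 ?invr_gt0// subr_ge0.
have c00 : c = 0.
  by apply/eqP; rewrite eq_le cle c0.
have [->|b0] := eqVneq b 0; first by rewrite c00 mulr0 expr0n.
have := H (- (a + 1) / (2 * b)); rewrite c00 mulr0 addr0.
have -> : a + 2 * (- (a + 1) / (2 * b)) * b = -1 by field.
by rewrite lerNr oppr0 ler10.
Qed.

Lemma cauchy_schwarz f g : sq f -> sq g ->
  `|Int mu (fun x => f x * g x)| <= nrm f * nrm g.
Proof.
move=> sf sg; have [mf If] := sf; have [mg Ig] := sg.
have Ifg := sqM_itg sf sg.
rewrite -(ler_pXn2r (ltn0Sn 1))// ?nnegrE ?mulr_ge0 ?nrm_ge0//.
rewrite real_normK ?num_real// exprMn !sqr_nrm; apply: discriminant_le.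
  by apply: Int_ge0 => x; exact: sqr_ge0.
move=> t; rewrite -IntZ// -IntZ// -IntD//; last exact: itgZ.
rewrite -IntD//; [|by apply: itgD => //; exact: itgZ|exact: itgZ].
apply: Int_ge0 => x.
have -> : f x ^+ 2 + 2 * t * (f x * g x) + t ^+ 2 * g x ^+ 2 =
  (f x + t * g x) ^+ 2 by ring.
exact: sqr_ge0.
Qed.

Lemma nrmD f g : sq f -> sq g -> nrm (fun x => f x + g x) <= nrm f + nrm g.
Proof.
move=> sf sg; have [mf If] := sf; have [mg Ig] := sg.
have Ifg := sqM_itg sf sg.
rewrite -(ler_pXn2r (ltn0Sn 1))// ?nnegrE ?addr_ge0 ?nrm_ge0//.
rewrite sqrrD !sqr_nrm.
under eq_Int do rewrite sqrrD.
rewrite IntD//; last by apply: itgD => //; under eq_fun do rewrite -mulr_natl;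
  exact: itgZ.
rewrite IntD//; last by under eq_fun do rewrite -mulr_natl; exact: itgZ.
rewrite lerD2r lerD2l; under eq_Int do rewrite -mulr_natl.
rewrite IntZ// -[leRHS]mulr_natl ler_pM2l//.
exact: le_trans (ler_norm _) (cauchy_schwarz sf sg).
Qed.

Lemma nrmB f g : sq f -> sq g -> nrm (fun x => f x - g x) <= nrm f + nrm g.
Proof. by move=> sf sg; rewrite -(nrmN g) nrmD//; exact: sqN. Qed.

Lemma nrm_dist f g h : sq f -> sq g -> sq h ->
  nrm (fun x => f x - h x) <= nrm (fun x => f x - g x) + nrm (fun x => g x - h x).
Proof.
move=> sf sg sh; have := nrmD (sqB sf sg) (sqB sg sh).
by congr (_ <= _); apply: eq_nrm => x; rewrite addrA subrK.
Qed.

Lemma nrm_lip f g : sq f -> sq g -> `|nrm f - nrm g| <= nrm (fun x => f x - g x).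
Proof.
move=> sf sg; rewrite ler_norml; apply/andP; split.
  have -> : nrm g = nrm (fun x => - (f x - g x) + f x).
    by apply: eq_nrm => x; ring.
  have := nrmD (sqN (sqB sf sg)) sf; rewrite nrmN; lra.
rewrite lerBlDr.
have -> : nrm f = nrm (fun x => (f x - g x) + g x).
  by apply: eq_nrm => x; rewrite subrK.
by apply: nrmD => //; exact: sqB.
Qed.

Lemma nrm_eq0 f : sq f -> nrm f = 0 -> {ae mu, forall x, f x = 0}.
Proof.
move=> [mf If] /eqP; rewrite sqrtr_eq0 => f0.
have : {ae mu, forall x, f x ^+ 2 = 0}.
  apply: Int_eq0 => //; first by move=> x; exact: sqr_ge0.
  by apply/eqP; rewrite eq_le f0/= Int_ge0// => x; exact: sqr_ge0.
by apply: filterS => x /eqP; rewrite sqrf_eq0 => /eqP.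
Qed.

Lemma Int_dominated (u : nat -> T -> R) f g : (forall n, measurable_fun setT (u n)) ->
  measurable_fun setT f -> (forall x, u ^~ x @ \oo --> f x) -> itg mu g ->
  (forall n x, `|u n x| <= g x) -> Int mu (u n) @[n --> \oo] --> Int mu f.
Proof.
move=> mu_ mf uf Ig ug.
have If : itg mu f.
  apply: itg_le Ig => // x.
  have ufx : `|u n x| @[n --> \oo] --> `|f x| by apply: cvg_norm; exact: uf.
  rewrite -(cvg_lim _ ufx)//; apply: limr_le; last by apply: nearW.
  by apply: cvgP ufx.
have [] := @dominated_convergence _ T R mu setT measurableT
  (fun n x => (u n x)%:E) (fun x => (f x)%:E) (fun x => (g x)%:E).
- by move=> n; exact/measurable_EFinP.
- exact/measurable_EFinP.
- by apply: aeW => x _; apply: cvg_EFin; [exact: nearW|exact: uf].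
- exact: Ig.
- by apply: aeW => x n _ /=; rewrite lee_fin.
move=> _ _ /=; rewrite (IntE If) => /fine_cvgP[_].
exact.
Qed.

End square_integrable.
Notation plane R := (measurableTypeR R * measurableTypeR R)%type.

(** * Measure-preserving maps *)

Section measure_preserving.
Context d (T : measurableType d) (R : realType).
Variable mu : {measure set T -> \bar R}.
Implicit Types (f : T -> R) (phi : T -> T).

(** The changes of variables in the plane, and in pairs of its points, are translations,
    reflections, exchanges and shears; preservation of the measure of preimages stands in for a
    Jacobian formula. *)
Definition mpres phi := measurable_fun setT phi /\
  forall A, measurable A -> mu (phi @^-1` A) = mu A.

Lemma mpres_ge0 phi (f : T -> \bar R) : mpres phi -> measurable_fun setT f ->
  (forall x, (0 <= f x)%E) -> (\int[mu]_x f (phi x) = \int[mu]_x f x)%E.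
Proof.
move=> [mphi phiE] mf f0.
have := @ge0_integral_pushforward _ _ T T R phi mphi mu setT f measurableT mf.
rewrite preimage_setT => <-; last by move=> x _.
apply: eq_measure_integral => A mA _; exact: phiE.
Qed.

Lemma mpres_itg phi f : mpres phi -> itg mu f -> itg mu (fun x => f (phi x)).
Proof.
move=> mp If; have [mphi _] := mp; have mf := itg_meas If.
apply/integrableP; split.
  exact/measurable_EFinP/(measurableT_comp mf mphi).
move/integrableP : If => [_]; rewrite -(mpres_ge0 mp)//.
by apply: measurableT_comp => //; exact/measurable_EFinP.
Qed.

Lemma mpres_Int phi f : mpres phi -> itg mu f ->
  Int mu (fun x => f (phi x)) = Int mu f.
Proof.
move=> mp If; have mf := itg_meas If.
have mpf : measurable_fun setT (EFin \o f) by exact/measurable_EFinP.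
rewrite /Int /Rintegral; congr fine.
have [mphi phiE] := mp.
have := @integral_pushforward _ _ T T R phi mphi mu setT (EFin \o f) mpf.
rewrite preimage_setT => <- //; last exact: mpres_itg mp If.
by apply: eq_measure_integral => A mA _; rewrite -phiE.
Qed.

Lemma mpres_sq phi f : mpres phi -> sq mu f -> sq mu (fun x => f (phi x)).
Proof.
move=> mp [mf If]; split; last exact: (mpres_itg mp If).
exact: (measurableT_comp mf mp.1).
Qed.

Lemma mpres_nrm phi f : mpres phi -> sq mu f ->
  nrm mu (fun x => f (phi x)) = nrm mu f.
Proof. by move=> mp [mf If]; rewrite /nrm (mpres_Int mp If). Qed.

End measure_preserving.

Section mpres_prod.
Context d1 d2 (T1 : measurableType d1) (T2 : measurableType d2) (R : realType).
Variable m1 : {sigma_finite_measure set T1 -> \bar R}.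
Variable m2 : {sigma_finite_measure set T2 -> \bar R}.

Lemma mpres_prod phi1 phi2 : mpres m1 phi1 -> mpres m2 phi2 ->
  mpres (m1 \x m2)%E (fun z => (phi1 z.1, phi2 z.2)).
Proof.
move=> [mp1 p1] [mp2 p2].
have mphi : measurable_fun setT (fun z : T1 * T2 => (phi1 z.1, phi2 z.2)).
  apply/measurable_fun_pairP; split => /=.
    exact: (measurableT_comp mp1 measurable_fst).
  exact: (measurableT_comp mp2 measurable_snd).
split => // A mA.
have /(_ mphi) H := @product_measure_unique _ _ T1 T2 R m1 m2
  (pushforward (m1 \x m2)%E (fun z => (phi1 z.1, phi2 z.2))).
apply/esym; apply: H => // A1 A2 mA1 mA2; rewrite /pushforward.
transitivity ((m1 \x m2)%E ((phi1 @^-1` A1) `*` (phi2 @^-1` A2))) => //.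
rewrite product_measure1E ?p1 ?p2//.
  by rewrite -[_ @^-1` _]setTI; exact: mp1.
by rewrite -[_ @^-1` _]setTI; exact: mp2.
Qed.

End mpres_prod.

Section sigma_finite_product.
Context d1 d2 (T1 : measurableType d1) (T2 : measurableType d2) (R : realType).
Variable m1 : {sigma_finite_measure set T1 -> \bar R}.
Variable m2 : {sigma_finite_measure set T2 -> \bar R}.

(** A named copy of the product measure, so that it can carry a sigma-finite structure: Fubini is
    applied later to pairs of points of the plane. *)
Definition prod_measure : set (T1 * T2) -> \bar R := (m1 \x m2)%E.

HB.instance Definition _ := Measure.on prod_measure.

Let sigma_finite_prod_measure : sigma_finite setT prod_measure.
Proof.
have /sigma_finiteP[F [TF ndF Foo]] := sigma_finiteT m1.
have /sigma_finiteP[G [TG ndG Goo]] := sigma_finiteT m2.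
exists (fun n => F n `*` G n).
  apply/seteqP; split => // -[x y] _.
  have : setT x by []. rewrite TF => -[n _ Fnx].
  have : setT y by []. rewrite TG => -[k _ Gky].
  exists (maxn n k) => //; split => /=.
  - by move: x Fnx; exact/subsetPset/ndF/leq_maxl.
  - by move: y Gky; exact/subsetPset/ndG/leq_maxr.
move=> k; have [? ?] := Foo k; have [? ?] := Goo k.
split; first exact: measurableX.
by rewrite /prod_measure product_measure1E// lte_mul_pinfty// ge0_fin_numE.
Qed.

HB.instance Definition _ := Measure_isSigmaFinite.Build _ _ _ prod_measure
  sigma_finite_prod_measure.

End sigma_finite_product.

(** * Lebesgue measure on the plane *)

Section plane.
Context {R : realType}.

Let leb := @lebesgue_measure R.

Definition lb2 : {sigma_finite_measure set (plane R) -> \bar R} :=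
  prod_measure (@lebesgue_measure R) (@lebesgue_measure R).

Lemma lb2E : (lb2 : {measure set _ -> \bar R}) = leb2.
Proof. by []. Qed.

Lemma mpres_shift1 (a : R) :
  mpres leb (fun x : measurableTypeR R => (x + a : measurableTypeR R)).
Proof.
have mphi : measurable_fun setT
   (fun x : measurableTypeR R => (x + a : measurableTypeR R)).
  exact: measurable_funD.
split=> // A mA.
have /(_ mphi) H := @lebesgue_measure_unique R
  (pushforward leb (fun x : measurableTypeR R => (x + a : measurableTypeR R))).
apply/esym; apply: H => //.
move=> _ [[b c] _ <-]; rewrite /pushforward.
transitivity (leb `]b - a, c - a]%classic); last first.
  congr (leb _); apply/seteqP; split => x /=; by rewrite !in_itv/= ltrBlDr lerBrDr.
rewrite /leb !lebesgue_measure_itv/= !lte_fin.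
have -> : (b - a < c - a) = (b < c) by rewrite ltrD2r.
by case: ifP => // _; rewrite -!EFinD; congr (_%:E); ring.
Qed.

Lemma mpres_opp1 : mpres leb (fun x : measurableTypeR R => (- x : measurableTypeR R)).
Proof.
split; first exact: oppr_measurable.
by move=> A mA; exact: lebesgue_measureN.
Qed.

Lemma mpres_shift (h : plane R) : mpres lb2 (fun z => z + h).
Proof. exact: (mpres_prod (mpres_shift1 h.1) (mpres_shift1 h.2)). Qed.

Lemma mpres_opp : mpres lb2 (fun z => - z).
Proof. exact: (mpres_prod mpres_opp1 mpres_opp1). Qed.

Lemma mpres_refl (h : plane R) : mpres lb2 (fun z => h - z).
Proof.
have [mo o] := mpres_opp; have [ms s] := mpres_shift h.
have -> : (fun z => h - z) = (fun z : plane R => z + h) \o (fun z => - z).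
  by apply/funext => z /=; rewrite addrC.
split; first exact: measurableT_comp.
move=> A mA; rewrite comp_preimage o ?s//.
by rewrite -[_ @^-1` _]setTI; exact: ms.
Qed.

End plane.

(** * Completeness of L^2 along geometrically Cauchy sequences *)

Section riesz_fischer.
Context d (T : measurableType d) (R : realType).
Variable mu : {measure set T -> \bar R}.
Variables (f : nat -> T -> R) (C : R).
Hypothesis sf : forall n, sq mu (f n).
Hypothesis cf : forall n, nrm mu (fun x => f n.+1 x - f n x) <= C / 2 ^+ n.

(** Partial sums of the absolute increments: they increase with n and are bounded in L^2, so by
    monotone convergence the increments are summable almost everywhere. *)
Let g n x : R := `|f 0 x| + \sum_(k < n) `|f k.+1 x - f k x|.

Let sg n : sq mu (g n).
Proof.
elim: n => [|n ih].
  by rewrite /g; under eq_fun do rewrite big_ord0 addr0; exact: sq_abs.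
rewrite /g; under eq_fun do rewrite big_ord_recr/= addrA.
by apply: sqD => //; apply: sq_abs; exact: sqB.
Qed.

Let sum_half n : \sum_(k < n) C / 2 ^+ k = 2 * C - 2 * C / 2 ^+ n.
Proof.
elim: n => [|n ih]; first by rewrite big_ord0 expr0 divr1 subrr.
rewrite big_ord_recr/= ih exprS; field.
by rewrite expf_neq0.
Qed.

Let C0 : 0 <= C.
Proof. by have := le_trans (nrm_ge0 _ _) (cf 0); rewrite expr0 divr1. Qed.

Let ng n : nrm mu (g n) <= nrm mu (f 0) + 2 * C.
Proof.
apply: (@le_trans _ _ (nrm mu (f 0) + \sum_(k < n) C / 2 ^+ k)); last first.
  rewrite lerD2l sum_half lerBlDr lerDl divr_ge0 ?mulr_ge0 ?exprn_ge0//.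
elim: n => [|n ih].
  rewrite big_ord0 addr0 /g -(nrm_abs mu (f 0)).
  by under eq_nrm do rewrite big_ord0 addr0.
rewrite big_ord_recr/= addrA.
rewrite /g; under eq_nrm do rewrite big_ord_recr/= addrA.
have sd : sq mu (fun x => f n.+1 x - f n x) by exact: sqB.
apply: (le_trans (nrmD (sg n) (sq_abs sd))).
by apply: lerD => //; rewrite nrm_abs.
Qed.

Let dist_le m n : nrm mu (fun x => f (n + m)%N x - f n x) <= 2 * C / 2 ^+ n.
Proof.
apply: (@le_trans _ _ (2 * C / 2 ^+ n - 2 * C / 2 ^+ (n + m))); last first.
  rewrite lerBlDr lerDl divr_ge0 ?mulr_ge0 ?exprn_ge0//.
elim: m => [|m ih].
  rewrite addn0 subrr; under eq_nrm do rewrite subrr.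
  rewrite /nrm; under eq_Int do rewrite expr0n/=.
  by rewrite Int0 sqrtr0.
apply: (le_trans (nrm_dist (sf _) (sf (n + m)%N) (sf _))).
rewrite addnS; apply: (le_trans (lerD (cf (n + m)%N) ih)).
rewrite le_eqVlt; apply/orP; left; apply/eqP.
by rewrite [in RHS]exprS; field; rewrite !expf_neq0.
Qed.

Let G x : \bar R := limn (fun n => (g n x ^+ 2)%:E).

Let ndg x : {homo g^~ x : m n / (m <= n)%N >-> m <= n}.
Proof.
apply/nondecreasing_seqP => n; rewrite /g big_ord_recr/= addrA lerDl//.
Qed.

Let g0 n x : 0 <= g n x.
Proof. by rewrite addr_ge0// sumr_ge0. Qed.

Let G_ae : {ae mu, forall x, exists M, forall n, g n x <= M}.
Proof.
have nd x : {homo (fun n => (g n x ^+ 2)%:E) : m n / (m <= n)%N >-> (m <= n)%E}.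
  by move=> m n mn; rewrite lee_fin ler_pXn2r ?nnegrE ?g0//; exact: ndg.
have mg n : measurable_fun setT (g n) by case: (sg n).
have mG n : measurable_fun setT (fun x => (g n x ^+ 2)%:E).
  by apply/measurable_EFinP; exact: (measurable_funX 2 (mg n)).
have IG : (\int[mu]_x G x <= ((nrm mu (f 0) + 2 * C) ^+ 2)%:E)%E.
  have -> : (\int[mu]_x G x = limn (fun n => \int[mu]_x (g n x ^+ 2)%:E))%E.
    apply: (monotone_convergence mu measurableT mG) => [n x _|x _].
      by rewrite lee_fin sqr_ge0.
    exact: nd.
  apply: lime_le.
    apply: ereal_nondecreasing_is_cvgn => m n mn.
    apply: ge0_le_integral => //.
    - by move=> x _; rewrite lee_fin sqr_ge0.
    - by move=> x _; exact: nd.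
  apply: nearW => n; rewrite IntE; last exact: (sg n).2.
  rewrite lee_fin -sqr_nrm ler_pXn2r ?nnegrE ?nrm_ge0 ?ng//.
  by rewrite (le_trans _ (ng 0))// nrm_ge0.
have IGi : mu.-integrable setT G.
  apply/integrableP; split.
    apply: (emeasurable_fun_cvg (fun n x => (g n x ^+ 2)%:E)) => //.
    by move=> x _; apply: ereal_nondecreasing_is_cvgn; exact: nd.
  rewrite (_ : integral _ _ _ = \int[mu]_x G x)%E.
    by rewrite (le_lt_trans IG)// ltry.
  apply: eq_integral => x _; rewrite gee0_abs//; apply: lime_ge.
    by apply: ereal_nondecreasing_is_cvgn; exact: nd.
  by apply: nearW => n; rewrite lee_fin sqr_ge0.
have := integrable_ae measurableT IGi; apply: filterS => x /(_ I) Gx.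
exists (fine (G x) + 1) => n.
have : ((g n x ^+ 2)%:E <= G x)%E.
  rewrite /G (cvg_lim _ (ereal_nondecreasing_cvgn (nd x)))//.
  by apply: ereal_sup_ubound; exists n.
rewrite -(fineK Gx) lee_fin; have := g0 n x.
have := sqr_ge0 (g n x - 1); rewrite sqrrB expr1n mulr1; lra.
Qed.

Let f_ae : {ae mu, forall x, f ^~ x @ \oo --> fine (limn_esup (fun n => (f n x)%:E))}.
Proof.
apply: filterS G_ae => x [M gM].
have cvf : cvgn (f ^~ x).
  have cs : cvgn (series (telescope (f ^~ x))).
    apply: normed_cvg.
    have -> : [normed series (telescope (f ^~ x))] =
        (fun n => \sum_(k < n) `|f k.+1 x - f k x|).
      by apply/funext => n; rewrite /normed_series_of seriesEord.
    apply: nondecreasing_is_cvgn.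
      by apply/nondecreasing_seqP => n; rewrite big_ord_recr/= lerDl.
    by exists M => _ [n _ <-]; apply: le_trans (gM n); rewrite /g lerDr.
  have -> : f ^~ x = (fun n => f 0 x + series (telescope (f ^~ x)) n).
    by apply/funext => n; exact: eq_sum_telescope.
  exact: is_cvgD (is_cvg_cst _) cs.
have cvfE : (f n x)%:E @[n --> \oo] --> (limn (f ^~ x))%:E.
  by apply: cvg_EFin; [exact: nearW|exact: cvf].
by have [_ ->] := cvg_limn_einf_sup cvfE.
Qed.

Lemma riesz_fischer : exists2 F, sq mu F &
  forall n, nrm mu (fun x => F x - f n x) <= 2 * C / 2 ^+ n.
Proof.
(* The upper limit is defined everywhere and measurable; it agrees almost everywhere with the
   pointwise limit, and Fatou's lemma on the squared differences gives both square integrability and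
   the rate. *)
pose F x := fine (limn_esup (fun n => (f n x)%:E)).
have mf n : measurable_fun setT (f n) by case: (sf n).
have mF : measurable_fun setT F.
  apply: measurableT_comp => //; apply: measurable_fun_limn_esup => n.
  exact/measurable_EFinP.
have mFf n : measurable_fun setT (fun x => ((F x - f n x) ^+ 2)%:E).
  apply/measurable_EFinP; apply: (measurable_funX 2).
  exact: measurable_funB.
have IF n : (\int[mu]_x ((F x - f n x) ^+ 2)%:E <= ((2 * C / 2 ^+ n) ^+ 2)%:E)%E.
  pose u m x := (((f (n + m)%N x - f n x) ^+ 2)%:E : \bar R).
  have mu_ m : measurable_fun setT (u m).
    apply/measurable_EFinP; apply: (measurable_funX 2).
    exact: measurable_funB.
  have -> : (\int[mu]_x ((F x - f n x) ^+ 2)%:E = \int[mu]_x limn_einf (u ^~ x))%E.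
    apply: ae_eq_integral => //.
      rewrite /limn_einf; apply: measurableT_comp => //.
      by apply: measurable_fun_limn_esup => m; exact: measurableT_comp.
    apply: filterS f_ae => x fx _.
    suff H : u m x @[m --> \oo] --> ((F x - f n x) ^+ 2)%:E.
      by have [-> _] := cvg_limn_einf_sup H.
    have H : f (n + m)%N x - f n x @[m --> \oo] --> F x - f n x.
      apply: cvgB; last exact: cvg_cst.
      under eq_fun do rewrite addnC.
      by have H0 := fx; rewrite -(cvg_shiftn n) in H0; exact: H0.
    have H2 : (f (n + m)%N x - f n x) ^+ 2 @[m --> \oo] --> (F x - f n x) ^+ 2.
      by rewrite expr2; under eq_fun do rewrite expr2; exact: cvgM.
    by apply: cvg_EFin; [exact: nearW|exact: H2].
  apply: (le_trans (fatou mu measurableT mu_ _)).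
    by move=> m x _; rewrite lee_fin sqr_ge0.
  rewrite limn_einf_lim; apply: lime_le; first exact: is_cvg_einfs.
  apply: nearW => m; apply: (@le_trans _ _ (\int[mu]_x u m x)%E).
    by apply: ereal_inf_lbound; exists m => /=.
  rewrite IntE; last by case: (sqB (sf (n + m)%N) (sf n)).
  rewrite lee_fin -sqr_nrm ler_pXn2r ?nnegrE ?nrm_ge0//.
  by rewrite divr_ge0// mulr_ge0.
have sFf n : sq mu (fun x => F x - f n x).
  split; first exact: measurable_funB.
  apply: itg_ltyP; first by apply/measurable_EFinP; exact: mFf.
    by move=> x; exact: sqr_ge0.
  by rewrite (le_lt_trans (IF n))// ltry.
exists F.
  have := sqD (sFf 0) (sf 0); congr (sq mu _).
  by apply/funext => x; rewrite subrK.
move=> n; rewrite -(ler_pXn2r (ltn0Sn 1))// ?nnegrE ?nrm_ge0//; last first.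
  by rewrite divr_ge0// mulr_ge0.
rewrite sqr_nrm -lee_fin -IntE ?IF//; exact: (sFf n).2.
Qed.

End riesz_fischer.

(** * Gaussian integrals on the line *)

Section gaussian.
Context {R : realType}.
Implicit Types (a s z : R) (f F : R -> R).

Let leb := @lebesgue_measure R.

Definition gau a s : R := expR (- (a * s ^+ 2)).

Lemma gau_ge0 a s : 0 <= gau a s. Proof. exact: expR_ge0. Qed.

Lemma continuous_derivable f : (forall x, derivable f x 1) -> continuous f.
Proof.
by move=> df x; apply: differentiable_continuous; exact/derivable1_diffP.
Qed.

Lemma derivable_measurable f : (forall x, derivable f x 1) ->
  measurable_fun setT f.
Proof.
by move=> /continuous_derivable; exact: continuous_measurable_fun.
Qed.

Lemma is_derive_gau a s : is_derive s 1 (gau a) (- (2 * a * s) * gau a s).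
Proof.
have H : is_derive s 1 (fun s => - (a * s ^+ 2)) (- (2 * a * s)).
  apply: is_derive_eq; rewrite /GRing.scale/=; ring.
have -> : gau a = expR \o (fun s => - (a * s ^+ 2)) by [].
apply: is_derive_eq; rewrite /GRing.scale/= /gau; ring.
Qed.

Lemma derivable_gau a s : derivable (gau a) s 1.
Proof. by have [] := is_derive_gau a s. Qed.

Lemma measurable_gau a : measurable_fun setT (gau a).
Proof. by apply: derivable_measurable => x; exact: derivable_gau. Qed.

Lemma Int_gau a : 0 < a ->
  itg leb (gau a) /\ Int leb (gau a) = Num.sqrt (pi / a).
Proof.
move=> a0; pose c := Num.sqrt a.
have c0 : 0 < c by rewrite sqrtr_gt0.
pose L (x : R) : R := c * x.
have H (x : R) : is_derive x 1 L c.
  by apply: is_derive_eq; rewrite /GRing.scale/= mulr1.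
have D : derive1 L = (fun=> c).
  by apply/funext => x; rewrite derive1E; exact: derive_val.
have E : (\int[leb]_s (gau a s * c)%:E = (Num.sqrt pi)%:E)%E.
  rewrite -integralT_gauss (@increasing_ge0_integration_by_substitutionT R L)//.
  - apply: eq_integral => x _; rewrite D mulrfctE /= /gauss_fun /gau /L.
    by rewrite exprMn sqr_sqrtr// ltW.
  - by move=> x y xy; rewrite /L ltr_pM2l.
  - by rewrite D; move=> x; exact: cvg_cst.
  - by rewrite D; exact: is_cvg_cst.
  - by rewrite D; exact: is_cvg_cst.
  - apply/cvgrNyPle => A; exists (A / c); split; first exact: num_real.
    by move=> x /= xA; rewrite /L mulrC -ler_pdivlMr// ltW.
  - apply/cvgryPge => A; exists (A / c); split; first exact: num_real.
    by move=> x /= xA; rewrite /L mulrC -ler_pdivrMr// ltW.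
  - exact: continuous_gauss_fun.
  - by move=> x; exact: gauss_fun_ge0.
have Ic : itg leb (fun s => gau a s * c).
  apply: itg_ltyP; last by rewrite E ltry.
    by apply: measurable_funM => //; exact: measurable_gau.
  by move=> x; rewrite mulr_ge0 ?gau_ge0 ?ltW.
have Ia : itg leb (gau a).
  have := itgZr c^-1 Ic; congr itg; apply/funext => x.
  by rewrite mulfK// gt_eqF.
split => //.
have : Int leb (gau a) * c = Num.sqrt pi.
  by apply: EFin_inj; rewrite -E -IntZr// IntE.
move=> /(canRL (mulfK _)) -> //; last by rewrite gt_eqF.
by rewrite -sqrtrV ?ltW// -sqrtrM// pi_ge0.
Qed.

Lemma itg_gau a : 0 < a -> itg leb (gau a).
Proof. by move=> /Int_gau[]. Qed.

Lemma sqr_gau_le a s : 0 < a -> s ^+ 2 * gau a s <= 2 / a * gau (a / 2) s.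
Proof.
move=> a0; have := expR_ge1Dx (a / 2 * s ^+ 2) => H.
have -> : gau a s = expR (- (a / 2 * s ^+ 2)) * gau (a / 2) s.
  by rewrite /gau -expRD; congr expR; field.
rewrite mulrA ler_wpM2r ?gau_ge0// expRN ler_pdivrMr ?expR_gt0//.
have {1}-> : s ^+ 2 = 2 / a * (a / 2 * s ^+ 2) by field; rewrite gt_eqF.
by rewrite ler_wpM2l ?divr_ge0 ?ltW// (lt_le_trans _ H)// ltrDr.
Qed.

Lemma gau_le1 a s : 0 <= a -> gau a s <= 1.
Proof.
by move=> a0; rewrite /gau -expR0 ler_expR oppr_le0 mulr_ge0 ?sqr_ge0.
Qed.

Lemma itg_sqr_gau a : 0 < a -> itg leb (fun s => s ^+ 2 * gau a s).
Proof.
move=> a0; have a2 : 0 < a / 2 by rewrite divr_gt0.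
apply: (itg_le _ _ (itgZ (2 / a) (itg_gau a2))).
- by apply: measurable_funM => //; exact: measurable_gau.
- move=> s; rewrite (ger0_norm (mulr_ge0 (sqr_ge0 _) (gau_ge0 _ _))).
  exact: sqr_gau_le.
Qed.

Lemma abs_le1Dsqr (s : R) : `|s| <= 1 + s ^+ 2.
Proof.
rewrite -(real_normK (num_real s)); have := sqr_ge0 (`|s| - 1).
have := normr_ge0 s; nra.
Qed.

Lemma itg_abs_gau a : 0 < a -> itg leb (fun s => `|s| * gau a s).
Proof.
move=> a0; apply: (itg_le _ _ (itgD (itg_gau a0) (itg_sqr_gau a0))).
- by apply: measurable_funM => //; exact: measurable_gau.
- move=> s; rewrite ger0_norm ?mulr_ge0 ?gau_ge0//.
  have -> : gau a s + s ^+ 2 * gau a s = (1 + s ^+ 2) * gau a s by ring.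
  by rewrite ler_wpM2r ?gau_ge0 ?abs_le1Dsqr.
Qed.

(** Truncate to [- n - 1, n + 1], which is nondegenerate for every n: the fundamental theorem
    evaluates the integral, and dominated convergence removes the truncation. *)
Lemma FTC_line f F : (forall x : R, is_derive x 1 F (f x)) -> continuous f ->
  itg leb f -> F n%:R @[n --> \oo] --> (0 : R) ->
  F (- n%:R) @[n --> \oo] --> (0 : R) -> Int leb f = 0.
Proof.
move=> dF cf If F1 F2.
have mf := itg_meas If.
pose u (n : nat) x := f x * \1_(`[- n.+1%:R, n.+1%:R]%classic : set R) x.
have ui : Int leb (u n) @[n --> \oo] --> Int leb f.
  apply: (@Int_dominated _ _ _ leb u f (fun x => `|f x|)) => //.
  - by move=> n; apply: measurable_funM => //; exact: measurable_indic.
  - move=> x; apply: cvg_near_cst; near=> n.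
    rewrite /u indicE mem_set ?mulr1//= in_itv/= -ler_norml.
    apply/ltW; rewrite -truncn_le_nat.
    by near: n; exists (Num.truncn `|x|).
  - exact: itg_abs.
  - move=> n x; rewrite /u normrM indicE.
    by case: (_ \in _); rewrite ?normr1 ?mulr1// normr0 mulr0.
have uE n : Int leb (u n) = F n.+1%:R - F (- n.+1%:R).
  have nn : - n.+1%:R < n.+1%:R :> R by rewrite gtrN.
  have -> : Int leb (u n) = \int[leb]_(x in `[- n.+1%:R, n.+1%:R]) f x.
    rewrite [RHS]Rintegral_mkcond; apply: eq_Int => x.
    rewrite /u patchE indicE; case: ifPn => xin.
      by rewrite mulr1.
    by rewrite mulr0.
  rewrite /Rintegral (@continuous_FTC2 R f F)//.
  - exact: continuous_subspaceT.
  - split.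
    + by move=> x _; have [] := dF x.
    + apply: cvg_at_right_filter; apply: continuous_derivable => x.
      by have [] := dF x.
    + apply: cvg_at_left_filter; apply: continuous_derivable => x.
      by have [] := dF x.
  - by move=> x _; rewrite derive1E; have [_ ->] := dF x.
have : F n.+1%:R - F (- n.+1%:R) @[n --> \oo] --> (0 - 0 : R).
  apply: cvgB.
    by rewrite (cvg_shiftS (fun n => F n%:R)).
  by rewrite (cvg_shiftS (fun n => F (- n%:R))).
rewrite subr0 => H.
have E : (fun n => Int leb (u n)) = (fun n => F n.+1%:R - F (- n.+1%:R)).
  by apply/funext.
by rewrite -E in H; exact: cvg_unique ui H.
Unshelve. all: by end_near. Qed.


Lemma FTC_line_decay f F C : (forall x : R, is_derive x 1 F (f x)) -> continuous f ->
  itg leb f -> (forall x, `|x| * `|F x| <= C) -> Int leb f = 0.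
Proof.
move=> dF cf If FC.
have H (u : nat -> R) : (forall n, `|u n| = n%:R) -> F (u n) @[n --> \oo] --> (0 : R).
  move=> un; apply: norm_cvg0.
  have C1 : C * n.+1%:R^-1 @[n --> \oo] --> (C * 0 : R).
    by apply: cvgM; [exact: cvg_cst|exact: cvg_harmonic].
  rewrite mulr0 in C1.
  rewrite -(cvg_shiftS (fun n => `|F (u n)|)).
  apply: (@squeeze_cvgr _ _ _ _ (fun=> 0) (fun n => C * n.+1%:R^-1)) => //.
    apply: nearW => n; rewrite normr_ge0/= ler_pdivlMr ?ltr0n// mulrC.
    by rewrite -un FC.
  exact: cvg_cst.
apply: (FTC_line dF) => //; apply: H => n; rewrite ?normrN normr_nat//.
Qed.

Lemma is_derive_cosM z s : is_derive s 1 (fun s => cos (s * z)) (- z * sin (s * z)).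
Proof.
have H : is_derive s 1 (fun s => s * z) z.
  by apply: is_derive_eq; rewrite /GRing.scale/=; ring.
have := @is_derive1_comp _ cos (fun s => s * z) s _ _ (is_derive_cos (s * z)) H.
by move=> /is_derive_eq; apply; ring.
Qed.

Lemma is_derive_sinM z s : is_derive s 1 (fun s => sin (s * z)) (z * cos (s * z)).
Proof.
have H : is_derive s 1 (fun s => s * z) z.
  by apply: is_derive_eq; rewrite /GRing.scale/=; ring.
have := @is_derive1_comp _ sin (fun s => s * z) s _ _ (is_derive_sin (s * z)) H.
by move=> /is_derive_eq; apply; ring.
Qed.

Lemma continuous_gau a : continuous (gau a).
Proof. by apply: continuous_derivable => s; exact: derivable_gau. Qed.

Lemma continuous_cosM z : continuous (fun s : R => cos (s * z)).
Proof. by apply: continuous_derivable => s; have [] := is_derive_cosM z s. Qed.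

Lemma continuous_sinM z : continuous (fun s : R => sin (s * z)).
Proof. by apply: continuous_derivable => s; have [] := is_derive_sinM z s. Qed.

Lemma measurable_cosM z : measurable_fun setT (fun s : R => cos (s * z)).
Proof. by apply: continuous_measurable_fun; exact: continuous_cosM. Qed.

Lemma measurable_sinM z : measurable_fun setT (fun s : R => sin (s * z)).
Proof. by apply: continuous_measurable_fun; exact: continuous_sinM. Qed.

Lemma normr_cos_le1 (x : R) : `|cos x| <= 1.
Proof. by rewrite ler_norml cos_geN1 cos_le1. Qed.

Lemma normr_sin_le1 (x : R) : `|sin x| <= 1.
Proof. by rewrite ler_norml sin_geN1 sin_le1. Qed.

Lemma itg_gau_cos a z : 0 < a -> itg leb (fun s => gau a s * cos (s * z)).
Proof.
move=> a0; apply: (itg_le _ _ (itg_gau a0)).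
  apply: measurable_funM; first exact: measurable_gau.
  exact: measurable_cosM.
move=> s; rewrite normrM (ger0_norm (gau_ge0 _ _)).
by rewrite ler_piMr ?gau_ge0 ?normr_cos_le1.
Qed.

Lemma itg_mul_gau_sin a z : 0 < a -> itg leb (fun s => s * gau a s * sin (s * z)).
Proof.
move=> a0; apply: (itg_le _ _ (itg_abs_gau a0)).
  apply: measurable_funM; last exact: measurable_sinM.
  by apply: measurable_funM => //; exact: measurable_gau.
move=> s; rewrite !normrM (ger0_norm (gau_ge0 _ _)).
by rewrite ler_piMr ?mulr_ge0 ?gau_ge0 ?normr_sin_le1.
Qed.

Lemma itg_sqr_gau_cos a z : 0 < a ->
  itg leb (fun s => s ^+ 2 * gau a s * cos (s * z)).
Proof.
move=> a0; apply: (itg_le _ _ (itg_sqr_gau a0)).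
  apply: measurable_funM; last exact: measurable_cosM.
  by apply: measurable_funM => //; exact: measurable_gau.
move=> s; rewrite normrM (ger0_norm (mulr_ge0 (sqr_ge0 _) (gau_ge0 _ _))).
by rewrite ler_piMr ?normr_cos_le1// mulr_ge0 ?gau_ge0 ?sqr_ge0.
Qed.

Let gau_sqr_le a s : 0 < a -> s ^+ 2 * gau a s <= 2 / a.
Proof.
move=> a0; rewrite (le_trans (sqr_gau_le _ a0))// ler_piMr//.
  by rewrite divr_ge0 ?ltW.
by rewrite gau_le1// divr_ge0 ?ltW.
Qed.

(** Integration by parts: the derivative of gau a s * sin (s z) has integral 0. *)
Lemma Int_mul_gau_sin a z : 0 < a -> Int leb (fun s => s * gau a s * sin (s * z)) =
  z / (2 * a) * Int leb (fun s => gau a s * cos (s * z)).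
Proof.
move=> a0; pose F s := gau a s * sin (s * z).
pose f s := z * (gau a s * cos (s * z)) - 2 * a * (s * gau a s * sin (s * z)).
have dF (x : R) : is_derive x 1 F (f x).
  have H1 := is_derive_gau a x; have H2 := is_derive_sinM z x.
  by apply: is_derive_eq; rewrite /f /GRing.scale/=; ring.
have : Int leb f = 0.
  apply: (@FTC_line_decay f F (1 + 2 / a)) => //.
  - move=> x; apply: cvgB; apply: cvgM; try exact: cvg_cst.
      by apply: cvgM; [exact: continuous_gau|exact: continuous_cosM].
    apply: cvgM; last exact: continuous_sinM.
    by apply: cvgM; [exact: cvg_id|exact: continuous_gau].
  - by apply: itgB; apply: itgZ; [exact: itg_gau_cos|exact: itg_mul_gau_sin].
  - move=> x; rewrite normrM (ger0_norm (gau_ge0 _ _)) mulrA.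
    apply: (@le_trans _ _ (`|x| * gau a x)).
      by rewrite ler_piMr ?mulr_ge0 ?gau_ge0 ?normr_sin_le1.
    apply: (@le_trans _ _ ((1 + x ^+ 2) * gau a x)).
      by rewrite ler_wpM2r ?gau_ge0 ?abs_le1Dsqr.
    by rewrite mulrDl mul1r lerD ?gau_le1 ?gau_sqr_le// ltW.
rewrite IntB; [|by apply: itgZ; exact: itg_gau_cos|
  by apply: itgZ; exact: itg_mul_gau_sin].
rewrite IntZ ?IntZ; [|exact: itg_mul_gau_sin|exact: itg_gau_cos].
move=> /eqP; rewrite subr_eq0 => /eqP E.
by rewrite mulrAC E; field; rewrite gt_eqF.
Qed.

Lemma Int_sqr_gau_cos a z : 0 < a ->
  Int leb (fun s => s ^+ 2 * gau a s * cos (s * z)) =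
  (2 * a)^-1 * (1 - z ^+ 2 / (2 * a)) * Int leb (fun s => gau a s * cos (s * z)).
Proof.
move=> a0; pose F s := s * gau a s * cos (s * z).
pose f s := gau a s * cos (s * z) - 2 * a * (s ^+ 2 * gau a s * cos (s * z))
  - z * (s * gau a s * sin (s * z)).
have dF (x : R) : is_derive x 1 F (f x).
  have H1 := is_derive_gau a x; have H2 := is_derive_cosM z x.
  by apply: is_derive_eq; rewrite /f /GRing.scale/=; ring.
have I0 := itg_gau_cos z a0; have I1 := itg_mul_gau_sin z a0.
have I2 := itg_sqr_gau_cos z a0.
have : Int leb f = 0.
  apply: (@FTC_line_decay f F (2 / a)) => //.
  - move=> x; apply: cvgB; [apply: cvgB|].
    + by apply: cvgM; [exact: continuous_gau|exact: continuous_cosM].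
    + apply: cvgM; first exact: cvg_cst.
      apply: cvgM; last exact: continuous_cosM.
      by apply: cvgM; [exact: exprn_continuous|exact: continuous_gau].
    + apply: cvgM; first exact: cvg_cst.
      apply: cvgM; last exact: continuous_sinM.
      by apply: cvgM; [exact: cvg_id|exact: continuous_gau].
  - by apply: itgB; [apply: itgB => //|]; apply: itgZ.
  - move=> x; apply: (le_trans _ (gau_sqr_le x a0)).
    rewrite !normrM (ger0_norm (gau_ge0 _ _)) !mulrA -expr2 real_normK ?num_real//.
    by rewrite ler_piMr ?normr_cos_le1// mulr_ge0 ?gau_ge0 ?sqr_ge0.
rewrite IntB; [|by apply: itgB => //; exact: itgZ|exact: itgZ].
rewrite IntB//; last exact: itgZ.
rewrite IntZ// IntZ// Int_mul_gau_sin// => E.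
set J := Int _ _ in E |- *; set K := Int _ _ in E |- *.
have -> : K = (2 * a)^-1 * (2 * a * K) by field; rewrite gt_eqF.
have -> : 2 * a * K = J - z * (z / (2 * a) * J) by lra.
by field; rewrite gt_eqF.
Qed.

(** Differentiation under the integral produces the sine integral of [Int_mul_gau_sin], which is a
    multiple of the original one: a linear differential equation. *)
Lemma is_derive_gau_cos a z : 0 < a ->
  is_derive z 1 (fun z => Int leb (fun s => gau a s * cos (s * z)))
   (- (z / (2 * a)) * Int leb (fun s => gau a s * cos (s * z))).
Proof.
move=> a0; pose f z s := gau a s * cos (s * z).
pose G s := `|s| * gau a s.
have df (x y : R) : is_derive x 1 (f ^~ y) (- (y * gau a y * sin (y * x))).
  have -> : f ^~ y = (fun x => gau a y * cos (x * y)).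
    by apply/funext => t; rewrite /f (mulrC y).
  have H := is_derive_cosM y x.
  apply: is_derive_eq; rewrite /GRing.scale/= (mulrC y x); ring.
have zI : ([set` `]z - 1, z + 1[] : set R) z.
  by rewrite /= in_itv/= ltrDl ltrBlDr ltrDl ltr01.
have A1 x : ([set` `]z - 1, z + 1[] : set R) x -> leb.-integrable setT (EFin \o f x).
  by move=> _; exact: itg_gau_cos.
have A2 x y : ([set` `]z - 1, z + 1[] : set R) x -> setT y -> derivable (f ^~ y) x 1.
  by move=> _ _; have [] := df x y.
have A3 y : 0 <= G y by rewrite mulr_ge0 ?gau_ge0.
have A4 x y : ([set` `]z - 1, z + 1[] : set R) x -> setT y ->
    `|partial1of2 f x y| <= G y.
  move=> _ _; rewrite partial1of2E; have [_ dE] := df x y; rewrite ?derive1E dE.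
  rewrite normrN !normrM (ger0_norm (gau_ge0 _ _)).
  by rewrite ler_piMr ?mulr_ge0 ?gau_ge0 ?normr_sin_le1.
have D := @derivable_under_integral R _ _ leb f setT measurableT z _ _ zI A1 A2 G
  A3 (itg_abs_gau a0) A4.
have E := @differentiation_under_integral R _ _ leb f setT measurableT z _ _ zI A1
  A2 G A3 (itg_abs_gau a0) A4.
apply: DeriveDef => //; rewrite -derive1E E.
rewrite mulNr -Int_mul_gau_sin// -IntN; last exact: itg_mul_gau_sin.
apply: eq_Rintegral => s _; rewrite partial1of2E.
by have [_ dE] := df z s; rewrite ?derive1E dE.
Qed.

(** The product with exp (z^2 / (4 a)) has zero derivative, hence equals its value at 0, the
    Gaussian integral. *)
Lemma Int_gau_cos a z : 0 < a -> Int leb (fun s => gau a s * cos (s * z)) =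
  Num.sqrt (pi / a) * gau (4 * a)^-1 z.
Proof.
move=> a0; pose b := (4 * a)^-1.
pose phi z := Int leb (fun s => gau a s * cos (s * z)) * gau (- b) z.
have dphi (x : R) : is_derive x 1 phi 0.
  have H1 := is_derive_gau_cos x a0; have H2 := is_derive_gau (- b) x.
  apply: is_derive_eq; rewrite /GRing.scale/= /b.
  set J := Int _ _.
  have -> : x / (2 * a) = 2 * (4 * a)^-1 * x by field; rewrite gt_eqF.
  ring.
have := @is_derive_0_is_cst R phi z 0 dphi.
rewrite /phi; have -> : gau (- b) 0 = 1 by rewrite /gau expr0n/= mulr0 oppr0 expR0.
rewrite mulr1; under [X in _ = X -> _]eq_Int do rewrite mulr0 cos0 mulr1.
rewrite (Int_gau a0).2 => <-.
rewrite -mulrA -[LHS]mulr1; congr (_ * _).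
by apply/esym; rewrite /gau -expRD -[RHS]expR0; congr expR; rewrite /b; ring.
Qed.

End gaussian.

(** * Continuity of translations in L^2 *)

Section translation_continuity.
Context d (T : measurableType d) (R : realType).
Variable mu : {measure set T -> \bar R}.
Context (I : Type) (F : set_system I) {FF : Filter F}.
Variable phi : I -> T -> T.
Hypothesis mphi : forall i, mpres mu (phi i).
Implicit Types f g : T -> R.

(** The maps [phi] and the filter stay abstract, so that one density argument serves both the line
    and the plane. *)
Definition tcont f := forall e : R, 0 < e ->
  \forall i \near F, nrm mu (fun x => f (phi i x) - f x) < e.

Let sqt i f : sq mu f -> sq mu (fun x => f (phi i x) - f x).
Proof. by move=> sf; apply: sqB => //; exact: mpres_sq. Qed.

Lemma tcontD f g : sq mu f -> sq mu g -> tcont f -> tcont g ->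
  tcont (fun x => f x + g x).
Proof.
move=> sf sg tf tg e e0; have e2 : 0 < e / 2 by rewrite divr_gt0.
apply: filterS2 (tf _ e2) (tg _ e2) => i fi gi.
rewrite [ltRHS](splitr e) (le_lt_trans _ (ltrD fi gi))//.
have := nrmD (sqt i sf) (sqt i sg); congr (_ <= _).
by apply: eq_nrm => x; ring.
Qed.

Lemma tcontZ k f : sq mu f -> tcont f -> tcont (fun x => k * f x).
Proof.
move=> sf tf e e0; have e2 : 0 < e / (`|k| + 1) by rewrite divr_gt0// ltr_wpDl.
apply: filterS (tf _ e2) => i; rewrite ltr_pdivlMr ?ltr_wpDl// => H.
have -> : nrm mu (fun x => k * f (phi i x) - k * f x) =
    `|k| * nrm mu (fun x => f (phi i x) - f x).
  by rewrite -nrmZ; [apply: eq_nrm => x; ring|exact: sqt].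
apply: le_lt_trans H; rewrite mulrC ler_wpM2l ?nrm_ge0//.
by rewrite lerDl.
Qed.

Lemma tcont0 : tcont (fun=> 0).
Proof.
move=> e e0; apply: nearW => i; rewrite /nrm.
under eq_Int do rewrite subrr expr0n/=.
by rewrite Int0 sqrtr0.
Qed.

(** Three-epsilon argument: [phi i] preserves the norm, so the translated approximation error is no
    larger than the error itself. *)
Lemma tcont_lim f : sq mu f ->
  (forall e, 0 < e -> exists g, [/\ sq mu g, tcont g &
     nrm mu (fun x => f x - g x) < e]) -> tcont f.
Proof.
move=> sf H e e0; have e3 : 0 < e / 3 by rewrite divr_gt0.
have [g [sg tg fg]] := H _ e3.
apply: filterS (tg _ e3) => i gi.
have s1 : sq mu (fun x => f (phi i x) - g (phi i x)).
  by apply: sqB; exact: mpres_sq.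
have s2 := sqt i sg.
have s3 : sq mu (fun x => g x - f x) by exact: sqB.
have -> : nrm mu (fun x => f (phi i x) - f x) = nrm mu (fun x =>
    ((f (phi i x) - g (phi i x)) + (g (phi i x) - g x)) + (g x - f x)).
  by apply: eq_nrm => x; ring.
apply: (le_lt_trans (nrmD (sqD s1 s2) s3)).
have := nrmD s1 s2.
have -> : nrm mu (fun x => f (phi i x) - g (phi i x)) =
    nrm mu (fun x => f x - g x).
  exact: (mpres_nrm (mphi i) (sqB sf sg)).
have -> : nrm mu (fun x => g x - f x) = nrm mu (fun x => f x - g x).
  by rewrite -nrmN; apply: eq_nrm => x; ring.
lra.
Qed.

Lemma eq_tcont f g : f =1 g -> tcont f -> tcont g.
Proof. by move=> /funext ->. Qed.

Lemma itg_indic (A : set T) : measurable A -> (mu A < +oo)%E -> itg mu (\1_A).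
Proof.
move=> mA Ay; apply: itg_ltyP; [exact: measurable_indic|move=> x //|].
by rewrite integral_indic// setIT.
Qed.

Lemma Int_indic (A : set T) : measurable A -> (mu A < +oo)%E ->
  ((Int mu (\1_A))%:E = mu A)%E.
Proof. by move=> mA Ay; rewrite -IntE ?integral_indic ?setIT//; exact: itg_indic. Qed.

Lemma sq_indic (A : set T) : measurable A -> (mu A < +oo)%E -> sq mu (\1_A).
Proof.
move=> mA Ay; split; first exact: measurable_indic.
have -> : (fun x => (\1_A x : R) ^+ 2) = \1_A.
  by apply/funext => x; rewrite indicE; case: (_ \in _); rewrite ?expr1n ?expr0n.
by apply: itg_ltyP; [exact: measurable_indic|move=> x|rewrite integral_indic// setIT].
Qed.

Lemma nrm_cvg0 (u : nat -> T -> R) f : (forall n, sq mu (u n)) -> sq mu f ->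
  (forall n x, `|u n x| <= `|f x|) -> (forall x, u ^~ x @ \oo --> (0 : R)) ->
  nrm mu (u n) @[n --> \oo] --> (0 : R).
Proof.
move=> su [mf If] uf u0.
have : Int mu (fun x => u n x ^+ 2) @[n --> \oo] --> Int mu (fun=> 0).
  apply: (@Int_dominated _ _ _ mu (fun n x => u n x ^+ 2) _ (fun x => f x ^+ 2)) => //.
  - by move=> n; apply: (measurable_funX 2); case: (su n).
  - move=> x; have H : u n x * u n x @[n --> \oo] --> (0 * 0 : R) by exact: cvgM.
    by rewrite mulr0 in H.
  - move=> n x; rewrite normrX -[leRHS]real_normK ?num_real//.
    by rewrite ler_pXn2r ?nnegrE.
rewrite Int0 => H; rewrite -[X in _ --> X]sqrtr0.
by apply: continuous_cvg => //; exact: sqrt_continuous.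
Qed.

Section density.
Variables (G : set (set T)) (Q : nat -> set T).
Hypothesis GE : @measurable _ T = <<s G >>.
Hypothesis GI : setI_closed G.
Hypothesis mQ : forall n, measurable (Q n).
Hypothesis Qy : forall n, (mu (Q n) < +oo)%E.
Hypothesis Qx : forall x, \forall n \near \oo, Q n x.
Hypothesis tQ : forall n, tcont (\1_(Q n)).
Hypothesis tG : forall A n, G A -> tcont (\1_(A `&` Q n)).

Let QAy A n : measurable A -> (mu (A `&` Q n) < +oo)%E.
Proof.
move=> mA; apply: le_lt_trans (Qy n).
by rewrite le_measure// inE//; exact: measurableI.
Qed.

Let sQ A n : measurable A -> sq mu (\1_(A `&` Q n)).
Proof. by move=> mA; apply: sq_indic; [exact: measurableI|exact: QAy]. Qed.

(** Dynkin's theorem on the generating class. Intersecting with [Q n] keeps all measures finite, so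
    that complements and countable disjoint unions remain in L^2. *)
Let tcont_QI A n : measurable A -> tcont (\1_(A `&` Q n)).
Proof.
rewrite GE => gA; move: A gA; apply: (@dynkin_induction _ T G
  (fun A => tcont (\1_(A `&` Q n)))) => //.
- by rewrite setTI; exact: tQ.
- by move=> A GA; exact: tG.
- move=> A mA tA.
  have := tcontD (sQ n measurableT) (sqZ (-1) (sQ n mA)).
  rewrite setTI => /(_ (@tQ n) (tcontZ (-1) (sQ n mA) tA)).
  apply: eq_tcont => x; rewrite !indicE !in_setI in_setC.
  by case: (x \in A); case: (x \in Q n) => /=; ring.
- move=> B mB tB PB.
  have mU : measurable (\bigcup_k B k) by exact: bigcup_measurable.
  apply: tcont_lim; first exact: sQ.
  pose S k := \big[setU/set0]_(i < k) B i.
  have mS k : measurable (S k) by exact: bigsetU_measurable.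
  have tS k : tcont (\1_(S k `&` Q n)).
    elim: k => [|k ih].
      apply: (eq_tcont _ tcont0) => x.
      by rewrite /S big_ord0 set0I indicE in_set0.
    have := tcontD (sQ n (mS k)) (sQ n (mB k)) ih (PB k).
    apply: eq_tcont => x; rewrite /S big_ord_recr/= -/(S k).
    rewrite !indicE !in_setI in_setU.
    have [xS|] := boolP (x \in S k) => /=; last by rewrite add0r.
    suff -> : x \in B k = false by rewrite /= addr0.
    apply/negbTE/negP; rewrite inE => Bk.
    move: xS; rewrite inE /S -bigcup_mkord => -[j /= jk Bj].
    have /trivIsetP/(_ j k Logic.I Logic.I) := tB; rewrite (ltn_eqF jk) => /(_ isT).
    by move=> /seteqP[/(_ x (conj Bj Bk))].
  have : nrm mu (fun x => \1_((\bigcup_k B k) `&` Q n) x - \1_(S k `&` Q n) x)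
      @[k --> \oo] --> (0 : R).
    apply: (nrm_cvg0 (f := \1_((\bigcup_k B k) `&` Q n))).
    - by move=> k; apply: sqB; exact: sQ.
    - exact: sQ.
    - move=> k x; rewrite !indicE !in_setI.
      have [xU|xU] := boolP (x \in \bigcup_k B k).
        by case: (x \in S k); case: (x \in Q n); rewrite /= ?subrr ?subr0 ?normr0 ?normr1 ?ler01.
      suff -> : x \in S k = false by rewrite /= subr0.
      apply/negbTE; apply: contra xU; rewrite !inE /S -bigcup_mkord.
      by move=> [j _ Bj]; exists j.
    - move=> x; apply: cvg_near_cst.
      have [[j _ Bj]|nU] := pselect ((\bigcup_k B k) x).
        exists j.+1 => // k /= jk.
        have xU : x \in \bigcup_k B k by rewrite inE; exists j.
        have xS : x \in S k by rewrite inE /S -bigcup_mkord; exists j.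
        by rewrite !indicE !in_setI xU xS subrr.
      apply: nearW => k.
      have xU : x \in \bigcup_k B k = false by apply/negbTE; rewrite notin_setE.
      have xS : x \in S k = false.
        apply/negbTE; rewrite notin_setE /S -bigcup_mkord => -[j _ Bj].
        by apply: nU; exists j.
      by rewrite !indicE !in_setI xU xS subrr.
  move=> H e e0.
  have /cvgr0Pnorm_lt/(_ _ e0)[k _ /(_ k (leqnn k))] := H.
  rewrite ger0_norm ?nrm_ge0// => He.
  by exists (\1_(S k `&` Q n)); split; [exact: sQ|exact: tS|exact: He].
Qed.

Let tcont_fin A : measurable A -> (mu A < +oo)%E -> tcont (\1_A).
Proof.
move=> mA Ay; apply: tcont_lim; first exact: sq_indic.
have : nrm mu (fun x => \1_A x - \1_(A `&` Q k) x) @[k --> \oo] --> (0 : R).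
  apply: (nrm_cvg0 (f := \1_A)).
  - by move=> k; apply: sqB; [exact: sq_indic|exact: sQ].
  - exact: sq_indic.
  - move=> k x; rewrite !indicE !in_setI.
    by case: (x \in A); case: (x \in Q k); rewrite /= ?subrr ?subr0 ?normr0 ?normr1 ?ler01.
  - move=> x; apply: cvg_near_cst; apply: filterS (Qx x) => k Qkx.
    by rewrite !indicE in_setI (mem_set Qkx) andbT subrr.
move=> H e e0.
have /cvgr0Pnorm_lt/(_ _ e0)[k _ /(_ k (leqnn k))] := H.
rewrite ger0_norm ?nrm_ge0// => He.
by exists (\1_(A `&` Q k)); split => //; [exact: sQ|exact: tcont_QI].
Qed.

Import HBNNSimple.

Let tcont_sfun (g : {nnsfun T >-> R}) : sq mu g -> tcont g /\ sq mu g.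
Proof.
move=> sg.
have mA y : measurable (g @^-1` [set y]) by exact: measurable_sfunP.
have Ay y : y != 0 -> (mu (g @^-1` [set y]) < +oo)%E.
  move=> y0; have [_ Ig] := sg.
  have y20 : 0 < y ^+ 2 by rewrite exprn_even_gt0.
  have -> : mu (g @^-1` [set y]) = (\int[mu]_x (\1_(g @^-1` [set y]) x)%:E)%E.
    by rewrite integral_indic// setIT.
  apply: (@le_lt_trans _ _ (\int[mu]_x (y ^- 2 * g x ^+ 2)%:E)%E); last first.
    by rewrite IntE ?ltry//; exact: itgZ.
  apply: ge0_le_integral => //.
  - exact/measurable_EFinP/measurable_indic.
  - by apply/measurable_EFinP/measurable_funM => //; exact: (measurable_funX 2 sg.1).
  - move=> x _; rewrite lee_fin indicE.
    have [|_] := boolP (_ \in _); last by rewrite mulr_ge0 ?invr_ge0 ?sqr_ge0.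
    by rewrite inE /= => ->; rewrite mulVf// gt_eqF.
have key y : sq mu (fun x => y * \1_(g @^-1` [set y]) x) /\
    tcont (fun x => y * \1_(g @^-1` [set y]) x).
  have [->|y0] := eqVneq y 0.
    by under eq_fun do rewrite mul0r; split; [exact: sq0|exact: tcont0].
  have s1 := sq_indic (mA y) (Ay y y0).
  by split; [exact: sqZ|apply: tcontZ => //; exact: tcont_fin (Ay y y0)].
split=> //.
suff [H1 H2] : sq mu (fun x => \sum_(y \in range g) y * \1_(g @^-1` [set y]) x) /\
   tcont (fun x => \sum_(y \in range g) y * \1_(g @^-1` [set y]) x).
  by apply: eq_tcont H2 => x; rewrite -fimfunE.
under eq_fun do rewrite fsbig_finite//=.
elim: (finmap.enum_fset (fset_set (range g))) => [|y s [sih ih]].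
  by under eq_fun do rewrite big_nil; split; [exact: sq0|exact: tcont0].
have [k1 k2] := key y.
by under eq_fun do rewrite big_cons; split; [exact: sqD|exact: tcontD].
Qed.

Let tcont_ge0 f : (forall x, 0 <= f x) -> sq mu f -> tcont f.
Proof.
move=> f0 sf; apply: tcont_lim => //.
have mf : measurable_fun setT (EFin \o f) by apply/measurable_EFinP; case: sf.
pose g n := nnsfun_approx measurableT mf n.
have cg x : g n x @[n --> \oo] --> f x.
  have := @cvg_nnsfun_approx _ T R setT measurableT _ mf _ x Logic.I.
  have -> : (EFin \o f) x = (f x)%:E by [].
  by move=> /(_ (fun y _ => f0 y)) /fine_cvgP[_ /=].
have gf n x : 0 <= g n x <= f x.
  rewrite fun_ge0/= -(cvg_lim _ (cg x))//.
  apply: (@nondecreasing_cvgn_le _ (fun n => g n x)); last exact: cvgP (cg x).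
  by move=> m k mk; have /lefP/(_ x) := nd_nnsfun_approx measurableT mf mk.
have sg n : sq mu (g n).
  apply: (@sq_le _ _ _ mu _ f) => // x; have /andP[g0 gx] := gf n x.
  by rewrite ger0_norm.
have H : nrm mu (fun x => f x - g n x) @[n --> \oo] --> (0 : R).
  apply: (nrm_cvg0 (f := f)) => //.
  - by move=> n; exact: sqB.
  - move=> n x; have /andP[g0 gx] := gf n x.
    by rewrite ger0_norm ?subr_ge0// ger0_norm// lerBlDr lerDl.
  - move=> x; rewrite -(subrr (f x)); apply: cvgB; first exact: cvg_cst.
    exact: cg.
move=> e e0; have /cvgr0Pnorm_lt/(_ _ e0)[n _ /(_ n (leqnn n))] := H.
rewrite ger0_norm ?nrm_ge0// => He.
exists (g n); split => //; exact: (tcont_sfun (sg n)).1.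
Qed.

Lemma tcont_sq f : sq mu f -> tcont f.
Proof.
move=> sf; have [mf _] := sf.
pose p x := Num.max (f x) 0; pose m x := Num.max (- f x) 0.
have sp : sq mu p.
  apply: (@sq_le _ _ _ mu _ (fun x => `|f x|)); last exact: sq_abs.
    exact: measurable_maxr.
  by move=> x; rewrite /p; case: (leP (f x) 0); rewrite ?normr0.
have sm : sq mu m.
  apply: (@sq_le _ _ _ mu _ (fun x => `|f x|)); last exact: sq_abs.
    by apply: measurable_maxr => //; exact: measurable_funN.
  by move=> x; rewrite /m; case: (leP (- f x) 0); rewrite ?normr0 ?normrN.
have tp : tcont p by apply: tcont_ge0 => // x; rewrite /p le_max lexx orbT.
have tm : tcont m by apply: tcont_ge0 => // x; rewrite /m le_max lexx orbT.
apply: eq_tcont (tcontD sp (sqZ (-1) sm) tp (tcontZ (-1) sm tm)) => x.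
by rewrite /p /m; case: (leP (f x) 0); case: (leP (- f x) 0); lra.
Qed.

End density.
End translation_continuity.

Section translation_line.
Context {R : realType}.
Let leb := @lebesgue_measure R.

Lemma lebesgue_itv_lty (a b : R) : (leb `]a, b]%classic < +oo)%E.
Proof. by rewrite /leb lebesgue_measure_itv/=; case: ifP => _; rewrite ltry. Qed.

Lemma near_bound (x : R) : \forall n \near \oo, `|x| < n%:R.
Proof.
exists (Num.bound `|x|) => // n /= bn.
by apply: (lt_le_trans (archi_boundP (normr_ge0 x))); rewrite ler_nat.
Qed.

(** The translated indicator differs from the original only within |h| of an endpoint, so the
    squared norm is at most 4 |h|. *)
Lemma tcont_itv (a b : R) :
  tcont leb (nbhs (0 : R)) (fun h (x : measurableTypeR R) => x + h) (\1_(`]a, b]%classic)).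
Proof.
move=> e e0.
have e2 : 0 < e ^+ 2 / 5 by rewrite divr_gt0// exprn_gt0.
near=> h.
have he : `|h| < e ^+ 2 / 5 by near: h; exact: (@nbhs0_lt R R _ e2).
pose J (c : R) : set R := `]c - `|h|, c + `|h|]%classic.
have mJ c : measurable (J c) by exact: measurable_itv.
have lJ c : leb (J c) = (2 * `|h|)%:E.
  rewrite /leb lebesgue_measure_itv/= lte_fin.
  case: ifPn => [_|].
    by rewrite -EFinD; congr (_%:E); ring.
  rewrite -leNgt => H; congr (_%:E).
  have := normr_ge0 h; move: H; lra.
have Jy c : (leb (J c) < +oo)%E by rewrite lJ ltry.
have sJ c : sq leb (\1_(J c)) by apply: sq_indic; [exact: mJ|exact: Jy].
have iJ c : itg leb (\1_(J c)) by apply: itg_indic; [exact: mJ|exact: Jy].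
have nJ c : Int leb (\1_(J c)) = 2 * `|h|.
  by apply: EFin_inj; rewrite -(lJ c); apply: Int_indic; [exact: mJ|exact: Jy].
pose f : R -> R := \1_(`]a, b]%classic).
have mf : measurable_fun setT f by apply: measurable_indic; exact: measurable_itv.
have bnd x : (f (x + h) - f x) ^+ 2 <= \1_(J a) x + \1_(J b) x.
  rewrite /f !indicE !mem_setE !in_itv/=.
  have n1 := ler_norm h; have n2 := ler_norm (- h); rewrite normrN in n2.
  have bb (p q : bool) : ((p%:R - q%:R) ^+ 2 : R) <= 1.
    by case: p; case: q; rewrite ?subrr ?subr0 ?sub0r ?sqrrN ?expr1n ?expr0n.
  have key c : (c < x + h) = (c < x) \/ (c - `|h| < x) && (x <= c + `|h|).
    have [h1|h1] := ltP c (x + h); have [h2|h2] := ltP c x; [by left|right|right|by left];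
      by apply/andP; split; lra.
  case: (key a) => [ea|->]; last by apply: (le_trans (bb _ _)); rewrite lerDl ler0n.
  case: (key b) => [eb|->]; last by apply: (le_trans (bb _ _)); rewrite lerDr ler0n.
  by rewrite !(leNgt _ b) ea eb subrr expr0n /= addr_ge0// ler0n.
have : nrm leb (fun x : measurableTypeR R => f (x + h) - f x) ^+ 2 <= 4 * `|h|.
  rewrite sqr_nrm (_ : 4 * `|h| = Int leb (fun x => \1_(J a) x + \1_(J b) x)).
    apply: le_trans (ler_norm _) _.
    apply: normr_Int_le2 => //.
    - apply: (measurable_funX 2); apply: measurable_funB => //.
      have [ms _] := @mpres_shift1 R h.
      exact: (measurableT_comp mf ms).
    - exact: itgD.
    - by move=> x; rewrite ger0_norm ?sqr_ge0.
  rewrite IntD// !nJ; ring.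
move=> H; rewrite -(ltr_pXn2r (ltn0Sn 1))// ?nnegrE ?nrm_ge0 ?ltW//.
apply: le_lt_trans H _; lra.
Unshelve. all: by end_near. Qed.

Lemma tcont_line (f : R -> R) : sq leb f ->
  tcont leb (nbhs (0 : R)) (fun h (x : measurableTypeR R) => x + h) f.
Proof.
pose Q (n : nat) : set R := `]- n%:R, n%:R]%classic.
apply: (@tcont_sq _ _ _ leb _ _ _ _ _ (@ocitv R) Q) => //.
- by move=> h; exact: mpres_shift1.
- by move=> A B [[a b] _ <-] [[c d'] _ <-]; apply: ocitvI; apply: is_ocitv.
- by move=> n; exact: measurable_itv.
- by move=> n; exact: lebesgue_itv_lty.
- move=> x; near=> n; rewrite /Q /= in_itv/=.
  have : `|x| < n%:R by near: n; exact: near_bound.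
  by rewrite ltr_norml => /andP[-> /ltW ->].
- by move=> n; exact: tcont_itv.
- move=> A n [[a b] _ <-].
  have [[c d'] _ <-] : ocitv (`]a, b]%classic `&` Q n).
    by apply: ocitvI; apply: is_ocitv.
  exact: tcont_itv.
Unshelve. all: by end_near. Qed.

End translation_line.

Section translation_plane.
Context {R : realType}.
Let leb := @lebesgue_measure R.
Let lb := @lb2 R.

Lemma sq_tensor (f g : R -> R) : sq leb f -> sq leb g ->
  sq lb (fun z => f z.1 * g z.2).
Proof.
move=> [mf If] [mg Ig]; split.
  apply: measurable_funM; first exact: (measurableT_comp mf measurable_fst).
  exact: (measurableT_comp mg measurable_snd).
under eq_fun do rewrite exprMn.
exact: (itg_tensor If Ig).
Qed.

Lemma nrm_tensor (f g : R -> R) : sq leb f -> sq leb g ->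
  nrm lb (fun z => f z.1 * g z.2) = nrm leb f * nrm leb g.
Proof.
move=> [mf If] [mg Ig]; rewrite /nrm -sqrtrM; last first.
  by apply: Int_ge0 => x; exact: sqr_ge0.
congr Num.sqrt; under eq_Int do rewrite exprMn.
exact: (Int_tensor If Ig).
Qed.

Lemma tcont_tensor (f g : R -> R) : sq leb f -> sq leb g ->
  tcont lb (nbhs (0 : R * R)) (fun h (z : plane R) => z + h) (fun z => f z.1 * g z.2).
Proof.
move=> sf sg e e0.
have arith (a b u v c : R) : 0 <= a -> 0 <= b -> 0 <= u -> 0 <= v ->
    a * (2 * (u + v + 1)) < c -> b * (2 * (u + v + 1)) < c -> a * v + u * b < c.
  by move=> a0 b0 u0 v0; have := mulr_ge0 a0 u0; have := mulr_ge0 b0 v0; lra.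
pose N := nrm leb f + nrm leb g + 1.
have N0 : 0 < N by rewrite ltr_wpDl// addr_ge0 ?nrm_ge0.
have eN : 0 < e / (2 * N) by rewrite divr_gt0// mulr_gt0.
have tf := tcont_line sf eN; have tg := tcont_line sg eN.
have sfh h : sq leb (fun x => f (x + h)) by exact: (mpres_sq (mpres_shift1 h) sf).
have sgh h : sq leb (fun x => g (x + h)) by exact: (mpres_sq (mpres_shift1 h) sg).
have H1 : \forall h \near (0 : R * R), nrm leb (fun x => f (x + h.1) - f x) < e / (2 * N).
  exact: (@cvg_fst _ _ (nbhs (0 : R)) (nbhs (0 : R)) _ _ tf).
have H2 : \forall h \near (0 : R * R), nrm leb (fun x => g (x + h.2) - g x) < e / (2 * N).
  exact: (@cvg_snd _ _ (nbhs (0 : R)) (nbhs (0 : R)) _ _ tg).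
apply: filterS2 H1 H2 => h H1 H2.
have s1 := sq_tensor (sqB (sfh h.1) sf) (sgh h.2).
have s2 := sq_tensor sf (sqB (sgh h.2) sg).
have -> : nrm lb (fun z => f (z + h).1 * g (z + h).2 - f z.1 * g z.2) =
  nrm lb (fun z => (f (z.1 + h.1) - f z.1) * g (z.2 + h.2) +
                    f z.1 * (g (z.2 + h.2) - g z.2)).
  by apply: eq_nrm => z /=; ring.
apply: (le_lt_trans (nrmD s1 s2)).
rewrite (nrm_tensor (sqB (sfh h.1) sf) (sgh h.2)).
rewrite (nrm_tensor sf (sqB (sgh h.2) sg)).
have -> : nrm leb (fun x => g (x + h.2)) = nrm leb g.
  exact: (mpres_nrm (mpres_shift1 h.2) sg).
move: H1 H2; set a := nrm _ _; rewrite ltr_pdivlMr ?mulr_gt0// => H1.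
set b := nrm _ _; rewrite ltr_pdivlMr ?mulr_gt0// => H2.
have a0 : 0 <= a := nrm_ge0 _ _; have b0 : 0 <= b := nrm_ge0 _ _.
have f0 := nrm_ge0 leb f; have g0 := nrm_ge0 leb g.
exact: arith H1 H2.
Qed.

(** Measurable rectangles generate the product sigma-algebra, and their indicators are tensor
    products, for which continuity on the line suffices. *)
Lemma tcont_plane (f : R * R -> R) : sq lb f ->
  tcont lb (nbhs (0 : R * R)) (fun h (z : plane R) => z + h) f.
Proof.
pose Q (n : nat) : set (R * R) :=
  (`]- n%:R, n%:R]%classic : set R) `*` (`]- n%:R, n%:R]%classic : set R).
pose I (n : nat) : set R := `]- n%:R, n%:R]%classic.
have fin (n : nat) : (leb (I n) < +oo)%E.
  exact: lebesgue_itv_lty.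
have indX (A B : set R) : (\1_(A `*` B) : R * R -> R) = fun z => \1_A z.1 * \1_B z.2.
  apply/funext => z; rewrite !indicE -natrM mulnb; congr (_%:R); congr nat_of_bool.
  by apply/idP/andP; rewrite !inE.
apply: (@tcont_sq _ _ _ lb _ _ _ _ _
  [set A `*` B | A in @measurable _ (measurableTypeR R) & B in @measurable _ (measurableTypeR R)] Q).
- by move=> h; exact: mpres_shift.
- exact: measurable_prod_measurableType.
- move=> _ _ [A mA [B mB <-]] [C mC [D mD <-]]; rewrite -setXI.
  by exists (A `&` C); [exact: measurableI|exists (B `&` D) => //; exact: measurableI].
- by move=> n; apply: measurableX; exact: measurable_itv.
- move=> n; rewrite /lb/= /prod_measure product_measure1E; try exact: measurable_itv.
  by apply: lte_mul_pinfty; rewrite ?ge0_fin_numE//; exact: (fin n).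
- move=> x; near=> n; rewrite /Q /= !in_itv/=.
  have bx (y : R) : `|y| < n%:R -> - n%:R < y <= n%:R.
    by rewrite ltr_norml => /andP[-> /ltW ->].
  by split; apply: bx; near: n; exact: near_bound.
- move=> n; rewrite /Q indX; by apply: tcont_tensor; apply: sq_indic; try exact: (fin n);
  exact: measurable_itv.
- move=> _ n [A mA [B mB <-]]; rewrite /Q -setXI indX.
  apply: tcont_tensor; apply: sq_indic;
    try (by apply: measurableI => //; exact: measurable_itv).
    apply: le_lt_trans (fin n); apply: le_measure; rewrite ?inE//.
      by apply: measurableI => //; exact: measurable_itv.
    exact: measurable_itv.
  apply: le_lt_trans (fin n); apply: le_measure; rewrite ?inE//.
    by apply: measurableI => //; exact: measurable_itv.
  exact: measurable_itv.
Unshelve. all: by end_near. Qed.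

End translation_plane.
Lemma odd_Int0 d (T : measurableType d) (R : realType)
    (mu : {measure set T -> \bar R}) (phi : T -> T) (f : T -> R) :
  mpres mu phi -> itg mu f -> (forall x, f (phi x) = - f x) -> Int mu f = 0.
Proof.
move=> mp If fo; have := mpres_Int mp If.
under eq_Int do rewrite fo.
rewrite IntN// => /eqP; rewrite -subr_eq0 -opprD oppr_eq0 -mulr2n.
by rewrite mulrn_eq0/= => /eqP.
Qed.

(** * The Hartley transform of integrable functions *)

Section hartley.
Context {R : realType}.
Let leb := @lebesgue_measure R.
Let lb := @lb2 R.
Implicit Types (f g : R * R -> R) (x xi z : R * R).

Definition cas (t : R) : R := cos t + sin t.

Lemma normr_cas_le (t : R) : `|cas t| <= 2.
Proof.
rewrite /cas (le_trans (ler_normD _ _))//.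
have := normr_cos_le1 t; have := normr_sin_le1 t; lra.
Qed.

Lemma measurable_cos : measurable_fun setT (@cos R).
Proof. by apply: continuous_measurable_fun; exact: continuous_cos. Qed.

Lemma measurable_sin : measurable_fun setT (@sin R).
Proof. by apply: continuous_measurable_fun; exact: continuous_sin. Qed.

Lemma measurable_cas : measurable_fun setT cas.
Proof. by apply: measurable_funD; [exact: measurable_cos|exact: measurable_sin]. Qed.

Lemma measurable_dotl x : measurable_fun setT (fun xi : plane R => dot x xi).
Proof.
apply: measurable_funD; apply: measurable_funM => //.
Qed.

Lemma measurable_dot2 :
  measurable_fun setT (fun p : plane R * plane R => dot p.1 p.2).
Proof.
apply: measurable_funD; apply: measurable_funM.
- exact: (measurableT_comp measurable_fst measurable_fst).
- exact: (measurableT_comp measurable_fst measurable_snd).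
- exact: (measurableT_comp measurable_snd measurable_fst).
- exact: (measurableT_comp measurable_snd measurable_snd).
Qed.

Lemma dotC x z : dot x z = dot z x. Proof. by rewrite /dot; ring. Qed.

Definition hart f xi : R := Int lb (fun x => f x * cas (dot x xi)).

Lemma itg_cas f xi : itg lb f -> itg lb (fun x => f x * cas (dot x xi)).
Proof.
move=> If; apply: (itg_le _ _ (itgZ 2 (itg_abs If))).
  apply: measurable_funM; first exact: itg_meas If.
  apply: (measurableT_comp measurable_cas).
  under eq_fun do rewrite dotC; exact: measurable_dotl.
by move=> x; rewrite normrM mulrC ler_wpM2r// normr_cas_le.
Qed.

Lemma itg_hart2 f g : itg lb f -> itg lb g ->
  itg (lb \x lb)%E (fun p => f p.1 * g p.2 * cas (dot p.1 p.2)).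
Proof.
move=> If Ig.
have H := itg_tensor (itg_abs If) (itg_abs Ig).
apply: (itg_le _ _ (itgZ 2 H)).
  apply: measurable_funM; last exact: (measurableT_comp measurable_cas measurable_dot2).
  apply: measurable_funM.
    exact: (measurableT_comp (itg_meas If) measurable_fst).
  exact: (measurableT_comp (itg_meas Ig) measurable_snd).
move=> p; rewrite !normrM mulrC ler_wpM2r ?mulr_ge0//.
exact: normr_cas_le.
Qed.

(** The kernel is not integrable in xi, so Fubini does not apply directly: a Gaussian factor in xi
    makes it integrable and is divided out afterwards. *)
Lemma measurable_hart f : itg lb f -> measurable_fun setT (hart f).
Proof.
move=> If; pose g xi : R := expR (- (dot xi xi)).
have Ig : itg lb g.
  have := itg_tensor (itg_gau (@ltr01 R)) (itg_gau (@ltr01 R)); congr itg.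
  apply/funext => z; rewrite /g /gau -expRD; congr expR; rewrite /dot; ring.
have H := measurable_Int2 (itg_hart2 If Ig).
have -> : hart f = fun xi => expR (dot xi xi) *
    Int lb (fun x => f x * g xi * cas (dot x xi)).
  apply/funext => xi; rewrite /hart -IntZ; last first.
    have := itgZ (g xi) (itg_cas xi If); congr itg.
    by apply/funext => x; ring.
  apply: eq_Int => x.
  rewrite [RHS](_ : _ = (expR (dot xi xi) * g xi) * (f x * cas (dot x xi))).
    by rewrite /g -expRD subrr expR0 mul1r.
  by ring.
apply: measurable_funM => //.
apply: measurableT_comp => //.
by apply: measurable_funD; apply: measurable_funM.
Qed.

Lemma hartB f g xi : itg lb f -> itg lb g ->
  hart (fun x => f x - g x) xi = hart f xi - hart g xi.
Proof.
move=> If Ig; rewrite /hart -IntB; [|exact: itg_cas|exact: itg_cas].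
by apply: eq_Int => x; ring.
Qed.

Lemma hart_adj f g : itg lb f -> itg lb g ->
  Int lb (fun x => hart f x * g x) = Int lb (fun x => f x * hart g x).
Proof.
move=> If Ig.
have H := Int_swap (itg_hart2 If Ig).
transitivity (Int lb (fun xi => Int lb (fun x => f x * g xi * cas (dot x xi)))).
  apply: eq_Int => xi; rewrite /hart -IntZr; last exact: itg_cas.
  by apply: eq_Int => x; ring.
rewrite -H; apply: eq_Int => x; rewrite /hart -IntZ; last exact: itg_cas.
by apply: eq_Int => xi; rewrite (dotC xi); ring.
Qed.

(* The Gaussian of variance tending to infinity, used as a multiplier on the
   frequency side, and its transform, an approximate identity of mass (2 pi)^2. *)
Definition gau2 (a : R) z : R := gau a z.1 * gau a z.2.
Definition ker (a : R) z : R := pi / a * gau2 (4 * a)^-1 z.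

Lemma gau2_ge0 a z : 0 <= gau2 a z.
Proof. by rewrite mulr_ge0 ?gau_ge0. Qed.

Lemma itg_gau2 a : 0 < a -> itg lb (gau2 a).
Proof. by move=> a0; exact: (itg_tensor (itg_gau a0) (itg_gau a0)). Qed.

Lemma Int_gau2 a : 0 < a -> Int lb (gau2 a) = pi / a.
Proof.
move=> a0; rewrite (Int_tensor (itg_gau a0) (itg_gau a0)) (Int_gau a0).2.
by rewrite -expr2 sqr_sqrtr// divr_ge0 ?pi_ge0 ?ltW.
Qed.

Lemma Int_ker a : 0 < a -> Int lb (ker a) = (2 * pi) ^+ 2.
Proof.
move=> a0; have a4 : 0 < (4 * a)^-1 by rewrite invr_gt0 mulr_gt0.
rewrite /ker IntZ; last exact: itg_gau2.
by rewrite Int_gau2//; field; rewrite gt_eqF//= invr_neq0// gt_eqF// mulr_gt0.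
Qed.

Lemma ker_ge0 a z : 0 < a -> 0 <= ker a z.
Proof. by move=> a0; rewrite mulr_ge0 ?gau2_ge0// divr_ge0 ?pi_ge0 ?ltW. Qed.

Lemma measurable_gau2 a : measurable_fun setT (gau2 a : plane R -> R).
Proof.
apply: measurable_funM.
  exact: (measurableT_comp (measurable_gau a) measurable_fst).
exact: (measurableT_comp (measurable_gau a) measurable_snd).
Qed.

Lemma measurable_ker a : measurable_fun setT (ker a : plane R -> R).
Proof. by apply: measurable_funM => //; exact: measurable_gau2. Qed.

(** cas A cas B = cos (A - B) + sin (A + B). The sine is odd and drops out; the cosine splits into
    one-dimensional Gaussian transforms. *)
Lemma Int_gau_cas2 a x z : 0 < a ->
  Int lb (fun xi => gau2 a xi * (cas (dot x xi) * cas (dot z xi))) = ker a (x - z).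
Proof.
move=> a0.
pose w := x - z.
pose C (s : R) (t : R) := gau a s * cos (s * t).
pose S (s : R) (t : R) := gau a s * sin (s * t).
have IS t : itg leb (S ^~ t).
  apply: (itg_le _ _ (itg_gau a0)).
    by apply: measurable_funM; [exact: measurable_gau|exact: measurable_sinM].
  by move=> s; rewrite normrM (ger0_norm (gau_ge0 _ _)) ler_piMr ?gau_ge0 ?normr_sin_le1.
have IC t : itg leb (C ^~ t) := itg_gau_cos t a0.
have I1 := itg_tensor (IC w.1) (IC w.2).
have I2 := itg_tensor (IS w.1) (IS w.2).
have mg : measurable_fun setT (fun xi : plane R => gau2 a xi * sin (dot (x + z) xi)).
  apply: measurable_funM; first exact: measurable_gau2.
  exact: (measurableT_comp measurable_sin (measurable_dotl _)).
have I3 : itg lb (fun xi => gau2 a xi * sin (dot (x + z) xi)).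
  apply: (itg_le mg _ (itg_gau2 a0)) => xi.
  by rewrite normrM (ger0_norm (gau2_ge0 _ _)) ler_piMr ?gau2_ge0 ?normr_sin_le1.
transitivity (Int lb (fun xi => (C xi.1 w.1 * C xi.2 w.2 - S xi.1 w.1 * S xi.2 w.2)
    + gau2 a xi * sin (dot (x + z) xi))).
  apply: eq_Int => xi; rewrite /C /S /gau2.
  set A := dot x xi; set B := dot z xi.
  have -> : dot (x + z) xi = A + B by rewrite /A /B /dot /=; ring.
  have E : cos (A - B) = cos (xi.1 * w.1) * cos (xi.2 * w.2) - sin (xi.1 * w.1) * sin (xi.2 * w.2).
    by rewrite -cosD; congr cos; rewrite /A /B /dot /w /=; ring.
  rewrite (_ : _ + _ = gau a xi.1 * gau a xi.2 * (cos (A - B) + sin (A + B))); last first.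
    by rewrite E; ring.
  by rewrite /cas cosB sinD; ring.
rewrite IntD//; last exact: itgB.
rewrite IntB// (odd_Int0 (@mpres_opp R) I3); last first.
  move=> xi; have -> : dot (x + z) (- xi) = - dot (x + z) xi by rewrite /dot /=; ring.
  by rewrite sinN mulrN /gau2 /gau /= !sqrrN.
rewrite addr0 (Int_tensor (IC w.1) (IC w.2)) (Int_tensor (IS w.1) (IS w.2)).
have -> : Int leb (S ^~ w.1) = 0.
  apply: (odd_Int0 (@mpres_opp1 R) (IS w.1)) => s.
  by rewrite /S /gau sqrrN mulNr sinN mulrN.
rewrite mul0r subr0 !Int_gau_cos// /ker /gau2.
rewrite mulrACA -expr2 sqr_sqrtr ?divr_ge0 ?pi_ge0 ?ltW//.
Qed.

End hartley.

(** * Plancherel's identity *)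

Section plancherel.
Context {R : realType}.
Let leb := @lebesgue_measure R.
Let lb := @lb2 R.
Implicit Types (f g : R * R -> R) (x xi z : R * R).

Lemma normr_hart_le f xi : itg lb f -> `|hart f xi| <= 2 * Int lb (fun x => `|f x|).
Proof.
move=> If; rewrite -IntZ; last exact: itg_abs.
apply: normr_Int_le2; first exact: itg_meas (itg_cas xi If).
  by apply: itgZ; exact: itg_abs.
by move=> x; rewrite normrM mulrC ler_wpM2r// normr_cas_le.
Qed.

Lemma gau2_le1 (a : R) z : 0 <= a -> gau2 a z <= 1.
Proof.
by move=> a0; rewrite /gau2 -[leRHS]mulr1 ler_pM ?gau_ge0 ?gau_le1.
Qed.

Section gaussian_regularization.
Variables (f : R * R -> R) (a : R).
Hypotheses (If : itg lb f) (sf : sq lb f) (a0 : 0 < a).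

Let h xi := gau2 a xi * hart f xi.

Let Ih : itg lb h.
Proof.
apply: (itg_le _ _ (itgZ (2 * Int lb (fun x => `|f x|)) (itg_gau2 a0))).
  by apply: measurable_funM; [exact: measurable_gau2|exact: measurable_hart].
move=> xi; rewrite normrM (ger0_norm (gau2_ge0 _ _)) mulrC.
by rewrite ler_wpM2r ?gau2_ge0 ?normr_hart_le.
Qed.

Let hart_h x : hart h x = Int lb (fun z => f z * ker a (x - z)).
Proof.
pose g xi := gau2 a xi * cas (dot x xi).
have Ig : itg lb g.
  apply: (itg_le _ _ (itgZ 2 (itg_gau2 a0))).
    apply: measurable_funM; first exact: measurable_gau2.
    exact: (measurableT_comp measurable_cas (measurable_dotl x)).
  move=> xi; rewrite normrM (ger0_norm (gau2_ge0 _ _)) mulrC.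
  by rewrite ler_wpM2r ?gau2_ge0 ?normr_cas_le.
have H := Int_swap (itg_hart2 If Ig).
transitivity (Int lb (fun xi => Int lb (fun z => f z * g xi * cas (dot z xi)))).
  apply: eq_Int => xi; rewrite /h.
  have -> : gau2 a xi * hart f xi * cas (dot xi x) = g xi * hart f xi.
    by rewrite /g dotC; ring.
  rewrite /hart -IntZ; last exact: itg_cas.
  by apply: eq_Int => z; ring.
rewrite -H; apply: eq_Int => z.
rewrite -(Int_gau_cas2 _ _ a0) -IntZ; last first.
  apply: (itg_le _ _ (itgZ 4 (itg_gau2 a0))).
    apply: measurable_funM; first exact: measurable_gau2.
    apply: measurable_funM.
      exact: (measurableT_comp measurable_cas (measurable_dotl x)).
    exact: (measurableT_comp measurable_cas (measurable_dotl z)).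
  move=> xi; rewrite normrM (ger0_norm (gau2_ge0 _ _)) mulrC.
  rewrite ler_wpM2r ?gau2_ge0// normrM.
  have := normr_cas_le (dot x xi); have := normr_cas_le (dot z xi).
  have := normr_ge0 (cas (dot x xi)); have := normr_ge0 (cas (dot z xi)); nra.
by apply: eq_Int => xi; rewrite /g; ring.
Qed.

Let F (p : plane R * plane R) : R := f p.1 * f (p.1 + p.2) * ker a p.2.

Let IF : itg (lb \x lb)%E F.
Proof.
have [mf If2] := sf.
have mF : measurable_fun setT F.
  apply: measurable_funM.
    apply: measurable_funM; first exact: (measurableT_comp mf measurable_fst).
    apply: (measurableT_comp mf).
    apply/measurable_fun_pairP; split; apply: measurable_funD.
    - exact: (measurableT_comp measurable_fst measurable_fst).
    - exact: (measurableT_comp measurable_fst measurable_snd).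
    - exact: (measurableT_comp measurable_snd measurable_fst).
    - exact: (measurableT_comp measurable_snd measurable_snd).
  exact: (measurableT_comp (measurable_ker a) measurable_snd).
have Ik : itg lb (ker a).
  by apply: itgZ; apply: itg_gau2; rewrite invr_gt0 mulr_gt0.
apply: itg_prod_abs2 => //.
apply: (@le_lt_trans _ _ (\int[lb]_w (Int lb (fun x => f x ^+ 2) * ker a w)%:E)%E).
  apply: ge0_le_integral => //.
  - by move=> w _; exact: integral_ge0.
  - apply: (measurable_fun_fubini_tonelli_G (m1 := lb) (fun p => (`|F p|)%:E)) => //.
    by apply/measurable_EFinP; exact: measurableT_comp.
  - by apply/measurable_EFinP; apply: measurable_funM => //; exact: measurable_ker.
  move=> w _.
  have sfw := mpres_sq (@mpres_shift R w) sf.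
  have Iw : itg lb (fun x => `|f x * f (x + w)| * ker a w).
    by apply: itgZr; apply: itg_abs; exact: sqM_itg.
  have -> : (\int[lb]_x `|F (x, w)|%:E = \int[lb]_x (`|f x * f (x + w)| * ker a w)%:E)%E.
    apply: eq_integral => x _; rewrite /F /= normrM.
    by rewrite (ger0_norm (ker_ge0 _ a0)).
  rewrite IntE// lee_fin IntZr; last by apply: itg_abs; exact: sqM_itg.
  rewrite ler_wpM2r ?ker_ge0// -sqr_nrm expr2.
  apply: (@le_trans _ _ (Int lb (fun x => `|f x| * `|f (x + w)|))).
    by under eq_Int do rewrite normrM.
  apply: le_trans (ler_norm _) _.
  apply: le_trans (cauchy_schwarz (sq_abs sf) (sq_abs sfw)) _.
  by rewrite !nrm_abs (mpres_nrm (@mpres_shift R w) sf).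
by rewrite IntE; [rewrite ltry|exact: itgZ].
Qed.

(** Self-adjointness moves [hart] onto the damped transform, whose own transform is the convolution
    of [f] with [ker a]; the substitution z = x + w then isolates the autocorrelation of [f]. *)
Lemma Int_gau_sqr_hart : Int lb (fun xi => gau2 a xi * hart f xi ^+ 2) =
  Int lb (fun w => Int lb (fun x => f x * f (x + w)) * ker a w).
Proof.
transitivity (Int lb (fun xi => hart f xi * h xi)).
  by apply: eq_Int => xi; rewrite /h; ring.
rewrite hart_adj//.
transitivity (Int lb (fun x => Int lb (fun w => F (x, w)))).
  apply: eq_Int => x; rewrite hart_h.
  have Ik : itg lb (fun z => f z * ker a (x - z)).
    apply: (itg_le _ _ (itgZ (pi / a) (itg_abs If))).
      apply: measurable_funM; first exact: itg_meas If.
      exact: (measurableT_comp (measurable_ker a) (mpres_refl x).1).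
    move=> z; rewrite normrM mulrC ler_wpM2r//.
    rewrite (ger0_norm (ker_ge0 _ a0)) /ker ler_piMr ?gau2_le1//.
      by rewrite divr_ge0 ?pi_ge0 ?ltW.
    by rewrite invr_ge0 mulr_ge0 ?ltW.
  rewrite -(mpres_Int (@mpres_shift R x) Ik).
  rewrite -IntZ; last exact: (mpres_itg (@mpres_shift R x) Ik).
  apply: eq_Int => w; rewrite /F /= (addrC w x) opprD addrA subrr add0r.
  by rewrite mulrA /ker /gau2 /gau /= !sqrrN.
rewrite (Int_swap IF); apply: eq_Int => w; rewrite /F/= IntZr//.
apply: sqM_itg => //; exact: (mpres_sq (@mpres_shift R w) sf).
Qed.

Lemma itg_autocorr :
  itg lb (fun w => Int lb (fun x => f x * f (x + w)) * ker a w).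
Proof.
have := itg_Int2 IF; congr itg; apply/funext => w; rewrite /F/= IntZr//.
apply: sqM_itg => //; exact: (mpres_sq (@mpres_shift R w) sf).
Qed.

Lemma itg_gau_sqr_hart : itg lb (fun xi => gau2 a xi * hart f xi ^+ 2).
Proof.
apply: (itg_le _ _ (itgZ ((2 * Int lb (fun x => `|f x|)) ^+ 2) (itg_gau2 a0))).
  apply: measurable_funM; first exact: measurable_gau2.
  by apply: (measurable_funX 2); exact: measurable_hart.
move=> xi; rewrite normrM (ger0_norm (gau2_ge0 _ _)) mulrC.
rewrite ler_wpM2r ?gau2_ge0// normrX ler_pXn2r ?nnegrE ?normr_hart_le//.
by rewrite mulr_ge0// Int_ge0.
Qed.

End gaussian_regularization.

Lemma itg_sqr_ker (a : R) : 0 < a ->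
  itg lb (fun w => (w.1 ^+ 2 + w.2 ^+ 2) * ker a w) /\
  Int lb (fun w => (w.1 ^+ 2 + w.2 ^+ 2) * ker a w) = (2 * pi) ^+ 2 * (4 * a).
Proof.
move=> a0; pose b := (4 * a)^-1; have b0 : 0 < b by rewrite invr_gt0 mulr_gt0.
have I0 := itg_gau b0; have I2 := itg_sqr_gau b0.
have S2 : Int leb (fun s => s ^+ 2 * gau b s) = (2 * b)^-1 * Int leb (gau b).
  have := Int_sqr_gau_cos 0 b0.
  under eq_Int do rewrite mulr0 cos0 mulr1.
  under [in RHS]eq_Int do rewrite mulr0 cos0 mulr1.
  by rewrite expr0n/= mul0r subr0 mulr1.
have J1 := itg_tensor I2 I0; have J2 := itg_tensor I0 I2.
have E : (fun w => (w.1 ^+ 2 + w.2 ^+ 2) * ker a w) = fun w => pi / a *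
    (w.1 ^+ 2 * gau b w.1 * gau b w.2 + gau b w.1 * (w.2 ^+ 2 * gau b w.2)).
  by apply/funext => w; rewrite /ker /gau2 -/b; ring.
rewrite E; split; first by apply: itgZ; exact: itgD.
rewrite IntZ; last exact: itgD.
rewrite IntD// (Int_tensor I2 I0) (Int_tensor I0 I2) S2 (Int_gau b0).2.
rewrite -!mulrA (mulrC _ (Num.sqrt _)) !mulrA.
have := sqr_sqrtr (divr_ge0 (pi_ge0 R) (ltW b0)); set q := Num.sqrt _ => q2.
transitivity (pi / a * (q ^+ 2 * b^-1)); first by field; rewrite !gt_eqF.
by rewrite q2 /b; field; rewrite gt_eqF.
Qed.

(** The autocorrelation at w differs from its value at 0 by half the squared translation error. That
    error is small near 0 by continuity of translations and at most a multiple of |w|^2 elsewhere,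
    while the kernel has fixed mass and a second moment proportional to 1 / (n + 1). *)
Lemma Int_autocorr_cvg f : itg lb f -> sq lb f ->
  Int lb (fun w => Int lb (fun x => f x * f (x + w)) * ker n.+1%:R^-1 w)
    @[n --> \oo] --> (2 * pi) ^+ 2 * nrm lb f ^+ 2.
Proof.
move=> If sf.
pose W w := nrm lb (fun x => f (x + w) - f x) ^+ 2.
have sfw w := mpres_sq (@mpres_shift R w) sf.
have WE w : Int lb (fun x => f x * f (x + w)) = nrm lb f ^+ 2 - W w / 2.
  have I1 : itg lb (fun x => f (x + w) ^+ 2) by case: (sfw w).
  have I2 : itg lb (fun x => f x ^+ 2) by case: sf.
  have I3 : itg lb (fun x => f x * f (x + w)) by exact: sqM_itg.
  have -> : W w = Int lb (fun x => f (x + w) ^+ 2) + Int lb (fun x => f x ^+ 2)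
      - 2 * Int lb (fun x => f x * f (x + w)).
    rewrite /W sqr_nrm -IntZ// -IntD// -IntB//; [|exact: itgD|exact: itgZ].
    by apply: eq_Int => x; ring.
  have -> : Int lb (fun x => f (x + w) ^+ 2) = nrm lb f ^+ 2.
    rewrite sqr_nrm; exact: (mpres_Int (@mpres_shift R w) I2).
  by rewrite sqr_nrm; field.
have W_le w : W w <= 4 * nrm lb f ^+ 2.
  have := nrmB (sfw w) sf; rewrite (mpres_nrm (@mpres_shift R w) sf) => H.
  have -> : 4 * nrm lb f ^+ 2 = (nrm lb f + nrm lb f) ^+ 2 by ring.
  by rewrite /W ler_pXn2r ?nnegrE ?addr_ge0 ?nrm_ge0.
apply/cvgrPdist_le => e e0.
have C0 : 0 < (2 * pi) ^+ 2 :> R by rewrite exprn_gt0 ?mulr_gt0 ?pi_gt0.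
have e1 : 0 < Num.sqrt (e / (2 * pi) ^+ 2) by rewrite sqrtr_gt0 divr_gt0.
have /nbhs_ballP[r /= r0 Wr] := tcont_plane sf e1.
pose B := 4 * nrm lb f ^+ 2 / r ^+ 2.
have B0 : 0 <= B by rewrite divr_ge0 ?sqr_ge0// mulr_ge0 ?sqr_ge0.
have Bq w : 0 <= B * (w.1 ^+ 2 + w.2 ^+ 2).
  by apply: mulr_ge0 => //; apply: addr_ge0; exact: sqr_ge0.
have eC0 : 0 <= e / (2 * pi) ^+ 2 by rewrite ltW// divr_gt0.
have W_le2 w : W w <= e / (2 * pi) ^+ 2 + B * (w.1 ^+ 2 + w.2 ^+ 2).
  have [wr|rw] := ltP `|w| r.
    have : ball (0 : R * R) r w by rewrite -ball_normE /ball_/= sub0r normrN.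
    move=> /Wr /= H; rewrite -[leLHS]addr0; apply: lerD => //.
    rewrite -[leRHS]sqr_sqrtr//.
    by rewrite /W ler_pXn2r ?nnegrE ?nrm_ge0 ?sqrtr_ge0// ltW.
  rewrite -[leLHS]add0r; apply: lerD => //; apply: (le_trans (W_le w)).
  rewrite /B mulrAC -mulrA ler_peMr//; first by rewrite mulr_ge0// sqr_ge0.
  rewrite ler_pdivlMr ?exprn_gt0// mul1r.
  have : r <= `|w.1| \/ r <= `|w.2|.
    by move: rw; rewrite prod_normE le_max => /orP.
  have rs (y : R) : r <= `|y| -> r ^+ 2 <= y ^+ 2.
    move=> H; rewrite -(real_normK (num_real y)) ler_pXn2r ?nnegrE ?normr_ge0//.
    exact: ltW.
  have := sqr_ge0 w.1; have := sqr_ge0 w.2.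
  by move=> H1 H2 [/rs|/rs]; lra.
have D1 : 0 < B * 4 * (2 * pi) ^+ 2 + 1.
  apply: ltr_wpDl => //; apply: mulr_ge0; last exact: ltW.
  by apply: mulr_ge0.
near=> n.
pose a : R := n.+1%:R^-1.
have a0 : 0 < a by rewrite invr_gt0.
have ae : a <= e / (B * 4 * (2 * pi) ^+ 2 + 1).
  rewrite -[leLHS]ger0_norm; last exact: ltW.
  rewrite /a.
  near: n; have := @cvg_harmonic R; move/cvgr0Pnorm_le; apply.
  by rewrite divr_gt0.
have Ik : itg lb (ker a).
  by apply: itgZ; apply: itg_gau2; rewrite invr_gt0 mulr_gt0.
rewrite -/a.
have [IS SE] := itg_sqr_ker a0.
have -> : (2 * pi) ^+ 2 * nrm lb f ^+ 2 =
  Int lb (fun w => nrm lb f ^+ 2 * ker a w) by rewrite IntZ// Int_ker// mulrC.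
rewrite -IntB; [|exact: itgZ|exact: itg_autocorr].
have IA := itg_autocorr sf a0.
pose U w := e / (2 * pi) ^+ 2 * ker a w + B * ((w.1 ^+ 2 + w.2 ^+ 2) * ker a w).
have IU : itg lb U by apply: itgD; exact: itgZ.
apply: (@le_trans _ _ (Int lb (fun w => U w / 2))).
  apply: normr_Int_le2.
  - apply: (@itg_meas _ _ _ lb); apply: itgB; first exact: itgZ.
    exact: IA.
  - exact: itgZr.
  move=> w; rewrite WE -mulrBl opprB addrC subrK normrM.
  rewrite (ger0_norm (ker_ge0 _ a0)) ger0_norm; last by rewrite divr_ge0 ?sqr_ge0.
  have := ler_wpM2r (ker_ge0 w a0) (W_le2 w); rewrite /U; lra.
rewrite IntZr// /U IntD; [|exact: itgZ|exact: itgZ].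
rewrite IntZ// Int_ker// IntZ// SE mulfVK ?gt_eqF//.
have : a * (B * 4 * (2 * pi) ^+ 2 + 1) <= e by rewrite -ler_pdivlMr.
have -> : B * ((2 * pi) ^+ 2 * (4 * a)) = a * (B * 4 * (2 * pi) ^+ 2) by ring.
by move: a0; lra.
Unshelve. all: by end_near. Qed.

(** In [Int_gau_sqr_hart] the Gaussian factors increase to 1: the left sides converge by
    monotonicity, the right sides by [Int_autocorr_cvg]. *)
Theorem plancherel f : itg lb f -> sq lb f ->
  sq lb (hart f) /\ nrm lb (hart f) = 2 * pi * nrm lb f.
Proof.
move=> If sf; have mH := measurable_hart If.
pose g n xi : \bar R := (gau2 n.+1%:R^-1 xi * hart f xi ^+ 2)%:E.
have a0 n : 0 < n.+1%:R^-1 :> R by rewrite invr_gt0.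
have mg n : measurable_fun setT (g n).
  by apply/measurable_EFinP; exact: itg_meas (itg_gau_sqr_hart If (a0 n)).
have g0 n x : setT x -> (0 <= g n x)%E.
  by move=> _; rewrite lee_fin mulr_ge0 ?gau2_ge0 ?sqr_ge0.
have nd x : setT x -> {homo g ^~ x : m n / (m <= n)%N >-> (m <= n)%E}.
  move=> _ m n mn; rewrite lee_fin ler_wpM2r ?sqr_ge0//.
  have H s : gau m.+1%:R^-1 s <= gau n.+1%:R^-1 s :> R.
    by rewrite ler_expR lerN2 ler_wpM2r ?sqr_ge0// lef_pV2 ?posrE// ler_nat.
  by rewrite ler_pM ?gau_ge0.
have lim x : limn (g ^~ x) = (hart f x ^+ 2)%:E.
  apply/cvg_lim => //; apply: cvg_EFin; first exact: nearW.
  rewrite -[X in _ --> X]mul1r; apply: cvgM; last exact: cvg_cst.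
  have H s : gau n.+1%:R^-1 s @[n --> \oo] --> (expR 0 : R).
    have C : - (n.+1%:R^-1 * s ^+ 2) @[n --> \oo] --> (- (0 * s ^+ 2) : R).
      by apply: cvgN; apply: cvgM; [exact: cvg_harmonic|exact: cvg_cst].
    rewrite mul0r oppr0 in C.
    exact: (cvg_comp _ _ C (@continuous_expR R 0)).
  rewrite expR0 in H.
  by rewrite -[X in _ --> X]mulr1; apply: cvgM; exact: H.
have := @cvg_monotone_convergence _ _ R lb setT measurableT g mg g0 nd.
rewrite (_ : (\int[lb]_x limn (g^~ x) = \int[lb]_x (hart f x ^+ 2)%:E)%E); last first.
  by apply: eq_integral => x _; rewrite lim.
move=> C1.
have C2 : (\int[lb]_x g n x)%E @[n --> \oo] --> ((2 * pi) ^+ 2 * nrm lb f ^+ 2)%:E.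
  rewrite (_ : (fun n => _) = fun n => (Int lb (fun w =>
      Int lb (fun x => f x * f (x + w)) * ker n.+1%:R^-1 w))%:E).
    by apply: cvg_EFin; [exact: nearW|exact: Int_autocorr_cvg].
  by apply/funext => n; rewrite /g IntE ?Int_gau_sqr_hart//; exact: itg_gau_sqr_hart.
have E := cvg_unique _ C1 C2.
have IH : itg lb (fun x => hart f x ^+ 2).
  apply: itg_ltyP; first exact: (measurable_funX 2).
    by move=> x; exact: sqr_ge0.
  by rewrite E ?ltry.
split; first by split.
rewrite /nrm (_ : Int lb _ = (2 * pi * nrm lb f) ^+ 2).
  by rewrite sqrtr_sqr ger0_norm// mulr_ge0 ?nrm_ge0// mulr_ge0 ?pi_ge0.
by apply: EFin_inj; rewrite -IntE// E// -exprMn.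
Qed.

End plancherel.

(** * Extension of the Hartley transform to L^2 *)

Section hartley_L2.
Context {R : realType}.
Let lb := @lb2 R.
Implicit Types (f g h phi : R * R -> R) (x xi z : R * R).

(** The transform of an L^2 function is determined only up to a null set, hence a relation.
    Comparison with all test functions in L^1 and L^2 says that [g] is the value at [f] of the
    continuous extension. *)
Definition hrel f g := [/\ sq lb f, sq lb g &
  forall phi, itg lb phi -> sq lb phi ->
    nrm lb (fun x => g x - hart phi x) <= 2 * pi * nrm lb (fun x => f x - phi x)].

Lemma hrel_seq f g (phi : nat -> R * R -> R) : sq lb f -> sq lb g ->
  (forall n, itg lb (phi n)) -> (forall n, sq lb (phi n)) ->
  nrm lb (fun x => f x - phi n x) @[n --> \oo] --> (0 : R) ->
  nrm lb (fun x => g x - hart (phi n) x) @[n --> \oo] --> (0 : R) ->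
  hrel f g.
Proof.
move=> sf sg Ip sp cf cg; split => // psi Ipsi spsi.
have H n : nrm lb (fun x => g x - hart psi x) <=
    nrm lb (fun x => g x - hart (phi n) x) +
    2 * pi * (nrm lb (fun x => f x - phi n x) + nrm lb (fun x => f x - psi x)).
  have [sh _] := plancherel (Ip n) (sp n); have [shp _] := plancherel Ipsi spsi.
  apply: (le_trans (nrm_dist sg sh shp)); rewrite lerD2l.
  have sd := sqB (sp n) spsi.
  have Id := itgB (Ip n) Ipsi.
  have [_ Pd] := plancherel Id sd.
  have -> : nrm lb (fun x => hart (phi n) x - hart psi x) =
      nrm lb (hart (fun x => phi n x - psi x)).
    by apply: eq_nrm => x; rewrite hartB.
  rewrite Pd ler_wpM2l ?mulr_ge0 ?pi_ge0//.
  have -> : nrm lb (fun x => f x - phi n x) = nrm lb (fun x => phi n x - f x).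
    by rewrite -nrmN; apply: eq_nrm => x; ring.
  exact: nrm_dist.
have C : nrm lb (fun x => g x - hart (phi n) x) + 2 * pi *
     (nrm lb (fun x => f x - phi n x) + nrm lb (fun x => f x - psi x))
     @[n --> \oo] --> 0 + 2 * pi * (0 + nrm lb (fun x => f x - psi x)).
  apply: cvgD => //; apply: cvgM; first exact: cvg_cst.
  by apply: cvgD => //; exact: cvg_cst.
rewrite !add0r in C; rewrite -(cvg_lim _ C)//.
by apply: limr_ge; [exact: cvgP C|exact: nearW].
Qed.

Lemma hrel_L1 f : itg lb f -> sq lb f -> hrel f (hart f).
Proof.
move=> If sf; have [sh _] := plancherel If sf.
split => // psi Ipsi spsi.
have [_ <-] := plancherel (itgB If Ipsi) (sqB sf spsi).
have -> // : nrm lb (fun x => hart f x - hart psi x) =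
  nrm lb (hart (fun x => f x - psi x)).
by apply: eq_nrm => x; rewrite hartB.
Qed.

Lemma measurable_enorm : measurable_fun setT (enorm : plane R -> R).
Proof.
apply: (measurableT_comp (f := @Num.sqrt R)).
  by apply: continuous_measurable_fun; exact: sqrt_continuous.
by apply: measurable_funD; apply: measurable_funM.
Qed.

Definition bnl (A : R) z : R := (nat_of_bool (enorm z <= A)%R)%:R.

Lemma measurable_bnl A : measurable_fun setT (bnl A : plane R -> R).
Proof.
have -> : bnl A = \1_[set z | enorm z <= A].
  by apply/funext => z; rewrite /bnl indicE; congr (nat_of_bool _)%:R;
    apply/idP/idP; rewrite inE.
apply: measurable_indic.
have -> : [set z : plane R | enorm z <= A] = setT `&` enorm @^-1` `]-oo, A]%classic.
  by rewrite setTI; apply/seteqP; split => z /=; rewrite in_itv.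
exact: measurable_enorm.
Qed.

Lemma sqr_enorm z : enorm z ^+ 2 = z.1 ^+ 2 + z.2 ^+ 2.
Proof.
rewrite sqr_sqrtr /dot; first by ring.
by rewrite -!expr2 addr_ge0 ?sqr_ge0.
Qed.

Lemma enorm_ge0 z : 0 <= enorm z. Proof. exact: sqrtr_ge0. Qed.

Lemma bnl_le A z : bnl A z <= expR (A ^+ 2) * gau2 1 z.
Proof.
rewrite /bnl; case: (leP (enorm z) A) => [zA|_] /=; last first.
  by apply: mulr_ge0; [exact: expR_ge0|exact: gau2_ge0].
rewrite /gau2 /gau !mul1r -!expRD -expR0 ler_expR.
have : enorm z ^+ 2 <= A ^+ 2.
  by rewrite ler_pXn2r ?nnegrE ?enorm_ge0// (le_trans (enorm_ge0 z)).
by rewrite sqr_enorm; lra.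
Qed.

Lemma bnl_ge0 A z : 0 <= bnl A z.
Proof. by rewrite /bnl ler0n. Qed.

Lemma bnl_sqr A z : bnl A z ^+ 2 = bnl A z.
Proof. by rewrite /bnl; case: (_ <= _); rewrite ?expr1n ?expr0n. Qed.

Lemma itg_bnl A : itg lb (bnl A).
Proof.
apply: (itg_le (measurable_bnl A) _ (itgZ (expR (A ^+ 2)) (itg_gau2 ltr01))) => z.
by rewrite ger0_norm ?bnl_ge0 ?bnl_le.
Qed.

Lemma sq_bnl A : sq lb (bnl A).
Proof.
split; first exact: measurable_bnl.
by under eq_fun do rewrite bnl_sqr; exact: itg_bnl.
Qed.

Definition trn f (n : nat) x := f x * bnl n%:R x.

Lemma itg_trn f n : sq lb f -> itg lb (trn f n).
Proof. by move=> sf; apply: sqM_itg => //; exact: sq_bnl. Qed.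

Lemma normr_trn_le f n x : `|trn f n x| <= `|f x|.
Proof.
rewrite /trn normrM ler_piMr// /bnl.
by case: (enorm x <= _) => /=; rewrite ?normr1 ?normr0 ?ler01.
Qed.

Lemma sq_trn f n : sq lb f -> sq lb (trn f n).
Proof.
move=> sf; apply: sq_le (sq_abs sf) => [|x].
  by apply: measurable_funM; [case: sf|exact: measurable_bnl].
exact: normr_trn_le.
Qed.

Lemma trn_cvg f : sq lb f -> nrm lb (fun x => f x - trn f n x) @[n --> \oo] --> (0 : R).
Proof.
move=> sf; apply: (@nrm_cvg0 _ _ _ lb (fun n x => f x - trn f n x) f) => //.
- by move=> n; apply: sqB => //; exact: sq_trn.
- move=> n x; rewrite /trn /bnl; case: (enorm x <= _) => /=.
    by rewrite mulr1 subrr normr0.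
  by rewrite mulr0 subr0.
- move=> x; apply: cvg_near_cst; apply: filterS (near_bound (enorm x)) => n.
  rewrite ger0_norm ?enorm_ge0// => /ltW H.
  by rewrite /trn /bnl H mulr1 subrr.
Qed.

(** Truncations to discs with error at most 2^-k have transforms with geometrically decaying
    increments, by Plancherel; Riesz-Fischer supplies the limit. *)
Lemma hrel_ex f : sq lb f -> exists g, hrel f g.
Proof.
move=> sf.
have C : nrm lb (fun x => f x - trn f n x) @[n --> \oo] --> (0 : R) := trn_cvg sf.
have H k : exists n, nrm lb (fun x => f x - trn f n x) <= (2 ^+ k)^-1.
  have k0 : 0 < (2 ^+ k)^-1 :> R by rewrite invr_gt0 exprn_gt0.
  have /cvgr0Pnorm_lt/(_ _ k0)[n _ /(_ n (leqnn n))] := C.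
  by rewrite ger0_norm ?nrm_ge0// => /ltW ?; exists n.
have [N HN] := choice H.
pose phi k := trn f (N k).
have Ip k : itg lb (phi k) := itg_trn (N k) sf.
have sp k : sq lb (phi k) := sq_trn (N k) sf.
have sh k : sq lb (hart (phi k)) := (plancherel (Ip k) (sp k)).1.
have E k l : nrm lb (fun x => hart (phi k) x - hart (phi l) x) =
    2 * pi * nrm lb (fun x => phi k x - phi l x).
  have [_ <-] := plancherel (itgB (Ip k) (Ip l)) (sqB (sp k) (sp l)).
  by apply: eq_nrm => x; rewrite hartB.
have [g sg Hg] : exists2 g, sq lb g &
    forall n, nrm lb (fun x => g x - hart (phi n) x) <= 2 * (4 * pi) / 2 ^+ n.
  apply: riesz_fischer => // n; rewrite E.
  have : nrm lb (fun x => phi n.+1 x - phi n x) <= 2 / 2 ^+ n.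
    apply: (le_trans (nrm_dist (sp _) sf (sp _))).
    have := HN n; have := HN n.+1.
    have -> : nrm lb (fun x => f x - trn f (N n.+1) x) = nrm lb (fun x => phi n.+1 x - f x).
      by rewrite -nrmN; apply: eq_nrm => x; rewrite /phi; ring.
    have : (2 ^+ n.+1)^-1 <= (2 ^+ n)^-1 :> R.
      by rewrite lef_pV2 ?posrE ?exprn_gt0// ler_eXn2l ?ltr1n.
    rewrite /phi; lra.
  move=> /(ler_wpM2l (mulr_ge0 (ltW (ltr0Sn R 1)) (pi_ge0 R))) H2.
  by apply: (le_trans H2); rewrite le_eqVlt; apply/orP; left; apply/eqP; ring.
have half0 (D : R) : D / 2 ^+ n @[n --> \oo] --> (0 : R).
  rewrite -[X in _ --> X](mulr0 D); apply: cvgM; first exact: cvg_cst.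
  under eq_fun do rewrite -exprVn.
  by apply: cvg_expr; rewrite ger0_norm ?invr_ge0// invf_lt1 ?ltr1n.
exists g; apply: (hrel_seq (phi := phi)) => //.
  apply: (@squeeze_cvgr _ _ _ _ (fun=> 0) (fun n => 1 / 2 ^+ n)).
  - by apply: nearW => n; rewrite nrm_ge0/= div1r HN.
  - exact: cvg_cst.
  - exact: half0.
apply: (@squeeze_cvgr _ _ _ _ (fun=> 0) (fun n => 2 * (4 * pi) / 2 ^+ n)).
- by apply: nearW => n; rewrite nrm_ge0/= Hg.
- exact: cvg_cst.
- exact: half0.
Qed.

Lemma hrel_cvg f g : hrel f g ->
  nrm lb (fun x => g x - hart (trn f n) x) @[n --> \oo] --> (0 : R).
Proof.
move=> [sf sg H].
apply: (@squeeze_cvgr _ _ _ _ (fun=> 0) (fun n => 2 * pi * nrm lb (fun x => f x - trn f n x))).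
- by apply: nearW => n; rewrite nrm_ge0/= H//; [exact: itg_trn|exact: sq_trn].
- exact: cvg_cst.
- rewrite -[X in _ --> X](mulr0 (2 * pi)); apply: cvgM; first exact: cvg_cst.
  exact: trn_cvg.
Qed.

Lemma hrel_nrm f g : hrel f g -> nrm lb g = 2 * pi * nrm lb f.
Proof.
move=> hfg; have [sf sg H] := hfg.
have sh n := plancherel (itg_trn n sf) (sq_trn n sf).
have C1 : nrm lb (hart (trn f n)) @[n --> \oo] --> nrm lb g.
  apply/cvgrPdist_le => e e0; have /cvgr0Pnorm_le/(_ _ e0) := hrel_cvg hfg.
  apply: filterS => n; rewrite ger0_norm ?nrm_ge0// => He.
  by apply: le_trans He; apply: nrm_lip => //; case: (sh n).
have C2 : nrm lb (hart (trn f n)) @[n --> \oo] --> 2 * pi * nrm lb f.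
  have -> : (fun n => nrm lb (hart (trn f n))) = (fun n => 2 * pi * nrm lb (trn f n)).
    by apply/funext => n; case: (sh n).
  apply: cvgM; first exact: cvg_cst.
  apply/cvgrPdist_le => e e0; have /cvgr0Pnorm_le/(_ _ e0) := trn_cvg sf.
  apply: filterS => n; rewrite ger0_norm ?nrm_ge0// => He.
  by apply: le_trans He; apply: nrm_lip => //; exact: sq_trn.
exact: cvg_unique C1 C2.
Qed.

Lemma hrelB f1 g1 f2 g2 : hrel f1 g1 -> hrel f2 g2 ->
  hrel (fun x => f1 x - f2 x) (fun x => g1 x - g2 x).
Proof.
move=> h1 h2; have [s1 t1 _] := h1; have [s2 t2 _] := h2.
have sh1 n := (plancherel (itg_trn n s1) (sq_trn n s1)).1.
have sh2 n := (plancherel (itg_trn n s2) (sq_trn n s2)).1.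
apply: (@hrel_seq _ _ (fun n x => trn f1 n x - trn f2 n x)).
- exact: sqB.
- exact: sqB.
- by move=> n; apply: itgB; exact: itg_trn.
- by move=> n; apply: sqB; exact: sq_trn.
- apply: (@squeeze_cvgr _ _ _ _ (fun=> 0) (fun n =>
    nrm lb (fun x => f1 x - trn f1 n x) + nrm lb (fun x => f2 x - trn f2 n x))).
  + apply: nearW => n; rewrite nrm_ge0/=.
    have := nrmB (sqB s1 (sq_trn n s1)) (sqB s2 (sq_trn n s2)).
    by congr (_ <= _); apply: eq_nrm => x; ring.
  + exact: cvg_cst.
  + by rewrite -[X in _ --> X]addr0; apply: cvgD; exact: trn_cvg.
- apply: (@squeeze_cvgr _ _ _ _ (fun=> 0) (fun n =>
    nrm lb (fun x => g1 x - hart (trn f1 n) x) + nrm lb (fun x => g2 x - hart (trn f2 n) x))).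
  + apply: nearW => n; rewrite nrm_ge0/=.
    have := nrmB (sqB t1 (sh1 n)) (sqB t2 (sh2 n)).
    congr (_ <= _); apply: eq_nrm => x; rewrite hartB; [|exact: itg_trn|exact: itg_trn].
    by ring.
  + exact: cvg_cst.
  + by rewrite -[X in _ --> X]addr0; apply: cvgD; exact: hrel_cvg.
Qed.

Lemma hartZ k f xi : itg lb f -> hart (fun x => k * f x) xi = k * hart f xi.
Proof.
move=> If; rewrite /hart -IntZ; last exact: itg_cas.
by apply: eq_Int => x; ring.
Qed.

Lemma hrelZ k f g : hrel f g -> hrel (fun x => k * f x) (fun x => k * g x).
Proof.
move=> h1; have [s1 t1 _] := h1.
have sh1 n := (plancherel (itg_trn n s1) (sq_trn n s1)).1.
apply: (@hrel_seq _ _ (fun n x => k * trn f n x)).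
- exact: sqZ.
- exact: sqZ.
- by move=> n; apply: itgZ; exact: itg_trn.
- by move=> n; apply: sqZ; exact: sq_trn.
- have -> : (fun n => nrm lb (fun x => k * f x - k * trn f n x)) =
      (fun n => `|k| * nrm lb (fun x => f x - trn f n x)).
    apply/funext => n; rewrite -nrmZ; last by apply: sqB => //; exact: sq_trn.
    by apply: eq_nrm => x; ring.
  rewrite -[X in _ --> X](mulr0 `|k|); apply: cvgM; first exact: cvg_cst.
  exact: trn_cvg.
- have -> : (fun n => nrm lb (fun x => k * g x - hart (fun x => k * trn f n x) x)) =
      (fun n => `|k| * nrm lb (fun x => g x - hart (trn f n) x)).
    apply/funext => n; rewrite -nrmZ; last exact: sqB.
    by apply: eq_nrm => x; rewrite hartZ; [ring|exact: itg_trn].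
  rewrite -[X in _ --> X](mulr0 `|k|); apply: cvgM; first exact: cvg_cst.
  exact: hrel_cvg.
Qed.

Lemma hrel_adj f g phi : hrel f g -> itg lb phi -> sq lb phi ->
  Int lb (fun x => g x * phi x) = Int lb (fun x => f x * hart phi x).
Proof.
move=> hfg Ip sp; have [sf sg H] := hfg.
have [shp _] := plancherel Ip sp.
have sh n := (plancherel (itg_trn n sf) (sq_trn n sf)).1.
apply/eqP; rewrite -subr_eq0 -normr_le0.
have B n : `|Int lb (fun x => g x * phi x) - Int lb (fun x => f x * hart phi x)| <=
   nrm lb (fun x => g x - hart (trn f n) x) * nrm lb phi +
   nrm lb (fun x => f x - trn f n x) * nrm lb (hart phi).
  have E := hart_adj (itg_trn n sf) Ip.
  have -> : Int lb (fun x => g x * phi x) - Int lb (fun x => f x * hart phi x) =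
     Int lb (fun x => (g x - hart (trn f n) x) * phi x) -
     Int lb (fun x => (f x - trn f n x) * hart phi x).
    have -> : Int lb (fun x => (g x - hart (trn f n) x) * phi x) =
        Int lb (fun x => g x * phi x) - Int lb (fun x => hart (trn f n) x * phi x).
      rewrite -IntB; [|exact: sqM_itg|exact: sqM_itg].
      by apply: eq_Int => x; ring.
    have -> : Int lb (fun x => (f x - trn f n x) * hart phi x) =
        Int lb (fun x => f x * hart phi x) - Int lb (fun x => trn f n x * hart phi x).
      rewrite -IntB; [|exact: sqM_itg|apply: sqM_itg => //; exact: sq_trn].
      by apply: eq_Int => x; ring.
    by rewrite E; ring.
  apply: (le_trans (ler_normB _ _)); apply: lerD; apply: cauchy_schwarz => //.
    exact: sqB.
  by apply: sqB => //; exact: sq_trn.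
have C : nrm lb (fun x => g x - hart (trn f n) x) * nrm lb phi +
   nrm lb (fun x => f x - trn f n x) * nrm lb (hart phi) @[n --> \oo] -->
   0 * nrm lb phi + 0 * nrm lb (hart phi).
  apply: cvgD; apply: cvgM; try exact: cvg_cst.
    exact: hrel_cvg.
  exact: trn_cvg.
rewrite !mul0r addr0 in C; rewrite -(cvg_lim _ C)//.
by apply: limr_ge; [exact: cvgP C|exact: nearW].
Qed.

Lemma hrel_ae f g g' : hrel f g -> sq lb g' ->
  nrm lb (fun x => g' x - g x) = 0 -> hrel f g'.
Proof.
move=> [sf sg H] sg' E; split => // phi Ip sp.
have [shp _] := plancherel Ip sp.
by apply: (le_trans (nrm_dist sg' sg shp)); rewrite E add0r H.
Qed.

(** Let g' be a transform of g and expand the square of |g' - (2 pi)^2 f|_2. The isometry gives the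
    norms of g and g', and adjointness along truncations of g gives the cross term, the integral of
    g' f, as |g|_2^2; everything cancels. *)
Lemma hrel_inv f g : hrel f g -> hrel g (fun x => (2 * pi) ^+ 2 * f x).
Proof.
move=> hfg; have [sf sg H] := hfg.
have [g' hg] := hrel_ex sg; have [_ sg' _] := hg.
have N1 := hrel_nrm hfg; have N2 := hrel_nrm hg.
have P : Int lb (fun x => g' x * f x) = nrm lb g ^+ 2.
  apply/eqP; rewrite -subr_eq0 -normr_le0.
  have sh n := (plancherel (itg_trn n sg) (sq_trn n sg)).1.
  have B n : `|Int lb (fun x => g' x * f x) - nrm lb g ^+ 2| <=
     nrm lb (fun x => g' x - hart (trn g n) x) * nrm lb f +
     nrm lb g * nrm lb (fun x => g x - trn g n x).
    have E := hrel_adj hfg (itg_trn n sg) (sq_trn n sg).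
    have -> : Int lb (fun x => g' x * f x) - nrm lb g ^+ 2 =
       Int lb (fun x => (g' x - hart (trn g n) x) * f x) -
       Int lb (fun x => g x * (g x - trn g n x)).
      have -> : Int lb (fun x => (g' x - hart (trn g n) x) * f x) =
          Int lb (fun x => g' x * f x) - Int lb (fun x => f x * hart (trn g n) x).
        rewrite -IntB; [|exact: sqM_itg|exact: sqM_itg].
        by apply: eq_Int => x; ring.
      have -> : Int lb (fun x => g x * (g x - trn g n x)) =
          nrm lb g ^+ 2 - Int lb (fun x => g x * trn g n x).
        rewrite sqr_nrm -IntB; [|by case: sg|apply: sqM_itg => //; exact: sq_trn].
        by apply: eq_Int => x; ring.
      by rewrite E; ring.
    apply: (le_trans (ler_normB _ _)); apply: lerD; apply: cauchy_schwarz => //.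
      exact: sqB.
    by apply: sqB => //; exact: sq_trn.
  have C : nrm lb (fun x => g' x - hart (trn g n) x) * nrm lb f +
     nrm lb g * nrm lb (fun x => g x - trn g n x) @[n --> \oo] -->
     0 * nrm lb f + nrm lb g * 0.
    apply: cvgD; apply: cvgM; try exact: cvg_cst.
      exact: hrel_cvg.
    exact: trn_cvg.
  rewrite mul0r mulr0 addr0 in C; rewrite -(cvg_lim _ C)//.
  by apply: limr_ge; [exact: cvgP C|exact: nearW].
apply: (hrel_ae hg); first exact: sqZ.
apply/eqP; rewrite -sqrf_eq0 sqr_nrm; apply/eqP.
have I1 : itg lb (fun x => g' x ^+ 2) by case: sg'.
have I2 : itg lb (fun x => f x ^+ 2) by case: sf.
have I3 : itg lb (fun x => g' x * f x) by exact: sqM_itg.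
transitivity (Int lb (fun x => (2 * pi) ^+ 4 * f x ^+ 2 + g' x ^+ 2 -
    2 * (2 * pi) ^+ 2 * (g' x * f x))).
  by apply: eq_Int => x; ring.
rewrite IntB; [|by apply: itgD => //; exact: itgZ|exact: itgZ].
rewrite IntD//; last exact: itgZ.
rewrite !IntZ// -!sqr_nrm P N2 N1; ring.
Qed.

End hartley_L2.


(** * Triangle integrals and duality in L^2 *)

Section plane_tools.
Context {R : realType}.
Let lb := @lb2 R.
Implicit Types (f g h : R * R -> R) (x xi z : R * R).

(** The positive or the negative part has infinite integral, so the extended integral is infinite,
    and [fine] sends infinite values to 0. *)
Lemma Int_notitg d (T : measurableType d) (mu : {measure set T -> \bar R}) (f : T -> R) :
  measurable_fun setT f -> ~ itg mu f -> Int mu f = 0.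
Proof.
move=> mf nf; rewrite /Int /Rintegral integralE.
set A := integral _ _ _; set B := integral _ _ _.
have A0 : (0 <= A)%E by apply: integral_ge0.
have B0 : (0 <= B)%E by apply: integral_ge0.
have H : (A + B)%E = (\int[mu]_x `|(f x)%:E|)%E.
  rewrite -ge0_integralD//; [|exact/measurable_funepos/measurable_EFinP|
    exact/measurable_funeneg/measurable_EFinP].
  by apply: eq_integral => x _; rewrite -[RHS]/((abse \o (fun y => (f y)%:E)) x) fune_abse.
case: A A0 H => [a| |]// A0; case: B B0 => [b| |]// B0 H.
exfalso; apply: nf; apply/integrableP; split; first exact/measurable_EFinP.
by rewrite /= -H ltry.
Qed.

(** Pulls out a constant with no integrability at hand: the inner integral of a convolution
    converges only for almost every frequency. *)
Lemma IntZm d (T : measurableType d) (mu : {measure set T -> \bar R}) (k : R) (f : T -> R) :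
  measurable_fun setT f -> Int mu (fun y => k * f y) = k * Int mu f.
Proof.
move=> mf; have [If|nf] := pselect (itg mu f); first exact: IntZ.
have [->|k0] := eqVneq k 0.
  by under eq_Int do rewrite mul0r; rewrite Int0 mul0r.
rewrite (Int_notitg mf nf) mulr0 Int_notitg//; first exact: measurable_funM.
move=> /(itgZ k^-1) H; apply: nf; move: H; congr itg.
by apply/funext => x; rewrite mulKf.
Qed.

Definition tau2 (p : plane R * plane R) : plane R * plane R := (p.1, p.1 - p.2).

Lemma measurable_subp :
  measurable_fun setT (fun p : plane R * plane R => (p.1 - p.2 : plane R)).
Proof.
have -> : (fun p : plane R * plane R => (p.1 - p.2 : plane R)) =
   (fun p => (p.1.1 - p.2.1, p.1.2 - p.2.2)).
  by apply/funext => p.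
apply/measurable_fun_pairP; split => /=; apply: measurable_funB.
- exact: (measurableT_comp measurable_fst measurable_fst).
- exact: (measurableT_comp measurable_fst measurable_snd).
- exact: (measurableT_comp measurable_snd measurable_fst).
- exact: (measurableT_comp measurable_snd measurable_snd).
Qed.

(** On each slice of fixed first variable xi the shear is the reflection eta -> xi - eta. *)
Lemma mpres_tau2 : mpres (lb \x lb)%E tau2.
Proof.
have mt : measurable_fun setT tau2.
  by apply/measurable_fun_pairP; split;
    [exact: measurable_fst|exact: measurable_subp].
split; first exact: mt.
move=> A mA; apply: eq_integral => x _ /=.
have <- := (mpres_refl x).2 _ (measurable_xsection x mA).
congr (lb _); apply/seteqP; split => y /=; by rewrite /xsection/= !inE.
Qed.

Lemma measurable_opp : measurable_fun setT (fun z : plane R => - z).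
Proof. exact: (@mpres_opp R).1. Qed.

Lemma measurable_comp_opp f : measurable_fun setT (f : plane R -> R) ->
  measurable_fun setT (fun z : plane R => f (- z)).
Proof. by move=> mf; exact: (measurableT_comp mf measurable_opp). Qed.

Lemma measurable_comp1 f : measurable_fun setT (f : plane R -> R) ->
  measurable_fun setT (fun p : plane R * plane R => f p.1).
Proof. by move=> mf; exact: (measurableT_comp mf measurable_fst). Qed.

Lemma measurable_comp2 f : measurable_fun setT (f : plane R -> R) ->
  measurable_fun setT (fun p : plane R * plane R => f p.2).
Proof. by move=> mf; exact: (measurableT_comp mf measurable_snd). Qed.

Lemma measurable_compB f : measurable_fun setT (f : plane R -> R) ->
  measurable_fun setT (fun p : plane R * plane R => f (p.1 - p.2)).
Proof. by move=> mf; exact: (measurableT_comp mf measurable_subp). Qed.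

Lemma mpres_swap2 : mpres (lb \x lb)%E (fun p => (p.2, p.1)).
Proof.
have mphi : measurable_fun setT (fun q : plane R * plane R => (q.2, q.1) : plane R * plane R).
  by apply/measurable_fun_pairP; split;
    [exact: measurable_snd|exact: measurable_fst].
split; first exact: mphi.
move=> A mA; have /(_ mphi) H := @product_measure_unique _ _ _ _ R lb lb
  (pushforward (lb \x lb)%E (fun q => (q.2, q.1))).
apply/esym; apply: H => // A1 A2 mA1 mA2; rewrite /pushforward.
transitivity ((lb \x lb)%E (A2 `*` A1)).
  by congr ((lb \x lb)%E _); apply/seteqP; split => q /=; case.
rewrite product_measure1E; [exact: muleC|exact: mA2|exact: mA1].
Qed.

Lemma mpres_opp2 : mpres (lb \x lb)%E (fun p => (- p.1, - p.2)).
Proof. by apply: mpres_prod; exact: mpres_opp. Qed.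

(* The double integral of a product of functions of the three sides
   [xi], [xi - eta], [eta] of a triangle: two of them in L^2, one in L^1. *)
Lemma tri12 f g h : sq lb f -> sq lb g -> itg lb h ->
  itg (lb \x lb)%E (fun p => f p.1 * g (p.1 - p.2) * h p.2) /\
  Int (lb \x lb)%E (fun p => `|f p.1 * g (p.1 - p.2) * h p.2|) <=
    nrm lb f * nrm lb g * Int lb (fun x => `|h x|).
Proof.
move=> sf sg Ih; have mh := itg_meas Ih; have [mf _] := sf; have [mg _] := sg.
pose F (p : plane R * plane R) := f p.1 * g (p.1 - p.2) * h p.2.
have mF : measurable_fun setT F.
  apply: measurable_funM; last exact: measurable_comp2.
  by apply: measurable_funM; [exact: measurable_comp1|exact: measurable_compB].
have sgw w : sq lb (fun x => g (x - w)) := mpres_sq (@mpres_shift R (- w)) sg.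
have Iw w : itg lb (fun x => `|F (x, w)|).
  rewrite /F/=; apply: itg_abs; apply: itgZr; exact: sqM_itg.
have Bw w : Int lb (fun x => `|F (x, w)|) <= nrm lb f * nrm lb g * `|h w|.
  rewrite /F/=; under eq_Int do rewrite normrM.
  rewrite IntZr; last by apply: itg_abs; exact: sqM_itg.
  rewrite ler_wpM2r//; under eq_Int do rewrite normrM.
  apply: le_trans (ler_norm _) _.
  apply: le_trans (cauchy_schwarz (sq_abs sf) (sq_abs (sgw w))) _.
  by rewrite !nrm_abs (mpres_nrm (@mpres_shift R (- w)) sg).
have IB : itg lb (fun w => nrm lb f * nrm lb g * `|h w|).
  by apply: itgZ; exact: itg_abs.
have IF : itg (lb \x lb)%E F.
  apply: itg_prod_abs2 => //.
  apply: (@le_lt_trans _ _ (\int[lb]_w (nrm lb f * nrm lb g * `|h w|)%:E)%E).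
    apply: ge0_le_integral => //.
    - by move=> w _; exact: integral_ge0.
    - apply: (measurable_fun_fubini_tonelli_G (m1 := lb) (fun p => (`|F p|)%:E)) => //.
      by apply/measurable_EFinP; exact: measurableT_comp.
    - by apply/measurable_EFinP; exact: itg_meas IB.
    by move=> w _; rewrite IntE// lee_fin.
  by rewrite IntE// ltry.
split => //; rewrite Int_prod2; last exact: itg_abs.
rewrite -IntZ; last exact: itg_abs.
by apply: le_Int => //; exact: (itg_Int2 (itg_abs IF)).
Qed.

Lemma tri13 f g h : sq lb f -> itg lb g -> sq lb h ->
  itg (lb \x lb)%E (fun p => f p.1 * g (p.1 - p.2) * h p.2) /\
  Int (lb \x lb)%E (fun p => `|f p.1 * g (p.1 - p.2) * h p.2|) <=
    nrm lb f * Int lb (fun x => `|g x|) * nrm lb h.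
Proof.
move=> sf Ig sh; have [I H] := tri12 sf sh Ig.
have E : (fun p : plane R * plane R => f p.1 * g (p.1 - p.2) * h p.2) =
    (fun p => f (tau2 p).1 * h ((tau2 p).1 - (tau2 p).2) * g (tau2 p).2).
  by apply/funext => p /=; rewrite subKr mulrAC.
split; first by rewrite E; exact: (mpres_itg mpres_tau2 I).
rewrite mulrAC; apply: le_trans H.
have := mpres_Int mpres_tau2 (itg_abs I).
by under eq_Int do rewrite -[f _ * _ * _](congr1 (fun k => k _) E)/=; move=> ->.
Qed.

Lemma tri23 f g h : itg lb f -> sq lb g -> sq lb h ->
  itg (lb \x lb)%E (fun p => f p.1 * g (p.1 - p.2) * h p.2) /\
  Int (lb \x lb)%E (fun p => `|f p.1 * g (p.1 - p.2) * h p.2|) <=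
    Int lb (fun x => `|f x|) * nrm lb g * nrm lb h.
Proof.
move=> If sg sh; have sg' := mpres_sq (@mpres_opp R) sg.
have [I H] := tri12 sh sg' If.
have E : (fun p : plane R * plane R => f p.1 * g (p.1 - p.2) * h p.2) =
    (fun p => h (p.2, p.1).1 * g (- ((p.2, p.1).1 - (p.2, p.1).2)) * f (p.2, p.1).2).
  by apply/funext => p /=; rewrite opprB; ring.
split; first by rewrite E; exact: (mpres_itg mpres_swap2 I).
rewrite (mpres_nrm (@mpres_opp R) sg) in H.
have -> : Int lb (fun x => `|f x|) * nrm lb g * nrm lb h =
  nrm lb h * nrm lb g * Int lb (fun x => `|f x|) by ring.
apply: le_trans H.
have <- := mpres_Int mpres_swap2 (itg_abs I).
by rewrite (_ : (fun p => `|f p.1 * g (p.1 - p.2) * h p.2|) =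
   (fun p => `|h (p.2, p.1).1 * g (- ((p.2, p.1).1 - (p.2, p.1).2)) * f (p.2, p.1).2|))//;
  apply/funext => p; congr `|_|; exact: (congr1 (fun k => k p) E).
Qed.

Lemma tri_L1 g h : itg lb g -> itg lb h ->
  itg (lb \x lb)%E (fun p => g (p.1 - p.2) * h p.2) /\
  Int (lb \x lb)%E (fun p => `|g (p.1 - p.2) * h p.2|) =
    Int lb (fun x => `|g x|) * Int lb (fun x => `|h x|).
Proof.
move=> Ig Ih.
have I := itg_tensor Ih Ig.
have E : (fun p : plane R * plane R => g (p.1 - p.2) * h p.2) =
    (fun p => h (tau2 (p.2, p.1)).1 * g (- (tau2 (p.2, p.1)).2)).
  by apply/funext => p /=; rewrite opprB mulrC.
have mp3 : mpres lb (fun z : plane R => - z) := mpres_opp.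
have Ig' := mpres_itg mp3 Ig.
have I1 := mpres_itg mpres_swap2 (mpres_itg mpres_tau2 (itg_tensor Ih Ig')).
split; first by rewrite E; exact: I1.
have I2 := itg_abs (itg_tensor Ih Ig').
have := mpres_Int mpres_swap2 (mpres_itg mpres_tau2 I2).
rewrite (mpres_Int mpres_tau2 I2).
under [in X in X -> _]eq_Int do rewrite /= opprB mulrC.
move=> ->.
under eq_Int do rewrite normrM.
rewrite (Int_tensor (itg_abs Ih) (itg_abs Ig')) mulrC; congr (_ * _).
exact: (mpres_Int mp3 (itg_abs Ig)).
Qed.

Lemma bnl_nd (m n : nat) z : (m <= n)%N -> bnl m%:R z <= bnl n%:R z :> R.
Proof.
move=> mn; rewrite /bnl; case: (leP (enorm z) m%:R) => H /=; last exact: ler0n.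
by rewrite (le_trans H) ?ler_nat.
Qed.

(** The truncations in space and in height are square integrable by construction, so a uniform bound
    on their norms passes to [f] by monotone convergence. *)
Lemma sq_sup f (X : R) : 0 <= X -> measurable_fun setT (f : plane R -> R) ->
  (forall n : nat, let u x := f x * bnl n%:R x * (nat_of_bool (`|f x| <= n%:R)%R)%:R in
     sq lb u -> nrm lb u <= X) ->
  sq lb f /\ nrm lb f <= X.
Proof.
move=> X0 mf H.
pose ind (n : nat) x : R := (nat_of_bool (`|f x| <= n%:R)%R)%:R.
have mind n : measurable_fun setT (ind n : plane R -> R).
  have -> : ind n = \1_[set x | `|f x| <= n%:R].
    apply/funext => x; rewrite /ind indicE; congr (nat_of_bool _)%:R.
    by apply/idP/idP; rewrite inE.
  apply: measurable_indic.
  have -> : [set x : plane R | `|f x| <= n%:R] =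
      setT `&` (fun x => `|f x|) @^-1` `]-oo, n%:R]%classic.
    by rewrite setTI; apply/seteqP; split => z /=; rewrite in_itv.
  by apply: (measurableT_comp (@normr_measurable R setT) mf).
have ind0 n x : 0 <= ind n x by rewrite ler0n.
pose u n x := f x * bnl n%:R x * ind n x.
have mu n : measurable_fun setT (u n : plane R -> R).
  by apply: measurable_funM => //; apply: measurable_funM => //; exact: measurable_bnl.
have su n : sq lb (u n).
  apply: (sq_le _ _ (sqZ n%:R (sq_bnl (R := R) n%:R))) => // x.
  rewrite /u !normrM (ger0_norm (bnl_ge0 _ _)) (ger0_norm (ind0 _ _)) mulrAC.
  rewrite ler_wpM2r ?bnl_ge0// /ind.
  by case: (leP `|f x| n%:R) => /= ?; rewrite ?mulr1 ?mulr0.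
have uX n : nrm lb (u n) <= X := H n (su n).
pose g n x : \bar R := (u n x ^+ 2)%:E.
have mg n : measurable_fun (setT : set (plane R)) (g n).
  by apply/measurable_EFinP; apply: (measurable_funX 2); exact: mu.
have g0 n x : setT x -> (0 <= g n x)%E by move=> _; rewrite lee_fin sqr_ge0.
have nd x : setT x -> {homo g ^~ x : m n / (m <= n)%N >-> (m <= n)%E}.
  move=> _ m n mn; rewrite lee_fin /u !(exprMn 2) -2!mulrA ler_wpM2l ?sqr_ge0//.
  apply: ler_pM; rewrite ?sqr_ge0// ler_pXn2r ?nnegrE ?bnl_ge0 ?bnl_nd//.
  rewrite /ind; case: (leP `|f x| m%:R) => HH /=; last exact: ler0n.
  by rewrite (le_trans HH) ?ler_nat.
have lim x : limn (g ^~ x) = (f x ^+ 2)%:E.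
  apply/cvg_lim => //; apply: cvg_near_cst.
  apply: filterS2 (near_bound (enorm x)) (near_bound (f x)) => n.
  rewrite ger0_norm ?enorm_ge0// => /ltW H1 /ltW H2.
  by rewrite /g /u /bnl /ind H1 H2 /= !mulr1.
have C := @cvg_monotone_convergence _ _ R lb setT measurableT g mg g0 nd.
have E : (\int[lb]_x (limn (g ^~ x)) = \int[lb]_x (f x ^+ 2)%:E)%E.
  by apply: eq_integral => x _; rewrite lim.
rewrite E in C.
have B : (\int[lb]_x (f x ^+ 2)%:E <= (X ^+ 2)%:E)%E.
  rewrite -(cvg_lim _ C)//; apply: lime_le; first exact: cvgP C.
  apply: nearW => n; rewrite IntE; last by case: (su n).
  by rewrite lee_fin -sqr_nrm ler_pXn2r ?nnegrE ?nrm_ge0.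
have sf : sq lb f.
  split => //; apply: itg_ltyP; [exact: (measurable_funX 2)|move=> x; exact: sqr_ge0|].
  exact: le_lt_trans B (ltry _).
split => //; move: B; rewrite IntE; last by case: sf.
by rewrite lee_fin -sqr_nrm ler_pXn2r ?nnegrE ?nrm_ge0.
Qed.

(** Test against a truncation u of [f] itself: the pairing is then |u|_2^2. *)
Lemma sq_dual f (X : R) : 0 <= X -> measurable_fun setT (f : plane R -> R) ->
  (forall phi, sq lb phi -> `|Int lb (fun x => phi x * f x)| <= X * nrm lb phi) ->
  sq lb f /\ nrm lb f <= X.
Proof.
move=> X0 mf H; apply: sq_sup => // n u su; have := H _ su.
have -> : Int lb (fun x => u x * f x) = nrm lb u ^+ 2.
  rewrite sqr_nrm; apply: eq_Int => x; rewrite /u !exprMn bnl_sqr.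
  case: (`|f x| <= n%:R)%R => /=; first by rewrite expr1n; ring.
  by rewrite expr0n/= !(mulr0, mul0r).
rewrite ger0_norm ?sqr_ge0// expr2.
have [->//|n0] := eqVneq (nrm lb u) 0.
by rewrite ler_pM2r// lt_neqAle eq_sym n0 nrm_ge0.
Qed.

End plane_tools.

(** * Frequency weights *)

Section weights.
Context {R : realType}.
Let lb := @lb2 R.
Implicit Types (f g y : R * R -> R) (xi z : R * R).

(* Annuli grow geometrically, so it is enough to gain a factor [th < 1] from one
   to the next. *)
Lemma itg_annuli f (chi : nat -> plane R -> R) (c th : R) :
  measurable_fun setT (f : plane R -> R) -> (forall z, 0 <= f z) ->
  (forall n, measurable_fun setT (chi n)) -> (forall n z, 0 <= chi n z) ->
  (forall n z, chi n z <= chi n.+1 z) ->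
  (forall z, exists n, forall m, (n <= m)%N -> f z * chi m z = f z) ->
  0 <= c -> 0 < th < 1 ->
  itg lb (fun z => f z * chi 0%N z) ->
  (forall n, exists g, [/\ itg lb g, forall z, f z * (chi n.+1 z - chi n z) <= g z &
     Int lb g <= c * th ^+ n]) ->
  itg lb f.
Proof.
move=> mf f0 mchi chi0 chiS chi1 c0 /andP[th0 th1] I0 H.
have In n : itg lb (fun z => f z * chi n z) /\
   Int lb (fun z => f z * chi n z) <=
   Int lb (fun z => f z * chi 0%N z) + c / (1 - th) * (1 - th ^+ n).
  elim: n => [|n [IH1 IH2]]; first by rewrite expr0 subrr mulr0 addr0.
  have [g [Ig fg Bg]] := H n.
  have E : (fun z => f z * chi n.+1 z) =
      (fun z => f z * chi n z + f z * (chi n.+1 z - chi n z)).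
    by apply/funext => z; ring.
  have Id : itg lb (fun z => f z * (chi n.+1 z - chi n z)).
    apply: (itg_le _ _ Ig).
      by apply: measurable_funM => //; apply: measurable_funB.
    by move=> z; rewrite ger0_norm ?fg// mulr_ge0 ?subr_ge0.
  rewrite E; split; first exact: itgD.
  rewrite IntD//.
  have B : Int lb (fun z => f z * (chi n.+1 z - chi n z)) <= c * th ^+ n.
    by apply: le_trans Bg; apply: le_Int.
  apply: (le_trans (lerD IH2 B)); rewrite -addrA lerD2l le_eqVlt; apply/orP; left.
  by apply/eqP; rewrite exprS; field; rewrite gt_eqF ?subr_gt0.
pose X := Int lb (fun z => f z * chi 0%N z) + c / (1 - th).
have IX n : Int lb (fun z => f z * chi n z) <= X.
  apply: (le_trans (In n).2); rewrite lerD2l ler_piMr//.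
    by rewrite divr_ge0// subr_ge0 ltW.
  by rewrite gerBl exprn_ge0// ltW.
pose g n z : \bar R := (f z * chi n z)%:E.
have mg n : measurable_fun (setT : set (plane R)) (g n).
  by apply/measurable_EFinP; apply: measurable_funM.
have g0 n x : setT x -> (0 <= g n x)%E by move=> _; rewrite lee_fin mulr_ge0.
have nd x : setT x -> {homo g ^~ x : m n / (m <= n)%N >-> (m <= n)%E}.
  move=> _ m n mn; rewrite lee_fin ler_wpM2l//.
  elim: n mn => [|n IH]; first by rewrite leqn0 => /eqP->.
  by rewrite leq_eqVlt => /predU1P[->//|/IH/le_trans]; apply.
have lim x : limn (g ^~ x) = (f x)%:E.
  apply/cvg_lim => //; apply: cvg_near_cst; have [n Hn] := chi1 x.
  by exists n => // m /= nm; rewrite /g Hn.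
have C := @cvg_monotone_convergence _ _ R lb setT measurableT g mg g0 nd.
have E : (\int[lb]_x (limn (g ^~ x)) = \int[lb]_x (f x)%:E)%E.
  by apply: eq_integral => x _; rewrite lim.
rewrite E in C.
apply: itg_ltyP => //; apply: (@le_lt_trans _ _ X%:E); last exact: ltry.
rewrite -(cvg_lim _ C)//; apply: lime_le; first exact: cvgP C.
by apply: nearW => n; rewrite IntE ?lee_fin//; case: (In n).
Qed.

Lemma bnl_le1 (A : R) z : bnl A z <= 1.
Proof. by rewrite /bnl; case: (enorm z <= A)%R. Qed.

Lemma bnl_mono (A B : R) z : A <= B -> bnl A z <= bnl B z.
Proof.
move=> AB; rewrite /bnl; case: (leP (enorm z) A) => H /=; last exact: ler0n.
by rewrite (le_trans H).
Qed.

(** A crude stand-in for the area of the unit disc: the indicator of a disc is at most e times a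
    Gaussian at the scale of its radius. *)
Definition cball : R := expR 1 * pi.

Lemma cball_ge0 : 0 <= cball. Proof. by rewrite mulr_ge0 ?expR_ge0 ?pi_ge0. Qed.

Lemma Int_bnl (A : R) : 0 < A -> Int lb (bnl A) <= cball * A ^+ 2.
Proof.
move=> A0; pose a := (A ^+ 2)^-1; have a0 : 0 < a by rewrite invr_gt0 exprn_gt0.
have -> : cball * A ^+ 2 = Int lb (fun z => expR 1 * gau2 a z).
  rewrite IntZ; last exact: itg_gau2.
  by rewrite Int_gau2// /cball /a invrK mulrA.
apply: le_Int; [exact: itg_bnl|by apply: itgZ; exact: itg_gau2|].
move=> z; rewrite /bnl; case: (leP (enorm z) A) => [zA|_] /=; last first.
  by apply: mulr_ge0; [exact: expR_ge0|exact: gau2_ge0].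
rewrite /gau2 /gau -!expRD -[X in X <= _]expR0 ler_expR.
have : enorm z ^+ 2 <= A ^+ 2.
  by rewrite ler_pXn2r ?nnegrE ?enorm_ge0// (le_trans (enorm_ge0 z)).
rewrite -(ler_pM2l a0) sqr_enorm mulVf ?gt_eqF ?exprn_gt0//; lra.
Qed.

Lemma nrm_bnl (A : R) : 0 < A -> nrm lb (bnl A) <= Num.sqrt cball * A.
Proof.
move=> A0; rewrite -(ler_pXn2r (ltn0Sn 1)) ?nnegrE ?nrm_ge0//; last first.
  by rewrite mulr_ge0 ?sqrtr_ge0 ?ltW.
rewrite sqr_nrm exprMn sqr_sqrtr ?cball_ge0//.
by under eq_Int do rewrite bnl_sqr; exact: Int_bnl.
Qed.

Definition jap xi : R := 1 + enorm xi ^+ 2.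
Definition rho (r : R) xi : R := jap xi `^ (r / 2).
(** Modulus of the velocity symbol perp xi |xi|^(-2 + 2 a). For a < 1 / 2 the value at the origin is
    0, by the convention on powers of 0. *)
Definition ka (a : R) xi : R := enorm xi `^ (-1 + 2 * a).

Lemma jap_ge1 xi : 1 <= jap xi.
Proof. by rewrite lerDl sqr_ge0. Qed.

Lemma jap_gt0 xi : 0 < jap xi.
Proof. exact: lt_le_trans (jap_ge1 xi). Qed.

Lemma rho_gt0 r xi : 0 < rho r xi.
Proof. by rewrite powR_gt0 ?jap_gt0. Qed.

Lemma rho_ge1 r xi : 0 <= r -> 1 <= rho r xi.
Proof.
move=> r0; rewrite -(powRr0 (jap xi)); apply: ler_powR; first exact: jap_ge1.
by rewrite divr_ge0.
Qed.

Lemma sqr_rho r xi : rho r xi ^+ 2 = jap xi `^ r.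
Proof.
rewrite expr2 -powRD; last by rewrite (gt_eqF (jap_gt0 xi)) implybT.
by congr (_ `^ _); field.
Qed.

Lemma measurable_jap : measurable_fun setT (jap : plane R -> R).
Proof. by apply: measurable_funD => //; apply: (measurable_funX 2); exact: measurable_enorm. Qed.

Lemma measurable_powRl (p : R) (h : plane R -> R) : measurable_fun setT h ->
  measurable_fun setT (fun z => h z `^ p).
Proof. by move=> mh; exact: (measurableT_comp (measurable_powR p) mh). Qed.

Lemma measurable_rho r : measurable_fun setT (rho r : plane R -> R).
Proof. by apply: measurable_powRl; exact: measurable_jap. Qed.

Lemma measurable_ka a : measurable_fun setT (ka a : plane R -> R).
Proof. by apply: measurable_powRl; exact: measurable_enorm. Qed.

Lemma powR_lt1 (b p : R) : 1 < b -> p < 0 -> b `^ p < 1.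
Proof.
move=> b1 p0; rewrite /powR gt_eqF ?(lt_trans ltr01)//.
by rewrite -[X in _ < X]expR0 ltr_expR nmulr_rlt0// ln_gt0.
Qed.

(** On annuli of radii 2^n the area grows by a factor 4 and the weight falls by 4^-s; the ratio 4^(1
    - s) is below 1 since s > 1. *)
Lemma itg_jap_powR (s : R) : 1 < s -> itg lb (fun z => jap z `^ (- s)).
Proof.
move=> s1; pose t : R := 4 `^ (1 - s).
have t1 : 0 < t < 1.
  rewrite powR_gt0//= powR_lt1 ?(ltr_nat R 1 4)//; lra.
have m4 : measurable_fun setT (fun z : plane R => jap z `^ (- s)).
  by apply: measurable_powRl; exact: measurable_jap.
apply: (@itg_annuli _ (fun n => bnl (2 ^+ n)) (4 * cball) t) => //.
- by move=> z; exact: powR_ge0.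
- by move=> n; exact: measurable_bnl.
- by move=> n z; apply: bnl_mono; rewrite ler_eXn2l ?ltr1n.
- move=> z; have [n _ Hn] := near_bound (enorm z); exists n => m nm.
  have H : enorm z <= 2 ^+ m.
    have /ltW := Hn m nm; rewrite ger0_norm ?enorm_ge0// => /le_trans; apply.
    by rewrite -natrX ler_nat ltnW// ltn_expl.
  by rewrite /bnl H mulr1.
- by rewrite mulr_ge0 ?cball_ge0.
- apply: (itg_le _ _ (itg_bnl (R := R) 1)).
    by apply: measurable_funM => //; exact: measurable_bnl.
  move=> z; rewrite expr0 ger0_norm; last by apply: mulr_ge0; [exact: powR_ge0|exact: bnl_ge0].
  rewrite ler_piMl ?bnl_ge0// powRN invf_le1 ?powR_gt0 ?jap_gt0//.
  rewrite -(powRr0 (jap z)); apply: ler_powR; [exact: jap_ge1|lra].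
- move=> n; pose c : R := (4 `^ (- s)) ^+ n.
  have c0 : 0 <= c by rewrite exprn_ge0 ?powR_ge0.
  exists (fun z => c * bnl (2 ^+ n.+1) z); split.
  + by apply: itgZ; exact: itg_bnl.
  + move=> z; rewrite /bnl; case: (leP (enorm z) (2 ^+ n)) => H1.
      have -> : enorm z <= 2 ^+ n.+1 by rewrite (le_trans H1)// ler_eXn2l ?ltr1n.
      by rewrite subrr mulr0 mulr1.
    case: (leP (enorm z) (2 ^+ n.+1)) => H2 /=; last by rewrite subrr !mulr0.
    rewrite subr0 !mulr1 /c -powR_mulrn ?powR_ge0// powRAC powR_mulrn//.
    rewrite !powRN lef_pV2 ?posrE ?powR_gt0 ?jap_gt0 ?exprn_gt0//.
    apply: ge0_ler_powR; rewrite ?nnegrE ?exprn_ge0 ?ltW ?jap_gt0//; first by lra.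
    have : 2 ^+ n * 2 ^+ n <= enorm z ^+ 2.
      by rewrite expr2; apply: ler_pM; rewrite ?exprn_ge0// ltW.
    rewrite -exprMn /jap.
    have -> : (2 * 2 = 4 :> R) by ring.
    by move=> /le_lt_trans; apply; rewrite ltrDr ltr01.
  + rewrite IntZ; last exact: itg_bnl.
    have /(ler_wpM2l c0) H := Int_bnl (exprn_gt0 n.+1 (ltr0Sn R 1)).
    apply: (le_trans H); rewrite le_eqVlt; apply/orP; left; apply/eqP.
    have -> : t = 4 * 4 `^ (- s).
      by rewrite /t powRD ?powRr1// (_ : (4 == 0 :> R) = false) ?implybT// gt_eqF.
    rewrite exprMn -/c -exprM mulnC exprM exprS.
    have -> : (2 ^+ 2 = 4 :> R) by ring.
    ring.
Qed.

(** On annuli shrinking to the origin the area falls by a factor 4 and |xi|^(-2 + 4 a) grows by 4^(1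
    - 2 a); the ratio 16^-a is below 1 because a > 0. *)
Lemma itg_ka2 (a : R) : 0 < a < 1 / 2 -> itg lb (fun z => ka a z ^+ 2 * bnl 1 z).
Proof.
move=> /andP[a0 a1]; pose t : R := 16 `^ (- a).
have t1 : 0 < t < 1.
  rewrite powR_gt0//= powR_lt1 ?(ltr_nat R 1 16)//; lra.
have m1 := @measurable_ka a.
pose chi (n : nat) (z : plane R) : R := 1 - bnl ((2 ^+ n)^-1) z.
have pS (n : nat) : (2 ^+ n.+1)^-1 <= (2 ^+ n)^-1 :> R.
  by rewrite lef_pV2 ?posrE ?exprn_gt0// ler_eXn2l ?ltr1n.
have mf : measurable_fun setT (fun z : plane R => ka a z ^+ 2 * bnl 1 z).
  by apply: measurable_funM; [exact: measurable_funX|exact: measurable_bnl].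
apply: (@itg_annuli _ chi (4 * cball) t) => //.
- by move=> z; rewrite mulr_ge0 ?sqr_ge0 ?bnl_ge0.
- by move=> n; apply: measurable_funB => //; exact: measurable_bnl.
- by move=> n z; rewrite subr_ge0 bnl_le1.
- by move=> n z; rewrite lerD2l lerN2 bnl_mono.
- move=> z; have [z0|z0] := eqVneq (enorm z) 0.
    exists 0%N => m _; rewrite /ka z0 powR0; last by rewrite lt_eqF//; lra.
    by rewrite expr0n/= !mul0r.
  have z1 : 0 < enorm z by rewrite lt_neqAle eq_sym z0 enorm_ge0.
  have [n _ Hn] := near_bound ((enorm z)^-1); exists n => m nm.
  have H : (2 ^+ m)^-1 < enorm z.
    rewrite invf_plt ?posrE ?exprn_gt0//.
    have := Hn m nm; rewrite ger0_norm ?invr_ge0 ?enorm_ge0// => /lt_le_trans; apply.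
    by rewrite -natrX ler_nat ltnW// ltn_expl.
  rewrite /chi [bnl (2 ^- m) z]/bnl (_ : (enorm z <= 2 ^- m) = false) ?subr0 ?mulr1//.
  by apply/negbTE; rewrite -ltNge.
- by rewrite mulr_ge0 ?cball_ge0.
- have -> : (fun z => ka a z ^+ 2 * bnl 1 z * chi 0%N z) = (fun=> 0).
    apply/funext => z; rewrite /chi expr0 invr1 /bnl.
    by case: (_ <= _)%R => /=; ring.
  exact: itg0.
- move=> n; pose c : R := 4 ^+ n.+1 * t ^+ n.+1.
  have c0 : 0 <= c by rewrite mulr_ge0 ?exprn_ge0 ?powR_ge0.
  exists (fun z => c * bnl ((2 ^+ n)^-1) z); split.
  + by apply: itgZ; exact: itg_bnl.
  + move=> z; rewrite /chi opprB addrC addrA subrK.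
    rewrite [bnl (2 ^+ n)^-1 z]/bnl [bnl (2 ^+ n.+1)^-1 z]/bnl.
    case: (leP (enorm z) (2 ^+ n.+1)^-1) => H1 /=.
      by rewrite (le_trans H1 (pS n)) subrr mulr0 mulr1.
    case: (leP (enorm z) (2 ^+ n)^-1) => H2 /=; last by rewrite subrr !mulr0.
    rewrite subr0 !mulr1; apply: le_trans (_ : ka a z ^+ 2 <= _).
      by rewrite ler_piMr ?sqr_ge0 ?bnl_le1.
    rewrite /c -exprMn.
    have -> : 4 * t = (2^-1) `^ (-1 + 2 * a) ^+ 2.
      rewrite -powR_mulrn ?powR_ge0// -powRrM.
      have E4 : 4 = 2^-1 `^ (- 2) :> R.
        by rewrite powRN powR_mulrn//; field.
      have -> : t = 2^-1 `^ (4 * a).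
        rewrite /t (_ : 16 = 2^-1 `^ (- 4)); last by rewrite powRN powR_mulrn//; field.
        by rewrite -powRrM; congr (_ `^ _); ring.
      rewrite [X in X * _]E4 -powRD.
        by congr (_ `^ _); ring.
      by apply/implyP => _; rewrite invr_eq0 pnatr_eq0.
    rewrite -exprM mulnC exprM ler_pXn2r ?nnegrE ?powR_ge0 ?exprn_ge0 ?powR_ge0//.
    rewrite -[X in _ <= X]powR_mulrn ?powR_ge0// powRAC powR_mulrn; last by rewrite invr_ge0.
    rewrite exprVn /ka; have -> : -1 + 2 * a = - (1 - 2 * a) by ring.
    rewrite !powRN lef_pV2 ?posrE ?powR_gt0 ?invr_gt0 ?exprn_gt0//; last first.
      by apply: lt_trans H1; rewrite invr_gt0 exprn_gt0.
    apply: ge0_ler_powR; rewrite ?nnegrE ?enorm_ge0 ?invr_ge0 ?exprn_ge0//.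
      lra.
    exact: ltW.
  + rewrite IntZ; last exact: itg_bnl.
    have p0 : 0 < (2 ^+ n)^-1 :> R by rewrite invr_gt0 exprn_gt0.
    have /(ler_wpM2l c0) H := Int_bnl p0.
    apply: (le_trans H).
    have -> : c * (cball * (2 ^+ n)^-1 ^+ 2) = 4 * cball * t ^+ n * t.
      have E : (2 ^+ n) ^+ 2 = 4 ^+ n :> R.
        by rewrite -exprM mulnC exprM; congr (_ ^+ _); ring.
      rewrite /c exprVn E !exprS; field.
      by rewrite expf_neq0//; rewrite gt_eqF.
    apply: ler_piMr; last by case/andP: t1 => _ /ltW.
    apply: mulr_ge0; last by rewrite exprn_ge0 ?powR_ge0.
    by apply: mulr_ge0 => //; exact: cball_ge0.
Qed.

End weights.

(** * Convolution integrals and the bilinear form of the equation *)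

Section bilinear.
Context {R : realType}.
Let lb := @lb2 R.
Implicit Types (f g y phi : R * R -> R) (xi z eta : R * R).

Lemma measurable_sec (k : plane R * plane R -> R) xi : measurable_fun setT k ->
  measurable_fun setT (fun eta : plane R => k (xi, eta)).
Proof. by move=> mk; exact: (measurableT_comp mk (measurable_pair1 xi)). Qed.

Section convolution.
Variables (k : plane R * plane R -> R) (F1 G1 F2 G2 : plane R -> R).
Hypotheses (mk : measurable_fun setT k)
  (k_le : forall p, `|k p| <= F1 (p.1 - p.2) * G1 p.2 + F2 (p.1 - p.2) * G2 p.2).
Hypotheses (F10 : forall z, 0 <= F1 z) (G10 : forall z, 0 <= G1 z)
  (F20 : forall z, 0 <= F2 z) (G20 : forall z, 0 <= G2 z).

Section form.
Hypotheses (IF1 : itg lb F1) (sG1 : sq lb G1) (sF2 : sq lb F2) (IG2 : itg lb G2).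
Variable phi : plane R -> R.
Hypothesis sphi : sq lb phi.

Let phik_le p : `|phi p.1 * k p| <= `|phi p.1 * F1 (p.1 - p.2) * G1 p.2| +
   `|phi p.1 * F2 (p.1 - p.2) * G2 p.2|.
Proof.
rewrite !normrM -!mulrA -mulrDr ler_wpM2l// (ger0_norm (F10 _)) (ger0_norm (G10 _)).
by rewrite (ger0_norm (F20 _)) (ger0_norm (G20 _)) k_le.
Qed.

(** Two products are allowed because a derivative of a convolution splits between its factors.
    Against an L^2 test function, each product needs one factor in L^1 and the other in L^2. *)
Lemma itg_form : itg (lb \x lb)%E (fun p => phi p.1 * k p).
Proof.
have [I1 _] := tri13 sphi IF1 sG1; have [I2 _] := tri12 sphi sF2 IG2.
apply: (itg_le _ phik_le (itgD (itg_abs I1) (itg_abs I2))).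
by apply: measurable_funM => //; apply: measurable_comp1; case: sphi.
Qed.

Lemma Int_form_le : `|Int (lb \x lb)%E (fun p => phi p.1 * k p)| <=
  nrm lb phi * (Int lb F1 * nrm lb G1 + nrm lb F2 * Int lb G2).
Proof.
have [I1 H1] := tri13 sphi IF1 sG1; have [I2 H2] := tri12 sphi sF2 IG2.
apply: (@le_trans _ _ (Int (lb \x lb)%E (fun p => `|phi p.1 * F1 (p.1 - p.2) * G1 p.2| +
   `|phi p.1 * F2 (p.1 - p.2) * G2 p.2|))).
  apply: normr_Int_le2 => //; first by apply: itg_meas itg_form.
  by apply: itgD; exact: itg_abs.
rewrite IntD; [|exact: itg_abs|exact: itg_abs]; rewrite mulrDr !mulrA; apply: lerD.
  by apply: (le_trans H1); under eq_Int do rewrite ger0_norm//.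
by apply: (le_trans H2); rewrite le_eqVlt; apply/orP; left; apply/eqP; congr (_ * _);
  apply: eq_Int => z; rewrite ger0_norm.
Qed.

End form.

Hypotheses (IF1 : itg lb F1) (IG1 : itg lb G1) (IF2 : itg lb F2) (IG2 : itg lb G2).

Let c xi := Int lb (fun eta => k (xi, eta)).

Lemma itg_conv_ker : itg (lb \x lb)%E k.
Proof.
have [I1 _] := tri_L1 IF1 IG1; have [I2 _] := tri_L1 IF2 IG2.
apply: (itg_le mk _ (itgD (itg_abs I1) (itg_abs I2))) => p.
by rewrite (ger0_norm (mulr_ge0 (F10 _) (G10 _))) (ger0_norm (mulr_ge0 (F20 _) (G20 _))).
Qed.

Lemma itg_conv : itg lb c /\
  Int lb (fun xi => `|c xi|) <= Int lb F1 * Int lb G1 + Int lb F2 * Int lb G2.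
Proof.
have Ik := itg_conv_ker; have Ic : itg lb c := itg_Int1 Ik.
split => //.
apply: (@le_trans _ _ (Int lb (fun xi => Int lb (fun eta => `|k (xi, eta)|)))).
  apply: le_Int; [exact: itg_abs|exact: (itg_Int1 (itg_abs Ik))|].
  move=> xi; have [I|I] := pselect (itg lb (fun eta => k (xi, eta))).
    exact: normr_Int_le.
  rewrite /c Int_notitg//; last exact: measurable_sec.
  by rewrite normr0 Int_ge0.
rewrite -(Int_prod1 (itg_abs Ik)).
have [I1 H1] := tri_L1 IF1 IG1; have [I2 H2] := tri_L1 IF2 IG2.
apply: (@le_trans _ _ (Int (lb \x lb)%E (fun p => `|F1 (p.1 - p.2) * G1 p.2| +
   `|F2 (p.1 - p.2) * G2 p.2|))).
  apply: le_Int; [exact: itg_abs|by apply: itgD; exact: itg_abs|].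
  by move=> p; rewrite (ger0_norm (mulr_ge0 (F10 _) (G10 _))) (ger0_norm (mulr_ge0 (F20 _) (G20 _))).
rewrite IntD; [|exact: itg_abs|exact: itg_abs]; rewrite H1 H2.
rewrite le_eqVlt; apply/orP; left; apply/eqP.
by congr (_ * _ + _ * _); apply: eq_Int => z; rewrite ger0_norm.
Qed.

Hypotheses (sG1 : sq lb G1) (sG2 : sq lb G2).

Lemma Int_conv phi : itg (lb \x lb)%E (fun p => phi p.1 * k p) ->
  Int lb (fun xi => phi xi * c xi) = Int (lb \x lb)%E (fun p => phi p.1 * k p).
Proof.
move=> I; rewrite (Int_prod1 I); apply: eq_Int => xi /=.
by rewrite IntZm//; exact: measurable_sec.
Qed.

End convolution.

(** Young's inequality for L^1 against L^2, by duality and the triangle integrals. *)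
Lemma sq_conv (k : plane R * plane R -> R) (F1 G1 F2 G2 : plane R -> R) :
  measurable_fun setT k ->
  (forall p, `|k p| <= F1 (p.1 - p.2) * G1 p.2 + F2 (p.1 - p.2) * G2 p.2) ->
  (forall z, 0 <= F1 z) -> (forall z, 0 <= G1 z) ->
  (forall z, 0 <= F2 z) -> (forall z, 0 <= G2 z) ->
  itg lb F1 -> itg lb G1 -> itg lb F2 -> itg lb G2 -> sq lb G1 -> sq lb G2 ->
  let c xi := Int lb (fun eta => k (xi, eta)) in
  sq lb c /\ nrm lb c <= Int lb F1 * nrm lb G1 + Int lb F2 * nrm lb G2.
Proof.
move=> mk kle F10 G10 F20 G20 IF1 IG1 IF2 IG2 sG1 sG2 c.
have [Ic _] := itg_conv mk kle F10 G10 F20 G20 IF1 IG1 IF2 IG2.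
have X0 : 0 <= Int lb F1 * nrm lb G1 + Int lb F2 * nrm lb G2.
  by rewrite addr_ge0// mulr_ge0 ?Int_ge0 ?nrm_ge0.
apply: sq_dual => //; first exact: itg_meas Ic.
move=> phi sphi.
have [I1 H1] := tri13 sphi IF1 sG1; have [I2 H2] := tri13 sphi IF2 sG2.
have le p : `|phi p.1 * k p| <= `|phi p.1 * F1 (p.1 - p.2) * G1 p.2| +
   `|phi p.1 * F2 (p.1 - p.2) * G2 p.2|.
  rewrite !normrM -!mulrA -mulrDr ler_wpM2l// (ger0_norm (F10 _)) (ger0_norm (G10 _)).
  by rewrite (ger0_norm (F20 _)) (ger0_norm (G20 _)) kle.
have I : itg (lb \x lb)%E (fun p => phi p.1 * k p).
  apply: (itg_le _ le (itgD (itg_abs I1) (itg_abs I2))).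
  by apply: measurable_funM => //; apply: measurable_comp1; case: sphi.
rewrite Int_conv//.
apply: (le_trans (normr_Int_le2 (itg_meas I) (itgD (itg_abs I1) (itg_abs I2)) le)).
rewrite IntD; [|exact: itg_abs|exact: itg_abs].
rewrite mulrC mulrDr !mulrA; apply: lerD.
  by apply: (le_trans H1); under eq_Int do rewrite ger0_norm//.
by apply: (le_trans H2); under eq_Int do rewrite ger0_norm//.
Qed.

(** An even majorant: Hartley convolutions evaluate their arguments at both signs. *)
Definition ab f xi : R := `|f xi| + `|f (- xi)|.

Lemma ab_ge0 f xi : 0 <= ab f xi. Proof. by rewrite addr_ge0. Qed.

Lemma abN f xi : ab f (- xi) = ab f xi.
Proof. by rewrite /ab opprK addrC. Qed.

Section even_weight.
Variables (w : plane R -> R) (f : plane R -> R).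
Hypotheses (w0 : forall z, 0 <= w z) (we : forall z, w (- z) = w z).

Let wab z : w z * ab f z = `|w z * f z| + `|w (- z) * f (- z)|.
Proof. by rewrite !normrM we (ger0_norm (w0 z)) /ab mulrDr. Qed.

Lemma itg_ab : itg lb (fun z => w z * f z) ->
  itg lb (fun z => w z * ab f z) /\
  Int lb (fun z => w z * ab f z) = 2 * Int lb (fun z => w z * `|f z|).
Proof.
move=> I; have I' := mpres_itg (@mpres_opp R) I; have J := itg_abs I.
have E : (fun z => w z * ab f z) = (fun z => `|w z * f z| + `|w (- z) * f (- z)|).
  by apply/funext => z.
rewrite E; split; first by apply: itgD => //; exact: (itg_abs I').
rewrite IntD//; last exact: (itg_abs I').
have -> : Int lb (fun z => `|w (- z) * f (- z)|) = Int lb (fun z => `|w z * f z|).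
  exact: (mpres_Int (@mpres_opp R) J).
transitivity (2 * Int lb (fun z => `|w z * f z|)); first by rewrite mulr_natl mulr2n.
congr (_ * _); by apply: eq_Int => z; rewrite normrM ger0_norm.
Qed.

Lemma sq_ab : sq lb (fun z => w z * f z) ->
  sq lb (fun z => w z * ab f z) /\
  nrm lb (fun z => w z * ab f z) <= 2 * nrm lb (fun z => w z * f z).
Proof.
move=> I; have I' := mpres_sq (@mpres_opp R) I.
have E : (fun z => w z * ab f z) = (fun z => `|w z * f z| + `|w (- z) * f (- z)|).
  by apply/funext => z.
rewrite E; split; first by apply: sqD; exact: sq_abs.
apply: (le_trans (nrmD (sq_abs I) (sq_abs I'))).
by rewrite !nrm_abs (mpres_nrm (@mpres_opp R) I) -mulr2n mulr_natl.
Qed.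

End even_weight.

(** Density of the Hartley convolution. Its four terms are the four sign choices in the expansion of
    cas s cas t, so that integrating it over eta corresponds to a pointwise product in physical
    space. *)
Definition qf f g z eta : R :=
  (f z * g eta + f z * g (- eta) + f (- z) * g eta - f (- z) * g (- eta)) / 2.

Lemma normr_qf_le f g z eta : `|qf f g z eta| <= ab f z * ab g eta / 2.
Proof.
rewrite /qf normrM (ger0_norm (_ : 0 <= 2^-1)) ?invr_ge0// ler_wpM2r ?invr_ge0//.
rewrite /ab mulrDl !mulrDr -!normrM.
have H (a b c d : R) : `|a + b + c - d| <= `|a| + `|b| + (`|c| + `|d|).
  by rewrite addrA; apply: (le_trans (ler_normB _ _)); rewrite lerD2r;
    apply: (le_trans (ler_normD _ _)); rewrite lerD2r ler_normD.
exact: H.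
Qed.

Lemma measurable_qf f g : measurable_fun setT (f : plane R -> R) ->
  measurable_fun setT (g : plane R -> R) ->
  measurable_fun setT (fun p : plane R * plane R => qf f g (p.1 - p.2) p.2).
Proof.
move=> mf mg.
have mf' := measurable_compB mf; have mg' := measurable_comp2 mg.
have mfo := measurable_compB (measurable_comp_opp mf).
have mgo := measurable_comp2 (measurable_comp_opp mg).
apply: measurable_funM => //; apply: measurable_funB; last exact: measurable_funM.
by apply: measurable_funD; [apply: measurable_funD|]; apply: measurable_funM.
Qed.

Definition c0 : R := (2 * pi) ^- 2.

Lemma c0_ge0 : 0 <= c0. Proof. by rewrite invr_ge0 sqr_ge0. Qed.

(** By [dot_perpB] the scalar product is perp (xi - eta) . eta: the direction of the velocity at
    frequency xi - eta against the gradient at eta. Written with xi it is visibly antisymmetric in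
    the two frequencies, which is how incompressibility enters. *)
Definition kap (a : R) xi eta : R :=
  c0 * dot (perp xi) eta * enorm (xi - eta) `^ (- 2 + 2 * a).

Lemma enormN xi : enorm (- xi) = enorm xi :> R.
Proof. by rewrite /enorm /dot /=; congr Num.sqrt; ring. Qed.

Lemma enormB xi eta : enorm (xi - eta) = enorm (eta - xi) :> R.
Proof. by rewrite -enormN opprB. Qed.

Lemma normr_dot_perp xi eta : `|dot (perp xi) eta| <= enorm xi * enorm eta.
Proof.
rewrite -(ler_pXn2r (ltn0Sn 1)) ?nnegrE ?mulr_ge0 ?enorm_ge0//.
rewrite real_normK ?num_real// exprMn !sqr_enorm /dot /perp /=.
have := sqr_ge0 (xi.1 * eta.1 + xi.2 * eta.2); lra.
Qed.

Lemma enorm_ge_abs xi : `|xi.1| <= enorm xi /\ `|xi.2| <= enorm xi.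
Proof.
split; rewrite -(ler_pXn2r (ltn0Sn 1)) ?nnegrE ?enorm_ge0// real_normK ?num_real//;
  rewrite sqr_enorm; [rewrite lerDl|rewrite lerDr]; exact: sqr_ge0.
Qed.

Lemma normr_dot xi eta : `|dot xi eta| <= enorm xi * enorm eta.
Proof.
rewrite -(ler_pXn2r (ltn0Sn 1)) ?nnegrE ?mulr_ge0 ?enorm_ge0//.
rewrite real_normK ?num_real// exprMn !sqr_enorm /dot.
have := sqr_ge0 (xi.1 * eta.2 - xi.2 * eta.1); lra.
Qed.

Lemma ler_enormD xi eta : enorm (xi + eta) <= enorm xi + enorm eta :> R.
Proof.
rewrite -(ler_pXn2r (ltn0Sn 1)) ?nnegrE ?addr_ge0 ?enorm_ge0//.
have := normr_dot xi eta; have := ler_norm (dot xi eta).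
rewrite sqrrD !sqr_enorm /dot /=; nra.
Qed.

Lemma enormM_powR (a : R) z : a < 1 / 2 -> enorm z * enorm z `^ (- 2 + 2 * a) = ka a z.
Proof.
move=> a1; rewrite /ka; have [->|z0] := eqVneq (enorm z) 0.
  by rewrite mul0r powR0// lt_eqF//; lra.
rewrite -{1}(powRr1 (enorm_ge0 z)) -powRD ?z0 ?implybT//.
by congr (_ `^ _); ring.
Qed.

Lemma dot_perpB xi eta : dot (perp xi) eta = dot (perp (xi - eta)) eta :> R.
Proof. by rewrite /dot /perp /=; ring. Qed.

Lemma normr_kap (a : R) xi eta : a < 1 / 2 ->
  `|kap a xi eta| <= c0 * (ka a (xi - eta) * enorm eta).
Proof.
move=> a1; rewrite /kap !normrM (ger0_norm c0_ge0) -mulrA ler_wpM2l ?c0_ge0//.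
rewrite (ger0_norm (powR_ge0 _ _)) -(enormM_powR _ a1) dot_perpB.
have := ler_wpM2r (powR_ge0 (enorm (xi - eta)) (- 2 + 2 * a)) (normr_dot_perp (xi - eta) eta).
by move=> /le_trans; apply; rewrite mulrAC.
Qed.

Lemma kapC (a : R) xi eta : kap a eta xi = - kap a xi eta.
Proof. by rewrite /kap enormB /dot /perp /=; ring. Qed.

Lemma kapNN (a : R) xi eta : kap a (- xi) (- eta) = kap a xi eta.
Proof.
by rewrite /kap -opprD enormN; congr (_ * _ * _); rewrite /dot /perp /=; ring.
Qed.

Lemma measurable_kap (a : R) :
  measurable_fun setT (fun p : plane R * plane R => kap a p.1 p.2).
Proof.
apply: measurable_funM.
  apply: measurable_funM => //; apply: measurable_funD; apply: measurable_funM.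
  - apply: (measurableT_comp (@oppr_measurable R setT)).
    exact: (measurableT_comp measurable_snd measurable_fst).
  - exact: (measurableT_comp measurable_fst measurable_snd).
  - exact: (measurableT_comp measurable_fst measurable_fst).
  - exact: (measurableT_comp measurable_snd measurable_snd).
apply: (measurable_compB (f := fun z => enorm z `^ (- 2 + 2 * a))).
by apply: measurable_powRl; exact: measurable_enorm.
Qed.

(** The transform of - u . grad g, where u is the velocity generated by [f]; [inv_bil] is the
    physical-space form. *)
Definition bil (a : R) f g xi : R :=
  Int lb (fun eta => kap a xi eta * qf f g (xi - eta) eta).

Lemma measurable_bil_ker a f g : measurable_fun setT (f : plane R -> R) ->
  measurable_fun setT (g : plane R -> R) -> measurable_fun setT
   (fun p : plane R * plane R => kap a p.1 p.2 * qf f g (p.1 - p.2) p.2).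
Proof.
by move=> mf mg; apply: measurable_funM; [exact: measurable_kap|exact: measurable_qf].
Qed.

Lemma normr_bil_ker a f g xi eta : a < 1 / 2 ->
  `|kap a xi eta * qf f g (xi - eta) eta| <=
   (c0 / 2 * (ka a (xi - eta) * ab f (xi - eta))) * (enorm eta * ab g eta).
Proof.
move=> a1; rewrite normrM.
apply: (le_trans (ler_pM (normr_ge0 _) (normr_ge0 _) (normr_kap _ _ a1) (normr_qf_le _ _ _ _))).
by rewrite le_eqVlt; apply/orP; left; apply/eqP; ring.
Qed.

End bilinear.

(** * Sobolev classes on the Hartley side and their constants *)

Section sobolev_class.
Context {R : realType}.
Let lb := @lb2 R.
Implicit Types (f g y phi : R * R -> R) (xi z eta : R * R).

Definition wr (r : R) y := sq lb (fun xi => rho r xi * y xi).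
Definition nr (r : R) y := nrm lb (fun xi => rho r xi * y xi).
(** Constant of the embedding of the Sobolev class into L^1 with two derivatives: finite for r > 3,
    and free of alpha. *)
Definition crs (r : R) := nrm lb (fun xi => (1 + enorm xi) ^+ 2 / rho r xi).
(** The low frequency part of the velocity symbol. For alpha > 0 this norm is finite but unbounded
    as alpha tends to 0; [Cb] inherits this, so neither may enter a bound that has to be uniform in
    alpha. *)
Definition ca (a : R) := nrm lb (fun xi => ka a xi * bnl 1 xi).
Definition Cb (a r : R) := 8 * (1 + ca a + crs r) ^+ 2.

Lemma nr_ge0 r y : 0 <= nr r y. Proof. exact: nrm_ge0. Qed.
Lemma crs_ge0 r : 0 <= crs r. Proof. exact: nrm_ge0. Qed.
Lemma ca_ge0 a : 0 <= ca a. Proof. exact: nrm_ge0. Qed.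

Lemma c0_le1 : c0 <= 1 :> R.
Proof.
rewrite /c0 invf_le1; last by rewrite exprn_gt0// mulr_gt0 ?pi_gt0.
have := pi_ge2 R; move=> H; nra.
Qed.

Lemma half_le (c I B : R) : 0 <= c -> c <= 1 -> 0 <= I -> I <= 2 * B -> c / 2 * I <= B.
Proof.
move=> c00 c1 I0 IB; apply: (@le_trans _ _ (1 / 2 * I)); last by lra.
by rewrite ler_wpM2r// ler_wpM2r.
Qed.

Lemma Cb_ge a r : 2 * (ca a + crs r) <= Cb a r.
Proof. by rewrite /Cb; have := crs_ge0 r; have := ca_ge0 a; nra. Qed.

Lemma measurable_rhoM r y : measurable_fun setT (fun xi : plane R => rho r xi * y xi) ->
  measurable_fun setT (y : plane R -> R).
Proof.
move=> m; have -> : y = fun xi => (rho r xi)^-1 * (rho r xi * y xi).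
  by apply/funext => xi; rewrite mulKf// gt_eqF// rho_gt0.
apply: measurable_funM => //.
have -> : (fun xi : plane R => (rho r xi)^-1) = (fun xi => jap xi `^ (- (r / 2))).
  by apply/funext => xi; rewrite powRN.
by apply: measurable_powRl; exact: measurable_jap.
Qed.

Lemma wr_meas r y : wr r y -> measurable_fun setT (y : plane R -> R).
Proof. by case=> m _; exact: measurable_rhoM m. Qed.

Lemma wrD r f g : wr r f -> wr r g -> wr r (fun xi => f xi + g xi).
Proof. by move=> wf wg; have := sqD wf wg; rewrite /wr; under eq_fun do rewrite -mulrDr. Qed.

Lemma wrZ r k f : wr r f -> wr r (fun xi => k * f xi).
Proof. by move=> wf; have := sqZ k wf; rewrite /wr; under eq_fun do rewrite mulrCA. Qed.

Lemma wrB r f g : wr r f -> wr r g -> wr r (fun xi => f xi - g xi).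
Proof. by move=> wf wg; have := sqB wf wg; rewrite /wr; under eq_fun do rewrite -mulrBr. Qed.

Lemma nrB r f g : wr r f -> wr r g -> nr r (fun xi => f xi - g xi) <= nr r f + nr r g.
Proof.
by move=> wf wg; have := nrmB wf wg; rewrite /nr; under eq_nrm do rewrite -mulrBr.
Qed.

Lemma nrZ r k f : wr r f -> nr r (fun xi => k * f xi) = `|k| * nr r f.
Proof.
by move=> wf; have := nrmZ k wf; rewrite /nr; under [in LHS]eq_nrm do rewrite mulrCA.
Qed.

Lemma wr_sq r y (w : plane R -> R) : measurable_fun setT w ->
  (forall xi, `|w xi| <= rho r xi) -> wr r y ->
  sq lb (fun xi => w xi * y xi) /\ nrm lb (fun xi => w xi * y xi) <= nr r y.
Proof.
move=> mw wle wy; have my := wr_meas wy.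
have m := measurable_funM mw my.
have le xi : `|w xi * y xi| <= `|rho r xi * y xi|.
  by rewrite !normrM ler_wpM2r// (ger0_norm (ltW (rho_gt0 _ _))).
by split; [exact: (sq_le m le (sq_abs wy))|exact: (le_nrm m le wy)].
Qed.

Lemma wr_sq0 r y : 0 <= r -> wr r y -> sq lb y /\ nrm lb y <= nr r y.
Proof.
move=> r0 wy.
have [|xi|] := @wr_sq r y (fun=> 1) _ _ wy; first exact: measurable_cst.
  by rewrite normr1 rho_ge1.
have -> // : (fun xi => 1 * y xi) = y by apply/funext => xi; rewrite mul1r.
Qed.

Lemma jap_le_rho (r : R) xi : 2 <= r -> jap xi <= rho r xi.
Proof.
move=> r2; rewrite -[leLHS]powRr1 ?(ltW (jap_gt0 _))//; apply: ler_powR.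
  exact: jap_ge1.
lra.
Qed.

Lemma sqr_1D_le_jap xi : (1 + enorm xi) ^+ 2 <= 2 * jap xi.
Proof. by rewrite /jap; have := sqr_ge0 (enorm xi - 1); nra. Qed.

Lemma measurable_1D2 : measurable_fun setT (fun xi : plane R => (1 + enorm xi) ^+ 2).
Proof.
by apply: (measurable_funX 2); apply: measurable_funD => //; exact: measurable_enorm.
Qed.

Lemma sq_crs (r : R) : 3 < r -> sq lb (fun xi => (1 + enorm xi) ^+ 2 / rho r xi).
Proof.
move=> r3.
have m : measurable_fun setT (fun xi : plane R => (1 + enorm xi) ^+ 2 / rho r xi).
  apply: measurable_funM; first exact: measurable_1D2.
  have -> : (fun xi : plane R => (rho r xi)^-1) = (fun xi => jap xi `^ (- (r / 2))).
    by apply/funext => xi; rewrite powRN.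
  by apply: measurable_powRl; exact: measurable_jap.
split => //; have r2 : 1 < r - 2 by lra.
apply: (itg_le _ _ (itgZ 4 (itg_jap_powR r2))); first exact: measurable_funX.
move=> xi; rewrite ger0_norm ?sqr_ge0// expr_div_n sqr_rho.
have -> : - (r - 2) = 2%:R - r by ring.
rewrite powRD; last by rewrite (gt_eqF (jap_gt0 xi)) implybT.
rewrite powR_mulrn ?(ltW (jap_gt0 _))// powRN mulrA ler_wpM2r ?invr_ge0 ?powR_ge0//.
have -> : 4 * jap xi ^+ 2 = (2 * jap xi) ^+ 2 by ring.
by rewrite ler_pXn2r ?nnegrE ?sqr_ge0 ?sqr_1D_le_jap// mulr_ge0 ?(ltW (jap_gt0 _)).
Qed.

Lemma wr_itg r y (w : plane R -> R) : 3 < r -> measurable_fun setT w ->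
  (forall xi, `|w xi| <= (1 + enorm xi) ^+ 2) -> wr r y ->
  itg lb (fun xi => w xi * y xi) /\
  Int lb (fun xi => `|w xi * y xi|) <= crs r * nr r y.
Proof.
move=> r3 mw wle wy; have my := wr_meas wy; have m := measurable_funM mw my.
have sc := sq_crs r3.
have le xi : `|w xi * y xi| <= `|(1 + enorm xi) ^+ 2 / rho r xi * (rho r xi * y xi)|.
  rewrite mulrA mulfVK ?gt_eqF ?rho_gt0// (normrM (w xi)) (normrM (_ ^+ 2)).
  by rewrite ler_wpM2r// (ger0_norm (sqr_ge0 _)).
have I := sqM_itg sc wy.
split; first exact: (itg_le m le (itg_abs I)).
apply: (@le_trans _ _ (Int lb (fun xi => `|(1 + enorm xi) ^+ 2 / rho r xi| * `|rho r xi * y xi|))).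
  apply: le_Int; [exact/itg_abs/(itg_le m le (itg_abs I))|exact: sqM_itg (sq_abs sc) (sq_abs wy)|].
  by move=> xi; rewrite -normrM.
apply: le_trans (ler_norm _) _.
by apply: le_trans (cauchy_schwarz (sq_abs sc) (sq_abs wy)) _; rewrite !nrm_abs.
Qed.

Lemma sq_ca (a : R) : 0 < a < 1 / 2 -> sq lb (fun xi => ka a xi * bnl 1 xi).
Proof.
move=> a1; split.
  by apply: measurable_funM; [exact: measurable_ka|exact: measurable_bnl].
by under eq_fun do rewrite exprMn bnl_sqr; exact: itg_ka2.
Qed.

Lemma ka_ge0 a xi : 0 <= ka a xi. Proof. exact: powR_ge0. Qed.

Lemma ka_le (a : R) xi : a < 1 / 2 -> ka a xi <= ka a xi * bnl 1 xi + 1.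
Proof.
move=> a1; rewrite /bnl; case: (leP (enorm xi) 1) => H /=.
  by rewrite mulr1 lerDl.
rewrite mulr0 add0r /ka -[leRHS](powRr0 (enorm xi)); apply: ler_powR; [exact: ltW|lra].
Qed.

Lemma itg_ka (a : R) y : 0 < a < 1 / 2 -> sq lb y -> itg lb y ->
  itg lb (fun xi => ka a xi * y xi) /\
  Int lb (fun xi => ka a xi * `|y xi|) <= ca a * nrm lb y + Int lb (fun xi => `|y xi|).
Proof.
move=> a1 sy Iy; have sc := sq_ca a1; have a12 : a < 1 / 2 by case/andP: a1.
have I1 : itg lb (fun xi => ka a xi * bnl 1 xi * `|y xi|).
  exact: sqM_itg sc (sq_abs sy).
have le xi : ka a xi * `|y xi| <= ka a xi * bnl 1 xi * `|y xi| + `|y xi|.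
  rewrite -[X in _ <= _ + X]mul1r -mulrDl ler_wpM2r//.
  exact: ka_le.
have I : itg lb (fun xi => ka a xi * y xi).
  apply: (itg_le _ _ (itgD I1 (itg_abs Iy))).
    by apply: measurable_funM; [exact: measurable_ka|case: sy].
  by move=> xi; rewrite normrM (ger0_norm (ka_ge0 _ _)).
split => //.
apply: (@le_trans _ _ (Int lb (fun xi => ka a xi * bnl 1 xi * `|y xi| + `|y xi|))).
  apply: le_Int => //; last by apply: itgD => //; exact: itg_abs.
  have := itg_abs I; congr itg; apply/funext => xi.
  by rewrite normrM (ger0_norm (ka_ge0 _ _)).
rewrite IntD//; last exact: itg_abs.
rewrite lerD2r; apply: le_trans (ler_norm _) _.
by apply: le_trans (cauchy_schwarz sc (sq_abs sy)) _; rewrite nrm_abs.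
Qed.

(** Young's inequality for x^p and 1 with exponents 1 / p and 1 / (1 - p). *)
Lemma powR_bernoulli (x p : R) : 0 <= x -> 0 < p <= 1 -> x `^ p <= 1 + p * x.
Proof.
move=> x0 /andP[p0]; rewrite le_eqVlt => /predU1P[->|p1].
  by rewrite powRr1// mul1r lerDr.
have q0 : 0 < 1 - p by rewrite subr_gt0.
have := @conjugate_powR R (x `^ p) 1 p^-1 (1 - p)^-1 (powR_ge0 _ _) ler01.
rewrite !invr_gt0 !invrK => /(_ p0 q0); rewrite addrC subrK => /(_ erefl).
rewrite mulr1 -powRrM mulfV ?gt_eqF// powRr1// powR1; lra.
Qed.

(** The velocity gradient has 2 a more derivatives than a Riesz transform of the vorticity;
    linearizing this loss in a gives every such term an explicit factor a. *)
Lemma enorm_ka_le (a : R) xi : 0 < a < 1 / 2 ->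
  enorm xi * ka a xi <= 1 + 2 * a * enorm xi.
Proof.
move=> /andP[a0 a1].
apply: (@le_trans _ _ (enorm xi `^ (2 * a))); last first.
  by apply: powR_bernoulli; [exact: enorm_ge0|apply/andP; split; lra].
have [->|z0] := eqVneq (enorm xi) 0; first by rewrite mul0r powR_ge0.
rewrite /ka -{1}(powRr1 (enorm_ge0 xi)) -powRD ?z0 ?implybT//.
by rewrite (_ : 1 + (-1 + 2 * a) = 2 * a)//; ring.
Qed.

End sobolev_class.

(** * Estimates of the bilinear form *)

Section bil_estimates.
Context {R : realType}.
Let lb := @lb2 R.
Implicit Types (f g y phi : R * R -> R) (xi z eta : R * R).
Variables (a r : R).
Hypotheses (Ha : 0 < a < 1 / 2) (Hr : 3 < r).

Let a12 : a < 1 / 2. Proof. by case/andP: Ha. Qed.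
Let r0 : 0 <= r. Proof. by apply/ltW/(lt_trans _ Hr). Qed.
Let r2 : 2 <= r. Proof. by apply/ltW/(lt_trans _ Hr); rewrite ltr_nat. Qed.
Let eN z : enorm (- z) = enorm z := enormN z.
Let kaN z : ka a (- z) = ka a z. Proof. by rewrite /ka enormN. Qed.

Lemma wr_enorm_sq y : wr r y -> sq lb (fun xi => enorm xi * y xi) /\
  nrm lb (fun xi => enorm xi * y xi) <= nr r y.
Proof.
apply: wr_sq; first exact: measurable_enorm.
move=> xi; rewrite ger0_norm ?enorm_ge0//; apply: le_trans (jap_le_rho xi r2).
by rewrite /jap; have := sqr_ge0 (enorm xi - 1); have := sqr_ge0 (enorm xi); nra.
Qed.

Lemma wr_enorm2_sq y : wr r y -> sq lb (fun xi => enorm xi ^+ 2 * y xi) /\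
  nrm lb (fun xi => enorm xi ^+ 2 * y xi) <= nr r y.
Proof.
apply: wr_sq; first by apply: (measurable_funX 2); exact: measurable_enorm.
move=> xi; rewrite ger0_norm ?sqr_ge0//; apply: le_trans (jap_le_rho xi r2).
by rewrite /jap lerDr.
Qed.

Lemma wr_enorm_itg (k : nat) y : (k <= 2)%N -> wr r y ->
  itg lb (fun xi => enorm xi ^+ k * y xi) /\
  Int lb (fun xi => enorm xi ^+ k * `|y xi|) <= crs r * nr r y.
Proof.
move=> k2 wy; have [||I] := @wr_itg _ r y (fun xi => enorm xi ^+ k) Hr _ _ wy.
- by apply: measurable_funX; exact: measurable_enorm.
- move=> xi; rewrite ger0_norm ?exprn_ge0 ?enorm_ge0//.
  have e0 := enorm_ge0 xi; move: k k2 => [|[|[|//]]] _; rewrite ?expr0 ?expr1; nra.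
under eq_Int do rewrite normrM ger0_norm ?exprn_ge0 ?enorm_ge0//.
by [].
Qed.

Lemma wr_itg0 y : wr r y -> itg lb y /\ Int lb (fun xi => `|y xi|) <= crs r * nr r y.
Proof.
move=> /(@wr_enorm_itg 0)[]//.
by under eq_fun do rewrite expr0 mul1r; under eq_Int do rewrite expr0 mul1r.
Qed.

Lemma wr_itg1 y : wr r y -> itg lb (fun xi => enorm xi * y xi) /\
  Int lb (fun xi => enorm xi * `|y xi|) <= crs r * nr r y.
Proof. exact: (@wr_enorm_itg 1). Qed.

Lemma wr_ka y : wr r y -> itg lb (fun xi => ka a xi * y xi) /\
  Int lb (fun xi => ka a xi * `|y xi|) <= (ca a + crs r) * nr r y.
Proof.
move=> wy; have [sy ny] := wr_sq0 r0 wy; have [Iy ly] := wr_itg0 wy.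
have [I H] := itg_ka Ha sy Iy; split => //; apply: (le_trans H).
by rewrite mulrDl lerD// ler_wpM2l ?ca_ge0.
Qed.

Lemma wr_enorm_ka y : wr r y -> itg lb (fun xi => enorm xi * ka a xi * y xi) /\
  Int lb (fun xi => enorm xi * ka a xi * `|y xi|) <= crs r * nr r y.
Proof.
move=> wy.
have k0 xi : 0 <= enorm xi * ka a xi by rewrite mulr_ge0 ?enorm_ge0 ?ka_ge0.
have [||I] := @wr_itg _ r y (fun xi => enorm xi * ka a xi) Hr _ _ wy.
- by apply: measurable_funM; [exact: measurable_enorm|exact: measurable_ka].
- move=> xi; rewrite ger0_norm//; apply: (le_trans (enorm_ka_le xi Ha)).
  have a21 : 2 * a <= 1 by move: a12; lra.
  have H := ler_wpM2r (enorm_ge0 xi) a21.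
  have := enorm_ge0 xi; have := sqr_ge0 (enorm xi); lra.
by under eq_Int do rewrite normrM ger0_norm//.
Qed.

Section two.
Variables f g : R * R -> R.
Hypotheses (wf : wr r f) (wg : wr r g).

Let F := fun z : plane R => c0 / 2 * (ka a z * ab f z).
Let G := fun z : plane R => enorm z * ab g z.
Let k := fun p : plane R * plane R => kap a p.1 p.2 * qf f g (p.1 - p.2) p.2.

Let mk : measurable_fun setT k.
Proof. exact: measurable_bil_ker (wr_meas wf) (wr_meas wg). Qed.

(** The second product of the convolution lemmas is zero here: two are needed only once a derivative
    has been distributed. *)
Let Z := fun _ : plane R => 0 : R.
Let sZ : sq lb Z := sq0 lb.
Let IZ : itg lb Z := itg0 lb.

Let kle p : `|k p| <= F (p.1 - p.2) * G p.2 + Z (p.1 - p.2) * Z p.2.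
Proof. by rewrite /Z mulr0 addr0; exact: normr_bil_ker. Qed.

Let F0 z : 0 <= F z.
Proof.
apply: mulr_ge0; first by rewrite divr_ge0 ?c0_ge0.
by rewrite mulr_ge0 ?ka_ge0 ?ab_ge0.
Qed.

Let G0 z : 0 <= G z. Proof. by rewrite mulr_ge0 ?enorm_ge0 ?ab_ge0. Qed.

Let IF : itg lb F /\ Int lb F = c0 * Int lb (fun z => ka a z * `|f z|).
Proof.
have [I E] := itg_ab (ka_ge0 (R := R) a) kaN (wr_ka wf).1.
split; first exact: itgZ.
by rewrite IntZ// E mulrA mulfVK.
Qed.

Let IG := itg_ab (@enorm_ge0 R) eN (wr_itg1 wg).1.
Let sG := sq_ab (@enorm_ge0 R) eN (wr_enorm_sq wg).1.

Lemma bil_form phi : sq lb phi ->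
  itg (lb \x lb)%E (fun p => phi p.1 * k p) /\
  Int lb (fun xi => phi xi * bil a f g xi) = Int (lb \x lb)%E (fun p => phi p.1 * k p).
Proof.
move=> sp.
have I : itg (lb \x lb)%E (fun p => phi p.1 * k p).
  by apply: (itg_form mk kle) => //; [exact: IF.1|exact: sG.1].
by split => //; exact: (Int_conv mk I).
Qed.

Lemma bil_L1 : itg lb (bil a f g) /\ Int lb (fun xi => `|bil a f g xi|) <=
  2 * Int lb (fun z => ka a z * `|f z|) * Int lb (fun z => enorm z * `|g z|).
Proof.
have [I H] := itg_conv mk kle F0 G0 (fun=> lexx 0) (fun=> lexx 0) IF.1 IG.1 IZ IZ.
split; first exact: I.
apply: (le_trans H); rewrite IF.2 IG.2 Int0 mulr0 addr0.
set A := Int lb _; set B := Int lb _.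
have A0 : 0 <= A by apply: Int_ge0 => z; rewrite mulr_ge0 ?ka_ge0.
have B0 : 0 <= B by apply: Int_ge0 => z; rewrite mulr_ge0 ?enorm_ge0.
have -> : c0 * A * (2 * B) = c0 * (2 * A * B) by ring.
by rewrite ler_piMl ?c0_le1// !mulr_ge0.
Qed.

Lemma bil_sq : sq lb (bil a f g) /\ nrm lb (bil a f g) <=
  2 * Int lb (fun z => ka a z * `|f z|) * nrm lb (fun z => enorm z * g z).
Proof.
have [I H] := sq_conv mk kle F0 G0 (fun=> lexx 0) (fun=> lexx 0) IF.1 IG.1 IZ IZ sG.1 sZ.
split; first exact: I.
apply: (le_trans H); rewrite IF.2 Int0 mul0r addr0.
set A := Int lb _.
have A0 : 0 <= A by apply: Int_ge0 => z; rewrite mulr_ge0 ?ka_ge0.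
have -> : 2 * A * nrm lb (fun z => enorm z * g z) = A * (2 * nrm lb (fun z => enorm z * g z)).
  by ring.
apply: ler_pM; [by rewrite mulr_ge0 ?c0_ge0|exact: nrm_ge0| |exact: sG.2].
by rewrite ler_piMl ?c0_le1.
Qed.

(* Moves one derivative into the product: |xi| <= |xi - eta| + |eta|. *)
Let F' := fun z : plane R => c0 / 2 * (enorm z * ka a z * ab f z).
Let G' := fun z : plane R => enorm z ^+ 2 * ab g z.
Let k' := fun p : plane R * plane R => enorm p.1 * k p.

Let mk' : measurable_fun setT k'.
Proof. by apply: measurable_funM => //; apply: measurable_comp1; exact: measurable_enorm. Qed.

Let kle' p : `|k' p| <= F' (p.1 - p.2) * G p.2 + F (p.1 - p.2) * G' p.2.
Proof.
rewrite /k' normrM (ger0_norm (enorm_ge0 _)).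
have H : enorm p.1 <= enorm (p.1 - p.2) + enorm p.2.
  by have := ler_enormD (p.1 - p.2) p.2; rewrite subrK.
have := kle p; rewrite /Z mulr0 addr0 => H2.
apply: (le_trans (ler_pM (enorm_ge0 _) (normr_ge0 _) H H2)).
by rewrite le_eqVlt; apply/orP; left; apply/eqP; rewrite /F /F' /G /G'; ring.
Qed.

Let F0' z : 0 <= F' z.
Proof.
apply: mulr_ge0; first by rewrite divr_ge0 ?c0_ge0.
by apply: mulr_ge0; [rewrite mulr_ge0 ?enorm_ge0 ?ka_ge0|exact: ab_ge0].
Qed.

Let G0' z : 0 <= G' z. Proof. by rewrite mulr_ge0 ?sqr_ge0 ?ab_ge0. Qed.

Let IF' : itg lb F' /\ Int lb F' = c0 * Int lb (fun z => enorm z * ka a z * `|f z|).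
Proof.
have k0 xi : 0 <= enorm xi * ka a xi by rewrite mulr_ge0 ?enorm_ge0 ?ka_ge0.
have kN xi : enorm (- xi) * ka a (- xi) = enorm xi * ka a xi by rewrite eN kaN.
have [I E] := itg_ab k0 kN (wr_enorm_ka wf).1.
split; first exact: itgZ.
by rewrite IntZ// E mulrA mulfVK.
Qed.

Let e20 (z : R * R) : 0 <= enorm z ^+ 2. Proof. exact: sqr_ge0. Qed.
Let e2N (z : R * R) : enorm (- z) ^+ 2 = enorm z ^+ 2. Proof. by rewrite eN. Qed.
Let IG' := itg_ab e20 e2N (@wr_enorm_itg 2 g erefl wg).1.
Let sG' := sq_ab e20 e2N (wr_enorm2_sq wg).1.

Let bil1E xi : enorm xi * bil a f g xi = Int lb (fun eta => k' (xi, eta)).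
Proof. by rewrite /k' /= IntZm//; exact: measurable_sec. Qed.

Let X := nr r f * nr r g.

Let X0 : 0 <= X. Proof. by rewrite mulr_ge0 ?nr_ge0. Qed.

Lemma bil_enorm_L1 : itg lb (fun xi => enorm xi * bil a f g xi) /\
  Int lb (fun xi => enorm xi * `|bil a f g xi|) <= Cb a r * X.
Proof.
have [I H] := itg_conv mk' kle' F0' G0 F0 G0' IF'.1 IG.1 IF.1 IG'.1.
have E : (fun xi => enorm xi * bil a f g xi) = (fun xi => Int lb (fun eta => k' (xi, eta))).
  by apply/funext => xi; exact: bil1E.
split; first by rewrite E.
have -> : Int lb (fun xi => enorm xi * `|bil a f g xi|) =
   Int lb (fun xi => `|Int lb (fun eta => k' (xi, eta))|).
  by apply: eq_Int => xi; rewrite -bil1E normrM ger0_norm ?enorm_ge0.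
apply: (le_trans H); rewrite IF.2 IF'.2 IG.2 IG'.2.
have := (wr_ka wf).2; have := (wr_enorm_ka wf).2; have := (wr_itg1 wg).2.
have := (@wr_enorm_itg 2 g erefl wg).2.
set A := Int lb _; set B := Int lb _; set C := Int lb _; set D := Int lb _ => hA hB hC hD.
have A0 : 0 <= A by apply: Int_ge0 => z; rewrite mulr_ge0 ?sqr_ge0.
have B0 : 0 <= B by apply: Int_ge0 => z; rewrite mulr_ge0 ?enorm_ge0.
have C0 : 0 <= C by apply: Int_ge0 => z; rewrite !mulr_ge0 ?enorm_ge0 ?ka_ge0.
have D0 : 0 <= D by apply: Int_ge0 => z; rewrite mulr_ge0 ?ka_ge0.
have h1 : C * B <= (crs r * nr r f) * (crs r * nr r g) by apply: ler_pM.
have h2 : D * A <= ((ca a + crs r) * nr r f) * (crs r * nr r g) by apply: ler_pM.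
apply: (@le_trans _ _ (2 * (C * B + D * A))).
  have -> : c0 * C * (2 * B) + c0 * D * (2 * A) = c0 * (2 * (C * B + D * A)) by ring.
  by rewrite ler_piMl ?c0_le1// mulr_ge0// addr_ge0// mulr_ge0.
apply: (@le_trans _ _ ((2 * (crs r ^+ 2 + (ca a + crs r) * crs r)) * X)).
  by rewrite /X; apply: le_trans (ler_wpM2l _ (lerD h1 h2)) _ => //;
    rewrite le_eqVlt; apply/orP; left; apply/eqP; ring.
rewrite ler_wpM2r// /Cb; have := crs_ge0 r; have := ca_ge0 a; nra.
Qed.

Lemma bil_enorm_sq : sq lb (fun xi => enorm xi * bil a f g xi) /\
  nrm lb (fun xi => enorm xi * bil a f g xi) <= Cb a r * X.
Proof.
have [I H] := sq_conv mk' kle' F0' G0 F0 G0' IF'.1 IG.1 IF.1 IG'.1 sG.1 sG'.1.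
have E : (fun xi => enorm xi * bil a f g xi) = (fun xi => Int lb (fun eta => k' (xi, eta))).
  by apply/funext => xi; exact: bil1E.
rewrite E; split => //.
apply: (le_trans H); rewrite IF.2 IF'.2.
have := (wr_ka wf).2; have := (wr_enorm_ka wf).2.
have hB : nrm lb G <= 2 * nr r g by apply: le_trans sG.2 _; rewrite ler_wpM2l// (wr_enorm_sq wg).2.
have hA : nrm lb G' <= 2 * nr r g by apply: le_trans sG'.2 _; rewrite ler_wpM2l// (wr_enorm2_sq wg).2.
set A := nrm lb _ in hA *; set B := nrm lb _ in hB *; set C := Int lb _; set D := Int lb _ => hC hD.
have A0 : 0 <= A by exact: nrm_ge0.
have B0 : 0 <= B by exact: nrm_ge0.
have C0 : 0 <= C by apply: Int_ge0 => z; rewrite !mulr_ge0 ?enorm_ge0 ?ka_ge0.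
have D0 : 0 <= D by apply: Int_ge0 => z; rewrite mulr_ge0 ?ka_ge0.
have h1 : C * B <= (crs r * nr r f) * (2 * nr r g) by apply: ler_pM.
have h2 : D * A <= ((ca a + crs r) * nr r f) * (2 * nr r g) by apply: ler_pM.
apply: (@le_trans _ _ (C * B + D * A)).
  have -> : c0 * C * B + c0 * D * A = c0 * (C * B + D * A) by ring.
  by rewrite ler_piMl ?c0_le1// addr_ge0// mulr_ge0.
apply: (@le_trans _ _ ((2 * (crs r + (ca a + crs r))) * X)).
  by rewrite /X; apply: le_trans (lerD h1 h2) _;
    rewrite le_eqVlt; apply/orP; left; apply/eqP; ring.
rewrite ler_wpM2r// /Cb; have := crs_ge0 r; have := ca_ge0 a; nra.
Qed.

Lemma bil_sq_le : nrm lb (bil a f g) <= Cb a r * (nr r f * nrm lb (fun z => enorm z * g z)).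
Proof.
apply: (le_trans bil_sq.2); have hA := (wr_ka wf).2.
move: hA; set A := Int lb _; set B := nrm lb _ => hA.
have B0 : 0 <= B by exact: nrm_ge0.
apply: (@le_trans _ _ ((2 * (ca a + crs r)) * (nr r f * B))).
  by rewrite !mulrA ler_wpM2r// -mulrA ler_wpM2l.
by apply: ler_wpM2r; [apply: mulr_ge0 => //; exact: nr_ge0|exact: Cb_ge].
Qed.

Lemma bil_sq_le2 : nrm lb (bil a f g) <= Cb a r * X.
Proof.
apply: (le_trans bil_sq_le); rewrite ler_wpM2l//.
  by rewrite mulr_ge0 ?sqr_ge0.
by rewrite ler_wpM2l ?nr_ge0// (wr_enorm_sq wg).2.
Qed.

(** The velocity factor [f] is measured in L^2 alone: the low frequencies of [ka] pair with [ca],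
    the high ones are bounded by 1, and the gradient of [g] supplies the integrability. This closes
    the L^2 comparison of two schemes. *)
Lemma bil_form_le phi : sq lb phi ->
  `|Int (lb \x lb)%E (fun p => phi p.1 * k p)| <= Cb a r * (nrm lb phi * nrm lb f * nr r g).
Proof.
move=> sp; have [sf _] := wr_sq0 r0 wf.
pose F1 z := c0 / 2 * (ka a z * bnl 1 z * ab f z).
pose F2 z := c0 / 2 * ab f z.
have one0 (z : R * R) : 0 <= (1 : R) by [].
have sf1 : sq lb (fun z => 1 * f z) by under eq_fun do rewrite mul1r.
have E1 (h : plane R -> R) : (fun z => 1 * h z) = h by apply/funext => z; rewrite mul1r.
have [] := sq_ab one0 (fun=> erefl) sf1; rewrite !E1 => sab nab.
have sc := sq_ca Ha.
have IF1 : itg lb F1 by apply: itgZ; exact: sqM_itg sc sab.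
have BF1 : Int lb F1 <= ca a * nrm lb f.
  rewrite /F1 IntZ; last exact: sqM_itg sc sab.
  have H := le_trans (ler_norm _) (cauchy_schwarz sc sab).
  have H2 := ler_wpM2l (ca_ge0 a) nab.
  have H3 := le_trans H H2.
  apply: half_le; [exact: c0_ge0|exact: c0_le1| |by rewrite mulrCA].
  by apply: Int_ge0 => z; rewrite !mulr_ge0 ?ka_ge0 ?bnl_ge0 ?ab_ge0.
have sF2 : sq lb F2 by exact: sqZ.
have BF2 : nrm lb F2 <= nrm lb f.
  rewrite nrmZ// ger0_norm; last by rewrite divr_ge0 ?c0_ge0.
  by apply: half_le; [exact: c0_ge0|exact: c0_le1|exact: nrm_ge0|].
have F10 z : 0 <= F1 z.
  apply: mulr_ge0; first by rewrite divr_ge0 ?c0_ge0.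
  by apply: mulr_ge0; [rewrite mulr_ge0 ?bnl_ge0 ?ka_ge0|exact: ab_ge0].
have F20 z : 0 <= F2 z.
  by apply: mulr_ge0; [rewrite divr_ge0 ?c0_ge0|exact: ab_ge0].
have kle2 p : `|k p| <= F1 (p.1 - p.2) * G p.2 + F2 (p.1 - p.2) * G p.2.
  apply: (le_trans (kle p)); rewrite /Z mulr0 addr0 -mulrDl ler_wpM2r// /F /F1 /F2 -mulrDr.
  apply: ler_wpM2l; first by rewrite divr_ge0 ?c0_ge0.
  have := ler_wpM2r (ab_ge0 f (p.1 - p.2)) (ka_le (p.1 - p.2) a12).
  by rewrite mulrDl mul1r.
have := @Int_form_le _ _ _ _ _ _ mk kle2 F10 G0 F20 G0 IF1 sG.1 sF2 IG.1 _ sp.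
move=> /le_trans; apply.
have hG : nrm lb G <= 2 * nr r g by apply: le_trans sG.2 _; rewrite ler_wpM2l// (wr_enorm_sq wg).2.
have hG1 : Int lb G <= 2 * (crs r * nr r g) by rewrite IG.2 ler_wpM2l// (wr_itg1 wg).2.
have h1 : Int lb F1 * nrm lb G <= (ca a * nrm lb f) * (2 * nr r g).
  by apply: ler_pM => //; [exact: Int_ge0|exact: nrm_ge0].
have h2 : nrm lb F2 * Int lb G <= nrm lb f * (2 * (crs r * nr r g)).
  by apply: ler_pM => //; [exact: nrm_ge0|exact: Int_ge0].
apply: le_trans (ler_wpM2l (nrm_ge0 _ _) (lerD h1 h2)) _.
have -> : nrm lb phi * (ca a * nrm lb f * (2 * nr r g) + nrm lb f * (2 * (crs r * nr r g))) =
   (2 * (ca a + crs r)) * (nrm lb phi * nrm lb f * nr r g) by ring.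
apply: ler_wpM2r (Cb_ge a r); apply: mulr_ge0; last exact: nr_ge0.
by apply: mulr_ge0; exact: nrm_ge0.
Qed.

End two.
End bil_estimates.

(** * Symmetrization of trilinear integrals *)

Section symmetrization.
Context {R : realType}.
Let lb := @lb2 R.
Implicit Types (f e y phi : R * R -> R) (xi z eta : R * R).

Definition tform a (A : plane R * plane R -> R) f e (p : plane R * plane R) : R :=
  A p * (e p.1 * (kap a p.1 p.2 * qf f e (p.1 - p.2) p.2)).

Definition tsym f e (p : plane R * plane R) : R :=
  (e p.1 * qf f e (p.1 - p.2) p.2 + e (- p.1) * qf f e (- (p.1 - p.2)) (- p.2)) / 2.

Lemma tsymC f e p : tsym f e (p.2, p.1) = tsym f e p.
Proof. by rewrite /tsym /qf /= !opprK !opprB; ring. Qed.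

Lemma normr_tsym_le f e p :
  `|tsym f e p| <= ab e p.1 * ab f (p.1 - p.2) * ab e p.2 / 4.
Proof.
have H1 := ler_wpM2l (normr_ge0 (e p.1)) (normr_qf_le f e (p.1 - p.2) p.2).
have H2 := ler_wpM2l (normr_ge0 (e (- p.1))) (normr_qf_le f e (- (p.1 - p.2)) (- p.2)).
rewrite !abN in H2.
rewrite /tsym normrM (ger0_norm (_ : 0 <= 2^-1)) ?invr_ge0//.
have H3 := ler_normD (e p.1 * qf f e (p.1 - p.2) p.2)
   (e (- p.1) * qf f e (- (p.1 - p.2)) (- p.2)).
rewrite (normrM (e p.1)) (normrM (e (- p.1))) in H3; rewrite {1}/ab; lra.
Qed.

(* The kernel is antisymmetric under the exchange of [xi] and [eta], while the
   trilinear density becomes symmetric once it is averaged over reflections. *)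
Lemma tform_sym a A f e : (forall p, A (- p.1, - p.2) = A p) ->
  itg (lb \x lb)%E (tform a A f e) ->
  itg (lb \x lb)%E (fun p => (A p - A (p.2, p.1)) * (kap a p.1 p.2 * tsym f e p)) /\
  2 * Int (lb \x lb)%E (tform a A f e) =
  Int (lb \x lb)%E (fun p => (A p - A (p.2, p.1)) * (kap a p.1 p.2 * tsym f e p)).
Proof.
move=> AN I.
have mo : mpres (lb \x lb)%E (fun p => (- p.1, - p.2)) := mpres_opp2.
have ms : mpres (lb \x lb)%E (fun p => (p.2, p.1)) := mpres_swap2.
have I2 := mpres_itg mo I.
have S1 : itg (lb \x lb)%E (fun p => A p * (kap a p.1 p.2 * tsym f e p)) /\
    Int (lb \x lb)%E (fun p => A p * (kap a p.1 p.2 * tsym f e p)) =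
    Int (lb \x lb)%E (tform a A f e).
  have E : (fun p : plane R * plane R => A p * (kap a p.1 p.2 * tsym f e p)) =
     (fun p => 2^-1 * (tform a A f e p + tform a A f e (- p.1, - p.2))).
    apply/funext => p; rewrite /tform /tsym /= AN kapNN.
    by rewrite (_ : - p.1 - - p.2 = - (p.1 - p.2)) ?opprD//; field.
  rewrite E; split; first by apply: itgZ; exact: itgD.
  rewrite IntZ; last exact: itgD.
  rewrite IntD//.
  have -> : Int (lb \x lb)%E (fun p => tform a A f e (- p.1, - p.2)) =
      Int (lb \x lb)%E (tform a A f e) by exact: (mpres_Int mo I).
  by field.
have [J1 E1] := S1; have J2 := mpres_itg ms J1; have E2 := mpres_Int ms J1.
have J3 : itg (lb \x lb)%E (fun p => A (p.2, p.1) * (kap a p.1 p.2 * tsym f e p)).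
  have := itgN J2; congr itg; apply/funext => p /=.
  by rewrite tsymC kapC; ring.
have E3 : Int (lb \x lb)%E (fun p => A (p.2, p.1) * (kap a p.1 p.2 * tsym f e p)) =
    - Int (lb \x lb)%E (tform a A f e).
  rewrite -E1 -E2 -IntN//; apply: eq_Int => p /=.
  by rewrite tsymC kapC; ring.
have E : (fun p : plane R * plane R => (A p - A (p.2, p.1)) * (kap a p.1 p.2 * tsym f e p)) =
  (fun p => A p * (kap a p.1 p.2 * tsym f e p) - A (p.2, p.1) * (kap a p.1 p.2 * tsym f e p)).
  by apply/funext => p; rewrite mulrBl.
by rewrite E; split; [exact: itgB|rewrite IntB// E1 E3; ring].
Qed.

(** Weight 1 gives conservation of the L^2 norm; weight xi . eta removes the term of highest order
    from the enstrophy balance. *)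
Lemma tform_sym0 a A f e : (forall p, A (- p.1, - p.2) = A p) ->
  (forall p, A (p.2, p.1) = A p) -> itg (lb \x lb)%E (tform a A f e) ->
  Int (lb \x lb)%E (tform a A f e) = 0.
Proof.
move=> AN AC I; have [_ H] := tform_sym AN I.
have : 2 * Int (lb \x lb)%E (tform a A f e) = 0.
  rewrite H -[RHS](Int0 (lb \x lb)%E); apply: eq_Int => p.
  by rewrite AC subrr mul0r.
by move/eqP; rewrite mulf_eq0 pnatr_eq0 => /eqP.
Qed.

End symmetrization.

(** * Commutator estimate for a radial weight *)

Section tame.
Context {R : realType}.
Let lb := @lb2 R.
Variables (a K : R) (W : R -> R).
Hypotheses (Ha : 0 < a < 1 / 2) (K1 : 1 <= K).
Hypotheses (W0 : forall x, 0 <= x -> 0 <= W x)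
  (Wnd : forall x y, 0 <= x -> x <= y -> W x <= W y)
  (Wdb : forall x, 0 <= x -> W (2 * x) <= K * W x)
  (Wd : forall x y, 0 <= y -> y <= x -> x * (W x - W y) <= K * (x - y) * W x).

Let w (z : R * R) := Num.sqrt (W (enorm z)).
Let s (z : R * R) := 1 + 2 * a * enorm z.

Let K0 : 0 <= K. Proof. exact: le_trans ler01 K1. Qed.

Let s0 z : 0 <= s z.
Proof.
by rewrite addr_ge0// mulr_ge0 ?enorm_ge0// mulr_ge0// ltW//; case/andP: Ha.
Qed.

Let sqr_w z : w z ^+ 2 = W (enorm z).
Proof. by rewrite sqr_sqrtr// W0// enorm_ge0. Qed.

Let w_le z1 z2 : W (enorm z1) <= K * W (enorm z2) -> w z1 <= K * w z2.
Proof.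
move=> H; rewrite -(ler_pXn2r (ltn0Sn 1)) ?nnegrE ?mulr_ge0 ?sqrtr_ge0//.
rewrite exprMn !sqr_w; apply: (le_trans H); rewrite ler_wpM2r ?W0 ?enorm_ge0//.
by rewrite expr2 ler_peMl.
Qed.

Let claim1 xi eta : enorm eta <= enorm xi ->
  `|W (enorm xi) - W (enorm eta)| * `|kap a xi eta| <=
  2 * c0 * K ^+ 2 * (w xi * w eta * s (xi - eta) + w xi * w (xi - eta) * s eta).
Proof.
move=> H; set z := xi - eta.
have a12 : a < 1 / 2 by case/andP: Ha.
have e0 := @enorm_ge0 R.
have dW0 : 0 <= W (enorm xi) - W (enorm eta) by rewrite subr_ge0 Wnd.
rewrite (ger0_norm dW0).
have [x0|x0] := eqVneq (enorm xi) 0.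
  have -> : enorm eta = enorm xi by apply/eqP; rewrite eq_le H x0 e0.
  rewrite subrr mul0r mulr_ge0// ?mulr_ge0 ?sqr_ge0 ?c0_ge0//.
  by rewrite addr_ge0// !mulr_ge0 ?sqrtr_ge0.
have xgt0 : 0 < enorm xi by rewrite lt_neqAle eq_sym x0 e0.
have tri : enorm xi - enorm eta <= enorm z.
  by have := ler_enormD z eta; rewrite subrK; lra.
have kle := normr_kap xi eta a12; rewrite -/z in kle.
have P1 : 0 <= w xi * w eta * s z by rewrite !mulr_ge0 ?sqrtr_ge0.
have P2 : 0 <= w xi * w z * s eta by rewrite !mulr_ge0 ?sqrtr_ge0.
have cK : 0 <= c0 * K ^+ 2 :> R by rewrite mulr_ge0 ?sqr_ge0 ?c0_ge0.
have [zx|xz] := leP (enorm z) (enorm xi / 2).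
  have h1 : enorm xi * (W (enorm xi) - W (enorm eta)) <= K * enorm z * W (enorm xi).
    apply: (le_trans (Wd (e0 eta) H)).
    by rewrite ler_wpM2r ?W0// ler_wpM2l.
  have h2 : w xi <= K * w eta.
    apply: w_le; apply: le_trans (Wdb (e0 eta)); apply: Wnd => //; lra.
  have h3 := enorm_ka_le z Ha.
  have h4 : enorm xi * ((W (enorm xi) - W (enorm eta)) * `|kap a xi eta|) <=
      enorm xi * (c0 * K ^+ 2 * (w xi * w eta * s z)).
    apply: (@le_trans _ _ ((K * enorm z * W (enorm xi)) * (c0 * (ka a z * enorm xi)))).
      rewrite mulrA; apply: ler_pM => //; first by rewrite mulr_ge0.
      by apply: (le_trans kle); rewrite ler_wpM2l ?c0_ge0// ler_wpM2l ?ka_ge0.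
    have -> : K * enorm z * W (enorm xi) * (c0 * (ka a z * enorm xi)) =
       enorm xi * (c0 * K * (w xi * w xi * (enorm z * ka a z))).
      by rewrite -sqr_w; ring.
    have -> : enorm xi * (c0 * K ^+ 2 * (w xi * w eta * s z)) =
       enorm xi * (c0 * K * (w xi * (K * w eta) * s z)) by ring.
    rewrite ler_wpM2l// ler_wpM2l ?mulr_ge0 ?c0_ge0//.
    apply: ler_pM => //; first by rewrite mulr_ge0 ?sqrtr_ge0.
      by rewrite mulr_ge0 ?ka_ge0.
    by rewrite ler_wpM2l ?sqrtr_ge0.
  rewrite ler_pM2l// in h4; apply: (le_trans h4).
  have -> : 2 * c0 * K ^+ 2 = c0 * K ^+ 2 + c0 * K ^+ 2 by ring.
  by have := mulr_ge0 cK P1; have := mulr_ge0 cK P2; rewrite mulrDl mulrDr; lra.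
have h2 : w xi <= K * w z.
  apply: w_le; apply: le_trans (Wdb (e0 z)); apply: Wnd => //; lra.
have h1 : W (enorm xi) - W (enorm eta) <= w xi * (K * w z).
  apply: (@le_trans _ _ (W (enorm xi))); first by rewrite gerBl W0.
  by rewrite -sqr_w expr2 ler_wpM2l ?sqrtr_ge0.
(* In this case |xi - eta| > |xi| / 2 >= |eta| / 2, and [ka] is decreasing in the modulus. *)
have h3 : ka a z * enorm eta <= 2 * s eta.
  have [y0|y0] := eqVneq (enorm eta) 0.
    by rewrite y0 mulr0 mulr_ge0.
  have ygt0 : 0 < enorm eta by rewrite lt_neqAle eq_sym y0 e0.
  apply: (@le_trans _ _ ((enorm eta / 2) `^ (-1 + 2 * a) * enorm eta)).
    rewrite ler_wpM2r// /ka (_ : -1 + 2 * a = - (1 - 2 * a)); last by ring.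
    rewrite !powRN lef_pV2 ?posrE ?powR_gt0 ?divr_gt0//; last by lra.
    by apply: ge0_ler_powR; rewrite ?nnegrE ?divr_ge0//; lra.
  have -> : (enorm eta / 2) `^ (-1 + 2 * a) * enorm eta =
     2 * ((enorm eta / 2) `^ (2 * a)).
    have h0 : 0 < enorm eta / 2 by rewrite divr_gt0.
    move: h0; set h := enorm eta / 2 => h0.
    have -> : enorm eta = 2 * h by rewrite /h; field.
    rewrite mulrCA -{2}(powRr1 (ltW h0)) -powRD; last by rewrite (gt_eqF h0) implybT.
    by congr (_ * _ `^ _); ring.
  rewrite ler_wpM2l//; apply: (le_trans (powR_bernoulli _ _)); first by rewrite divr_ge0.
    by case/andP: Ha => ? ?; apply/andP; split; lra.
  rewrite /s lerD2l ler_wpM2l//; last by lra.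
  by case/andP: Ha => ? _; lra.
apply: (@le_trans _ _ (w xi * (K * w z) * (c0 * (2 * s eta)))).
  apply: ler_pM => //; apply: (le_trans kle).
  by rewrite ler_wpM2l ?c0_ge0.
have -> : w xi * (K * w z) * (c0 * (2 * s eta)) = 2 * c0 * K * (w xi * w z * s eta) by ring.
apply: (@le_trans _ _ (2 * c0 * K ^+ 2 * (w xi * w z * s eta))).
  rewrite ler_wpM2r// ler_wpM2l ?mulr_ge0 ?c0_ge0//.
  by rewrite expr2 ler_peMl.
by rewrite ler_wpM2l ?lerDr// -mulrA mulr_ge0.
Qed.

(** Covers both orders of |xi| and |eta|: the third term is the second one after exchange of the two
    frequencies. *)
Let claim xi eta : `|W (enorm xi) - W (enorm eta)| * `|kap a xi eta| <=
  2 * c0 * K ^+ 2 * (w xi * w eta * s (xi - eta) + w xi * w (xi - eta) * s eta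
     + w eta * w (xi - eta) * s xi).
Proof.
have c : 0 <= 2 * c0 * K ^+ 2 by rewrite mulr_ge0 ?sqr_ge0// mulr_ge0 ?c0_ge0.
have [H|/ltW H] := leP (enorm eta) (enorm xi).
  apply: (le_trans (claim1 H)); rewrite ler_wpM2l// lerDl.
  by rewrite !mulr_ge0 ?sqrtr_ge0.
have := claim1 H; rewrite distrC kapC normrN => /le_trans; apply.
rewrite ler_wpM2l//.
have -> : w (eta - xi) = w (xi - eta) by rewrite /w enormB.
have -> : s (eta - xi) = s (xi - eta) by rewrite /s enormB.
rewrite (mulrC (w eta) (w xi)) -addrA lerD2l lerDr.
by rewrite !mulr_ge0 ?sqrtr_ge0.
Qed.

(** Each product of [claim] is a triangle integral whose factor with [s] is taken in L^1 and the two
    weighted ones in L^2. The growth rate of the weighted norm thus involves only the L^1 norm of (1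
    + 2 a |xi|) y. *)
Lemma tame_estimate (y : R * R -> R) :
  sq lb (fun xi => w xi * y xi) -> itg lb (fun xi => s xi * y xi) ->
  itg (lb \x lb)%E (tform a (fun p => W (enorm p.1)) y y) ->
  `|Int (lb \x lb)%E (tform a (fun p => W (enorm p.1)) y y)| <=
   6 * K ^+ 2 * Int lb (fun xi => s xi * `|y xi|) * nrm lb (fun xi => w xi * y xi) ^+ 2.
Proof.
move=> swy Isy I.
have AN (p : plane R * plane R) : W (enorm (- p.1)) = W (enorm p.1) by rewrite enormN.
have [I2 E2] := tform_sym (A := fun p => W (enorm p.1)) AN I.
have wN z : w (- z) = w z by rewrite /w enormN.
have w0 z : 0 <= w z by exact: sqrtr_ge0.
have sN z : s (- z) = s z by rewrite /s enormN.
have [sab nab] := sq_ab w0 wN swy; have [Iab Eab] := itg_ab s0 sN Isy.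
pose f1 z := w z * ab y z; pose g1 z := s z * ab y z.
have f10 z : 0 <= f1 z by rewrite mulr_ge0 ?ab_ge0.
have g10 z : 0 <= g1 z by rewrite mulr_ge0 ?ab_ge0.
have [T1 B1] := tri13 sab Iab sab; have [T2 B2] := tri12 sab sab Iab.
have [T3 B3] := tri23 Iab sab sab.
pose H p := 2 * c0 * K ^+ 2 / 4 * (f1 p.1 * g1 (p.1 - p.2) * f1 p.2 +
   f1 p.1 * f1 (p.1 - p.2) * g1 p.2 + g1 p.1 * f1 (p.1 - p.2) * f1 p.2) : R.
have IH : itg (lb \x lb)%E H by apply: itgZ; apply: itgD => //; exact: itgD.
have le (p : plane R * plane R) : `|(W (enorm p.1) - W (enorm p.2)) *
    (kap a p.1 p.2 * tsym y y p)| <= H p.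
  rewrite mulrA normrM normrM.
  apply: (le_trans (ler_pM (mulr_ge0 (normr_ge0 _) (normr_ge0 _)) (normr_ge0 _)
     (claim p.1 p.2) (normr_tsym_le y y p))).
  by rewrite le_eqVlt; apply/orP; left; apply/eqP; rewrite /H /f1 /g1; ring.
have B := normr_Int_le2 (itg_meas I2) IH le.
rewrite -E2 normrM (ger0_norm (_ : 0 <= 2)) in B; last by [].
set N := nrm lb (fun xi => w xi * y xi) in nab *; set L := Int lb _ in Eab *.
have N0 : 0 <= N by exact: nrm_ge0.
have L0 : 0 <= L by apply: Int_ge0 => z; rewrite mulr_ge0.
have nf : nrm lb f1 <= 2 * N by exact: nab.
have ng : Int lb (fun x => `|g1 x|) = 2 * L.
  by rewrite -Eab; apply: eq_Int => z; rewrite ger0_norm.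
have nf0 : 0 <= nrm lb f1 by exact: nrm_ge0.
have bnd : nrm lb f1 * nrm lb f1 <= 4 * N ^+ 2.
  have -> : 4 * N ^+ 2 = (2 * N) * (2 * N) by ring.
  exact: ler_pM.
have fin t : t = 2 * (nrm lb f1 * nrm lb f1 * L) -> t <= 8 * (N ^+ 2 * L).
  move=> ->; have -> : 8 * (N ^+ 2 * L) = 2 * (4 * N ^+ 2 * L) by ring.
  by rewrite ler_pM2l ?ltr0n// ler_wpM2r.
have IntH : Int (lb \x lb)%E H <= 2 * c0 * K ^+ 2 / 4 * (24 * (N ^+ 2 * L)).
  rewrite /H IntZ; last by apply: itgD => //; exact: itgD.
  apply: ler_wpM2l; first by rewrite !mulr_ge0 ?invr_ge0 ?sqr_ge0 ?c0_ge0.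
  rewrite IntD//; last exact: itgD.
  rewrite IntD//.
  have b1 : Int (lb \x lb)%E (fun p => f1 p.1 * g1 (p.1 - p.2) * f1 p.2) <= 8 * (N ^+ 2 * L).
    apply: (@le_trans _ _ (nrm lb f1 * (2 * L) * nrm lb f1)).
      rewrite -ng; apply: le_trans B1; apply: le_Int => //; first exact: itg_abs.
      by move=> p; exact: ler_norm.
    by apply: fin; ring.
  have b2 : Int (lb \x lb)%E (fun p => f1 p.1 * f1 (p.1 - p.2) * g1 p.2) <= 8 * (N ^+ 2 * L).
    apply: (@le_trans _ _ (nrm lb f1 * nrm lb f1 * (2 * L))).
      rewrite -ng; apply: le_trans B2; apply: le_Int => //; first exact: itg_abs.
      by move=> p; exact: ler_norm.
    by apply: fin; ring.
  have b3 : Int (lb \x lb)%E (fun p => g1 p.1 * f1 (p.1 - p.2) * f1 p.2) <= 8 * (N ^+ 2 * L).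
    apply: (@le_trans _ _ (2 * L * nrm lb f1 * nrm lb f1)).
      rewrite -ng; apply: le_trans B3; apply: le_Int => //; first exact: itg_abs.
      by move=> p; exact: ler_norm.
    by apply: fin; ring.
  by apply: (le_trans (lerD (lerD b1 b2) b3)); apply: eq_lexx; ring.
have X0 : 0 <= 24 * (K ^+ 2 * (N ^+ 2 * L)) by rewrite !mulr_ge0 ?sqr_ge0.
rewrite -(ler_pM2l (ltr0n R 2)); apply: (le_trans B); apply: (le_trans IntH).
have -> : 2 * c0 * K ^+ 2 / 4 * (24 * (N ^+ 2 * L)) = c0 * (24 * (K ^+ 2 * (N ^+ 2 * L))) / 2.
  by field.
rewrite ler_pdivrMr//; apply: le_trans (ler_piMl X0 (@c0_le1 R)) _.
by apply: eq_lexx; ring.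
Qed.

End tame.

(** * Products and the Hartley transform *)

Section convolution_theorem.
Context {R : realType}.
Let lb := @lb2 R.
Implicit Types (f g y phi : R * R -> R) (x xi z eta : R * R).

Lemma mpres_comp d (T : measurableType d) (mu : {measure set T -> \bar R}) (phi psi : T -> T) :
  mpres mu phi -> mpres mu psi -> mpres mu (phi \o psi).
Proof.
move=> [mp p] [mq q]; split; first exact: measurableT_comp.
move=> A mA; rewrite comp_preimage q ?p//.
by rewrite -[X in measurable X]setTI; exact: mp.
Qed.

Lemma mpres_id d (T : measurableType d) (mu : {measure set T -> \bar R}) : mpres mu (@id T).
Proof. by split=> [|A mA]; [exact: measurable_id|rewrite preimage_id]. Qed.

Lemma mpres_sub2 : mpres (lb \x lb)%E (fun p => (p.1 - p.2, p.2)).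
Proof.
have H1 : mpres (lb \x lb)%E (fun p : plane R * plane R => (- p.1, p.2)).
  by apply: (@mpres_prod _ _ _ _ _ lb lb (fun z => - z) id); [exact: mpres_opp|exact: mpres_id].
have H := mpres_comp H1 (mpres_comp mpres_swap2 (mpres_comp mpres_tau2 mpres_swap2)).
suff -> : (fun p : plane R * plane R => (p.1 - p.2, p.2)) =
  (fun p : plane R * plane R => (- p.1, p.2)) \o ((fun q : plane R * plane R => (q.2, q.1)) \o
     (@tau2 R \o (fun q : plane R * plane R => (q.2, q.1)))) by [].
by apply/funext => p /=; rewrite opprB.
Qed.

Lemma cas_mul (s t : R) : cas s * cas t =
  (cas (s + t) + cas (s - t) + cas (- s + t) - cas (- s - t)) / 2.
Proof.
by rewrite /cas !cosD !sinD !cosN !sinN; field.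
Qed.

Section product.
Variables (f g : R * R -> R) (x : R * R).
Hypotheses (If : itg lb f) (Ig : itg lb g).

Let H (s t : bool) (p : plane R * plane R) : R :=
  (if s then f (- p.1) else f p.1) * (if t then g (- p.2) else g p.2) *
    cas (dot (p.1 + p.2) x).

Let h (s t : bool) (p : plane R * plane R) : R :=
  f p.1 * g p.2 * cas ((-1) ^+ s * dot p.1 x + (-1) ^+ t * dot p.2 x).

Let mcas (s t : bool) : measurable_fun setT (fun p : plane R * plane R =>
  cas ((-1) ^+ s * dot p.1 x + (-1) ^+ t * dot p.2 x)).
Proof.
apply: (measurableT_comp measurable_cas).
apply: measurable_funD; apply: measurable_funM => //.
  apply: (measurable_comp1 (f := fun z => dot z x)).
  by under eq_fun do rewrite dotC; exact: measurable_dotl.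
apply: (measurable_comp2 (f := fun z => dot z x)).
by under eq_fun do rewrite dotC; exact: measurable_dotl.
Qed.

Let Ih s t : itg (lb \x lb)%E (h s t).
Proof.
have I := itg_tensor If Ig.
apply: (itg_le _ _ (itgZ 2 (itg_abs I))).
  by apply: measurable_funM => //; exact: itg_meas I.
by move=> p; rewrite normrM mulrC ler_wpM2r// normr_cas_le.
Qed.

Let HE s t : itg (lb \x lb)%E (H s t) /\
  Int (lb \x lb)%E (H s t) = Int (lb \x lb)%E (h s t).
Proof.
pose rf (b : bool) (z : plane R) : plane R := if b then - z else z.
have mr b : mpres lb (rf b) by case: b; [exact: mpres_opp|exact: mpres_id].
have mp := mpres_prod (mr s) (mr t).
have E : H s t = (fun p => h s t (rf s p.1, rf t p.2)).
  clear mp; apply/funext => p; rewrite /H /h /rf /dot /=.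
  by case: s; case: t; congr (_ * cas _) => /=; rewrite ?expr0 ?expr1; ring.
rewrite E; split; [exact: (mpres_itg mp (Ih s t))|exact: (mpres_Int mp (Ih s t))].
Qed.

(** After the shear to the variables xi - eta and eta, reflecting either variable gives the four
    terms of [qf] a common density; their cas factors then run through all signs, and [cas_mul]
    recombines them. *)
Lemma hart_qf : itg (lb \x lb)%E (fun p => cas (dot p.1 x) * qf f g (p.1 - p.2) p.2) /\
  Int (lb \x lb)%E (fun p => cas (dot p.1 x) * qf f g (p.1 - p.2) p.2) =
  hart f x * hart g x.
Proof.
pose G (p : plane R * plane R) : R :=
  2^-1 * (H false false p + H false true p + H true false p - H true true p).
have E : (fun p : plane R * plane R => cas (dot p.1 x) * qf f g (p.1 - p.2) p.2) =
    (fun p => G (p.1 - p.2, p.2)).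
  by apply/funext => p; rewrite /G /H /qf /= subrK; field.
have I1 := (HE false false).1; have I2 := (HE false true).1.
have I3 := (HE true false).1; have I4 := (HE true true).1.
have IG : itg (lb \x lb)%E G.
  by apply: itgZ; apply: itgB => //; apply: itgD => //; exact: itgD.
rewrite E; split; first exact: (mpres_itg mpres_sub2 IG).
rewrite (mpres_Int mpres_sub2 IG) /G IntZ; last first.
  by apply: itgB => //; apply: itgD => //; exact: itgD.
rewrite IntB//; last by apply: itgD => //; exact: itgD.
rewrite IntD//; last exact: itgD.
rewrite IntD// (HE _ _).2 (HE _ _).2 (HE _ _).2 (HE _ _).2.
rewrite -IntD// -IntD//; last exact: itgD.
rewrite -IntB//; last by apply: itgD => //; exact: itgD.
rewrite -IntZ; last by apply: itgB => //; apply: itgD => //; exact: itgD.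
rewrite -(Int_tensor (itg_cas x If) (itg_cas x Ig)); apply: eq_Int => p.
rewrite /h /= !expr0 !expr1 !mul1r !mulN1r.
have := cas_mul (dot p.1 x) (dot p.2 x) => C.
transitivity (f p.1 * g p.2 * (cas (dot p.1 x) * cas (dot p.2 x))); last by ring.
by rewrite C; field.
Qed.

End product.

(** Polarization of [plancherel]. *)
Lemma plancherel2 f g : itg lb f -> sq lb f -> itg lb g -> sq lb g ->
  Int lb (fun x => hart f x * hart g x) = (2 * pi) ^+ 2 * Int lb (fun x => f x * g x).
Proof.
move=> If sf Ig sg.
have [shf nf] := plancherel If sf; have [shg ng] := plancherel Ig sg.
have [_ nd] := plancherel (itgB If Ig) (sqB sf sg).
have E (u v : R * R -> R) : sq lb u -> sq lb v ->
   nrm lb (fun x => u x - v x) ^+ 2 = nrm lb u ^+ 2 + nrm lb v ^+ 2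
     - 2 * Int lb (fun x => u x * v x).
  move=> su sv; have [_ Iu] := su; have [_ Iv] := sv; have Iuv := sqM_itg su sv.
  rewrite !sqr_nrm -IntZ// -IntD// -IntB//; [|exact: itgD|exact: itgZ].
  by apply: eq_Int => x; ring.
have D : nrm lb (hart (fun x => f x - g x)) = nrm lb (fun x => hart f x - hart g x).
  by apply: eq_nrm => x; rewrite hartB.
have E1 := E _ _ shf shg; have E2 := E _ _ sf sg.
rewrite -D nd nf ng !exprMn E2 in E1.
have arith (P u v A B : R) : P * (u + v - 2 * A) = P * u + P * v - 2 * B -> B = P * A.
  move=> H; have : 2 * (B - P * A) = 0.
    transitivity (P * (u + v - 2 * A) - (P * u + P * v - 2 * B)); first by ring.
    by rewrite H subrr.
  by move/eqP; rewrite mulf_eq0 pnatr_eq0 /= subr_eq0 => /eqP.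
by rewrite exprMn; exact: arith E1.
Qed.

End convolution_theorem.

(** * Elementary calculus *)

Section calculus.
Context {R : realType}.
Implicit Types (f d : R -> R) (t s b h : R).

Lemma quad_derive f (t : R) (d C : R) : (forall h, `|f (t + h) - f t - h * d| <= C * h ^+ 2) ->
  is_derive t 1 f d.
Proof.
move=> H.
have D : h^-1 *: (f (h *: 1 + t) - f t) @[h --> 0^'] --> d.
  have C0 : 0 <= C.
    by have := H 1; rewrite expr1n mulr1; apply: le_trans; exact: normr_ge0.
  apply/cvgrPdist_le => e e0; near=> h.
  have h0 : h != 0 by near: h; exact: nbhs_dnbhs_neq.
  have hn : 0 < `|h| by rewrite normr_gt0.
  have hC : (C + 1) * `|h| <= e.
    rewrite mulrC -ler_pdivlMr ?ltr_wpDl//.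
    apply/ltW; near: h; apply: dnbhs0_lt.
    by rewrite divr_gt0// ltr_wpDl.
  have -> : d - h^-1 *: (f (h *: 1 + t) - f t) =
     - h^-1 * (f (t + h) - f t - h * d).
    by rewrite /GRing.scale /= mulr1 (addrC h); field.
  rewrite normrM normrN normfV ler_pdivrMl//.
  apply: (le_trans (H h)); rewrite -(real_normK (num_real h)) expr2 mulrA mulrC ler_wpM2l//.
  by apply: le_trans hC; rewrite ler_wpM2r// lerDl.
by apply: DeriveDef; [apply/cvg_ex; exists d|apply: cvg_lim].
Unshelve. all: by end_near. Qed.

Lemma mvt_le f d (G s t : R) : (forall x : R, is_derive x 1 f (d x)) ->
  (forall x, Num.min s t <= x <= Num.max s t -> `|d x| <= G) -> `|f t - f s| <= G * `|t - s|.
Proof.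
move=> df dG.
wlog st : s t dG / s <= t => [H|].
  have [|/ltW] := leP s t; first exact: H.
  by rewrite distrC (distrC t); apply: H => x; rewrite minC maxC; exact: dG.
move: st; rewrite le_eqVlt => /predU1P[->|st]; first by rewrite !subrr normr0 mulr0.
have cf : continuous f.
  by apply: continuous_derivable => x; have := df x; case.
have [|c cst ->] := @MVT R f d s t st (fun x _ => df x).
  by apply: continuous_subspaceT.
rewrite normrM ler_wpM2r// dG// min_l ?max_r; try exact: ltW.
by move: cst; rewrite in_itv /= => /andP[/ltW-> /ltW->].
Qed.

Lemma normr_sin_le t : `|sin t| <= `|t|.
Proof.
have := @mvt_le sin cos 1 0 t (fun x => is_derive_sin x).
by rewrite sin0 !subr0 mul1r; apply => x _; exact: normr_cos_le1.
Qed.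

Lemma normr_1Bcos_le t : `|cos t - 1| <= t ^+ 2 / 2.
Proof.
have -> : cos t - 1 = - (2 * sin (t / 2) ^+ 2).
  have {1}-> : t = t / 2 + t / 2 by field.
  by rewrite cosD; have := cos2Dsin2 (t / 2); lra.
rewrite normrN normrM ger0_norm// normrX.
have H := normr_sin_le (t / 2).
have : `|sin (t / 2)| ^+ 2 <= `|t / 2| ^+ 2 by rewrite ler_pXn2r ?nnegrE.
rewrite (real_normK (num_real (t / 2))) expr_div_n; lra.
Qed.

Lemma normr_sinB_le t : `|sin t - t| <= 2 * t ^+ 2.
Proof.
have [t1|t1] := leP `|t| 1; last first.
  have H := normr_sin_le t; have := ler_normB (sin t) t.
  have : `|t| * 1 <= `|t| * `|t| by rewrite ler_wpM2l// ltW.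
  by rewrite -expr2 (real_normK (num_real t)); lra.
have D (x : R) : is_derive x 1 (fun s => sin s - s) (cos x - 1).
  by apply: is_derive_eq.
have := @mvt_le _ _ (t ^+ 2 / 2) 0 t D.
rewrite sin0 !subr0 => H; have {}H : `|sin t - t| <= t ^+ 2 / 2 * `|t|.
  apply: H => x xt; apply: (le_trans (normr_1Bcos_le x)).
  rewrite ler_wpM2r// -(real_normK (num_real x)) -(real_normK (num_real t)).
  rewrite ler_pXn2r ?nnegrE//.
  by move: xt; case: (leP 0 t) => t0 /andP[h1 h2];
    [rewrite !ger0_norm|rewrite !ler0_norm ?lerN2//; apply: ltW].
apply: (le_trans H); have t2 := sqr_ge0 t.
by have := ler_wpM2l (_ : 0 <= t ^+ 2 / 2) t1; rewrite mulr1 divr_ge0// => /(_ isT); lra.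
Qed.

Lemma casB s b : cas (s - b) = cas s * cos b - cas (- s) * sin b.
Proof. by rewrite /cas cosB sinB cosN sinN; ring. Qed.

(** The derivative of cas at s is cas (- s). The formula [casB] isolates the increment and leaves
    expansions of cos and sin at 0. *)
Lemma cas_taylor s b : `|cas (s - b) - cas s + b * cas (- s)| <= 5 * b ^+ 2.
Proof.
have -> : cas (s - b) - cas s + b * cas (- s) =
  cas s * (cos b - 1) - cas (- s) * (sin b - b) by rewrite casB; ring.
apply: (le_trans (ler_normB _ _)); rewrite !normrM.
have h1 := ler_pM (normr_ge0 _) (normr_ge0 _) (normr_cas_le s) (normr_1Bcos_le b).
have h2 := ler_pM (normr_ge0 _) (normr_ge0 _) (normr_cas_le (- s)) (normr_sinB_le b).
lra.
Qed.

End calculus.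

(** * Derivatives, velocity and enstrophy in physical space *)

Section physical_space.
Context {R : realType}.
Let lb := @lb2 R.
Implicit Types (f g y : R * R -> R) (x xi z eta : R * R) (i j k : bool).

Definition co i x : R := if i then x.1 else x.2.
Definition inv g x : R := c0 * hart g x.
(* [dv] and [ug] are the Hartley transforms of the partial derivatives and of the
   components of the velocity; the symbols are odd and imaginary on the Fourier side,
   whence the reflection of the argument. *)
Definition dv i g xi : R := - co i xi * g (- xi).
Definition sg i xi : R := if i then xi.2 else - xi.1.
Definition ug (a : R) i g xi : R := sg i xi * enorm xi `^ (- 2 + 2 * a) * g (- xi).

Lemma normr_co i x : `|co i x| <= enorm x.
Proof. by case: i; have [] := enorm_ge_abs x. Qed.

Lemma normr_sg i x : `|sg i x| <= enorm x.
Proof. by case: i => /=; rewrite ?normrN; have [] := enorm_ge_abs x. Qed.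

Lemma coN i x : co i (- x) = - co i x. Proof. by case: i. Qed.
Lemma sgN i x : sg i (- x) = - sg i x. Proof. by case: i. Qed.

Lemma measurable_co i : measurable_fun setT (co i : plane R -> R).
Proof. by case: i; [exact: measurable_fst|exact: measurable_snd]. Qed.

Lemma measurable_sg i : measurable_fun setT (sg i : plane R -> R).
Proof.
case: i; first exact: measurable_snd.
exact: (measurableT_comp (@oppr_measurable R setT) measurable_fst).
Qed.

Lemma measurable_dv i g : measurable_fun setT (g : plane R -> R) ->
  measurable_fun setT (dv i g : plane R -> R).
Proof.
move=> mg; apply: measurable_funM; last exact: measurable_comp_opp.
exact: (measurableT_comp (@oppr_measurable R setT) (measurable_co i)).
Qed.

Lemma measurable_ug a i g : measurable_fun setT (g : plane R -> R) ->
  measurable_fun setT (ug a i g : plane R -> R).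
Proof.
move=> mg; apply: measurable_funM; last exact: measurable_comp_opp.
apply: measurable_funM; first exact: measurable_sg.
by apply: measurable_powRl; exact: measurable_enorm.
Qed.

Lemma normr_dv i g xi : `|dv i g xi| <= enorm (- xi) * `|g (- xi)|.
Proof. by rewrite normrM normrN ler_wpM2r// enormN normr_co. Qed.

Lemma normr_ug a i g xi : a < 1 / 2 -> `|ug a i g xi| <= ka a (- xi) * `|g (- xi)|.
Proof.
move=> a1; rewrite !normrM ler_wpM2r// (ger0_norm (powR_ge0 _ _)).
have -> : ka a (- xi) = ka a xi by rewrite /ka enormN.
by rewrite -(enormM_powR _ a1) ler_wpM2r ?powR_ge0// normr_sg.
Qed.

Lemma itg_opp_le f g : measurable_fun setT (f : plane R -> R) ->
  (forall z, `|f z| <= g (- z)) -> itg lb g ->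
  itg lb f /\ Int lb (fun z => `|f z|) <= Int lb g.
Proof.
move=> mf fg Ig; have Ig' := mpres_itg (@mpres_opp R) Ig.
have If : itg lb f by exact: (itg_le mf fg Ig').
split => //; rewrite -(mpres_Int (@mpres_opp R) Ig).
by apply: le_Int => //; exact: itg_abs.
Qed.

Lemma itg_wabs (w : plane R -> R) g : (forall z, 0 <= w z) ->
  itg lb (fun z => w z * g z) -> itg lb (fun z => w z * `|g z|).
Proof.
move=> w0 /itg_abs; congr itg; apply/funext => z.
by rewrite normrM (ger0_norm (w0 z)).
Qed.

Lemma itg_dv i g : measurable_fun setT (g : plane R -> R) ->
  itg lb (fun z => enorm z * g z) -> itg lb (dv i g) /\
  Int lb (fun z => `|dv i g z|) <= Int lb (fun z => enorm z * `|g z|).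
Proof.
move=> mg I; apply: (@itg_opp_le _ (fun z => enorm z * `|g z|)).
- exact: measurable_dv.
- by move=> z; exact: normr_dv.
- by apply: itg_wabs => // z; exact: enorm_ge0.
Qed.

Lemma sq_dv i g : measurable_fun setT (g : plane R -> R) ->
  sq lb (fun z => enorm z * g z) -> sq lb (dv i g) /\
  nrm lb (dv i g) <= nrm lb (fun z => enorm z * g z).
Proof.
move=> mg s; have s' := mpres_sq (@mpres_opp R) s.
have m : measurable_fun setT (dv i g : plane R -> R) by exact: measurable_dv.
have le z : `|dv i g z| <= `|enorm (- z) * g (- z)|.
  by rewrite (normrM (enorm _)) (ger0_norm (enorm_ge0 _)) normr_dv.
split; first by apply: (sq_le m le); exact: (sq_abs s').
by rewrite -(mpres_nrm (@mpres_opp R) s); exact: (le_nrm m le s').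
Qed.

Lemma itg_ug a i g : a < 1 / 2 -> measurable_fun setT (g : plane R -> R) ->
  itg lb (fun z => ka a z * g z) -> itg lb (ug a i g) /\
  Int lb (fun z => `|ug a i g z|) <= Int lb (fun z => ka a z * `|g z|).
Proof.
move=> a1 mg I; apply: (@itg_opp_le _ (fun z => ka a z * `|g z|)).
- exact: measurable_ug.
- by move=> z; exact: normr_ug.
- by apply: itg_wabs => // z; exact: ka_ge0.
Qed.

Lemma c0_le_half : 2 * c0 <= 1 :> R.
Proof.
rewrite /c0 ler_pdivrMr ?mul1r; last by rewrite exprn_gt0// mulr_gt0 ?pi_gt0.
by have := pi_ge2 R; move=> H; nra.
Qed.

Lemma normr_inv g x : itg lb g -> `|inv g x| <= Int lb (fun z => `|g z|).
Proof.
move=> I; rewrite normrM (ger0_norm (@c0_ge0 R)).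
apply: le_trans (ler_wpM2l (@c0_ge0 R) (normr_hart_le x I)) _.
have I0 : 0 <= Int lb (fun z => `|g z|) by exact: Int_ge0.
by have := ler_wpM2r I0 c0_le_half; rewrite mul1r; apply: le_trans; rewrite mulrCA mulrA.
Qed.

Lemma invB f g x : itg lb f -> itg lb g -> inv (fun z => f z - g z) x = inv f x - inv g x.
Proof. by move=> If Ig; rewrite /inv hartB// mulrBr. Qed.

Lemma invZ (c : R) g x : itg lb g -> inv (fun z => c * g z) x = c * inv g x.
Proof. by move=> Ig; rewrite /inv hartZ// mulrCA. Qed.

Lemma invD f g x : itg lb f -> itg lb g -> inv (fun z => f z + g z) x = inv f x + inv g x.
Proof.
move=> If Ig; have E : inv (fun z => - g z) x = - inv g x.
  have := invZ (-1) x Ig; rewrite mulN1r => <-.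
  by congr (c0 * hart _ x); apply/funext => z; rewrite mulN1r.
have := invB x If (itgN Ig); rewrite E opprK => <-.
by congr (c0 * hart _ x); apply/funext => z; rewrite opprK.
Qed.

Lemma inv_dv i g x : itg lb (fun z => enorm z * g z) ->
  measurable_fun setT (g : plane R -> R) ->
  itg lb (fun z => co i z * g z * cas (- dot z x)) /\
  inv (dv i g) x = c0 * Int lb (fun z => co i z * g z * cas (- dot z x)).
Proof.
move=> I mg; have [J _] := itg_dv i mg I; have J' := itg_cas x J.
have E : (fun z => co i z * g z * cas (- dot z x)) =
   (fun z => dv i g (- z) * cas (dot (- z) x)).
  apply/funext => z; rewrite /dv coN !opprK; congr (_ * cas _).
  by rewrite /dot /=; ring.
rewrite E; split; first exact: (mpres_itg (@mpres_opp R) J').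
by rewrite /inv /hart; congr (_ * _); apply/esym; exact: (mpres_Int (@mpres_opp R) J').
Qed.

Lemma inv_taylor g x (k : R * R) : itg lb g -> itg lb (fun z => enorm z * g z) ->
  itg lb (fun z => enorm z ^+ 2 * g z) ->
  `|inv g (x - k) - inv g x + (k.1 * inv (dv true g) x + k.2 * inv (dv false g) x)| <=
  5 * enorm k ^+ 2 * Int lb (fun z => enorm z ^+ 2 * `|g z|).
Proof.
move=> I0 I1 I2; have mg := itg_meas I0.
have [D1 ->] := inv_dv true x I1 mg; have [D2 ->] := inv_dv false x I1 mg.
have C1 := itg_cas (x - k) I0; have C2 := itg_cas x I0.
pose h z := g z * (cas (dot z x - dot z k) - cas (dot z x) + dot z k * cas (- dot z x)).
have E : (fun z => g z * cas (dot z (x - k)) - g z * cas (dot z x) +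
   (k.1 * (co true z * g z * cas (- dot z x)) +
    k.2 * (co false z * g z * cas (- dot z x)))) = h.
  apply/funext => z; rewrite /h /co.
  have -> : dot z (x - k) = dot z x - dot z k by rewrite /dot /=; ring.
  by rewrite /dot; ring.
have Ih : itg lb h.
  by rewrite -E; apply: itgD; [exact: itgB|apply: itgD; exact: itgZ].
have -> : inv g (x - k) - inv g x +
   (k.1 * (c0 * Int lb (fun z => co true z * g z * cas (- dot z x))) +
    k.2 * (c0 * Int lb (fun z => co false z * g z * cas (- dot z x)))) = c0 * Int lb h.
  rewrite -E IntD; [|exact: itgB|by apply: itgD; exact: itgZ].
  rewrite IntB// IntD; [|exact: itgZ|exact: itgZ].
  by rewrite IntZ// IntZ// /inv /hart; ring.
have e20 z : 0 <= enorm z ^+ 2 by exact: sqr_ge0.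
have J := itg_wabs e20 I2.
have B : `|Int lb h| <= Int lb (fun z => 5 * enorm k ^+ 2 * (enorm z ^+ 2 * `|g z|)).
  apply: normr_Int_le2; [exact: itg_meas Ih|exact: itgZ|move=> z].
  rewrite /h normrM.
  have := ler_wpM2l (normr_ge0 (g z)) (cas_taylor (dot z x) (dot z k)).
  move=> /le_trans; apply.
  have : dot z k ^+ 2 <= (enorm z * enorm k) ^+ 2.
    rewrite -(real_normK (num_real (dot z k))) ler_pXn2r ?nnegrE ?normr_dot//.
    by rewrite mulr_ge0 ?enorm_ge0.
  move=> /(ler_wpM2l (normr_ge0 (g z))); rewrite exprMn.
  have -> : `|g z| * (5 * dot z k ^+ 2) = 5 * (`|g z| * dot z k ^+ 2) by ring.
  move=> H; apply: le_trans (ler_wpM2l _ H) _ => //.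
  by rewrite le_eqVlt; apply/orP; left; apply/eqP; ring.
rewrite normrM (ger0_norm (@c0_ge0 R)) IntZ// in B *.
apply: le_trans (ler_wpM2l (@c0_ge0 R) B) _.
apply: ler_piMl; last exact: c0_le1.
apply: mulr_ge0; first by rewrite mulr_ge0 ?sqr_ge0.
by apply: Int_ge0 => z; rewrite mulr_ge0.
Qed.

(** Along the segment from x' to x, [inv_taylor] gives the derivative and the mean value theorem the
    bound; the factor 2 comes from adding the two components. *)
Lemma inv_lip_grad g (G : R) x x' : itg lb g -> itg lb (fun z => enorm z * g z) ->
  itg lb (fun z => enorm z ^+ 2 * g z) ->
  (forall i z, `|inv (dv i g) z| <= G) ->
  `|inv g x - inv g x'| <= 2 * G * enorm (x - x').
Proof.
move=> I0 I1 I2 HG; pose k := x - x'.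
pose p (t : R) : R * R := (x'.1 + t * k.1, x'.2 + t * k.2).
pose phi (t : R) := inv g (p t).
pose d (t : R) := k.1 * inv (dv true g) (p t) + k.2 * inv (dv false g) (p t).
pose C := 5 * enorm k ^+ 2 * Int lb (fun z => enorm z ^+ 2 * `|g z|).
have D (t : R) : is_derive t 1 phi (d t).
  apply: (@quad_derive _ _ _ _ C) => h.
  pose kh : R * R := (- h * k.1, - h * k.2).
  have := inv_taylor (p t) kh I0 I1 I2.
  have -> : p t - kh = p (t + h).
    by rewrite /p /kh; congr (_, _) => /=; ring.
  have -> : enorm kh ^+ 2 = h ^+ 2 * enorm k ^+ 2 by rewrite !sqr_enorm /kh /=; ring.
  have -> : 5 * (h ^+ 2 * enorm k ^+ 2) * Int lb (fun z => enorm z ^+ 2 * `|g z|) =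
     C * h ^+ 2 by rewrite /C; ring.
  congr (`|_| <= _); rewrite /phi /d /kh /=; ring.
have dG (t : R) : `|d t| <= 2 * G * enorm k.
  apply: (le_trans (ler_normD _ _)); rewrite (normrM k.1) (normrM k.2).
  have [k1 k2] := enorm_ge_abs k.
  have h1 := ler_pM (normr_ge0 _) (normr_ge0 _) k1 (HG true (p t)).
  have h2 := ler_pM (normr_ge0 _) (normr_ge0 _) k2 (HG false (p t)).
  by move: h1 h2; lra.
have := @mvt_le _ phi d (2 * G * enorm k) 0 1 D (fun t _ => dG t).
rewrite subr0 normr1 mulr1 /phi /p !mul0r !mul1r !addr0 /k /=.
by rewrite -[(x'.1, x'.2)]surjective_pairing !(addrC _ (_ - _)) !subrK -surjective_pairing.
Qed.

Lemma kap_qf a y xi eta : kap a xi eta * qf y y (xi - eta) eta =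
  - c0 * (qf (ug a true y) (dv true y) (xi - eta) eta +
          qf (ug a false y) (dv false y) (xi - eta) eta).
Proof.
rewrite /kap dot_perpB; set z := xi - eta.
rewrite /qf /ug /dv /= enormN !opprK /dot /perp /=.
by field.
Qed.

(** The factor [co i z] is a derivative: it falls on the velocity, at the price of reflecting both
    arguments. *)
Lemma co_qf_ug a i j y z eta : co i z * qf (ug a j y) (dv j y) z eta =
  qf (dv i (ug a j y)) (dv j y) (- z) (- eta).
Proof. by rewrite /qf /dv !coN !opprK; field. Qed.

Section euler.
Variables (a r : R) (y : R * R -> R).
Hypotheses (Ha : 0 < a < 1 / 2) (Hr : 3 < r) (wy : wr r y).

Let a12 : a < 1 / 2. Proof. by case/andP: Ha. Qed.
Let my := wr_meas wy.

Lemma wr_ug k : itg lb (ug a k y). Proof. by case: (itg_ug k a12 my (wr_ka Ha Hr wy).1). Qed.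
Lemma wr_dv k : itg lb (dv k y). Proof. by case: (itg_dv k my (wr_itg1 Hr wy).1). Qed.

(** [kap_qf] writes the kernel as two Hartley convolutions, of each velocity component with the
    matching derivative, and [hart_qf] turns these into products. *)
Lemma inv_bil x : inv (bil a y y) x =
  - (inv (ug a true y) x * inv (dv true y) x + inv (ug a false y) x * inv (dv false y) x).
Proof.
have [I1 E1] := hart_qf x (wr_ug true) (wr_dv true).
have [I2 E2] := hart_qf x (wr_ug false) (wr_dv false).
pose k (p : plane R * plane R) := kap a p.1 p.2 * qf y y (p.1 - p.2) p.2.
have E : (fun p : plane R * plane R => cas (dot p.1 x) * k p) =
   (fun p => - c0 * (cas (dot p.1 x) * qf (ug a true y) (dv true y) (p.1 - p.2) p.2 +
     cas (dot p.1 x) * qf (ug a false y) (dv false y) (p.1 - p.2) p.2)).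
  by apply/funext => p; rewrite /k kap_qf; ring.
have H : hart (bil a y y) x = Int (lb \x lb)%E (fun p => cas (dot p.1 x) * k p).
  have I : itg (lb \x lb)%E (fun p => cas (dot p.1 x) * k p).
    by rewrite E; apply: itgZ; exact: itgD.
  have mk : measurable_fun setT k by exact: measurable_bil_ker.
  rewrite -(Int_conv (phi := fun z => cas (dot z x)) mk I).
  by apply: eq_Int => z; rewrite mulrC.
rewrite /inv H E IntZ; last exact: itgD.
by rewrite IntD// E1 E2; ring.
Qed.

Section enstrophy.
Variable G : R.
Hypothesis HG : forall i k x, `|inv (dv i (ug a k y)) x| <= G.
Hypothesis Iu : forall i k, itg lb (dv i (ug a k y)).

Let sdv k : sq lb (dv k y).
Proof. by case: (sq_dv k my (wr_enorm_sq Hr wy).1). Qed.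

Let N := nrm lb (fun z => enorm z * y z).

(** Back to physical space by Plancherel: the integral of d_i w d_i u_k d_k w is at most the
    supremum of the velocity gradient times two L^2 norms. *)
Let term i k : itg (lb \x lb)%E (fun p => co i p.1 * y p.1 *
     (co i (p.1 - p.2) * qf (ug a k y) (dv k y) (p.1 - p.2) p.2)) /\
  c0 * `|Int (lb \x lb)%E (fun p => co i p.1 * y p.1 *
     (co i (p.1 - p.2) * qf (ug a k y) (dv k y) (p.1 - p.2) p.2))| <= G * N ^+ 2.
Proof.
pose K (p : plane R * plane R) := qf (dv i (ug a k y)) (dv k y) (p.1 - p.2) p.2.
pose Z := fun _ : plane R => 0 : R.
have one0 z : 0 <= (1 : R) by [].
have E1 (h : plane R -> R) : (fun z => 1 * h z) = h by apply/funext => z; rewrite mul1r.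
have h1 : itg lb (fun z => 1 * dv i (ug a k y) z) by rewrite E1.
have h2 : itg lb (fun z => 1 * dv k y z) by rewrite E1; exact: wr_dv.
have h3 : sq lb (fun z => 1 * dv k y z) by rewrite E1.
have [] := itg_ab one0 (fun=> erefl) h1; rewrite E1 => IF _.
have [] := itg_ab one0 (fun=> erefl) h2; rewrite E1 => IG _.
have [] := sq_ab one0 (fun=> erefl) h3; rewrite E1 => sG _.
have mK : measurable_fun setT K.
  by apply: measurable_qf; [exact: itg_meas (Iu i k)|exact: itg_meas (wr_dv k)].
have Kle p : `|K p| <= (fun z => 2^-1 * ab (dv i (ug a k y)) z) (p.1 - p.2) *
   ab (dv k y) p.2 + Z (p.1 - p.2) * Z p.2.
  rewrite /Z mulr0 addr0 (_ : _ * _ = ab (dv i (ug a k y)) (p.1 - p.2) * ab (dv k y) p.2 / 2).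
    exact: normr_qf_le.
  by ring.
have F0 z : 0 <= 2^-1 * ab (dv i (ug a k y)) z by rewrite mulr_ge0 ?invr_ge0 ?ab_ge0.
have [Ic _] := itg_conv mK Kle F0 (ab_ge0 _) (fun=> lexx 0) (fun=> lexx 0)
  (itgZ 2^-1 IF) IG (itg0 lb) (itg0 lb).
have [sc _] := sq_conv mK Kle F0 (ab_ge0 _) (fun=> lexx 0) (fun=> lexx 0)
  (itgZ 2^-1 IF) IG (itg0 lb) (itg0 lb) sG (sq0 lb).
have IK : itg (lb \x lb)%E (fun p => dv i y p.1 * K p).
  exact: (itg_form mK Kle F0 (ab_ge0 _) (fun=> lexx 0) (fun=> lexx 0)
    (itgZ 2^-1 IF) sG (sq0 lb) (itg0 lb) (sdv i)).
set c := fun xi => _ in Ic sc.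
have EI : Int lb (fun xi => dv i y xi * c xi) = Int (lb \x lb)%E (fun p => dv i y p.1 * K p).
  exact: (Int_conv (phi := dv i y) mK IK).
have mo : mpres (lb \x lb)%E (fun p => (- p.1, - p.2)) := mpres_opp2.
have E : (fun p : plane R * plane R => co i p.1 * y p.1 *
     (co i (p.1 - p.2) * qf (ug a k y) (dv k y) (p.1 - p.2) p.2)) =
   (fun p => (fun p => dv i y p.1 * K p) (- p.1, - p.2)).
  apply/funext => p /=; rewrite co_qf_ug /K /=.
  have -> : dv i y (- p.1) = co i p.1 * y p.1 by rewrite /dv coN !opprK.
  by rewrite opprD.
rewrite E; split; first exact: (mpres_itg mo IK).
rewrite (mpres_Int mo IK) -EI.
have hc x : hart c x = hart (dv i (ug a k y)) x * hart (dv k y) x.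
  have [I' <-] := hart_qf x (Iu i k) (wr_dv k).
  rewrite -(Int_conv (phi := fun z => cas (dot z x)) mK I').
  by apply: eq_Int => z; rewrite mulrC.
have P := plancherel2 (wr_dv i) (sdv i) Ic sc.
have [si ni] := plancherel (wr_dv i) (sdv i); have [sk nk] := plancherel (wr_dv k) (sdv k).
have [shc _] := plancherel Ic sc.
have pi2 : 0 < (2 * pi) ^+ 2 :> R by rewrite exprn_gt0// mulr_gt0 ?pi_gt0.
have nd l : nrm lb (dv l y) <= N by case: (sq_dv l my (wr_enorm_sq Hr wy).1).
have G0 : 0 <= G by apply: le_trans (HG true true 0).
have B : c0 * `|Int lb (fun x => hart (dv i y) x * hart c x)| <=
    G * (nrm lb (hart (dv i y)) * nrm lb (hart (dv k y))).
  have I3 := sqM_itg si shc.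
  have I4 := sqM_itg (sq_abs si) (sq_abs sk).
  rewrite -[X in X * _](ger0_norm (@c0_ge0 R)) -normrM -IntZ//.
  apply: (@le_trans _ _ (Int lb (fun x => G * (`|hart (dv i y) x| * `|hart (dv k y) x|)))).
    apply: normr_Int_le2; [exact: itg_meas (itgZ c0 I3)|exact: itgZ|move=> x].
    rewrite hc.
    have -> : c0 * (hart (dv i y) x * (hart (dv i (ug a k y)) x * hart (dv k y) x)) =
      inv (dv i (ug a k y)) x * (hart (dv i y) x * hart (dv k y) x) by rewrite /inv; ring.
    rewrite normrM (normrM (hart _ _)); exact: ler_wpM2r.
  rewrite IntZ// ler_wpM2l//; apply: le_trans (ler_norm _) _.
  by apply: le_trans (cauchy_schwarz (sq_abs si) (sq_abs sk)) _; rewrite !nrm_abs.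
rewrite P normrM (ger0_norm (ltW pi2)) ni nk in B.
rewrite -(ler_pM2l pi2).
have -> : (2 * pi) ^+ 2 * (c0 * `|Int lb (fun x => dv i y x * c x)|) =
   c0 * ((2 * pi) ^+ 2 * `|Int lb (fun x => dv i y x * c x)|) by ring.
apply: (le_trans B).
have -> : G * (2 * pi * nrm lb (dv i y) * (2 * pi * nrm lb (dv k y))) =
  (2 * pi) ^+ 2 * (G * (nrm lb (dv i y) * nrm lb (dv k y))) by ring.
by rewrite ler_pM2l// ler_wpM2l// expr2; apply: ler_pM; rewrite ?nrm_ge0.
Qed.

(** |xi|^2 = xi . (xi - eta) + xi . eta. The second weight is symmetric and contributes nothing; the
    first puts a derivative on the velocity and leaves the four products bounded by [term]. *)
Lemma enstrophy_estimate :
  itg (lb \x lb)%E (tform a (fun p => enorm p.1 ^+ 2) y y) /\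
  `|Int (lb \x lb)%E (tform a (fun p => enorm p.1 ^+ 2) y y)| <= 4 * G * N ^+ 2.
Proof.
have s2 := (wr_enorm2_sq Hr wy).1.
have I : itg (lb \x lb)%E (tform a (fun p => enorm p.1 ^+ 2) y y).
  have [J _] := bil_form Ha Hr wy wy s2; move: J; congr itg.
  by apply/funext => p; rewrite /tform; ring.
split => //.
pose X i k (p : plane R * plane R) := co i p.1 * y p.1 *
     (co i (p.1 - p.2) * qf (ug a k y) (dv k y) (p.1 - p.2) p.2).
have IX i k : itg (lb \x lb)%E (X i k) by case: (term i k).
pose S p := - c0 * (X true true p + X true false p + (X false true p + X false false p)).
have IS : itg (lb \x lb)%E S.
  by apply: itgZ; apply: itgD; apply: itgD.
have E1 : S = tform a (fun p => dot p.1 (p.1 - p.2)) y y.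
  apply/funext => p; rewrite /S /X /tform kap_qf /co /dot /=; ring.
have E2 : (fun p => tform a (fun p => enorm p.1 ^+ 2) y y p - S p) =
    tform a (fun p => dot p.1 p.2) y y.
  by apply/funext => p; rewrite E1 /tform sqr_enorm /dot /=; ring.
have I2 : itg (lb \x lb)%E (tform a (fun p => dot p.1 p.2) y y).
  by rewrite -E2; exact: itgB.
have Z : Int (lb \x lb)%E (tform a (fun p => dot p.1 p.2) y y) = 0.
  apply: tform_sym0 => // p /=; last exact: dotC.
  by rewrite /dot /=; ring.
have -> : Int (lb \x lb)%E (tform a (fun p => enorm p.1 ^+ 2) y y) = Int (lb \x lb)%E S.
  by apply/eqP; rewrite -subr_eq0 -IntB// E2 Z.
have b i k : c0 * `|Int (lb \x lb)%E (X i k)| <= G * N ^+ 2 by case: (term i k).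
rewrite /S IntZ; last by apply: itgD; apply: itgD.
rewrite IntD; [|exact: itgD|exact: itgD]; rewrite IntD// IntD//.
rewrite normrM normrN (ger0_norm (@c0_ge0 R)).
have := b true true; have := b true false; have := b false true; have := b false false.
set A := Int _ (X true true); set B := Int _ (X true false).
set C := Int _ (X false true); set D := Int _ (X false false) => h1 h2 h3 h4.
apply: (@le_trans _ _ (c0 * (`|A| + `|B| + (`|C| + `|D|)))).
  rewrite ler_wpM2l ?c0_ge0//; apply: (le_trans (ler_normD _ _)).
  by apply: lerD; exact: ler_normD.
rewrite !mulrDr; apply: (le_trans (lerD (lerD h4 h3) (lerD h2 h1))).
by apply: eq_lexx; ring.
Qed.

End enstrophy.
End euler.
End physical_space.

(** * Second derivatives of Gaussians as convolution kernels *)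

Section gaussian_kernels.
Context {R : realType}.
Let leb := @lebesgue_measure R.
Let lb := @lb2 R.
Implicit Types (x xi z : R * R) (i j : bool).

Lemma taylor2 (f f1 f2 : R -> R) (K x h : R) :
  (forall v : R, is_derive v 1 f (f1 v)) -> (forall v : R, is_derive v 1 f1 (f2 v)) ->
  (forall v : R, `|f2 v| <= K) -> `|f (x + h) - f x - h * f1 x| <= K * h ^+ 2.
Proof.
move=> d1 d2 HK.
have D (v : R) : is_derive v 1 (fun v => f v - v * f1 x) (f1 v - f1 x).
  have := d1 v => dv1; apply: is_derive_eq; rewrite /GRing.scale /=; ring.
have K0 : 0 <= K by apply: le_trans (HK 0).
have := @mvt_le _ _ _ (K * `|h|) x (x + h) D.
have -> : f (x + h) - (x + h) * f1 x - (f x - x * f1 x) = f (x + h) - f x - h * f1 x by ring.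
rewrite (addrC x h) addrK -mulrA -expr2 (real_normK (num_real h)); apply => v xv.
have H := @mvt_le _ f1 f2 K x v d2 (fun u _ => HK u).
apply: (le_trans H); rewrite ler_wpM2l//.
move: xv; have [h0|/ltW h0] := leP 0 h.
  by rewrite min_l ?max_r ?lerDr// => /andP[a b]; rewrite !ger0_norm ?subr_ge0//; lra.
by rewrite min_r ?max_l ?gerDr// => /andP[a b]; rewrite (ler0_norm h0) ler0_norm; lra.
Qed.

Lemma gau_taylor (s x h : R) : 0 <= s ->
  `|gau s (x + h) - gau s x - h * (- (2 * s * x) * gau s x)| <= 6 * s * h ^+ 2.
Proof.
move=> s0; pose f1 (x : R) := - (2 * s * x) * gau s x : R.
pose f2 (x : R) := - (2 * s) * gau s x + - (2 * s * x) * (- (2 * s * x) * gau s x) : R.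
apply: (@taylor2 (gau s) f1 f2) => v.
- exact: is_derive_gau.
- have := is_derive_gau s v => dg.
  have dl : is_derive v 1 (fun v : R => - (2 * s * v)) (- (2 * s)).
    by apply: is_derive_eq; rewrite /GRing.scale /=; ring.
  apply: is_derive_eq; rewrite /GRing.scale /= /f2; ring.
- have g0 := gau_ge0 s v; have g1 := gau_le1 v s0.
  have E : s * v ^+ 2 * gau s v <= 1.
    have := expR_ge1Dx (s * v ^+ 2); rewrite /gau expRN => H.
    rewrite ler_pdivrMr ?expR_gt0// mul1r; apply: le_trans H; by rewrite lerDr.
  have E0 : 0 <= s * v ^+ 2 * gau s v.
    by rewrite mulr_ge0 ?gau_ge0// mulr_ge0 ?sqr_ge0.
  have -> : f2 v = s * (4 * (s * v ^+ 2 * gau s v) - 2 * gau s v) by rewrite /f2; ring.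
  rewrite normrM (ger0_norm s0) mulrC ler_wpM2r// ler_norml; apply/andP; split; lra.
Qed.

Variable b : R.
Hypothesis b0 : 0 < b.

Let g := gau b.
Let A0 (t : R) := Int leb (fun s => g s * cos (s * t)).

Let itg_sc (h : R -> R) (t : R) : itg leb h -> itg leb (fun s => h s * sin (s * t)) /\
  itg leb (fun s => h s * cos (s * t)).
Proof.
move=> Ih; split; apply: (itg_le _ _ (itg_abs Ih)).
- by apply: measurable_funM; [exact: itg_meas Ih|exact: measurable_sinM].
- by move=> s; rewrite normrM ler_piMr// normr_sin_le1.
- by apply: measurable_funM; [exact: itg_meas Ih|exact: measurable_cosM].
- by move=> s; rewrite normrM ler_piMr// normr_cos_le1.
Qed.

Let odd0 (h : R -> R) : itg leb h -> (forall s, h (- s) = - h s) -> Int leb h = 0.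
Proof. by move=> Ih ho; exact: (odd_Int0 mpres_opp1 Ih ho). Qed.

Let gN s : g (- s) = g s. Proof. by rewrite /g /gau sqrrN. Qed.

Let I0 : itg leb g. Proof. exact: itg_gau. Qed.
Let I1 : itg leb (fun s => s * g s).
Proof.
apply: (itg_le _ _ (itg_abs_gau b0)).
  by apply: measurable_funM => //; exact: measurable_gau.
by move=> s; rewrite normrM (ger0_norm (gau_ge0 _ _)).
Qed.
Let I2 : itg leb (fun s => s ^+ 2 * g s). Proof. exact: itg_sqr_gau. Qed.
Let q s := (s ^+ 2 - (2 * b)^-1) * g s.
Let Iq : itg leb q.
Proof.
have -> : q = fun s => s ^+ 2 * g s - (2 * b)^-1 * g s.
  by apply/funext => s; rewrite /q mulrBl.
by apply: itgB => //; exact: itgZ.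
Qed.

Let q_cos t : Int leb (fun s => q s * cos (s * t)) = - (t ^+ 2 / (2 * b) ^+ 2) * A0 t.
Proof.
have -> : (fun s => q s * cos (s * t)) =
    (fun s => s ^+ 2 * g s * cos (s * t) - (2 * b)^-1 * (g s * cos (s * t))).
  by apply/funext => s; rewrite /q; ring.
have [_ J2] := itg_sc t I2; have [_ J0] := itg_sc t I0.
rewrite IntB//; last exact: itgZ.
rewrite IntZ// Int_sqr_gau_cos// -/(A0 t) /A0; field.
by rewrite gt_eqF.
Qed.

(** The second derivative of exp (- b |z|^2) in directions i and j, divided by 4 b^2. *)
Definition pk i j z : R := (co i z * co j z - (i == j)%:R / (2 * b)) * gau2 b z.

Let pk_cos i j xi : itg lb (fun z => pk i j z * cos (dot z xi)) /\
  Int lb (fun z => pk i j z * cos (dot z xi)) =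
    - (co i xi * co j xi / (2 * b) ^+ 2) * (A0 xi.1 * A0 xi.2).
Proof.
have T (u1 u2 v1 v2 : R -> R) (c : R) : itg leb u1 -> itg leb u2 -> itg leb v1 -> itg leb v2 ->
   (forall z, pk i j z * cos (dot z xi) = u1 z.1 * u2 z.2 - v1 z.1 * v2 z.2) ->
   Int leb u1 * Int leb u2 - Int leb v1 * Int leb v2 = c ->
   itg lb (fun z => pk i j z * cos (dot z xi)) /\
   Int lb (fun z => pk i j z * cos (dot z xi)) = c.
  move=> Iu1 Iu2 Iv1 Iv2 E <-.
  have J1 := itg_tensor Iu1 Iu2; have J2 := itg_tensor Iv1 Iv2.
  have -> : (fun z => pk i j z * cos (dot z xi)) =
     (fun z => u1 z.1 * u2 z.2 - v1 z.1 * v2 z.2) by apply/funext.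
  split; first exact: itgB.
  by rewrite IntB// (Int_tensor Iu1 Iu2) (Int_tensor Iv1 Iv2).
have cE z : cos (dot z xi) = cos (z.1 * xi.1) * cos (z.2 * xi.2) -
   sin (z.1 * xi.1) * sin (z.2 * xi.2) by rewrite /dot cosD.
have [s0 c0'] := itg_sc xi.1 I0; have [s0' c0''] := itg_sc xi.2 I0.
have [s1 c1] := itg_sc xi.1 I1; have [s1' c1'] := itg_sc xi.2 I1.
have [sq1 cq1] := itg_sc xi.1 Iq; have [sq2 cq2] := itg_sc xi.2 Iq.
have og t : itg leb (fun s => g s * sin (s * t)) -> Int leb (fun s => g s * sin (s * t)) = 0.
  by move=> I; apply: odd0 => // s; rewrite gN mulNr sinN mulrN.
have oc t : itg leb (fun s => s * g s * cos (s * t)) -> Int leb (fun s => s * g s * cos (s * t)) = 0.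
  by move=> I; apply: odd0 => // s; rewrite gN mulNr (mulNr s t) cosN mulNr.
have ms t : Int leb (fun s => s * g s * sin (s * t)) = t / (2 * b) * A0 t.
  exact: Int_mul_gau_sin.
case: i T => T; case: j T => T /=.
- apply: (T (fun s => q s * cos (s * xi.1)) (fun s => g s * cos (s * xi.2))
    (fun s => q s * sin (s * xi.1)) (fun s => g s * sin (s * xi.2))) => //.
    by move=> z; rewrite cE /pk /q /gau2 /g /=; ring.
  by rewrite q_cos (og _ s0') mulr0 subr0 /A0; ring.
- apply: (T (fun s => s * g s * cos (s * xi.1)) (fun s => s * g s * cos (s * xi.2))
    (fun s => s * g s * sin (s * xi.1)) (fun s => s * g s * sin (s * xi.2))) => //.
    by move=> z; rewrite cE /pk /gau2 /g /=; ring.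
  by rewrite (oc _ c1) !ms; field; rewrite gt_eqF.
- apply: (T (fun s => s * g s * cos (s * xi.1)) (fun s => s * g s * cos (s * xi.2))
    (fun s => s * g s * sin (s * xi.1)) (fun s => s * g s * sin (s * xi.2))) => //.
    by move=> z; rewrite cE /pk /gau2 /g /=; ring.
  by rewrite (oc _ c1) !ms; field; rewrite gt_eqF.
- apply: (T (fun s => g s * cos (s * xi.1)) (fun s => q s * cos (s * xi.2))
    (fun s => g s * sin (s * xi.1)) (fun s => q s * sin (s * xi.2))) => //.
    by move=> z; rewrite cE /pk /q /gau2 /g /=; ring.
  by rewrite q_cos (og _ s0) mul0r subr0 /A0; ring.
Qed.

Let pkN i j z : pk i j (- z) = pk i j z.
Proof. by rewrite /pk !coN mulrNN /gau2 /gau /= !sqrrN. Qed.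

Lemma measurable_pk i j : measurable_fun setT (pk i j : plane R -> R).
Proof.
apply: measurable_funM; last exact: measurable_gau2.
by apply: measurable_funB => //; apply: measurable_funM; exact: measurable_co.
Qed.

Let bz z : 0 <= b * enorm z ^+ 2. Proof. by rewrite mulr_ge0 ?sqr_ge0// ltW. Qed.

Let gau2E z : gau2 b z = expR (- (b * enorm z ^+ 2)).
Proof. by rewrite /gau2 /gau -expRD sqr_enorm; congr expR; ring. Qed.

Let gau2hE z : gau2 (b / 2) z = expR (- (b * enorm z ^+ 2) / 2).
Proof. by rewrite /gau2 /gau -expRD sqr_enorm; congr expR; field. Qed.

(** Half of the exponent pays for the polynomial factor. *)
Let poly_gau z : (1 + b * enorm z ^+ 2) ^+ 2 * gau2 b z <= 16 * gau2 (b / 2) z.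
Proof.
rewrite gau2E gau2hE; have u0 := bz z; move: u0; set u := b * _ => u0.
have h : 1 + u <= 4 * expR (u / 4) by have := expR_ge1Dx (u / 4); lra.
have h2 : (1 + u) ^+ 2 <= 16 * expR (u / 2).
  have -> : 16 * expR (u / 2) = (4 * expR (u / 4)) ^+ 2.
    by rewrite exprMn (_ : u / 2 = u / 4 + u / 4) ?expRD; [ring|field].
  by rewrite ler_pXn2r ?nnegrE ?mulr_ge0 ?expR_ge0// addr_ge0.
have -> : expR (- u / 2) = expR (u / 2) * expR (- u) by rewrite -expRD; congr expR; field.
by rewrite mulrA ler_wpM2r ?expR_ge0.
Qed.

Let pk_le0 i j z : `|pk i j z| <= b^-1 * ((1 + b * enorm z ^+ 2) * gau2 b z).
Proof.
rewrite /pk normrM (ger0_norm (gau2_ge0 _ _)) [leRHS]mulrA ler_wpM2r ?gau2_ge0//.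
have h : `|co i z * co j z| <= enorm z ^+ 2.
  by rewrite normrM expr2; apply: ler_pM => //; exact: normr_co.
have bi : 0 < b^-1 by rewrite invr_gt0.
have h3 : `|(i == j)%:R / (2 * b)| <= b^-1.
  rewrite ger0_norm; last by rewrite divr_ge0// mulr_ge0// ltW.
  by rewrite invfM; case: (i == j) => /=; lra.
apply: (le_trans (ler_normB _ _)).
have -> : b^-1 * (1 + b * enorm z ^+ 2) = b^-1 + enorm z ^+ 2 by field; rewrite gt_eqF.
by lra.
Qed.

Lemma pk_le i j z : `|pk i j z| <= 16 / b * gau2 (b / 2) z.
Proof.
have bi : 0 < b^-1 by rewrite invr_gt0.
apply: (le_trans (pk_le0 i j z)).
have -> : 16 / b * gau2 (b / 2) z = b^-1 * (16 * gau2 (b / 2) z) by ring.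
rewrite ler_pM2l//; apply: le_trans (poly_gau z).
have u1 : 1 <= 1 + b * enorm z ^+ 2 by rewrite lerDl.
apply: ler_wpM2r; first exact: gau2_ge0.
by rewrite expr2 ler_peMl// (le_trans ler01).
Qed.

(** The relation b (2 th)^2 = 1 means that the Gaussian lives at scale 2 th, so a factor |z| costs 2
    th. *)
Lemma enorm_pk_le i j z (th : R) : 0 <= th -> b * (2 * th) ^+ 2 = 1 ->
  enorm z * `|pk i j z| <= 2 * th * (16 / b * gau2 (b / 2) z).
Proof.
move=> th0 bth.
have bi : 0 < b^-1 by rewrite invr_gt0.
have h : enorm z <= 2 * th * (1 + b * enorm z ^+ 2).
  have p : 0 <= 2 * th by rewrite mulr_ge0.
  have -> : 2 * th * (1 + b * enorm z ^+ 2) = 2 * th + b * (2 * th) * enorm z ^+ 2 by ring.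
  have e0 := enorm_ge0 z.
  have [H|H] := leP (enorm z) (2 * th).
    by apply: (le_trans H); rewrite lerDl !mulr_ge0 ?sqr_ge0// ltW.
  have : enorm z * 1 <= enorm z * (b * (2 * th) * enorm z).
    rewrite ler_wpM2l// -[leLHS]bth expr2 mulrA; apply: ler_wpM2l; last exact: ltW.
    by rewrite mulr_ge0// ltW.
  by rewrite mulr1 => H2; apply: (le_trans H2); rewrite expr2 mulrCA mulrA mulrA -mulrA lerDr.
apply: (le_trans (ler_pM (enorm_ge0 z) (normr_ge0 _) h (pk_le0 i j z))).
have -> : 2 * th * (1 + b * enorm z ^+ 2) * (b^-1 * ((1 + b * enorm z ^+ 2) * gau2 b z)) =
   2 * th * b^-1 * ((1 + b * enorm z ^+ 2) ^+ 2 * gau2 b z) by ring.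
have -> : 2 * th * (16 / b * gau2 (b / 2) z) = 2 * th * b^-1 * (16 * gau2 (b / 2) z) by ring.
by rewrite ler_wpM2l ?poly_gau// !mulr_ge0// ltW.
Qed.

Lemma itg_pk i j : itg lb (pk i j).
Proof.
have b2 : 0 < b / 2 by rewrite divr_gt0.
apply: (itg_le _ _ (itgZ (16 / b) (itg_gau2 b2))); first exact: measurable_pk.
exact: pk_le.
Qed.

(** Read off the transform at frequency 0. The vanishing mean allows increments of the vorticity to
    replace its values. *)
Lemma Int_pk i j : Int lb (pk i j) = 0.
Proof.
have [_ H] := pk_cos i j 0; have -> : 0 = - (co i 0 * co j 0 / (2 * b) ^+ 2) * (A0 0 * A0 0) :> R.
  by case: i {H} => /=; rewrite !mul0r oppr0 mul0r.
rewrite -[RHS]H; apply: eq_Int => z.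
by rewrite (_ : dot z 0 = 0) ?cos0 ?mulr1// /dot /= !mulr0 addr0.
Qed.

Lemma Int_pk_cas i j x xi : itg lb (fun z => pk i j z * cas (dot (x - z) xi)) /\
  Int lb (fun z => pk i j z * cas (dot (x - z) xi)) =
  - (pi / (4 * b ^+ 3)) * (co i xi * co j xi * gau2 (4 * b)^-1 xi * cas (dot x xi)).
Proof.
have [Ic Ec] := pk_cos i j xi.
have Is : itg lb (fun z => pk i j z * sin (dot z xi)).
  apply: (itg_le _ _ (itg_abs (itg_pk i j))).
    apply: measurable_funM; first exact: measurable_pk.
    apply: (measurableT_comp measurable_sin).
    by under eq_fun do rewrite dotC; exact: measurable_dotl.
  by move=> z; rewrite normrM ler_piMr// normr_sin_le1.
have Es : Int lb (fun z => pk i j z * sin (dot z xi)) = 0.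
  apply: (odd_Int0 (@mpres_opp R) Is) => z.
  by rewrite pkN -mulrN -sinN; congr (_ * sin _); rewrite /dot /=; ring.
have E : (fun z => pk i j z * cas (dot (x - z) xi)) =
   (fun z => cas (dot x xi) * (pk i j z * cos (dot z xi)) -
             cas (- dot x xi) * (pk i j z * sin (dot z xi))).
  apply/funext => z; have -> : dot (x - z) xi = dot x xi - dot z xi.
    by rewrite /dot /=; ring.
  by rewrite casB; ring.
rewrite E; split; first by apply: itgB; exact: itgZ.
rewrite IntB; [|exact: itgZ|exact: itgZ]; rewrite !IntZ// Ec Es mulr0 subr0.
have -> : A0 xi.1 * A0 xi.2 = pi / b * gau2 (4 * b)^-1 xi.
  rewrite /A0 !Int_gau_cos// /gau2.
  have := sqr_sqrtr (divr_ge0 (pi_ge0 R) (ltW b0)).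
  by set t := Num.sqrt _ => <-; ring.
by field; rewrite gt_eqF.
Qed.

Lemma Int_pk_le i j : Int lb (fun z => `|pk i j z|) <= 32 * pi / b ^+ 2.
Proof.
have b2 : 0 < b / 2 by rewrite divr_gt0.
apply: (@le_trans _ _ (Int lb (fun z => 16 / b * gau2 (b / 2) z))).
  apply: le_Int; [exact: itg_abs (itg_pk i j)|by apply: itgZ; exact: itg_gau2|exact: pk_le].
rewrite IntZ; last exact: itg_gau2.
rewrite Int_gau2// le_eqVlt; apply/orP; left; apply/eqP; field.
by rewrite gt_eqF.
Qed.

Lemma Int_enorm_pk_le i j (th : R) : 0 <= th -> b * (2 * th) ^+ 2 = 1 ->
  itg lb (fun z => enorm z * `|pk i j z|) /\
  Int lb (fun z => enorm z * `|pk i j z|) <= 2 * th * (32 * pi / b ^+ 2).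
Proof.
move=> th0 bth; have b2 : 0 < b / 2 by rewrite divr_gt0.
have IB : itg lb (fun z => 2 * th * (16 / b * gau2 (b / 2) z)).
  by apply: itgZ; apply: itgZ; exact: itg_gau2.
have I : itg lb (fun z => enorm z * `|pk i j z|).
  apply: (itg_le _ _ IB).
    apply: measurable_funM; first exact: measurable_enorm.
    by apply: measurableT_comp => //; exact: measurable_pk.
  move=> z; rewrite ger0_norm; last by rewrite mulr_ge0 ?enorm_ge0.
  exact: enorm_pk_le.
split => //.
apply: (@le_trans _ _ (Int lb (fun z => 2 * th * (16 / b * gau2 (b / 2) z)))).
  by apply: le_Int => // z; exact: enorm_pk_le.
rewrite IntZ; last by apply: itgZ; exact: itg_gau2.
rewrite IntZ; last exact: itg_gau2.
rewrite Int_gau2// le_eqVlt; apply/orP; left; apply/eqP; field.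
by rewrite gt_eqF.
Qed.

End gaussian_kernels.

Lemma normr_chain (R : realDomainType) (p q u v A B C D : R) :
  `|v| <= A -> `|v - u| <= B -> `|u - q| <= C -> `|p - q| <= D -> `|p| <= A + B + C + D.
Proof.
move=> hA hB hC hD; have -> : p = v - (v - u) - (u - q) + (p - q) by ring.
apply: (le_trans (ler_normD _ _)); apply: lerD => //.
apply: (le_trans (ler_normB _ _)); apply: lerD => //.
by apply: (le_trans (ler_normB _ _)); apply: lerD.
Qed.

(** * Logarithmic sup bound for Riesz transforms *)

Section velocity_gradient.
Context {R : realType}.
Let lb := @lb2 R.
Implicit Types (x xi z : R * R) (i j k : bool).
Variables (r : R) (y : R * R -> R) (M G e : R).
Hypotheses (Hr : 3 < r) (wy : wr r y).
(** The additive [e] is forced by the scheme: a step transports the vorticity only up to an error,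
    so an iterate is Lipschitz only up to a constant. *)
Hypotheses (HM : forall x, `|inv y x| <= M)
  (HG : forall x x', `|inv y x - inv y x'| <= G * enorm (x - x') + e).
Hypotheses (G0 : 0 <= G) (e0 : 0 <= e).

Let r0 : 0 <= r. Proof. by apply/ltW/(lt_trans _ Hr). Qed.
Let my := wr_meas wy.
Let sy := (wr_sq0 r0 wy).1.
Let I0 := (wr_itg0 Hr wy).1.
Let I1 := (wr_itg1 Hr wy).1.
Let I2 := (@wr_enorm_itg _ _ Hr 2 y erefl wy).1.

(* The Riesz transforms; 0 at the origin. *)
Definition rz i j (f : R * R -> R) xi : R := co i xi * co j xi * (enorm xi ^+ 2)^-1 * f xi.

Let cc_le i j xi : `|co i xi * co j xi| <= enorm xi ^+ 2.
Proof. by rewrite normrM expr2; apply: ler_pM => //; exact: normr_co. Qed.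

Lemma rz_le i j f xi : `|rz i j f xi| <= `|f xi|.
Proof.
rewrite /rz !(normrM _ (f xi)) ler_piMl// normrM.
have [z0|z0] := eqVneq (enorm xi) 0.
  by rewrite z0 expr0n /= invr0 normr0 mulr0.
have p : 0 < enorm xi ^+ 2 by rewrite exprn_gt0// lt_neqAle eq_sym z0 enorm_ge0.
by rewrite normfV (ger0_norm (ltW p)) ler_pdivrMr// mul1r.
Qed.

Lemma measurable_rz i j f : measurable_fun setT (f : plane R -> R) ->
  measurable_fun setT (rz i j f : plane R -> R).
Proof.
move=> mf; apply: measurable_funM => //; apply: measurable_funM.
  by apply: measurable_funM; exact: measurable_co.
have -> : (fun z : plane R => (enorm z ^+ 2)^-1) = (fun z => enorm z `^ (- 2)).
  by apply/funext => z; rewrite powRN -powR_mulrn ?enorm_ge0.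
by apply: measurable_powRl; exact: measurable_enorm.
Qed.

Variables (i j : bool) (x : R * R).

(** The Riesz transform smoothed at scale th. The value [psi] is followed from th = 1 down to th =
    0; its derivative is - 2 th times the smoothed second derivative [jm], up to sign. *)
Let q th xi := rz i j y xi * gau (enorm xi ^+ 2) th.
Let jm th xi := co i xi * co j xi * gau (enorm xi ^+ 2) th * y xi.
Let psi th := inv (q th) x.

Let e20 xi : 0 <= enorm xi ^+ 2. Proof. exact: sqr_ge0. Qed.

Let mgau th : measurable_fun setT (fun xi : plane R => gau (enorm xi ^+ 2) th).
Proof.
apply: (measurableT_comp (continuous_measurable_fun (@continuous_expR R))).
apply: (measurableT_comp (@oppr_measurable R setT)).
by apply: measurable_funM => //; apply: (measurable_funX 2); exact: measurable_enorm.
Qed.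

Let mq th : measurable_fun setT (q th : plane R -> R).
Proof. by apply: measurable_funM => //; exact: measurable_rz. Qed.

Let mjm th : measurable_fun setT (jm th : plane R -> R).
Proof.
apply: measurable_funM => //; apply: measurable_funM => //.
by apply: measurable_funM; exact: measurable_co.
Qed.

Let gau01 th xi : 0 <= gau (enorm xi ^+ 2) th <= 1.
Proof. by rewrite gau_ge0 gau_le1. Qed.

Let Iq th : itg lb (q th).
Proof.
apply: (itg_le (mq th) _ (itg_abs I0)) => xi.
rewrite normrM; have /andP[g0 g1] := gau01 th xi.
rewrite (ger0_norm g0); apply: le_trans (rz_le i j y xi).
by rewrite ler_piMr.
Qed.

Let J2 : itg lb (fun xi => enorm xi ^+ 2 * `|y xi|).
Proof. exact: (itg_wabs e20 I2). Qed.

Let Ijm th : itg lb (jm th).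
Proof.
apply: (itg_le (mjm th) _ J2) => xi.
rewrite normrM ler_wpM2r// normrM; have /andP[g0 g1] := gau01 th xi.
by rewrite (ger0_norm g0); apply: le_trans (cc_le i j xi); rewrite ler_piMr.
Qed.

Let rz_e2 xi : rz i j y xi * enorm xi ^+ 2 = co i xi * co j xi * y xi.
Proof.
rewrite /rz; have [z0|z0] := eqVneq (enorm xi) 0.
  have : co i xi * co j xi = 0.
    by apply/eqP; rewrite -normr_le0; apply: le_trans (cc_le i j xi) _; rewrite z0 expr0n.
  by move=> ->; rewrite !mul0r.
by rewrite mulrAC mulfVK// expf_neq0.
Qed.

(** The remainder in [gau_taylor] integrates against |xi|^2 |y|, which is finite since r > 3. *)
Let psi_derive (th : R) : is_derive th 1 psi (- (2 * th) * inv (jm th) x).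
Proof.
pose C := 6 * Int lb (fun xi => enorm xi ^+ 2 * `|y xi|).
apply: (@quad_derive _ _ _ _ C) => h.
have -> : psi (th + h) - psi th - h * (- (2 * th) * inv (jm th) x) =
   inv (fun xi => q (th + h) xi - q th xi - (- (2 * th * h)) * jm th xi) x.
  rewrite invB; [|exact: itgB|exact: itgZ].
  rewrite invB// invZ// /psi; move: (inv _ _) (inv (q th) x) (inv (jm th) x) => u v w.
  by ring.
have I : itg lb (fun xi => q (th + h) xi - q th xi - (- (2 * th * h)) * jm th xi).
  by apply: itgB; [exact: itgB|exact: itgZ].
apply: (le_trans (normr_inv x I)).
have -> : C * h ^+ 2 = Int lb (fun xi => 6 * h ^+ 2 * (enorm xi ^+ 2 * `|y xi|)).
  by rewrite IntZ// /C; ring.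
apply: le_Int; [exact: itg_abs|exact: itgZ|move=> xi].
have -> : q (th + h) xi - q th xi - - (2 * th * h) * jm th xi =
   rz i j y xi * (gau (enorm xi ^+ 2) (th + h) - gau (enorm xi ^+ 2) th -
     h * (- (2 * enorm xi ^+ 2 * th) * gau (enorm xi ^+ 2) th)).
  rewrite /q /jm.
  have -> : co i xi * co j xi * gau (enorm xi ^+ 2) th * y xi =
     rz i j y xi * enorm xi ^+ 2 * gau (enorm xi ^+ 2) th by rewrite rz_e2; ring.
  ring.
rewrite normrM.
apply: (le_trans (ler_pM (normr_ge0 _) (normr_ge0 _) (rz_le i j y xi)
   (gau_taylor th h (e20 xi)))).
by rewrite le_eqVlt; apply/orP; left; apply/eqP; ring.
Qed.

(** Rewriting [jm] as a convolution of the vorticity with [pk] lets the physical-space hypotheses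
    [HM] and [HG] act on it. *)
Let jm_conv (th : R) : 0 < th -> let b := (2 * th) ^- 2 in
  itg lb (fun z => pk b i j z * inv y (x - z)) /\
  inv (jm th) x = - (16 * pi * th ^+ 6)^-1 * Int lb (fun z => pk b i j z * inv y (x - z)).
Proof.
move=> th0 b; have b0 : 0 < b by rewrite invr_gt0 exprn_gt0// mulr_gt0.
have Ip := itg_pk b0 i j.
have I := itg_tensor I0 Ip.
pose F (p : plane R * plane R) := y p.1 * pk b i j p.2 * cas (dot (x - p.2) p.1).
have IF : itg (lb \x lb)%E F.
  apply: (itg_le _ _ (itgZ 2 (itg_abs I))).
    apply: measurable_funM; first exact: itg_meas I.
    apply: (measurableT_comp measurable_cas).
    have -> : (fun p : plane R * plane R => dot (x - p.2) p.1) =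
       (fun p => dot x p.1 - dot p.1 p.2).
      by apply/funext => p; rewrite /dot /=; ring.
    apply: measurable_funB; last exact: measurable_dot2.
    exact: (measurable_comp1 (measurable_dotl x)).
  by move=> p; rewrite normrM mulrC ler_wpM2r// normr_cas_le.
have S := Int_swap IF.
have E1 : (fun xi => Int lb (fun z => F (xi, z))) =
   (fun xi => - (16 * pi * th ^+ 6) * (jm th xi * cas (dot xi x))).
  apply/funext => xi; rewrite /F /=.
  have [Ic Ec] := Int_pk_cas b0 i j x xi.
  transitivity (y xi * Int lb (fun z => pk b i j z * cas (dot (x - z) xi))).
    by rewrite -IntZ//; apply: eq_Int => z; ring.
  rewrite Ec.
  have -> : (4 * b)^-1 = th ^+ 2 by rewrite /b; field; rewrite gt_eqF.
  have -> : gau2 (th ^+ 2) xi = gau (enorm xi ^+ 2) th.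
    by rewrite /gau2 /gau -expRD sqr_enorm; congr expR; ring.
  rewrite /jm /b (dotC xi x); field.
  by rewrite gt_eqF.
have E2 z : Int lb (fun xi => F (xi, z)) = pk b i j z * hart y (x - z).
  rewrite /F /= /hart -IntZ; last exact: itg_cas.
  by apply: eq_Int => xi; rewrite dotC; ring.
have I2' := itg_Int2 IF.
have Ipw : itg lb (fun z => pk b i j z * inv y (x - z)).
  have := itgZ c0 I2'; congr itg; apply/funext => z.
  by rewrite E2 /inv; ring.
split => //.
have : Int lb (fun z => pk b i j z * inv y (x - z)) =
   c0 * Int lb (fun xi => - (16 * pi * th ^+ 6) * (jm th xi * cas (dot xi x))).
  rewrite -E1 S -IntZ//; apply: eq_Int => z; rewrite E2 /inv; ring.
rewrite IntZ; last exact: itg_cas.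
have X0 : 16 * pi * th ^+ 6 != 0 by rewrite gt_eqF// mulr_gt0 ?exprn_gt0// mulr_gt0 ?pi_gt0.
move=> ->; rewrite /inv /hart; move: (Int _ _) X0; set X := 16 * _ * _ => Z X0.
by rewrite !mulNr !mulrN opprK mulrCA mulKf.
Qed.

(** Uses the supremum only. Multiplied by 2 th and integrated over a dyadic range of th, it costs a
    constant per scale: this is the source of the logarithm. *)
Let jm_le1 (th : R) : 0 < th -> `|inv (jm th) x| <= 32 * M / th ^+ 2.
Proof.
move=> th0; have [I ->] := jm_conv th0; move: I; set b := (2 * th) ^- 2 => I.
have b0 : 0 < b by rewrite invr_gt0 exprn_gt0// mulr_gt0.
have p6 : 0 < 16 * pi * th ^+ 6 by rewrite mulr_gt0 ?exprn_gt0// mulr_gt0 ?pi_gt0.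
have M0 : 0 <= M by apply: le_trans (HM 0).
rewrite normrM normrN normfV (gtr0_norm p6) mulrC ler_pdivrMr//.
apply: (@le_trans _ _ (Int lb (fun z => M * `|pk b i j z|))).
  apply: normr_Int_le2; [exact: itg_meas I|by apply: itgZ; exact: itg_abs (itg_pk b0 i j)|].
  by move=> z; rewrite normrM mulrC ler_wpM2r.
rewrite IntZ; last exact: itg_abs (itg_pk b0 i j).
apply: le_trans (ler_wpM2l M0 (Int_pk_le b0 i j)) _.
rewrite le_eqVlt; apply/orP; left; apply/eqP; rewrite /b; field.
by rewrite gt_eqF.
Qed.

(** As the kernel has mean 0, the value at x may be subtracted; one power of th is gained, and the
    dyadic contributions become summable apart from those of [e]. *)
Let jm_le2 (th : R) : 0 < th -> `|inv (jm th) x| <= 64 * G / th + 32 * e / th ^+ 2.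
Proof.
move=> th0; have [I ->] := jm_conv th0; move: I; set b := (2 * th) ^- 2 => I.
have b0 : 0 < b by rewrite invr_gt0 exprn_gt0// mulr_gt0.
have p6 : 0 < 16 * pi * th ^+ 6 by rewrite mulr_gt0 ?exprn_gt0// mulr_gt0 ?pi_gt0.
have bth : b * (2 * th) ^+ 2 = 1 by rewrite mulVf// gt_eqF// exprn_gt0// mulr_gt0.
have Ip := itg_pk b0 i j.
rewrite normrM normrN normfV (gtr0_norm p6) mulrC ler_pdivrMr//.
have -> : Int lb (fun z => pk b i j z * inv y (x - z)) =
    Int lb (fun z => pk b i j z * (inv y (x - z) - inv y x)).
  under [RHS]eq_Int do rewrite mulrBr.
  by rewrite IntB//; [rewrite IntZr// Int_pk// mul0r subr0|exact: itgZr].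
have [Ie Be] := Int_enorm_pk_le b0 i j (ltW th0) bth.
have Iabs := itg_abs Ip.
apply: (@le_trans _ _ (Int lb (fun z => G * (enorm z * `|pk b i j z|) + e * `|pk b i j z|))).
  apply: normr_Int_le2.
  - under eq_fun do rewrite mulrBr.
    by apply: itg_meas (itgB I (itgZr _ Ip)).
  - by apply: itgD; exact: itgZ.
  move=> z; rewrite normrM.
  have H := HG (x - z) x; rewrite (_ : x - z - x = - z) ?enormN in H; last by rewrite addrAC subrr add0r.
  have := ler_wpM2l (normr_ge0 (pk b i j z)) H; rewrite mulrDr => /le_trans; apply.
  by rewrite le_eqVlt; apply/orP; left; apply/eqP; ring.
rewrite IntD; [|exact: itgZ|exact: itgZ]; rewrite !IntZ//.
apply: le_trans (lerD (ler_wpM2l G0 Be) (ler_wpM2l e0 (Int_pk_le b0 i j))) _.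
rewrite le_eqVlt; apply/orP; left; apply/eqP; rewrite /b; field.
by rewrite gt_eqF.
Qed.

Let tk (k : nat) : R := (2 ^+ k)^-1.
Let tk0 (k : nat) : 0 < tk k. Proof. by rewrite invr_gt0 exprn_gt0. Qed.
Let tkS (k : nat) : tk k = 2 * tk k.+1.
Proof. by rewrite /tk exprS; field; rewrite expf_neq0// pnatr_eq0. Qed.

Let piece (k : nat) (D : R) :
  (forall th, tk k.+1 <= th -> th <= tk k -> 2 * th * `|inv (jm th) x| <= D) ->
  `|psi (tk k) - psi (tk k.+1)| <= D * tk k.+1.
Proof.
move=> H.
have t12 : tk k.+1 <= tk k by rewrite [leRHS]tkS; have := tk0 k.+1; lra.
have := @mvt_le _ psi _ D (tk k.+1) (tk k) psi_derive.
have E : `|tk k - tk k.+1| = tk k.+1.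
  by rewrite ger0_norm ?subr_ge0// (tkS k); ring.
rewrite min_l// max_r// E.
apply=> th /andP[h1 h2]; have th0 : 0 <= 2 * th by rewrite mulr_ge0// (le_trans _ h1)// ltW.
by rewrite (normrM (- (2 * th))) normrN (ger0_norm th0); exact: H.
Qed.

Let piece1 (k : nat) : `|psi (tk k) - psi (tk k.+1)| <= 64 * M.
Proof.
have M0 : 0 <= M by apply: le_trans (HM 0).
apply: (le_trans (@piece k (64 * M / tk k.+1) _)); last first.
  by rewrite mulfVK// gt_eqF.
move=> th h1 h2; have th0 := lt_le_trans (tk0 k.+1) h1.
apply: le_trans (ler_wpM2l _ (jm_le1 th0)) _; first by rewrite mulr_ge0// ltW.
have -> : 2 * th * (32 * M / th ^+ 2) = 64 * M / th by field; rewrite gt_eqF.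
by rewrite ler_wpM2l ?mulr_ge0// lef_pV2 ?posrE.
Qed.

Let piece2 (k : nat) : `|psi (tk k) - psi (tk k.+1)| <= 64 * (G * tk k + e).
Proof.
apply: (le_trans (@piece k (128 * G + 64 * e / tk k.+1) _)); last first.
  have n0 : tk k.+1 != 0 by rewrite gt_eqF.
  by rewrite mulrDl mulfVK// (tkS k); lra.
move=> th h1 h2; have th0 := lt_le_trans (tk0 k.+1) h1.
apply: le_trans (ler_wpM2l _ (jm_le2 th0)) _; first by rewrite mulr_ge0// ltW.
have -> : 2 * th * (64 * G / th + 32 * e / th ^+ 2) = 128 * G + 64 * e / th.
  by field; rewrite gt_eqF.
by rewrite lerD2l ler_wpM2l ?mulr_ge0// lef_pV2 ?posrE.
Qed.

Let sum1 (K : nat) : `|psi 1 - psi (tk K)| <= 64 * (K%:R * M).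
Proof.
elim: K => [|K IH]; first by rewrite /tk expr0 invr1 subrr normr0 mul0r mulr0.
apply: le_trans (ler_distD (psi (tk K)) _ _) _.
apply: le_trans (lerD IH (piece1 K)) _; rewrite -natr1.
by rewrite le_eqVlt; apply/orP; left; apply/eqP; ring.
Qed.

Let sum2 (K n : nat) : `|psi (tk K) - psi (tk (K + n))| <=
  64 * (2 * G * (tk K - tk (K + n)) + n%:R * e).
Proof.
elim: n => [|n IH]; first by rewrite addn0 !subrr normr0 mulr0 mul0r addr0 mulr0.
apply: le_trans (ler_distD (psi (tk (K + n))) _ _) _; rewrite addnS.
apply: le_trans (lerD IH (piece2 (K + n))) _; rewrite (tkS (K + n)) -natr1.
by rewrite le_eqVlt; apply/orP; left; apply/eqP; ring.
Qed.

Let psi0 : psi 0 = inv (rz i j y) x.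
Proof.
by congr (c0 * hart _ x); apply/funext => xi; rewrite /q /gau expr0n /= mulr0 oppr0 expR0 mulr1.
Qed.

Let tail (th : R) : 0 <= th -> `|psi 0 - psi th| <= th * Int lb (fun xi => enorm xi * `|y xi|).
Proof.
move=> th0; rewrite /psi -invB//.
have J1 := itg_wabs (@enorm_ge0 R) I1.
apply: (le_trans (normr_inv x (itgB (Iq 0) (Iq th)))).
rewrite -IntZ//; apply: le_Int; [exact: itg_abs (itgB (Iq 0) (Iq th))|exact: itgZ|move=> xi].
have -> : q 0 xi - q th xi = (1 - gau (enorm xi ^+ 2) th) * rz i j y xi.
  by rewrite /q {1}/gau expr0n /= mulr0 oppr0 expR0; ring.
have /andP[g0 g1] := gau01 th xi.
rewrite normrM ger0_norm ?subr_ge0// mulrA; apply: ler_pM => //.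
- by rewrite subr_ge0.
- set p := th * enorm xi; have p0 : 0 <= p by rewrite mulr_ge0 ?enorm_ge0.
  have -> : gau (enorm xi ^+ 2) th = expR (- p ^+ 2) by rewrite /gau /p; congr expR; ring.
  have h := expR_ge1Dx (- p ^+ 2); have h2 := expR_ge0 (- p ^+ 2).
  have [p1|p1] := leP p 1; last by lra.
  have : p * p <= p * 1 by rewrite ler_wpM2l.
  by rewrite -expr2; lra.
- exact: rz_le.
Qed.

Let head : `|psi 1| <= nrm lb (gau2 1) * nrm lb y.
Proof.
apply: (le_trans (normr_inv x (Iq 1))).
have sg : sq lb (gau2 (1 : R)).
  apply: (@sq_le _ _ _ lb _ (gau2 2^-1)) => [|z|].
  - exact: measurable_gau2.
  - rewrite ger0_norm ?gau2_ge0// /gau2.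
    have H (s : R) : gau 1 s <= gau 2^-1 s.
      by rewrite /gau ler_expR lerN2 ler_wpM2r ?sqr_ge0// invf_le1 ?ler1n.
    by apply: ler_pM; rewrite ?gau_ge0.
  - split; first exact: measurable_gau2.
    have -> : (fun z : R * R => gau2 2^-1 z ^+ 2) = gau2 1.
      by apply/funext => z; rewrite /gau2 /gau -!expRD expr2 -expRD; congr expR; field.
    exact: itg_gau2.
have Ig := sqM_itg sg (sq_abs sy).
apply: (@le_trans _ _ (Int lb (fun z => gau2 1 z * `|y z|))).
  apply: le_Int => //; first exact: itg_abs.
  move=> xi; rewrite normrM mulrC.
  have -> : gau (enorm xi ^+ 2) 1 = gau2 1 xi.
    by rewrite /gau2 /gau -expRD sqr_enorm; congr expR; ring.
  by rewrite (ger0_norm (gau2_ge0 _ _)) ler_wpM2l ?gau2_ge0// rz_le.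
apply: le_trans (ler_norm _) _.
by apply: le_trans (cauchy_schwarz sg (sq_abs sy)) _; rewrite nrm_abs.
Qed.

(** Four regimes: the L^2 norm at th = 1, the supremum over K dyadic scales, the Lipschitz bound
    over n more with a geometric sum, and the L^1 norm of |xi| y below. K and n stay free: K is
    later proportional to the logarithm of the Lipschitz constant, and n makes the last term
    small. *)
Lemma riesz_estimate (K n : nat) : `|inv (rz i j y) x| <= nrm lb (gau2 1) * nrm lb y +
  64 * (K%:R * M + 2 * G / 2 ^+ K + n%:R * e) +
  (2 ^+ (K + n))^-1 * Int lb (fun xi => enorm xi * `|y xi|).
Proof.
have h1 := sum1 K; have h2 := sum2 K n; have h3 := tail (ltW (tk0 (K + n))).
rewrite psi0 in h3; apply: (le_trans (normr_chain head h1 h2 h3)).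
rewrite lerD2r -addrA lerD2l -mulrDr ler_wpM2l// addrA lerD2r.
rewrite lerD2l ler_wpM2l ?mulr_ge0// gerBl; exact: ltW.
Qed.

End velocity_gradient.

(** * Logarithmic bound for the velocity gradient *)

Section log_estimate.
Context {R : realType}.
Let lb := @lb2 R.
Variables (a r : R) (y : R * R -> R) (M G e : R).
Hypotheses (Ha : 0 < a < 1 / 2) (Hr : 3 < r) (wy : wr r y).
Hypotheses (HM : forall x, `|inv y x| <= M)
  (HG : forall x x', `|inv y x - inv y x'| <= G * enorm (x - x') + e).
Hypotheses (G0 : 0 <= G) (e0 : 0 <= e).

Let a12 : a < 1 / 2. Proof. by case/andP: Ha. Qed.
Let r0 : 0 <= r. Proof. by apply/ltW/(lt_trans _ Hr). Qed.
Let my := wr_meas wy.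
Let sy := (wr_sq0 r0 wy).1.
Let I0 := (wr_itg0 Hr wy).1.
Let I1 := (wr_itg1 Hr wy).1.

(** The symbol of d_i u_k is, up to sign, a Riesz symbol times |xi|^(2 a), and |xi|^(2 a) differs
    from 1 by at most 1 below frequency 1 and by at most 2 a |xi| above. *)
Let dug_le i k xi : `|dv i (ug a k y) xi - (-1) ^+ (~~ k) * rz i (~~ k) y xi| <=
  bnl 1 xi * `|y xi| + 2 * a * (enorm xi * `|y xi|).
Proof.
have -> : dv i (ug a k y) xi = (-1) ^+ (~~ k) *
    (co i xi * co (~~ k) xi * enorm xi `^ (- 2 + 2 * a) * y xi).
  by rewrite /dv /ug enormN opprK; case: k => /=; rewrite ?expr0 ?expr1; ring.
rewrite -mulrBr normrM normr_sign mul1r /rz -mulrBl -mulrBr normrM.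
rewrite [leRHS](_ : _ = (bnl 1 xi + 2 * a * enorm xi) * `|y xi|); last by ring.
rewrite ler_wpM2r// normrM.
have a0 : 0 <= 2 * a by rewrite mulr_ge0// ltW//; case/andP: Ha.
have [z0|z0] := eqVneq (enorm xi) 0.
  have : co i xi = 0 by apply/eqP; rewrite -normr_le0; apply: le_trans (normr_co i xi) _; rewrite z0.
  move=> ->; rewrite mul0r normr0 mul0r addr_ge0 ?bnl_ge0// mulr_ge0//; exact: enorm_ge0.
have zp : 0 < enorm xi by rewrite lt_neqAle eq_sym z0 enorm_ge0.
have p2 : 0 < enorm xi ^+ 2 by rewrite exprn_gt0.
have -> : enorm xi `^ (- 2 + 2 * a) = (enorm xi ^+ 2)^-1 * enorm xi `^ (2 * a).
  rewrite powRD; last by rewrite z0 implybT.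
  by congr (_ * _); rewrite powRN -powR_mulrn ?enorm_ge0.
have -> : enorm xi ^- 2 * enorm xi `^ (2 * a) - enorm xi ^- 2 =
    enorm xi ^- 2 * (enorm xi `^ (2 * a) - 1) by rewrite mulrBr mulr1.
rewrite (normrM (enorm xi ^- 2)) normfV (gtr0_norm p2).
have h : `|co i xi * co (~~ k) xi| * (enorm xi ^+ 2)^-1 <= 1.
  rewrite ler_pdivrMr// mul1r normrM expr2; apply: ler_pM => //; exact: normr_co.
apply: (@le_trans _ _ `|enorm xi `^ (2 * a) - 1|).
  by rewrite mulrA ler_piMl.
have P0 := powR_ge0 (enorm xi) (2 * a).
rewrite /bnl; case: (leP (enorm xi) 1) => H /=.
  have P1 : enorm xi `^ (2 * a) <= 1.
    have := @ge0_ler_powR R (2 * a) a0 (enorm xi) 1.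
    by rewrite powR1 !nnegrE enorm_ge0 ler01; apply.
  have := mulr_ge0 a0 (enorm_ge0 xi).
  by rewrite ler0_norm ?subr_le0//; lra.
have P1 : 1 <= enorm xi `^ (2 * a).
  by rewrite -[leLHS](powRr0 (enorm xi)); apply: ler_powR => //; exact: ltW.
have B : enorm xi `^ (2 * a) <= 1 + 2 * a * enorm xi.
  by apply: powR_bernoulli; [exact: enorm_ge0|case/andP: Ha => ? ?; apply/andP; split; lra].
by rewrite ger0_norm ?subr_ge0//; lra.
Qed.

Lemma itg_dug i k : itg lb (dv i (ug a k y)).
Proof.
have J := wr_enorm_ka Ha Hr wy.
have k0 xi : 0 <= enorm xi * ka a xi by rewrite mulr_ge0 ?enorm_ge0 ?ka_ge0.
apply: (itg_le _ _ (itg_wabs k0 J.1)).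
  by apply: measurable_dv; exact: measurable_ug.
move=> xi; apply: (le_trans (normr_dv _ _ _)); rewrite enormN -mulrA ler_wpM2l ?enorm_ge0//.
by have := normr_ug k y (- xi) a12; rewrite opprK.
Qed.

Definition Clog : R := nrm lb (gau2 1) + nrm lb (bnl 1).

Lemma log_estimate i k x (K n : nat) : `|inv (dv i (ug a k y)) x| <= Clog * nrm lb y +
  64 * (K%:R * M + 2 * G / 2 ^+ K + n%:R * e) +
  ((2 ^+ (K + n))^-1 + 2 * a) * Int lb (fun xi => enorm xi * `|y xi|).
Proof.
have Irz : itg lb (rz i (~~ k) y).
  apply: (itg_le _ _ (itg_abs I0)); first exact: measurable_rz.
  by move=> xi; exact: rz_le.
have Id := itg_dug i k.
have H := riesz_estimate Hr wy HM HG G0 e0 i (~~ k) x K n.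
have Is : itg lb (fun xi => (-1) ^+ (~~ k) * rz i (~~ k) y xi) by exact: itgZ.
have E : inv (dv i (ug a k y)) x = (-1) ^+ (~~ k) * inv (rz i (~~ k) y) x +
   inv (fun xi => dv i (ug a k y) xi - (-1) ^+ (~~ k) * rz i (~~ k) y xi) x.
  by rewrite invB// invZ//; ring.
have sb := sq_bnl (R := R) 1.
have Ib := sqM_itg sb (sq_abs sy).
have J1 := itg_wabs (@enorm_ge0 R) I1.
have B : `|inv (fun xi => dv i (ug a k y) xi - (-1) ^+ (~~ k) * rz i (~~ k) y xi) x| <=
   nrm lb (bnl 1) * nrm lb y + 2 * a * Int lb (fun xi => enorm xi * `|y xi|).
  apply: (le_trans (normr_inv x (itgB Id Is))).
  apply: (@le_trans _ _ (Int lb (fun xi => bnl 1 xi * `|y xi| + 2 * a * (enorm xi * `|y xi|)))).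
    apply: le_Int; [exact: itg_abs (itgB Id Is)|by apply: itgD => //; exact: itgZ|].
    exact: dug_le.
  rewrite IntD//; last exact: itgZ.
  rewrite IntZ// lerD2r; apply: le_trans (ler_norm _) _.
  by apply: le_trans (cauchy_schwarz sb (sq_abs sy)) _; rewrite nrm_abs.
rewrite E; apply: (le_trans (ler_normD _ _)); rewrite normrM normr_sign mul1r.
by rewrite /Clog; move: H B; lra.
Qed.

End log_estimate.

(** * Weights for the commutator estimate *)

Section weight_family.
Context {R : realType}.
Implicit Types x y : R.


Lemma powR_convex x (p : R) : 0 <= x -> 1 < p -> 1 - p * (1 - x) <= x `^ p.
Proof.
move=> x0 p1; have p0 : 0 < p by exact: lt_trans ltr01 p1.
have q0 : 0 < 1 - p^-1 by rewrite subr_gt0 invf_lt1.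
have := @conjugate_powR R x 1 p (1 - p^-1)^-1 x0 ler01 p0.
rewrite invr_gt0 invrK => /(_ q0); rewrite addrC subrK => /(_ erefl).
rewrite mulr1 powR1 mul1r => H.
have : p * x <= p * (x `^ p / p + (1 - p^-1)) by rewrite ler_wpM2l// ltW.
by rewrite mulrDr mulrCA mulfV ?gt_eqF// mulr1 mulrBr mulr1 mulfV ?gt_eqF//; lra.
Qed.

(** For c = d = 1 this is the squared Sobolev weight; for d = 0 and c = A^2 it is comparable to it
    above frequency A and much smaller far below. A single verification of the structural properties
    covers both. *)
Definition Wt (r c d x : R) := (1 + x ^+ 2) `^ r * ((d + x ^+ 2) / (c + x ^+ 2)).
Definition Kr (r : R) := 4 * 4 `^ r + (2 * r + 2).

Variables r c d : R.
Hypotheses (r1 : 1 < r) (c0 : 0 < c) (d0 : 0 <= d) (dc : d <= c).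

Let A x := 1 + x ^+ 2.
Let A1 x : 1 <= A x. Proof. by rewrite lerDl sqr_ge0. Qed.
Let A0 x : 0 < A x. Proof. exact: lt_le_trans (A1 x). Qed.
Let g x := (d + x ^+ 2) / (c + x ^+ 2).
Let cx x : 0 < c + x ^+ 2. Proof. by rewrite ltr_wpDr// sqr_ge0. Qed.
Let dx x : 0 <= d + x ^+ 2. Proof. by rewrite addr_ge0// sqr_ge0. Qed.
Let g0 x : 0 <= g x. Proof. by rewrite divr_ge0// ltW. Qed.
Let r0 : 0 <= r. Proof. by apply/ltW/(lt_trans ltr01 r1). Qed.
Let P x := A x `^ r.
Let P0 x : 0 <= P x. Proof. exact: powR_ge0. Qed.

Lemma Kr_ge1 : 1 <= Kr r.
Proof. by rewrite /Kr; have := powR_ge0 4 r; have := r0; lra. Qed.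

Lemma Wt_ge0 x : 0 <= Wt r c d x. Proof. exact: (mulr_ge0 (P0 x) (g0 x)). Qed.

Lemma Wt_le x : Wt r c d x <= (1 + x ^+ 2) `^ r.
Proof. by apply: ler_piMr; [exact: P0|rewrite ler_pdivrMr// mul1r lerD2r]. Qed.

Let sq_mono x y : 0 <= x -> x <= y -> x ^+ 2 <= y ^+ 2.
Proof. by move=> x0 xy; rewrite ler_pXn2r ?nnegrE// (le_trans x0). Qed.

Let P_mono x y : 0 <= x -> x <= y -> P x <= P y.
Proof.
move=> x0 xy; apply: ge0_ler_powR; rewrite ?nnegrE ?(ltW (A0 _))//.
by rewrite lerD2l sq_mono.
Qed.

Let gB x y : g x - g y = (c - d) * (x ^+ 2 - y ^+ 2) / ((c + x ^+ 2) * (c + y ^+ 2)).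
Proof. by rewrite /g; field; rewrite !gt_eqF. Qed.

Let g_mono x y : 0 <= x -> x <= y -> g x <= g y.
Proof.
move=> x0 xy; rewrite -subr_ge0 gB divr_ge0 ?mulr_ge0 ?subr_ge0 ?sq_mono//; exact: ltW.
Qed.

Lemma Wt_mono x y : 0 <= x -> x <= y -> Wt r c d x <= Wt r c d y.
Proof. by move=> x0 xy; apply: ler_pM; [exact: P0|exact: g0|exact: P_mono|exact: g_mono]. Qed.

Lemma Wt_double x : 0 <= x -> Wt r c d (2 * x) <= Kr r * Wt r c d x.
Proof.
move=> x0.
have h1 : P (2 * x) <= 4 `^ r * P x.
  rewrite /P -powRM ?(ltW (A0 _))//; apply: ge0_ler_powR; rewrite ?nnegrE ?(ltW (A0 _))//.
    by rewrite mulr_ge0// ltW.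
  by rewrite /A exprMn; have := sqr_ge0 x; lra.
have h2 : g (2 * x) <= 4 * g x.
  rewrite /g ler_pdivrMr// mulrA mulrAC ler_pdivlMr//.
  rewrite exprMn; have := sqr_ge0 x; set t := x ^+ 2 => t0.
  have := mulr_ge0 d0 (ltW c0); have := mulr_ge0 d0 t0.
  by have := mulr_ge0 (ltW c0) t0; have := mulr_ge0 t0 t0; lra.
apply: (@le_trans _ _ (4 * 4 `^ r * (P x * g x))).
  have := ler_pM (P0 _) (g0 _) h1 h2; rewrite /Wt => /le_trans; apply.
  by apply: eq_lexx; ring.
apply: ler_wpM2r; [exact: (mulr_ge0 (P0 x) (g0 x))|rewrite /Kr; have := r0; lra].
Qed.

(** Product rule: the power contributes 2 r by convexity and the fraction contributes 2, whence the
    summand 2 r + 2 of [Kr]. *)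
Lemma Wt_diff x y : 0 <= y -> y <= x ->
  x * (Wt r c d x - Wt r c d y) <= Kr r * (x - y) * Wt r c d x.
Proof.
move=> y0 yx; have x0 := le_trans y0 yx.
have xy0 : 0 <= x - y by rewrite subr_ge0.
have s : x * (x ^+ 2 - y ^+ 2) <= 2 * (x - y) * x ^+ 2.
  have -> : x * (x ^+ 2 - y ^+ 2) = (x - y) * (x * (x + y)) by ring.
  have -> : 2 * (x - y) * x ^+ 2 = (x - y) * (x * (x + x)) by ring.
  by rewrite ler_wpM2l// ler_wpM2l// lerD2l.
have h1 : x * (P x - P y) <= 2 * r * (x - y) * P x.
  have B := powR_convex (divr_ge0 (ltW (A0 y)) (ltW (A0 x))) r1.
  rewrite powRM ?invr_ge0 ?(ltW (A0 _))// in B.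
  have Pi : (A x)^-1 `^ r = (P x)^-1.
    by rewrite -powR_inv1 ?(ltW (A0 _))// -powRrM mulN1r powRN.
  rewrite Pi in B.
  have Px : 0 < P x by rewrite powR_gt0.
  have {}B : P x - P y <= r * (1 - A y / A x) * P x.
    have := ler_wpM2r (P0 x) B; rewrite mulfVK ?gt_eqF//; rewrite /P; lra.
  have E : 1 - A y / A x = (x ^+ 2 - y ^+ 2) / A x by rewrite /A; field; rewrite gt_eqF// A0.
  rewrite E in B.
  apply: le_trans (ler_wpM2l x0 B) _.
  have -> : x * (r * ((x ^+ 2 - y ^+ 2) / A x) * P x) =
    r * P x * (x * (x ^+ 2 - y ^+ 2) / A x) by ring.
  have -> : 2 * r * (x - y) * P x = r * P x * (2 * (x - y)) by ring.
  rewrite ler_wpM2l ?mulr_ge0// ler_pdivrMr//; apply: (le_trans s).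
  by rewrite ler_wpM2l ?mulr_ge0// /A lerDr.
have h2 : x * (g x - g y) <= 2 * (x - y) * g x.
  rewrite gB /g.
  have -> : x * ((c - d) * (x ^+ 2 - y ^+ 2) / ((c + x ^+ 2) * (c + y ^+ 2))) =
     (c - d) / (c + y ^+ 2) * (x * (x ^+ 2 - y ^+ 2)) / (c + x ^+ 2).
    by field; rewrite !gt_eqF.
  rewrite [leRHS]mulrA ler_wpM2r ?invr_ge0 ?(ltW (cx _))//.
  apply: (@le_trans _ _ (1 * (2 * (x - y) * x ^+ 2))).
    apply: ler_pM => //.
    - by rewrite divr_ge0 ?subr_ge0// ltW.
    - by rewrite mulr_ge0// subr_ge0 sq_mono.
    - by rewrite ler_pdivrMr// mul1r; have := d0; have := sqr_ge0 y; lra.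
  by rewrite mul1r ler_wpM2l ?mulr_ge0// lerDr.
have -> : x * (Wt r c d x - Wt r c d y) = x * (P x - P y) * g x + P y * (x * (g x - g y)).
  by rewrite /Wt -/(P x) -/(P y) -/(g x) -/(g y); ring.
have Py : P y <= P x by exact: P_mono.
have gx : 0 <= x * (g x - g y) by rewrite mulr_ge0// subr_ge0 g_mono.
apply: (@le_trans _ _ (2 * r * (x - y) * P x * g x + P x * (2 * (x - y) * g x))).
  apply: lerD; first by rewrite ler_wpM2r.
  exact: ler_pM.
have -> : 2 * r * (x - y) * P x * g x + P x * (2 * (x - y) * g x) =
  (2 * r + 2) * ((x - y) * Wt r c d x) by rewrite /Wt -/(P x) -/(g x); ring.
rewrite -mulrA; apply: ler_wpM2r; first exact: (mulr_ge0 xy0 (Wt_ge0 x)).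
by rewrite /Kr; have := powR_ge0 4 r; lra.
Qed.

End weight_family.

(** * L^1 norm of the transform with a logarithm *)

Section dyadic.
Context {R : realType}.
Let lb := @lb2 R.

Lemma bnl_tail (A : R) (xi : R * R) (c : R) : 0 < A ->
  `|c - bnl A xi * c| <= A^-1 * (enorm xi * `|c|).
Proof.
move=> A0; rewrite -{1}[c]mul1r -mulrBl normrM mulrA ler_wpM2r// /bnl.
case: (leP (enorm xi) A) => h /=.
  by rewrite subrr normr0 mulr_ge0 ?enorm_ge0 ?invr_ge0// ltW.
by rewrite subr0 normr1 mulrC ler_pdivlMr// mul1r ltW.
Qed.

Variables (r : R) (y : R * R -> R).
Hypotheses (Hr : 3 < r) (wy : wr r y).

Let I0 := (wr_itg0 Hr wy).1.
Let J1 := itg_wabs (@enorm_ge0 R) (wr_itg1 Hr wy).1.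
Let r0 : 0 <= r. Proof. by apply/ltW/(lt_trans _ Hr). Qed.
Let sy := (wr_sq0 r0 wy).1.
Let s1 := (wr_enorm_sq Hr wy).1.
Let N := nrm lb y.
Let H := nrm lb (fun xi => enorm xi * y xi).

Let tail (A : R) xi : 0 < A -> (1 - bnl A xi) * `|y xi| <= A^-1 * (enorm xi * `|y xi|).
Proof. by move=> A0; have := bnl_tail xi `|y xi| A0; rewrite normr_id mulrBl mul1r; apply/le_trans/ler_norm. Qed.

Let Ib (A : R) : itg lb (fun xi => bnl A xi * `|y xi|).
Proof. exact: sqM_itg (sq_bnl A) (sq_abs sy). Qed.

(** In dimension two, Cauchy-Schwarz against |xi| y gives the same contribution for every dyadic
    annulus, hence a factor K and not a power of 2^K. *)
Let low (K : nat) : Int lb (fun xi => bnl (2 ^+ K) xi * `|y xi|) <=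
  Num.sqrt cball * (N + 2 * K%:R * H).
Proof.
have p2 (n : nat) : 0 < 2 ^+ n :> R by rewrite exprn_gt0.
elim: K => [|K IH].
  rewrite mulr0 mul0r addr0; apply: le_trans (ler_norm _) _.
  apply: le_trans (cauchy_schwarz (sq_bnl _) (sq_abs sy)) _; rewrite nrm_abs ler_wpM2r ?nrm_ge0//.
  by have := @nrm_bnl R (2 ^+ 0) (p2 0%N); rewrite expr0 mulr1.
have Ih := sqM_itg (sq_bnl (2 ^+ K.+1)) (sq_abs s1).
have B : Int lb (fun xi => bnl (2 ^+ K.+1) xi * `|y xi|) <=
   Int lb (fun xi => bnl (2 ^+ K) xi * `|y xi|) +
   (2 ^+ K)^-1 * Int lb (fun xi => bnl (2 ^+ K.+1) xi * `|enorm xi * y xi|).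
  rewrite -IntZ// -IntD//; last exact: itgZ.
  apply: le_Int => //; first by apply: itgD => //; exact: itgZ.
  move=> xi; rewrite normrM (ger0_norm (enorm_ge0 _)).
  have := tail xi (p2 K); have [h|h] := leP (enorm xi) (2 ^+ K).
    have -> : bnl (2 ^+ K) xi = 1 by rewrite /bnl h.
    have -> : bnl (2 ^+ K.+1) xi = 1.
      by rewrite /bnl (le_trans h)// ler_eXn2l ?ltr1n.
    by rewrite !mul1r lerDl => _; rewrite mulr_ge0 ?mulr_ge0 ?enorm_ge0 ?invr_ge0 ?(ltW (p2 _)).
  have -> : bnl (2 ^+ K) xi = 0 by rewrite /bnl leNgt h.
  rewrite subr0 mul1r mul0r add0r => h2.
  have := ler_wpM2l (bnl_ge0 (2 ^+ K.+1) xi) h2; move=> /le_trans; apply; apply: eq_lexx; ring.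
apply: (le_trans B).
have C : Int lb (fun xi => bnl (2 ^+ K.+1) xi * `|enorm xi * y xi|) <=
    Num.sqrt cball * 2 ^+ K.+1 * H.
  apply: le_trans (ler_norm _) _.
  apply: le_trans (cauchy_schwarz (sq_bnl _) (sq_abs s1)) _; rewrite nrm_abs ler_wpM2r ?nrm_ge0//.
  exact: nrm_bnl.
have {}C : (2 ^+ K)^-1 * Int lb (fun xi => bnl (2 ^+ K.+1) xi * `|enorm xi * y xi|) <=
   Num.sqrt cball * (2 * H).
  apply: le_trans (ler_wpM2l _ C) _; first by rewrite invr_ge0 ltW.
  by rewrite exprS; apply: eq_lexx; field; rewrite gt_eqF.
apply: (le_trans (lerD IH C)); rewrite -mulrDr -natr1.
by apply: eq_lexx; ring.
Qed.

Lemma L1_dyadic (K : nat) : Int lb (fun xi => `|y xi|) <=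
  Num.sqrt cball * (N + 2 * K%:R * H) + (2 ^+ K)^-1 * Int lb (fun xi => enorm xi * `|y xi|).
Proof.
have p2 : 0 < 2 ^+ K :> R by rewrite exprn_gt0.
apply: le_trans (lerD (low K) (lexx _)); rewrite -IntZ// -IntD//; last exact: itgZ.
apply: le_Int; [exact: itg_abs|by apply: itgD => //; exact: itgZ|].
by move=> xi; have := tail xi p2; rewrite mulrBl mul1r; lra.
Qed.

End dyadic.

(** * One Euler step: energy and transport *)

Section euler_step.
Context {R : realType}.
Let lb := @lb2 R.
Implicit Types (x xi z : R * R) (i j k : bool).
Variables (a r L h : R) (y : R * R -> R).
Hypotheses (Ha : 0 < a < 1 / 2) (Hr : 3 < r) (L1 : 1 <= L) (h0 : 0 <= h).

Definition csup (A : R) (f : R * R -> R) := forall xi, A < enorm xi -> f xi = 0.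
(** The Sobolev weight at radius A. On functions cut off at A it trades the weight for a constant,
    which the smallness of the step has to beat. *)
Definition rhoL (s A : R) : R := (1 + A ^+ 2) `^ (s / 2).
Definition estep xi : R := y xi + h * (bnl L xi * bil a y y xi).

Hypotheses (wy : wr r y) (cy : csup L y).

Let L0 : 0 < L. Proof. exact: lt_le_trans L1. Qed.
Let r0 : 0 <= r. Proof. by apply/ltW/(lt_trans _ Hr). Qed.
Let my := wr_meas wy.
Let sy := (wr_sq0 r0 wy).1.
Let B := bil a y y.
Let sB : sq lb B := (bil_sq Ha Hr wy wy).1.
Let IB : itg lb B := (bil_L1 Ha Hr wy wy).1.
Let A := nr r y.

Lemma rho_le_L xi : enorm xi <= L -> rho r xi <= rhoL r L.
Proof.
move=> H; apply: ge0_ler_powR; rewrite ?nnegrE ?divr_ge0 ?(ltW (jap_gt0 _))//.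
  by rewrite addr_ge0 ?sqr_ge0.
by rewrite lerD2l ler_pXn2r ?nnegrE ?enorm_ge0// ltW.
Qed.

Lemma weight_cut_le (w : plane R -> R) : (forall xi, `|w xi| <= rho r xi) ->
  forall xi, `|w xi * bnl L xi| <= rhoL r L.
Proof.
move=> wle xi; rewrite normrM (ger0_norm (bnl_ge0 _ _)) /bnl.
case: (leP (enorm xi) L) => H /=.
  by rewrite mulr1 (le_trans (wle xi))// rho_le_L.
by rewrite mulr0 powR_ge0.
Qed.

Lemma sq_weight_cut (w f : plane R -> R) : (forall xi, `|w xi| <= rho r xi) ->
  measurable_fun setT w -> sq lb f -> sq lb (fun xi => w xi * (bnl L xi * f xi)) /\
  nrm lb (fun xi => w xi * (bnl L xi * f xi)) <= rhoL r L * nrm lb f.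
Proof.
move=> wle mw sf.
have m : measurable_fun (setT : set (plane R)) (fun xi => w xi * (bnl L xi * f xi)).
  apply: measurable_funM => //; apply: measurable_funM; first exact: measurable_bnl.
  by case: sf.
have R0 : 0 <= rhoL r L by exact: powR_ge0.
have le xi : `|w xi * (bnl L xi * f xi)| <= `|rhoL r L * f xi|.
  by rewrite mulrA !(normrM _ (f xi)) (ger0_norm R0) ler_wpM2r// weight_cut_le.
have s2 := sqZ (rhoL r L) sf.
split; first exact: (sq_le m le (sq_abs s2)).
by rewrite -[X in _ <= X * _](ger0_norm R0) -nrmZ//; exact: (le_nrm m le s2).
Qed.

Lemma csup_bnl f xi : csup L f -> bnl L xi * f xi = f xi.
Proof.
move=> cf; rewrite /bnl; case: (leP (enorm xi) L) => H /=; first by rewrite mul1r.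
by rewrite cf// mulr0.
Qed.

Lemma csup_step : csup L estep.
Proof.
move=> xi H; rewrite /estep cy// /bnl leNgt H /= mul0r mulr0 addr0//.
Qed.

Lemma wr_step : wr r estep.
Proof.
have rle xi : `|rho r xi| <= rho r xi by rewrite ger0_norm// ltW// rho_gt0.
have [s _] := sq_weight_cut rle (measurable_rho r) sB.
have := sqD wy (sqZ h s); rewrite /wr; congr (sq _ _); apply/funext => xi.
by rewrite /estep /B; ring.
Qed.

(** Quadratic defect of an explicit Euler step in a weighted energy, per unit of time. *)
Definition eng_err : R := h * (rhoL r L * (Cb a r * A ^+ 2)) ^+ 2.

(** Expand the square. In the cross term the cutoff disappears because [y] already vanishes beyond
    L, so that the exact trilinear integral is left. *)
Lemma energy_step (w : plane R -> R) : measurable_fun setT w ->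
  (forall xi, `|w xi| <= rho r xi) ->
  itg (lb \x lb)%E (tform a (fun p => w p.1 ^+ 2) y y) /\
  nrm lb (fun xi => w xi * estep xi) ^+ 2 <= nrm lb (fun xi => w xi * y xi) ^+ 2 +
    h * (2 * Int (lb \x lb)%E (tform a (fun p => w p.1 ^+ 2) y y) + eng_err).
Proof.
move=> mw wle.
have [sw _] := wr_sq mw wle wy.
have [sb nb] := sq_weight_cut wle mw sB.
have sphi : sq lb (fun xi => w xi ^+ 2 * y xi).
  have sz : sq lb (fun xi => rhoL r L * (w xi * y xi)) by exact: sqZ.
  apply: (sq_le _ _ (sq_abs sz)).
    by apply: measurable_funM => //; exact: (measurable_funX 2).
  move=> xi; rewrite -(csup_bnl xi cy).
  have -> : w xi ^+ 2 * (bnl L xi * y xi) = w xi * bnl L xi * (w xi * y xi) by ring.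
  rewrite !(normrM _ (w xi * _)) (ger0_norm (powR_ge0 _ _)).
  rewrite (csup_bnl xi cy); exact: ler_wpM2r (weight_cut_le wle xi).
have [If Ef] := bil_form Ha Hr wy wy sphi.
have E : (fun p : plane R * plane R => w p.1 ^+ 2 * y p.1 *
     (kap a p.1 p.2 * qf y y (p.1 - p.2) p.2)) = tform a (fun p => w p.1 ^+ 2) y y.
  by apply/funext => p; rewrite /tform; ring.
rewrite E in If Ef; split => //.
have Iwb := sqM_itg sw sb.
have -> : nrm lb (fun xi => w xi * estep xi) ^+ 2 = nrm lb (fun xi => w xi * y xi) ^+ 2 +
   h * (2 * Int lb (fun xi => w xi * y xi * (w xi * (bnl L xi * B xi)))) +
   h ^+ 2 * nrm lb (fun xi => w xi * (bnl L xi * B xi)) ^+ 2.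
  have [_ I1] := sw; have [_ I2] := sb; rewrite !sqr_nrm.
  have E' : (fun xi => (w xi * estep xi) ^+ 2) = (fun xi => (w xi * y xi) ^+ 2 +
     2 * h * (w xi * y xi * (w xi * (bnl L xi * B xi))) +
     h ^+ 2 * (w xi * (bnl L xi * B xi)) ^+ 2).
    by apply/funext => xi; rewrite /estep /B; ring.
  rewrite E' (IntD (itgD I1 (itgZ _ Iwb)) (itgZ _ I2)) (IntD I1 (itgZ _ Iwb)).
  by rewrite (IntZ _ Iwb) (IntZ _ I2); ring.
have -> : Int lb (fun xi => w xi * y xi * (w xi * (bnl L xi * B xi))) =
    Int (lb \x lb)%E (tform a (fun p => w p.1 ^+ 2) y y).
  rewrite -Ef; apply: eq_Int => xi; rewrite -[in RHS](csup_bnl xi cy) /B; ring.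
rewrite -addrA lerD2l mulrDr lerD2l expr2 -mulrA ler_wpM2l// /eng_err ler_wpM2l//.
rewrite ler_pXn2r ?nnegrE ?nrm_ge0//; last first.
  by rewrite mulr_ge0 ?powR_ge0// mulr_ge0 ?sqr_ge0// mulr_ge0 ?sqr_ge0.
apply: (le_trans nb); rewrite ler_wpM2l ?powR_ge0//.
by have := bil_sq_le2 Ha Hr wy wy; rewrite -expr2.
Qed.

(** Defect of transport per unit of time: first the frequencies removed by the cutoff, then the
    second order Taylor remainder along the displacement. *)
Definition eps_err : R := Cb a r * A ^+ 2 / L + h * (10 * (ca a + crs r) ^+ 2 * crs r * A ^+ 3).

Let U x : R * R := (inv (ug a true y) x, inv (ug a false y) x).

Let mB : measurable_fun setT (bnl L : plane R -> R) := measurable_bnl L.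
Let IbB : itg lb (fun xi => bnl L xi * B xi).
Proof. by apply: sqM_itg => //; exact: sq_bnl. Qed.
Let ID : itg lb (fun xi => B xi - bnl L xi * B xi). Proof. exact: itgB. Qed.

Lemma bil_cut x : `|inv (fun xi => B xi - bnl L xi * B xi) x| <= Cb a r * A ^+ 2 / L.
Proof.
have [IeB hE] := bil_enorm_L1 Ha Hr wy wy; have J := itg_wabs (@enorm_ge0 R) IeB.
apply: (le_trans (normr_inv x ID)).
apply: (@le_trans _ _ (Int lb (fun xi => L^-1 * (enorm xi * `|B xi|)))).
  by apply: le_Int; [exact: itg_abs|exact: itgZ|move=> xi; exact: bnl_tail].
by rewrite IntZ// mulrC ler_wpM2r ?invr_ge0 ?(ltW L0)// expr2.
Qed.

Lemma inv_step x : inv estep x = inv y x + h * inv (fun xi => bnl L xi * B xi) x.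
Proof. by rewrite /estep invD ?invZ//; [exact: (wr_itg0 Hr wy).1|exact: itgZ]. Qed.

Lemma nrm_bil_cut : nrm lb (fun xi => B xi - bnl L xi * B xi) <= Cb a r * A ^+ 2 / L.
Proof.
have [s n] := bil_enorm_sq Ha Hr wy wy; have [m _] := sB.
have mD : measurable_fun setT (fun xi : plane R => B xi - bnl L xi * B xi).
  by apply: measurable_funB => //; apply: measurable_funM.
apply: (@le_trans _ _ (nrm lb (fun xi => L^-1 * (enorm xi * B xi)))).
  apply: le_nrm => //; last exact: sqZ.
  move=> xi; apply: (le_trans (bnl_tail xi (B xi) L0)).
  by rewrite !normrM (ger0_norm (enorm_ge0 _)) ger0_norm ?invr_ge0 ?(ltW L0).
by rewrite nrmZ// ger0_norm ?invr_ge0 ?(ltW L0)// mulrC ler_wpM2r ?invr_ge0 ?(ltW L0)// expr2.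
Qed.

(** As [bil] is - u . grad, one step is the first order expansion of the vorticity at the foot x - h
    u(x). *)
Lemma transport_step x : `|inv estep x - inv y (x - (h * (U x).1, h * (U x).2))| <= h * eps_err.
Proof.
have I0 := (wr_itg0 Hr wy).1; have I1 := (wr_itg1 Hr wy).1.
have I2 := (@wr_enorm_itg _ _ Hr 2 y erefl wy).
set kk := (h * _, _).
have T := inv_taylor x kk I0 I1 I2.1.
have E1 : inv estep x = inv y x + h * (inv B x - inv (fun xi => B xi - bnl L xi * B xi) x).
  by rewrite (invB x IB IbB) inv_step opprB addrCA subrr addr0.
have E2 := inv_bil Ha Hr wy x.
have cut := bil_cut x.
have Ub k : `|inv (ug a k y) x| <= (ca a + crs r) * A.
  have [Ik Hk] := wr_ka Ha Hr wy.
  have a12 : a < 1 / 2 by case/andP: Ha.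
  have [Iu Hu] := itg_ug k a12 my Ik.
  by apply: (le_trans (normr_inv x Iu)); apply: (le_trans Hu).
have c0' : 0 <= (ca a + crs r) * A.
  by apply: mulr_ge0; [exact: addr_ge0 (ca_ge0 a) (crs_ge0 r)|exact: nr_ge0].
have kk2 : enorm kk ^+ 2 <= h ^+ 2 * (2 * ((ca a + crs r) * A) ^+ 2).
  have -> : enorm kk ^+ 2 = h ^+ 2 * (inv (ug a true y) x ^+ 2 + inv (ug a false y) x ^+ 2).
    by rewrite sqr_enorm /kk /=; ring.
  apply: ler_wpM2l; first exact: sqr_ge0.
  have sqb k : inv (ug a k y) x ^+ 2 <= ((ca a + crs r) * A) ^+ 2.
    by rewrite -(real_normK (num_real (inv _ _))) ler_pXn2r ?nnegrE.
  by rewrite mulr_natl mulr2n; apply: lerD; exact: sqb.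
set I := Int _ _ in T; have I20 : 0 <= I by apply: Int_ge0 => z; rewrite mulr_ge0 ?sqr_ge0.
have tay : 5 * enorm kk ^+ 2 * I <= h * (h * (10 * (ca a + crs r) ^+ 2 * crs r * A ^+ 3)).
  apply: (@le_trans _ _ (5 * (h ^+ 2 * (2 * ((ca a + crs r) * A) ^+ 2)) * (crs r * A))).
    apply: ler_pM => //; first by rewrite mulr_ge0 ?sqr_ge0.
      by rewrite ler_wpM2l.
    exact: I2.2.
  by apply: eq_lexx; ring.
set Dt := inv (dv true y) x in T E2; set Df := inv (dv false y) x in T E2.
have -> : inv estep x - inv y (x - kk) =
  - (inv y (x - kk) - inv y x + (kk.1 * Dt + kk.2 * Df)) -
    h * inv (fun xi => B xi - bnl L xi * B xi) x.
  by rewrite E1 -/B in E2 *; rewrite E2 /kk /U /=; ring.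
apply: (le_trans (ler_normB _ _)); rewrite normrN normrM (ger0_norm h0).
by rewrite /eps_err mulrDr addrC; apply: lerD; [rewrite ler_wpM2l|exact: le_trans T tay].
Qed.

End euler_step.

(** * Discrete growth estimates *)

Section growth.
Context {R : realType}.
Implicit Types (c t h q N E I : R).

Lemma exp_grow c t h q : 0 <= q -> q * expR (c * t) * (1 + c * h) <= q * expR (c * (t + h)).
Proof.
move=> q0; have -> : c * (t + h) = c * t + c * h by ring.
rewrite expRD [leRHS]mulrA; apply: ler_wpM2l; first by rewrite mulr_ge0 ?expR_ge0.
exact: expR_ge1Dx.
Qed.

(** A relative growth rate proportional to the logarithm q is absorbed when q itself grows
    exponentially: the discrete form of y' <= c y log y. *)
Lemma exp_step q c h q' : q * (1 + c * h) <= q' -> expR q * (1 + c * q * h) <= expR q'.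
Proof.
move=> H; apply: (@le_trans _ _ (expR q * expR (c * q * h))).
  by rewrite ler_wpM2l ?expR_ge0// expR_ge1Dx.
by rewrite -expRD ler_expR; apply: le_trans H; apply: eq_lexx; ring.
Qed.

Lemma gronwall_step N N' E h c I phi : 0 <= h -> 0 <= c -> N <= phi -> 1 <= phi ->
  `|I| <= c * N -> E <= 1 -> N' <= N + h * (2 * I + E) -> N' <= phi * (1 + (2 * c + 1) * h).
Proof.
move=> h0 c0 Np p1 HI E1 /le_trans; apply.
have I1 : I <= c * phi by apply: (le_trans (ler_norm _)); apply: (le_trans HI); rewrite ler_wpM2l.
have -> : phi * (1 + (2 * c + 1) * h) = phi + h * (2 * (c * phi) + phi) by ring.
by apply: lerD => //; rewrite ler_wpM2l//; apply: lerD; [rewrite ler_wpM2l|exact: le_trans p1].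
Qed.

Lemma mul_exp_ge1 q t : 1 <= q -> 0 <= t -> 1 <= q * expR t.
Proof.
by move=> q1 t0; rewrite -[leLHS]mulr1; apply: ler_pM => //; rewrite -[leLHS]expR0 ler_expR.
Qed.

(** Provides the number of dyadic levels for the logarithmic estimates: proportional to q, and
    sufficient to beat e^q. *)
Lemma exp2_dominate : exists2 k : R, 1 <= k &
  forall q, 1 <= q -> exists2 K : nat, K%:R <= k * q & expR q <= 2 ^+ K.
Proof.
have l0 : 0 < ln (2 : R) by rewrite ln_gt0// ltr1n.
have li : 0 <= (ln (2 : R))^-1 by rewrite invr_ge0 ltW.
exists ((ln 2)^-1 + 1) => [|q q1]; first by rewrite lerDr.
have q0 : 0 <= q / ln 2 by rewrite mulr_ge0// (le_trans ler01).
have /andP[t1 t2] := truncn_itv q0.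
exists (Num.truncn (q / ln 2)).+1.
  by rewrite -natr1 mulrDl mul1r (mulrC _ q); exact: lerD.
have p2 : (2 : R) ^+ (Num.truncn (q / ln 2)).+1 \is Num.pos by rewrite posrE exprn_gt0.
rewrite -(lnK p2) ler_expR lnXn//.
by move: t2; rewrite ltr_pdivrMr// mulr_natl => /ltW.
Qed.

Lemma enorm_le_abs (x : R * R) : enorm x <= `|x.1| + `|x.2|.
Proof.
rewrite -(ler_pXn2r (ltn0Sn 1)) ?nnegrE ?addr_ge0 ?enorm_ge0//.
rewrite sqr_enorm sqrrD !real_normK ?num_real// lerD2r lerDl.
by rewrite pmulrn_lge0 ?mulr_ge0.
Qed.

Lemma enorm_le_rho (r : R) xi : 2 <= r -> enorm xi <= rho r xi.
Proof.
move=> r2; apply: le_trans (jap_le_rho xi r2); rewrite /jap.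
by have := sqr_ge0 (enorm xi - 1); have := sqr_ge0 (enorm xi); nra.
Qed.

End growth.

(** * Bounds on the iterates, uniform in the step *)

Section uniform_bound.
Context {R : realType}.
Let lb := @lb2 R.
Implicit Types (x xi z : R * R) (i j k : bool) (y : R * R -> R).
Variables (a r L h T eps : R) (n : nat).
Hypotheses (Ha : 0 < a < 1 / 2) (Hr : 3 < r) (L1 : 1 <= L) (h0 : 0 <= h).
(** A chain of constants: [N2] and [M] bound the L^2 norm and the supremum; [C4] and [q0] govern the
    Lipschitz constant; [Gm] bounds the velocity gradient and [H] the L^2 norm of the vorticity
    gradient; [C5], [C6], [p0] govern the H^r norm, bounded by [N0]. *)
Variables (A0 N2 M k2 C4 q0 Gm H C5 C6 p0 N0 : R).
Hypotheses (HN2 : 0 <= N2) (HN2' : A0 ^+ 2 + T <= N2 ^+ 2) (HM : crs r * A0 + T <= M).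
Hypotheses (k1 : 1 <= k2)
  (Hk : forall q, 1 <= q -> exists2 K : nat, K%:R <= k2 * q & expR q <= 2 ^+ K).
Hypotheses (HC4 : Clog * N2 + 64 * k2 * M + 194 <= C4) (Hq0 : 1 <= q0).
Definition qt t := q0 * expR (4 * C4 * t).
Hypotheses (HGm : C4 * qt T <= Gm) (H0 : 0 <= H).
Definition Ht t := (A0 ^+ 2 + 1) * expR ((8 * Gm + 1) * t).
Hypotheses (HH : Ht T <= H ^+ 2).
Hypotheses (HC5 : Num.sqrt cball * (N2 + 2 * k2 * H) + crs r + 1 <= C5).
Hypotheses (HC6 : 12 * Kr r ^+ 2 * C5 + 1 <= C6) (Hp0 : 1 <= p0).
Definition pt t := p0 * expR (C6 * t).
Hypotheses (HN0 : expR (pt T) <= N0).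
Hypotheses (Hn : crs r * N0 <= 2 ^+ n) (Han : 2 * a * (crs r * N0) <= 1).
Hypotheses (eps0 : 0 <= eps <= 1) (Hne : n%:R * (2 * T * eps) <= 1).
Hypotheses (Heng : h * (rhoL r L * (Cb a r * N0 ^+ 2)) ^+ 2 <= 1)
  (Heps : Cb a r * N0 ^+ 2 / L + h * (10 * (ca a + crs r) ^+ 2 * crs r * N0 ^+ 3) <= eps).

(** The induction invariant. [qt] and [pt] are logarithms of bounds on the Lipschitz constant and on
    the H^r norm; they grow exponentially because each growth rate is proportional to the logarithm
    itself. The summands t and 2 t eps collect the errors of the steps taken. *)
Definition good t y :=
  [/\ wr r y, csup L y, nrm lb y ^+ 2 <= A0 ^+ 2 + t,
    forall x, `|inv y x| <= crs r * A0 + t &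
    forall x x', `|inv y x - inv y x'| <= expR (qt t) * enorm (x - x') + 2 * t * eps] /\
  (nrm lb (fun xi => enorm xi * y xi) ^+ 2 <= Ht t /\ nr r y ^+ 2 <= expR (2 * pt t)).

Let r0 : 0 <= r. Proof. by apply/ltW/(lt_trans _ Hr). Qed.
Let a0 : 0 < a. Proof. by case/andP: Ha. Qed.
Let a12 : a < 1 / 2. Proof. by case/andP: Ha. Qed.
Let e0 : 0 <= eps. Proof. by case/andP: eps0. Qed.
Let e1 : eps <= 1. Proof. by case/andP: eps0. Qed.
Let N00 : 0 <= N0. Proof. exact: le_trans (expR_ge0 _) HN0. Qed.
Let cN0 : 0 <= crs r * N0. Proof. by rewrite mulr_ge0 ?crs_ge0. Qed.
Let k0 : 0 <= k2. Proof. exact: le_trans ler01 k1. Qed.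
Let C50 : 1 <= C5.
Proof.
apply: le_trans HC5; rewrite lerDr addr_ge0 ?crs_ge0// mulr_ge0 ?sqrtr_ge0//.
by rewrite addr_ge0// mulr_ge0// mulr_ge0.
Qed.
Let C60 : 0 <= C6.
Proof.
apply: le_trans HC6; apply: addr_ge0 => //; apply: mulr_ge0; last exact: (le_trans ler01 C50).
by apply: mulr_ge0 => //; exact: sqr_ge0.
Qed.

Section bounds_at.
Variables (t : R) (y : R * R -> R).
Hypotheses (t0 : 0 <= t) (tT : t <= T) (gy : good t y).

Let wy : wr r y. Proof. by case: gy => -[]. Qed.
Let cy : csup L y. Proof. by case: gy => -[]. Qed.
Let my := wr_meas wy.
Let M0 : 0 <= M.
Proof.
apply: le_trans HM; apply: le_trans (lerD (lexx _) tT).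
by case: gy => -[_ _ _ /(_ 0) h1 _] _; exact: le_trans h1.
Qed.
Let C40 : 194 <= C4.
Proof.
apply: le_trans HC4; rewrite lerDr addr_ge0//.
  by rewrite mulr_ge0// addr_ge0 ?nrm_ge0.
by rewrite mulr_ge0// mulr_ge0.
Qed.
Let C4_0 : 0 <= C4. Proof. exact: (le_trans (ler0n _ 194) C40). Qed.
Let C4p : 0 <= 4 * C4. Proof. by rewrite mulr_ge0. Qed.

Lemma good_nr : nr r y <= N0.
Proof.
apply: le_trans HN0; case: gy => _ [_ b].
rewrite -(ler_pXn2r (ltn0Sn 1)) ?nnegrE ?nr_ge0 ?expR_ge0//; apply: (le_trans b).
rewrite -expRM_natl ler_expR; rewrite ler_wpM2l// /pt ler_wpM2l ?(le_trans ler01)// ler_expR.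
exact: ler_wpM2l.
Qed.

Lemma good_N2 : nrm lb y <= N2.
Proof.
case: gy => -[_ _ b _ _] _.
rewrite -(ler_pXn2r (ltn0Sn 1)) ?nnegrE ?nrm_ge0//; apply: (le_trans b).
by apply: le_trans HN2'; rewrite lerD2l.
Qed.

Let l1 : Int lb (fun xi => enorm xi * `|y xi|) <= crs r * N0.
Proof. by apply: le_trans (wr_itg1 Hr wy).2 _; rewrite ler_wpM2l ?crs_ge0// good_nr. Qed.

Let al1 : 2 * a * Int lb (fun xi => enorm xi * `|y xi|) <= 1.
Proof. by apply: le_trans Han; rewrite ler_wpM2l// mulr_ge0// ltW. Qed.

Let qt1 : 1 <= qt t.
Proof.
by apply: mul_exp_ge1 => //; rewrite mulr_ge0. Qed.

(** [log_estimate] with K proportional to qt t, so that 2^K beats the Lipschitz constant exp (qt t).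
    The number 194 = 64 (2 + 1) + 2 collects the four terms that the choices of K, n, eps and alpha
    make bounded. *)
Lemma good_grad i k x : `|inv (dv i (ug a k y)) x| <= C4 * qt t.
Proof.
case: gy => -[_ _ _ bM bG] _.
have [K K1 K2] := Hk qt1.
have bM' z : `|inv y z| <= M.
  by apply: (le_trans (bM z)); apply: le_trans HM; rewrite lerD2l.
have := log_estimate Ha Hr wy bM' bG (expR_ge0 _) (mulr_ge0 (mulr_ge0 (ler0n _ 2) t0) e0) i k x K n.
move=> /le_trans; apply.
have p2 (m : nat) : 0 < 2 ^+ m :> R by rewrite exprn_gt0.
have b1 : Clog * nrm lb y <= Clog * N2.
  by rewrite ler_wpM2l ?good_N2// addr_ge0 ?nrm_ge0.
have b2 : K%:R * M <= k2 * qt t * M by rewrite ler_wpM2r.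
have b3 : 2 * expR (qt t) / 2 ^+ K <= 2.
  by rewrite ler_pdivrMr// ler_wpM2l.
have b4 : n%:R * (2 * t * eps) <= 1.
  by apply: le_trans Hne; rewrite ler_wpM2l// ler_wpM2r// ler_wpM2l.
have b5 : (2 ^+ (K + n))^-1 * Int lb (fun xi => enorm xi * `|y xi|) <= 1.
  rewrite mulrC ler_pdivrMr// mul1r; apply: (le_trans l1); apply: (le_trans Hn).
  by rewrite ler_eXn2l ?ltr1n// leq_addl.
rewrite [X in _ + X]mulrDl.
have b6 : Clog * N2 + 64 * k2 * M + 194 <= C4 := HC4.
have b7 : (Clog * N2 + 194) <= (Clog * N2 + 194) * qt t.
  by rewrite ler_peMr// addr_ge0// mulr_ge0// addr_ge0 ?nrm_ge0.
have b8 := ler_wpM2r (le_trans ler01 qt1) b6.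
apply: (@le_trans _ _ (Clog * N2 + 194 + 64 * (k2 * qt t * M))).
  apply: (@le_trans _ _ (Clog * N2 + 64 * (k2 * qt t * M + 2 + 1) + (1 + 1))).
    apply: lerD; last exact: lerD.
    apply: lerD; first exact: b1.
    by rewrite ler_wpM2l//; apply: lerD => //; exact: lerD.
  by apply: eq_lexx; ring.
apply: le_trans b8; move: b7.
set Z := Clog * N2; move=> b7.
have -> : (Z + 64 * k2 * M + 194) * qt t = (Z + 194) * qt t + 64 * (k2 * qt t * M) by ring.
by rewrite lerD2r.
Qed.

Let I2 k : itg lb (fun z => enorm z ^+ 2 * ug a k y z).
Proof.
have [J1 _] := wr_itg1 Hr wy; have [J2 _] := @wr_enorm_itg _ _ Hr 2 y erefl wy.
have P0 z : 0 <= enorm z + 2 * a * enorm z ^+ 2.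
  by rewrite addr_ge0 ?enorm_ge0// mulr_ge0 ?sqr_ge0// mulr_ge0// ltW.
have J : itg lb (fun z => (enorm z + 2 * a * enorm z ^+ 2) * y z).
  have -> : (fun z => (enorm z + 2 * a * enorm z ^+ 2) * y z) =
     (fun z => enorm z * y z + 2 * a * (enorm z ^+ 2 * y z)) by apply/funext => z; ring.
  by apply: itgD => //; exact: itgZ.
have m : measurable_fun setT (fun z : plane R => enorm z ^+ 2 * ug a k y z).
  apply: measurable_funM; last exact: measurable_ug.
  by apply: (measurable_funX 2); exact: measurable_enorm.
have [z|//] := itg_opp_le m (g := fun z => (enorm z + 2 * a * enorm z ^+ 2) * `|y z|) _ (itg_wabs P0 J).
rewrite normrM ger0_norm ?sqr_ge0// enormN.
have := normr_ug k y z a12 => /(ler_wpM2l (sqr_ge0 (enorm z)))/le_trans; apply.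
rewrite mulrA ler_wpM2r//.
have := enorm_ka_le (- z) Ha; rewrite enormN => /(ler_wpM2l (enorm_ge0 z)).
by rewrite mulrA -expr2 mulrDr mulr1 mulrCA -expr2.
Qed.

Let I1 k : itg lb (fun z => enorm z * ug a k y z).
Proof.
have [J _] := wr_enorm_ka Ha Hr wy.
have kk z : 0 <= enorm z * ka a z by rewrite mulr_ge0 ?enorm_ge0 ?ka_ge0.
have m : measurable_fun setT (fun z : plane R => enorm z * ug a k y z).
  by apply: measurable_funM; [exact: measurable_enorm|exact: measurable_ug].
have [z|//] := itg_opp_le m (g := fun z => enorm z * ka a z * `|y z|) _ (itg_wabs kk J).
rewrite normrM ger0_norm ?enorm_ge0// -mulrA enormN ler_wpM2l ?enorm_ge0//.
exact: normr_ug.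
Qed.

Lemma good_vel_lip k x x' : `|inv (ug a k y) x - inv (ug a k y) x'| <=
  2 * (C4 * qt t) * enorm (x - x').
Proof.
by apply: inv_lip_grad; [exact: (wr_ug Ha Hr wy)|exact: I1|exact: I2|move=> i z; exact: good_grad].
Qed.

(** With 2^K above exp (pt t), hence above the H^r norm, the tail in [L1_dyadic] is at most [crs r];
    only the logarithm of that norm remains, through K. *)
Lemma good_L1 : Int lb (fun xi => (1 + 2 * a * enorm xi) * `|y xi|) <= C5 * pt t.
Proof.
have p1 : 1 <= pt t.
  by apply: mul_exp_ge1 => //; rewrite mulr_ge0.
have [I0 _] := wr_itg0 Hr wy; have [J1 _] := wr_itg1 Hr wy.
have J1' := itg_wabs (@enorm_ge0 R) J1.
have -> : Int lb (fun xi => (1 + 2 * a * enorm xi) * `|y xi|) =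
   Int lb (fun xi => `|y xi|) + 2 * a * Int lb (fun xi => enorm xi * `|y xi|).
  rewrite -IntZ// -IntD; [|exact: itg_abs|exact: itgZ].
  by apply: eq_Int => xi; ring.
have [K K1 K2] := Hk p1.
have [_ [bH bn]] := gy.
have D := L1_dyadic Hr wy K.
have bH' : nrm lb (fun xi => enorm xi * y xi) <= H.
  rewrite -(ler_pXn2r (ltn0Sn 1)) ?nnegrE ?nrm_ge0//; apply: (le_trans bH).
  apply: le_trans HH; rewrite /Ht ler_wpM2l ?addr_ge0 ?sqr_ge0// ler_expR ler_wpM2l//.
  rewrite addr_ge0// mulr_ge0//; apply: le_trans HGm.
  by rewrite !mulr_ge0 ?expR_ge0//; exact: (le_trans ler01 Hq0).
have bt : (2 ^+ K)^-1 * Int lb (fun xi => enorm xi * `|y xi|) <= crs r.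
  rewrite mulrC ler_pdivrMr ?exprn_gt0//; apply: (le_trans (wr_itg1 Hr wy).2).
  rewrite ler_wpM2l ?crs_ge0//; apply: le_trans K2.
  by rewrite -(ler_pXn2r (ltn0Sn 1)) ?nnegrE ?nr_ge0 ?expR_ge0// -expRM_natl.
have bc : Num.sqrt cball * (nrm lb y + 2 * K%:R * nrm lb (fun xi => enorm xi * y xi)) <=
    Num.sqrt cball * (N2 + 2 * k2 * H) * pt t.
  rewrite -[leRHS]mulrA; apply: ler_wpM2l; first exact: sqrtr_ge0.
  rewrite [leRHS]mulrDl; apply: lerD.
    by apply: (le_trans good_N2); rewrite ler_peMr.
  rewrite -!mulrA ler_wpM2l//; apply: (@le_trans _ _ (k2 * pt t * H)).
    by apply: ler_pM => //; exact: nrm_ge0.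
  by apply: eq_lexx; ring.
apply: (@le_trans _ _ ((Num.sqrt cball * (N2 + 2 * k2 * H) + crs r + 1) * pt t)).
  rewrite [leRHS]mulrDl [X in _ <= X + _]mulrDl mul1r; apply: lerD; last exact: (le_trans al1 p1).
  apply: (le_trans D); apply: lerD => //; apply: (le_trans bt).
  by rewrite ler_peMr ?crs_ge0.
by rewrite ler_wpM2r// (le_trans ler01).
Qed.

Let A := nr r y.
Let A00 : 0 <= A. Proof. exact: nr_ge0. Qed.

Lemma good_eng_err : eng_err a r L h y <= 1.
Proof.
apply: le_trans Heng; rewrite /eng_err ler_wpM2l//.
have C0 : 0 <= Cb a r by rewrite mulr_ge0 ?sqr_ge0.
have R0 : 0 <= rhoL r L by exact: powR_ge0.
have P0 (u : R) : 0 <= rhoL r L * (Cb a r * u ^+ 2).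
  by apply: mulr_ge0 => //; apply: mulr_ge0 => //; exact: sqr_ge0.
rewrite ler_pXn2r ?nnegrE//; apply: ler_wpM2l => //; apply: ler_wpM2l => //.
by rewrite ler_pXn2r ?nnegrE// good_nr.
Qed.

Lemma good_eps_err : eps_err a r L h y <= eps.
Proof.
have C0 : 0 <= Cb a r by rewrite mulr_ge0 ?sqr_ge0.
apply: le_trans Heps; apply: lerD.
  rewrite ler_wpM2r ?invr_ge0 ?(le_trans ler01)// ler_wpM2l//.
  by rewrite ler_pXn2r ?nnegrE// good_nr.
rewrite ler_wpM2l// ler_wpM2l.
  by [].
  by rewrite mulr_ge0 ?crs_ge0// mulr_ge0 ?sqr_ge0.
by rewrite ler_pXn2r ?nnegrE// good_nr.
Qed.

Let Y := estep a L h y.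
Let U x : R * R := (inv (ug a true y) x, inv (ug a false y) x).
Let foot x := x - (h * (U x).1, h * (U x).2).
Let tr x : `|inv Y x - inv y (foot x)| <= h * eps.
Proof.
apply: (le_trans (transport_step Ha Hr L1 h0 wy x)).
by rewrite ler_wpM2l// good_eps_err.
Qed.

Let step_sup x : `|inv Y x| <= crs r * A0 + (t + h).
Proof.
case: gy => -[_ _ _ bM _] _.
have he : h * eps <= h by rewrite ler_piMr.
have := ler_normD (inv Y x - inv y (foot x)) (inv y (foot x)); rewrite subrK.
move=> /le_trans; apply; apply: (le_trans (lerD (le_trans (tr x) he) (bM (foot x)))).
by apply: eq_lexx; ring.
Qed.

Let foot_lip x x' : enorm (foot x - foot x') <= (1 + 4 * C4 * qt t * h) * enorm (x - x').
Proof.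
pose d : R * R := (h * ((U x).1 - (U x').1), h * ((U x).2 - (U x').2)).
have -> : foot x - foot x' = (x - x') + - d.
  by rewrite /foot /d; congr pair; rewrite /=; ring.
apply: (le_trans (ler_enormD _ _)); rewrite enormN mulrDl mul1r lerD2l.
apply: (le_trans (enorm_le_abs _)); rewrite /d /= !normrM (ger0_norm h0) -mulrDr.
apply: (@le_trans _ _ (h * (2 * (C4 * qt t) * enorm (x - x') + 2 * (C4 * qt t) * enorm (x - x')))).
  by rewrite ler_wpM2l//; apply: lerD; exact: good_vel_lip.
by apply: eq_lexx; ring.
Qed.

Let qt_step : qt t * (1 + 4 * C4 * h) <= qt (t + h).
Proof. by apply: exp_grow; apply: le_trans Hq0. Qed.

Let dist_tri4 (p q p' q' : R) : `|p - q| <= `|p - p'| + `|p' - q'| + `|q - q'|.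
Proof.
rewrite (distrC q); apply: le_trans (ler_distD q' _ _) _.
by rewrite lerD2r ler_distD.
Qed.

(** Compare through the two feet. A transport error occurs at each of the two points, whence the
    factor 2 in 2 t eps. *)
Let step_lip x x' : `|inv Y x - inv Y x'| <=
  expR (qt (t + h)) * enorm (x - x') + 2 * (t + h) * eps.
Proof.
case: gy => -[_ _ _ _ bG] _.
have h1 := bG (foot x) (foot x'); have h2 := tr x; have h3 := tr x'.
have h4 := ler_wpM2l (expR_ge0 (qt t)) (foot_lip x x').
have h5 := ler_wpM2r (enorm_ge0 (x - x')) (exp_step qt_step).
rewrite mulrA in h4.
have h6 : `|inv Y x - inv Y x'| <= `|inv Y x - inv y (foot x)| +
   `|inv y (foot x) - inv y (foot x')| + `|inv Y x' - inv y (foot x')|.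
  exact: dist_tri4.
have -> : 2 * (t + h) * eps = 2 * t * eps + (h * eps + h * eps) by ring.
apply: (le_trans h6).
apply: (le_trans (lerD (lerD h2 (le_trans h1 (lerD (le_trans h4 h5) (lexx _)))) h3)).
by apply: eq_lexx; ring.
Qed.

(** The weight 1 is symmetric, so only the quadratic Euler defect is left. *)
Let step_N2 : nrm lb Y ^+ 2 <= A0 ^+ 2 + (t + h).
Proof.
have [||I E] := @energy_step _ a r L h y Ha Hr L1 h0 wy cy (fun=> 1).
- exact: measurable_cst.
- by move=> xi; rewrite normr1 rho_ge1.
rewrite (tform_sym0 _ _ I)// in E.
have EE (f : R * R -> R) : (fun xi => 1 * f xi) = f by apply/funext => z; rewrite mul1r.
rewrite !EE mulr0 add0r in E; apply: (le_trans E).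
case: gy => -[_ _ b _ _] _; rewrite addrA; apply: lerD => //.
by rewrite ler_piMr// good_eng_err.
Qed.

Let step_H : nrm lb (fun xi => enorm xi * Y xi) ^+ 2 <= Ht (t + h).
Proof.
have G0 : 0 <= C4 * qt t by rewrite mulr_ge0// (le_trans ler01 qt1).
have qT : qt t <= qt T.
  by rewrite /qt ler_wpM2l ?(le_trans ler01)// ler_expR ler_wpM2l.
have Gm1 : C4 * qt t <= Gm by apply: le_trans HGm; exact: ler_wpM2l.
have [||_ E] := @energy_step _ a r L h y Ha Hr L1 h0 wy cy (fun xi => enorm xi).
- exact: measurable_enorm.
- by move=> xi; rewrite ger0_norm ?enorm_ge0// enorm_le_rho// ltW// (lt_trans _ Hr)// ltr_nat.
have [_ B] := enstrophy_estimate Ha Hr wy (fun i k x => good_grad i k x) (fun i k => itg_dug Ha Hr wy i k).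
have [_ [bH _]] := gy.
have c8 : 8 * Gm + 1 = 2 * (4 * Gm) + 1 by ring.
have Ht1 : 1 <= Ht t.
  by apply: mul_exp_ge1; [rewrite lerDr sqr_ge0|rewrite mulr_ge0// addr_ge0// mulr_ge0// (le_trans G0)].
have G4 : 0 <= 4 * Gm by rewrite mulr_ge0// (le_trans G0).
have B' : `|Int (lb \x lb)%E (tform a (fun p => enorm p.1 ^+ 2) y y)| <=
    4 * Gm * nrm lb (fun xi => enorm xi * y xi) ^+ 2.
  by apply: (le_trans B); rewrite ler_wpM2r ?sqr_ge0// ler_wpM2l.
apply: (le_trans (gronwall_step h0 G4 bH Ht1 B' good_eng_err E)).
by rewrite -c8; apply: exp_grow; rewrite addr_ge0 ?sqr_ge0.
Qed.

(** By [good_L1] the rate in the commutator estimate is a multiple of pt t, the logarithm of the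
    norm bound, so [exp_step] closes the induction. *)
Let step_nr : nr r Y ^+ 2 <= expR (2 * pt (t + h)).
Proof.
have rle xi : `|rho r xi| <= rho r xi by rewrite ger0_norm// ltW// rho_gt0.
have [I E] := energy_step Ha Hr L1 h0 wy cy (measurable_rho r) rle.
have r1 : 1 < r by apply: lt_trans Hr; rewrite ltr1n.
have WE z : Wt r 1 1 (enorm z) = rho r z ^+ 2.
  by rewrite /Wt mulfV ?mulr1 ?sqr_rho// gt_eqF// ltr_wpDr ?sqr_ge0.
have WF : (fun p : plane R * plane R => Wt r 1 1 (enorm p.1)) = (fun p => rho r p.1 ^+ 2).
  by apply/funext => p; rewrite WE.
have sE z : Num.sqrt (Wt r 1 1 (enorm z)) = rho r z.
  by rewrite WE sqrtr_sqr ger0_norm// ltW// rho_gt0.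
have l01 := @ler01 R; have lt01 := @ltr01 R.
have B := @tame_estimate _ a (Kr r) (Wt r 1 1) Ha (Kr_ge1 r1) (fun (x : R) _ => Wt_ge0 r lt01 l01 x)
  (Wt_mono r1 lt01 l01 (lexx 1)) (Wt_double r1 lt01 l01) (Wt_diff r1 lt01 l01 (lexx 1)).
have Is : itg lb (fun xi => (1 + 2 * a * enorm xi) * y xi).
  have -> : (fun xi => (1 + 2 * a * enorm xi) * y xi) =
    (fun xi => y xi + 2 * a * (enorm xi * y xi)) by apply/funext => z; ring.
  by apply: itgD; [exact: (wr_itg0 Hr wy).1|apply: itgZ; exact: (wr_itg1 Hr wy).1].
have swy : (fun xi => Num.sqrt (Wt r 1 1 (enorm xi)) * y xi) = (fun xi => rho r xi * y xi).
  by apply/funext => xi; rewrite sE.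
have {}B := B y; rewrite WF swy in B.
have {B}B := B wy Is I.
have p1 : 1 <= pt t.
  by apply: mul_exp_ge1 => //; rewrite mulr_ge0.
pose c := 6 * Kr r ^+ 2 * (C5 * pt t).
have K0 : 0 <= 6 * Kr r ^+ 2 by rewrite mulr_ge0 ?sqr_ge0.
have c0 : 0 <= c by rewrite mulr_ge0// mulr_ge0//; [apply: le_trans C50|apply: le_trans p1].
have B' : `|Int (lb \x lb)%E (tform a (fun p => rho r p.1 ^+ 2) y y)| <=
    c * nrm lb (fun xi => rho r xi * y xi) ^+ 2.
  by apply: (le_trans B); rewrite ler_wpM2r ?sqr_ge0// ler_wpM2l// good_L1.
have [_ [_ bn]] := gy.
have ep1 : 1 <= expR (2 * pt t).
  by rewrite -[leLHS]expR0 ler_expR mulr_ge0// (le_trans _ p1).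
apply: (le_trans (gronwall_step h0 c0 bn ep1 B' good_eng_err E)).
have pp' : 2 * pt t * (1 + C6 * h) <= 2 * pt (t + h).
  have := @exp_grow R C6 t h p0 (le_trans ler01 Hp0); rewrite -/(pt t) -/(pt (t + h)).
  by move=> /(ler_wpM2l (ler0n _ 2)); apply: le_trans; apply: eq_lexx; ring.
apply: le_trans (exp_step pp'); rewrite ler_wpM2l ?expR_ge0// lerD2l ler_wpM2r//.
rewrite /c; set K2 := Kr r ^+ 2.
have b1 : (12 * K2 * C5 + 1) * pt t <= C6 * pt t by rewrite ler_wpM2r// (le_trans _ p1).
have b2 : 0 <= C6 * pt t by rewrite mulr_ge0// (le_trans _ p1).
have -> : 2 * (6 * K2 * (C5 * pt t)) + 1 = 12 * K2 * C5 * pt t + 1 by ring.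
apply: (@le_trans _ _ ((12 * K2 * C5 + 1) * pt t)); first by rewrite [leRHS]mulrDl mul1r; apply: lerD.
apply: (le_trans b1); have -> : C6 * (2 * pt t) = C6 * pt t + C6 * pt t by ring.
by rewrite lerDl.
Qed.

Lemma good_step : good (t + h) (estep a L h y).
Proof.
split; last by split; [exact: step_H|exact: step_nr].
split; [exact: wr_step|exact: csup_step|exact: step_N2|exact: step_sup|exact: step_lip].
Qed.

End bounds_at.
End uniform_bound.

(** * The a priori bound for the Euler scheme *)

Section euler_bound.
Context {R : realType}.
Let lb := @lb2 R.
Implicit Types (x xi z : R * R) (v y : R * R -> R).

Definition euler (a L h : R) v (j : nat) := iter j (estep a L h) (fun xi => bnl L xi * v xi).

Lemma wr_bnl (r L : R) v : wr r v ->
  wr r (fun xi => bnl L xi * v xi) /\ nr r (fun xi => bnl L xi * v xi) <= nr r v.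
Proof.
move=> wv; have mv := wr_meas wv.
have m : measurable_fun setT (fun xi : plane R => rho r xi * (bnl L xi * v xi)).
  apply: measurable_funM; first exact: measurable_rho.
  by apply: measurable_funM => //; exact: measurable_bnl.
have le xi : `|rho r xi * (bnl L xi * v xi)| <= `|rho r xi * v xi|.
  rewrite !normrM; apply: ler_wpM2l => //; apply: ler_piMl => //.
  by rewrite ger0_norm ?bnl_ge0// bnl_le1.
by split; [exact: (sq_le m le (sq_abs wv))|exact: (le_nrm m le wv)].
Qed.

Lemma csup_cut (L : R) v : csup L (fun xi => bnl L xi * v xi).
Proof. by move=> xi H; rewrite /bnl leNgt H mul0r. Qed.

Lemma rhoL_ge1 (r L : R) : 0 <= r -> 1 <= rhoL r L.
Proof.
move=> r0; rewrite -[leLHS](powRr0 (1 + L ^+ 2)); apply: ler_powR; last by rewrite divr_ge0.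
by rewrite lerDl sqr_ge0.
Qed.

Section init.
Variables (r L eps C4 q0 Gm C6 p0 : R) (v : R * R -> R).
Hypotheses (Hr : 3 < r) (wv : wr r v).
Let A0 := nr r v.
Hypotheses (Hq0 : 2 * (crs r * A0) <= expR q0) (Hp0 : A0 <= expR p0).

Lemma good_init : good r L eps A0 C4 q0 Gm C6 p0 0 (fun xi => bnl L xi * v xi).
Proof.
have r0 : 0 <= r by apply/ltW/(lt_trans _ Hr).
have [wy ny] := wr_bnl L wv; set y := fun xi => _.
have [I0 b0] := wr_itg0 Hr wy; have [I1 b1] := wr_itg1 Hr wy; have my := wr_meas wy.
have I2 := (@wr_enorm_itg _ _ Hr 2 y erefl wy).1.
have cA : crs r * nr r y <= crs r * A0 by rewrite ler_wpM2l ?crs_ge0.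
have sq_mono u : 0 <= u -> u <= A0 -> u ^+ 2 <= A0 ^+ 2.
  by move=> u0 uA; rewrite ler_pXn2r ?nnegrE ?(le_trans u0).
split.
  split => //; first exact: csup_cut.
  - rewrite addr0; apply: sq_mono; first exact: nrm_ge0.
    exact: le_trans (wr_sq0 r0 wy).2 ny.
  - move=> x; rewrite addr0; apply: (le_trans (normr_inv x I0)).
    exact: le_trans b0 cA.
  move=> x x'; rewrite mulr0 mul0r addr0 /qt mulr0 expR0 mulr1.
  apply: (le_trans (@inv_lip_grad R y (crs r * A0) x x' I0 I1 I2 _)).
    move=> i z; have [Id Hd] := itg_dv i my I1.
    by apply: (le_trans (normr_inv z Id)); apply: (le_trans Hd); exact: le_trans b1 cA.
  by rewrite ler_wpM2r ?enorm_ge0.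
rewrite /Ht /pt !mulr0 expR0 !mulr1; split.
  apply: (@le_trans _ _ (A0 ^+ 2)); last by rewrite lerDl.
  apply: sq_mono; first exact: nrm_ge0.
  exact: le_trans (wr_enorm_sq Hr wy).2 ny.
apply: (@le_trans _ _ (A0 ^+ 2)); first by apply: sq_mono => //; exact: nr_ge0.
by rewrite expRM_natl ler_pXn2r ?nnegrE ?nr_ge0 ?expR_ge0.
Qed.

End init.

(* The bound [N0] and the threshold [a0] are chosen before [a]: only the admissible
   discretization parameters depend on [a]. *)
Lemma euler_bound (r T : R) v : 3 < r -> 0 <= T -> wr r v ->
  exists N0 a0 : R, [/\ 0 <= N0, 0 < a0, a0 <= 1 / 2 & forall a, 0 < a < a0 ->
    exists2 delta : R, 0 < delta & forall L h, 1 <= L -> 0 <= h -> L^-1 <= delta ->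
      h * rhoL r L ^+ 2 <= delta -> forall j : nat, j%:R * h <= T ->
      [/\ wr r (euler a L h v j), csup L (euler a L h v j) & nr r (euler a L h v j) <= N0]].
Proof.
move=> Hr T0 wv; have r0 : 0 <= r by apply/ltW/(lt_trans _ Hr).
have [k2 k1 Hk] := @exp2_dominate R.
pose A0 := nr r v; have A00 : 0 <= A0 by exact: nr_ge0.
pose N2 := Num.sqrt (A0 ^+ 2 + T); pose M := crs r * A0 + T.
have sT : 0 <= A0 ^+ 2 + T by rewrite addr_ge0 ?sqr_ge0.
have HN2' : A0 ^+ 2 + T <= N2 ^+ 2 by rewrite (sqr_sqrtr sT) lexx.
pose C4 := @Clog R * N2 + 64 * k2 * M + 194.
pose q0 := 1 + 2 * (crs r * A0); pose Gm := C4 * qt C4 q0 T.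
pose H := Num.sqrt (Ht A0 Gm T).
have HH : Ht A0 Gm T <= H ^+ 2.
  by rewrite sqr_sqrtr ?lexx// mulr_ge0 ?expR_ge0// addr_ge0 ?sqr_ge0.
pose C5 := Num.sqrt (@cball R) * (N2 + 2 * k2 * H) + crs r + 1.
pose C6 := 12 * Kr r ^+ 2 * C5 + 1; pose p0 := 1 + A0; pose N0 := expR (pt C6 p0 T).
have cA0 : 0 <= crs r * A0 by rewrite mulr_ge0 ?crs_ge0.
have Hq0 : 1 <= q0 by rewrite lerDl mulr_ge0.
have Hp0 : 1 <= p0 by rewrite lerDl.
have N00 : 0 <= N0 by exact: expR_ge0.
have cN0 : 0 <= crs r * N0 by rewrite mulr_ge0 ?crs_ge0.
have [n _ En] : exists2 n : nat, n%:R <= k2 * (1 + crs r * N0) & expR (1 + crs r * N0) <= 2 ^+ n.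
  by apply: Hk; rewrite lerDl.
have Hn : crs r * N0 <= 2 ^+ n.
  by apply: le_trans En; apply: le_trans (expR_ge1Dx _); rewrite addrA lerDr.
pose eps := (1 + n%:R * (2 * T))^-1.
have nT : 0 <= n%:R * (2 * T) by rewrite mulr_ge0// mulr_ge0.
have e0 : 0 < eps by rewrite invr_gt0 ltr_wpDr.
have e01 : 0 <= eps <= 1 by rewrite (ltW e0) /= invf_le1 ?lerDl// ltr_wpDr.
have Hne : n%:R * (2 * T * eps) <= 1.
  by rewrite mulrA ler_pdivrMr ?mul1r ?lerDr// ltr_wpDr.
have d0 : 0 < 2 * (1 + crs r * N0) by rewrite mulr_gt0// ltr_wpDr.
(* The threshold is what 2 a crs N0 <= 1 requires; adding 1 keeps it at most 1 / 2. *)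
exists N0, (2 * (1 + crs r * N0))^-1; split => //; first by rewrite invr_gt0.
  by rewrite div1r lef_pV2 ?posrE// ler_peMr// lerDl.
move=> a /andP[a0 a1].
have Han : 2 * a * (crs r * N0) <= 1.
  apply: (@le_trans _ _ (2 * (1 + crs r * N0) * a)).
    rewrite mulrAC ler_wpM2r ?(ltW a0)//; by apply: ler_wpM2l => //; rewrite lerDr.
  by rewrite -ler_pdivlMl// mulr1 ltW.
have Ha : 0 < a < 1 / 2.
  by rewrite a0 (lt_le_trans a1)// div1r lef_pV2 ?posrE// ler_peMr// lerDl.
pose X1 := Cb a r * N0 ^+ 2; pose X2 := 10 * (ca a + crs r) ^+ 2 * crs r * N0 ^+ 3.
have X10 : 0 <= X1 by rewrite mulr_ge0 ?sqr_ge0// mulr_ge0 ?sqr_ge0.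
have X20 : 0 <= X2.
  by apply: mulr_ge0; rewrite ?exprn_ge0//; apply: mulr_ge0; rewrite ?crs_ge0// mulr_ge0 ?sqr_ge0.
(* The inverse of D has to control two errors: X1^2 stands for the energy defect, (X1 + X2) / eps
   for the transport defect. Both contain [ca a], so the admissible step depends on alpha. *)
pose D := 1 + X1 ^+ 2 + (X1 + X2) / eps.
have XE : 0 <= (X1 + X2) / eps by rewrite divr_ge0 ?addr_ge0// ltW.
have D0 : 0 < D by rewrite ltr_wpDr// ltr_wpDr ?sqr_ge0.
exists D^-1; first by rewrite invr_gt0.
move=> L h L1 h0 Ld hd.
have R1 := rhoL_ge1 L r0.
have hD : h <= D^-1.
  apply: le_trans hd; apply: ler_peMr => //.
  by rewrite expr2; have := ler_pM ler01 ler01 R1 R1; rewrite mulr1.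
have Heng : h * (rhoL r L * X1) ^+ 2 <= 1.
  have -> : h * (rhoL r L * X1) ^+ 2 = h * rhoL r L ^+ 2 * X1 ^+ 2 by ring.
  apply: (@le_trans _ _ (D^-1 * X1 ^+ 2)); first by rewrite ler_wpM2r ?sqr_ge0.
  by rewrite mulrC ler_pdivrMr// mul1r /D -addrA addrCA lerDl addr_ge0.
have Heps : X1 / L + h * X2 <= eps.
  apply: (@le_trans _ _ (X1 * D^-1 + D^-1 * X2)).
    by apply: lerD; [rewrite ler_wpM2l|rewrite ler_wpM2r].
  rewrite (mulrC D^-1) -mulrDl ler_pdivrMr// mulrC -ler_pdivrMr//.
  by rewrite /D lerDr addr_ge0 ?sqr_ge0.
have G j : j%:R * h <= T -> good r L eps A0 C4 q0 Gm C6 p0 (j%:R * h) (euler a L h v j).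
  elim: j => [_|j IH].
    rewrite mul0r; apply: good_init => //.
      by apply: le_trans (expR_ge1Dx _); rewrite /q0 addrA lerDr.
    by apply: le_trans (expR_ge1Dx _); rewrite /p0 addrA lerDr.
  rewrite -natr1 mulrDl mul1r => jT.
  have jT' : j%:R * h <= T by apply: le_trans jT; rewrite lerDl.
  have jh0 : 0 <= j%:R * h by rewrite mulr_ge0.
  exact: (good_step Ha Hr L1 h0 (sqrtr_ge0 _) HN2' (lexx M) k1 Hk (lexx C4) Hq0
    (lexx Gm) (sqrtr_ge0 _) HH (lexx C5) (lexx C6) Hp0 (lexx N0) Hn Han e01 Hne Heng Heps
    jh0 jT' (IH jT')).
move=> j jT; have gj := G _ jT; have jh0 : 0 <= j%:R * h by rewrite mulr_ge0.
split; [by case: gj => -[]|by case: gj => -[]|].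
exact: (good_nr (sqrtr_ge0 _) k1 (sqrtr_ge0 _) (lexx C5) (lexx C6) Hp0 (lexx N0) jT gj).
Qed.

End euler_bound.

(** * Comparison of two schemes over one step *)

Section difference_step.
Context {R : realType}.
Let lb := @lb2 R.
Implicit Types (x xi z : R * R).

Lemma discrete_gronwall (u : nat -> R) (h c E : R) (n : nat) : 0 <= h -> 0 <= c -> 0 <= E ->
  0 <= u 0 -> (forall k, (k < n)%N -> u k.+1 <= u k * (1 + h * c) + h * E) ->
  forall k, (k <= n)%N -> u k <= (u 0 + k%:R * h * E) * expR (c * (k%:R * h)).
Proof.
move=> h0 c0 E0 u0 H; elim=> [_|k IH kn]; first by rewrite !mul0r mulr0 expR0 mulr1 addr0.
apply: (le_trans (H k kn)).
have e1 : 1 + h * c <= expR (h * c) by exact: expR_ge1Dx.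
have X : c * (k.+1%:R * h) = c * (k%:R * h) + h * c by rewrite -natr1; ring.
rewrite X expRD mulrA.
have g0 : 0 <= 1 + h * c by rewrite addr_ge0// mulr_ge0.
apply: (@le_trans _ _ ((u 0 + k%:R * h * E) * expR (c * (k%:R * h)) * expR (h * c) + h * E)).
  rewrite lerD2r; apply: (le_trans (ler_wpM2r g0 (IH (ltnW kn)))); apply: ler_wpM2l => //.
  by rewrite mulr_ge0 ?expR_ge0// addr_ge0// !mulr_ge0.
have -> : (u 0 + k.+1%:R * h * E) * expR (c * (k%:R * h)) * expR (h * c) =
  (u 0 + k%:R * h * E) * expR (c * (k%:R * h)) * expR (h * c) +
  h * E * (expR (c * (k%:R * h)) * expR (h * c)) by rewrite -natr1; ring.
rewrite lerD2l; apply: ler_peMr; first by rewrite mulr_ge0.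
rewrite -expRD -[leLHS]expR0 ler_expR addr_ge0//; rewrite ?mulr_ge0//.
Qed.

Variables (a r L L' h N eta : R) (Y y z : R * R -> R).
Hypotheses (Ha : 0 < a < 1 / 2) (Hr : 3 < r) (L1 : 1 <= L) (h0 : 0 <= h).
Hypotheses (wY : wr r Y) (wy : wr r y) (wz : wr r z) (cY : csup L' Y) (cz : csup L' z).
Hypotheses (NY : nr r Y <= N) (Ny : nr r y <= N) (Nz : nr r (fun xi => z xi - y xi) <= eta).

Let r0 : 0 <= r. Proof. by apply/ltW/(lt_trans _ Hr). Qed.
Let e xi := Y xi - z xi.
Let g xi := z xi - y xi.
Let we : wr r e. Proof. have := wrD wY (wrZ (-1) wz); congr wr; apply/funext => xi; rewrite /e; ring. Qed.
Let wg : wr r g. Proof. have := wrD wz (wrZ (-1) wy); congr wr; apply/funext => xi; rewrite /g; ring. Qed.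
Let se := (wr_sq0 r0 we).1.
Let B f := bil a f f.
Let F xi := bnl L' xi * B Y xi - bnl L xi * B y xi.
Let N0 : 0 <= N. Proof. exact: le_trans (nr_ge0 _ _) NY. Qed.
Let C := Cb a r.
Let C0 : 0 <= C. Proof. by rewrite mulr_ge0 ?sqr_ge0. Qed.
Let ne := nrm lb e.
Let ne0 : 0 <= ne. Proof. exact: nrm_ge0. Qed.
Let X := C * N ^+ 2 / L + 2 * (C * N * eta).

Let cut A f : sq lb f -> sq lb (fun xi => bnl A xi * f xi) /\
  nrm lb (fun xi => bnl A xi * f xi) <= nrm lb f.
Proof.
move=> sf; have [mf _] := sf.
have m : measurable_fun setT (fun xi : plane R => bnl A xi * f xi).
  by apply: measurable_funM => //; exact: measurable_bnl.
have le xi : `|bnl A xi * f xi| <= `|f xi|.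
  by rewrite normrM ler_piMl// ger0_norm ?bnl_ge0// bnl_le1.
by split; [exact: (sq_le m le (sq_abs sf))|exact: le_nrm].
Qed.

Let sB f : wr r f -> nr r f <= N -> sq lb (B f) /\ nrm lb (B f) <= C * N ^+ 2.
Proof.
move=> wf Nf; split; first exact: (bil_sq Ha Hr wf wf).1.
apply: (le_trans (bil_sq_le2 Ha Hr wf wf)); rewrite ler_wpM2l// expr2.
by apply: ler_pM => //; exact: nr_ge0.
Qed.

Let sF : sq lb F /\ nrm lb F <= 2 * (C * N ^+ 2).
Proof.
have [s1 n1] := sB wY NY; have [s2 n2] := sB wy Ny.
have [t1 m1] := cut L' s1; have [t2 m2] := cut L s2.
split; first exact: sqB.
apply: (le_trans (nrmB t1 t2)); rewrite mulr_natl mulr2n.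
by apply: lerD; [exact: le_trans m1 n1|exact: le_trans m2 n2].
Qed.

Let P (f k : R * R -> R) (p : plane R * plane R) :=
  e p.1 * (kap a p.1 p.2 * qf f k (p.1 - p.2) p.2).

(** The difference of the nonlinearities is bil e Y + bil g Y + bil y g + bil y e. Paired with e,
    the last term vanishes by antisymmetry; it is the one that would put a derivative on e. *)
Let form : Int lb (fun xi => e xi * B Y xi) - Int lb (fun xi => e xi * B y xi) =
  Int (lb \x lb)%E (P e Y) + Int (lb \x lb)%E (P g Y) + Int (lb \x lb)%E (P y g).
Proof.
have [I1 E1] := bil_form Ha Hr wY wY se; have [I2 E2] := bil_form Ha Hr wy wy se.
rewrite E1 E2 -/(P Y Y) -/(P y y).
have [J1 _] := bil_form Ha Hr we wY se; have [J2 _] := bil_form Ha Hr wg wY se.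
have [J3 _] := bil_form Ha Hr wy wg se; have [J4 _] := bil_form Ha Hr wy we se.
rewrite -/(P _ _) in I1 I2 J1 J2 J3 J4.
have E4 : Int (lb \x lb)%E (P y e) = 0.
  have T : tform a (fun=> 1) y e = P y e by apply/funext => p; rewrite /tform mul1r.
  by rewrite -T; apply: tform_sym0 => //; rewrite T.
have J5 : itg (lb \x lb)%E (fun p => P e Y p + P g Y p) := itgD J1 J2.
have J6 : itg (lb \x lb)%E (fun p => P y g p + P y e p) := itgD J3 J4.
rewrite -(IntB I1 I2) -[in RHS](IntD J1 J2) -[RHS]addr0 -E4 -addrA -(IntD J3 J4) -(IntD J5 J6).
by apply: eq_Int => p; rewrite /P /qf /e /g; ring.
Qed.

Let pair : `|Int lb (fun xi => e xi * F xi)| <= C * N * ne ^+ 2 + ne * X.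
Proof.
have [s1 n1] := sB wY NY; have [s2 n2] := sB wy Ny.
have K1 := sqM_itg se s1; have K2 := sqM_itg se s2.
have sD := sqB s2 (cut L s2).1; have K3 := sqM_itg se sD.
have -> : Int lb (fun xi => e xi * F xi) =
   (Int lb (fun xi => e xi * B Y xi) - Int lb (fun xi => e xi * B y xi)) +
   Int lb (fun xi => e xi * (B y xi - bnl L xi * B y xi)).
  rewrite -(IntB K1 K2) -(IntD (itgB K1 K2) K3); apply: eq_Int => xi.
  have ce : bnl L' xi * e xi = e xi.
    by rewrite /e mulrBr (csup_bnl xi cY) (csup_bnl xi cz).
  have -> : e xi * F xi = bnl L' xi * e xi * B Y xi - e xi * (bnl L xi * B y xi).
    by rewrite /F; ring.
  by rewrite ce; ring.
rewrite form.
have h1 : `|Int (lb \x lb)%E (P e Y)| <= C * N * ne ^+ 2.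
  apply: (le_trans (bil_form_le Ha Hr we wY se)); rewrite -/C -/ne.
  have -> : C * N * ne ^+ 2 = C * (ne * ne * N) by ring.
  by rewrite ler_wpM2l// ler_wpM2l// mulr_ge0.
have ng : nrm lb g <= eta by apply: le_trans (wr_sq0 r0 wg).2 Nz.
have h2 : `|Int (lb \x lb)%E (P g Y)| <= ne * (C * N * eta).
  apply: (le_trans (bil_form_le Ha Hr wg wY se)); rewrite -/C -/ne.
  have -> : ne * (C * N * eta) = C * (ne * eta * N) by ring.
  rewrite ler_wpM2l//; apply: ler_pM => //; rewrite ?mulr_ge0 ?nrm_ge0 ?nr_ge0//.
  exact: ler_wpM2l.
have h3 : `|Int (lb \x lb)%E (P y g)| <= ne * (C * N * eta).
  rewrite -(bil_form Ha Hr wy wg se).2.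
  apply: (le_trans (cauchy_schwarz se (bil_sq Ha Hr wy wg).1)); rewrite ler_wpM2l//.
  apply: (le_trans (bil_sq_le2 Ha Hr wy wg)); rewrite -mulrA ler_wpM2l//.
  by apply: ler_pM => //; exact: nr_ge0.
have h4 : `|Int lb (fun xi => e xi * (B y xi - bnl L xi * B y xi))| <= ne * (C * N ^+ 2 / L).
  apply: (le_trans (cauchy_schwarz se sD)); rewrite ler_wpM2l//.
  apply: (le_trans (nrm_bil_cut Ha Hr L1 wy)).
  rewrite ler_wpM2r ?invr_ge0 ?(le_trans ler01)// ler_wpM2l// ler_pXn2r ?nnegrE ?nr_ge0//.
apply: (le_trans (ler_normD _ _)).
apply: (le_trans (lerD (le_trans (ler_normD _ _) (lerD (le_trans (ler_normD _ _) (lerD h1 h2)) h3)) h4)).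
by rewrite /X; apply: eq_lexx; ring.
Qed.

Lemma difference_step :
  nrm lb (fun xi => e xi + h * F xi) ^+ 2 <= ne ^+ 2 * (1 + h * (2 * (C * N) + 1)) +
    h * (X ^+ 2 + h * (2 * (C * N ^+ 2)) ^+ 2).
Proof.
have [s2 n2] := sF; have [_ I1] := se; have [_ I2] := s2; have I3 := sqM_itg se s2.
have -> : nrm lb (fun xi => e xi + h * F xi) ^+ 2 = ne ^+ 2 +
   h * (2 * Int lb (fun xi => e xi * F xi) + h * nrm lb F ^+ 2).
  rewrite !sqr_nrm.
  have E : (fun xi => (e xi + h * F xi) ^+ 2) = (fun xi => e xi ^+ 2 +
     2 * h * (e xi * F xi) + h ^+ 2 * F xi ^+ 2) by apply/funext => xi; ring.
  rewrite E (IntD (itgD I1 (itgZ _ I3)) (itgZ _ I2)) (IntD I1 (itgZ _ I3)).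
  by rewrite (IntZ _ I3) (IntZ _ I2); ring.
have b1 : Int lb (fun xi => e xi * F xi) <= C * N * ne ^+ 2 + ne * X.
  exact: le_trans (ler_norm _) pair.
have b2 : nrm lb F ^+ 2 <= (2 * (C * N ^+ 2)) ^+ 2.
  by rewrite ler_pXn2r ?nnegrE ?nrm_ge0// mulr_ge0// mulr_ge0 ?sqr_ge0.
have b3 : 2 * (ne * X) <= ne ^+ 2 + X ^+ 2 by have := sqr_ge0 (ne - X); rewrite sqrrB; lra.
have -> : ne ^+ 2 * (1 + h * (2 * (C * N) + 1)) +
    h * (X ^+ 2 + h * (2 * (C * N ^+ 2)) ^+ 2) =
  ne ^+ 2 + h * (2 * (C * N * ne ^+ 2) + (ne ^+ 2 + X ^+ 2) + h * (2 * (C * N ^+ 2)) ^+ 2) by ring.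
rewrite lerD2l; apply: ler_wpM2l => //; apply: lerD; last exact: ler_wpM2l.
by apply: le_trans (ler_wpM2l (ler0n _ 2) b1) _; rewrite mulrDr lerD2l.
Qed.

End difference_step.

(** * Comparison of a scheme with its refinement *)

Section refinement.
Context {R : realType}.
Let lb := @lb2 R.
Implicit Types (x xi : R * R).
Variables (a r L L' h h' T N : R) (m : nat) (v : R * R -> R).
Hypotheses (Ha : 0 < a < 1 / 2) (Hr : 3 < r) (L1 : 1 <= L) (LL : L <= L') (h0 : 0 <= h').
Hypotheses (m0 : (0 < m)%N) (hm : h = m%:R * h') (T0 : 0 <= T) (wv : wr r v).
Let y := euler a L h v.
Let Y := euler a L' h' v.
Hypotheses (Hy : forall j : nat, j%:R * h <= T -> [/\ wr r (y j), csup L (y j) & nr r (y j) <= N]).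
Hypotheses (HY : forall j : nat, j%:R * h' <= T -> [/\ wr r (Y j), csup L' (Y j) & nr r (Y j) <= N]).

Let r0 : 0 <= r. Proof. by apply/ltW/(lt_trans _ Hr). Qed.
Let sp (j : nat) xi := bnl L xi * bil a (y j) (y j) xi.
(** The coarse scheme interpolated linearly in time and sampled on the fine grid, so that both
    sequences advance by the fine step. *)
Let z (k : nat) xi := y (k %/ m) xi + (k %% m)%:R * (h' * sp (k %/ m) xi).
Let C := Cb a r.
Let C0 : 0 <= C. Proof. by rewrite mulr_ge0 ?sqr_ge0. Qed.
Let eta := h * (rhoL r L * (C * N ^+ 2)).
Let N0 : 0 <= N.
Proof. have [|_ _] := Hy (j := 0); first by rewrite mul0r. exact: le_trans (nr_ge0 _ _). Qed.

Let z0 : z 0 = y 0.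
Proof. by apply/funext => xi; rewrite /z div0n mod0n mul0r addr0. Qed.

(** When m divides k + 1 the quotient jumps and the interpolant restarts from the next coarse
    iterate, which m fine increments have just reached. *)
Let zS k xi : z k.+1 xi = z k xi + h' * sp (k %/ m) xi.
Proof.
rewrite /z modnS divnS//; case: ifP => [/dvdnP[q E]|_]; last first.
  by rewrite add0n -natr1; ring.
have q0 : (0 < q)%N by case: (q) E.
have kE : k = (q.-1 * m + m.-1)%N.
  move: E m0; case: (q) => [|q']; first by rewrite mul0n.
  by rewrite mulSn; case: (m) => // m' /=; rewrite addSn => -[->] _; rewrite addnC.
rewrite add1n /= kE divnMDl// modnMDl (@divn_small m.-1) ?prednK// addn0 modn_small ?prednK//.
rewrite mul0r addr0 /y /euler /= {1}/estep -/(euler a L h v q.-1) -/(y q.-1) hm.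
by rewrite -/(sp _ _) -[in m%:R](prednK m0) -natr1; ring.
Qed.

Let kT k : k%:R * h' <= T -> (k %/ m)%:R * h <= T.
Proof.
apply: le_trans; rewrite hm mulrA ler_wpM2r// -natrM ler_nat; exact: leq_trunc_div.
Qed.

Let wsp j : j%:R * h <= T -> wr r (sp j) /\ nr r (sp j) <= rhoL r L * (C * N ^+ 2).
Proof.
move=> jT; have [wy _ Ny] := Hy jT.
have rle xi : `|rho r xi| <= rho r xi by rewrite ger0_norm// ltW// rho_gt0.
have [s n] := sq_weight_cut Hr L1 rle (measurable_rho r) (bil_sq Ha Hr wy wy).1.
split; first exact: s.
apply: (le_trans n); rewrite ler_wpM2l ?powR_ge0//.
apply: (le_trans (bil_sq_le2 Ha Hr wy wy)); rewrite ler_wpM2l// expr2.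
by apply: ler_pM => //; exact: nr_ge0.
Qed.

Let csp j : csup L (sp j).
Proof. by move=> xi H; rewrite /sp /bnl leNgt H /= mul0r. Qed.

Lemma interp_props k : k%:R * h' <= T ->
  [/\ wr r (z k), csup L' (z k) & nr r (fun xi => z k xi - y (k %/ m) xi) <= eta].
Proof.
move=> /kT jT; have [wy cy Ny] := Hy jT; have [ws ns] := wsp jT.
split.
- by apply: wrD => //; apply: wrZ; exact: wrZ.
- move=> xi H; have HL := le_lt_trans LL H.
  by rewrite /z (cy _ HL) (csp _ HL) !mulr0 addr0.
have -> : (fun xi => z k xi - y (k %/ m) xi) = (fun xi => (k %% m)%:R * h' * sp (k %/ m) xi).
  by apply/funext => xi; rewrite /z; ring.
rewrite nrZ// ger0_norm ?mulr_ge0// /eta hm; apply: ler_pM => //.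
- by rewrite mulr_ge0.
- exact: nr_ge0.
by rewrite ler_wpM2r// ler_nat ltnW// ltn_mod.
Qed.

Let E := (C * N ^+ 2 / L + 2 * (C * N * eta)) ^+ 2 + h' * (2 * (C * N ^+ 2)) ^+ 2.

Lemma refinement_bound k : k%:R * h' <= T ->
  nrm lb (fun xi => Y k xi - y (k %/ m) xi) <=
  Num.sqrt (((nr r v / L) ^+ 2 + T * E) * expR ((2 * (C * N) + 1) * T)) + eta.
Proof.
move=> kTT; pose u k := nrm lb (fun xi => Y k xi - z k xi) ^+ 2.
have E0 : 0 <= E by rewrite addr_ge0 ?sqr_ge0// mulr_ge0 ?sqr_ge0.
have c0 : 0 <= 2 * (C * N) + 1 by rewrite addr_ge0// mulr_ge0// mulr_ge0.
have step l : (l < k)%N -> u l.+1 <= u l * (1 + h' * (2 * (C * N) + 1)) + h' * E.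
  move=> lk; have lT : l%:R * h' <= T.
    by apply: le_trans kTT; rewrite ler_wpM2r// ler_nat ltnW.
  have [wY cY NY] := HY lT; have [wz cz Nz] := interp_props lT.
  have [wy _ Ny] := Hy (kT lT).
  have := difference_step Ha Hr L1 h0 wY wy wz cY cz NY Ny Nz.
  rewrite /u; congr (_ <= _); congr (_ ^+ 2); apply: eq_nrm => xi.
  have -> : Y l.+1 xi = estep a L' h' (Y l) xi by [].
  by rewrite zS /estep /sp; ring.
have := discrete_gronwall h0 c0 E0 (sqr_ge0 _) step (leqnn k); rewrite {1}/u => B.
have [wY _ _] := HY kTT; have [wz _ Nz] := interp_props kTT.
have [wy _ _] := Hy (kT kTT).
have sz := (wr_sq0 r0 wz).1.
apply: (le_trans (nrm_dist (wr_sq0 r0 wY).1 sz (wr_sq0 r0 wy).1)); apply: lerD; last first.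
  apply: le_trans Nz; have wd : wr r (fun xi => z k xi - y (k %/ m) xi).
    have := wrD wz (wrZ (-1) wy); congr wr; apply/funext => xi; ring.
  exact: (wr_sq0 r0 wd).2.
have u0 : u 0 <= (nr r v / L) ^+ 2.
  rewrite /u z0 ler_pXn2r ?nnegrE ?nrm_ge0 ?divr_ge0 ?nr_ge0 ?(le_trans ler01 L1)//.
  have L0 : 0 < L by exact: lt_le_trans L1.
  have [se ne] := wr_enorm_sq Hr wv; have mv := wr_meas wv.
  apply: (@le_trans _ _ (nrm lb (fun xi => L^-1 * (enorm xi * v xi)))).
    apply: le_nrm; last exact: sqZ.
      by apply: measurable_funB; apply: measurable_funM => //; exact: measurable_bnl.
    move=> xi; apply: (@le_trans _ _ (`|v xi - bnl L xi * v xi|)).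
      rewrite -mulrBl -[X in `|X - _|]mul1r -mulrBl !normrM ler_wpM2r//.
      rewrite !ger0_norm ?subr_ge0 ?bnl_le1 ?bnl_mono// lerD2r; exact: bnl_le1.
    apply: (le_trans (bnl_tail xi (v xi) L0)).
    by rewrite !normrM (ger0_norm (enorm_ge0 _)) ger0_norm ?invr_ge0 ?(ltW L0).
  by rewrite nrmZ// ger0_norm ?invr_ge0 ?(ltW L0)// mulrC ler_wpM2r ?invr_ge0 ?(ltW L0).
rewrite -[leLHS]ger0_norm ?nrm_ge0// -sqrtr_sqr; apply: ler_wsqrtr; apply: (le_trans B).
apply: ler_pM; rewrite ?expR_ge0//.
- by rewrite addr_ge0 ?sqr_ge0// mulr_ge0// mulr_ge0.
- by apply: lerD => //; rewrite ler_wpM2r.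
by rewrite ler_expR ler_wpM2l.
Qed.

End refinement.

(** * Tails of the Sobolev norm *)

Section tail.
Context {R : realType}.
Let lb := @lb2 R.
Implicit Types (x xi : R * R) (y : R * R -> R).

(** A smooth substitute for the Sobolev weight restricted to frequencies above A: a sharp
    restriction would violate the difference condition of the commutator estimate. *)
Definition tw (r A : R) xi : R := Num.sqrt (Wt r (A ^+ 2) 0 (enorm xi)).

Lemma sqr_tw r A xi : 0 < A -> tw r A xi ^+ 2 = Wt r (A ^+ 2) 0 (enorm xi).
Proof. by move=> A0; rewrite sqr_sqrtr// Wt_ge0// exprn_gt0. Qed.

Lemma tw_le r A xi : 0 < A -> `|tw r A xi| <= rho r xi.
Proof.
move=> A0; have r0 := rho_gt0 r xi; rewrite ger0_norm ?sqrtr_ge0//.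
rewrite -(ler_pXn2r (ltn0Sn 1)) ?nnegrE ?sqrtr_ge0 ?(ltW r0)// sqr_tw// sqr_rho.
by apply: Wt_le; rewrite ?exprn_gt0 ?sqr_ge0.
Qed.

Lemma rho_tw r A xi : 0 < A -> 0 <= r -> rho r xi ^+ 2 <= (1 + A ^+ 2) `^ r + 2 * tw r A xi ^+ 2.
Proof.
move=> A0 r0; rewrite sqr_tw// sqr_rho /Wt /jap add0r.
have P0 : 0 <= (1 + enorm xi ^+ 2) `^ r by exact: powR_ge0.
have e2 := sqr_ge0 (enorm xi); have A2 : 0 < A ^+ 2 by rewrite exprn_gt0.
have [h|h] := leP (enorm xi) A.
  apply: (@le_trans _ _ ((1 + A ^+ 2) `^ r)).
    apply: ge0_ler_powR; rewrite ?nnegrE ?addr_ge0 ?sqr_ge0// lerD2l.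
    by rewrite ler_pXn2r ?nnegrE ?enorm_ge0// ltW.
  by rewrite lerDl mulr_ge0// mulr_ge0// divr_ge0// addr_ge0// ltW.
apply: (@le_trans _ _ (2 * ((1 + enorm xi ^+ 2) `^ r * (enorm xi ^+ 2 / (A ^+ 2 + enorm xi ^+ 2))))).
  rewrite mulrCA; apply: ler_peMr => //.
  rewrite mulrA ler_pdivlMr ?mul1r ?ltr_wpDr//.
  have : A ^+ 2 <= enorm xi ^+ 2 by rewrite ler_pXn2r ?nnegrE ?enorm_ge0 ?(ltW A0)// ltW.
  lra.
by rewrite lerDr powR_ge0.
Qed.

Lemma measurable_tw r A : 0 < A -> measurable_fun setT (tw r A : plane R -> R).
Proof.
move=> A0; have me := @measurable_enorm R; have me2 := measurable_funX 2 me.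
have -> : tw r A = (fun x : plane R => Wt r (A ^+ 2) 0 (enorm x) `^ 2^-1).
  by apply/funext => x; rewrite /tw powR12_sqrt// Wt_ge0// exprn_gt0.
apply: measurable_powRl; apply: measurable_funM.
  by apply: measurable_powRl; apply: measurable_funD.
apply: measurable_funM; first exact: measurable_funD.
have -> : (fun x : plane R => (A ^+ 2 + enorm x ^+ 2)^-1) =
    (fun x : plane R => (A ^+ 2 + enorm x ^+ 2) `^ (-1)).
  by apply/funext => x; rewrite powR_inv1// addr_ge0 ?sqr_ge0.
by apply: measurable_powRl; apply: measurable_funD.
Qed.

Lemma tail_step (a r L h N A : R) y : 0 < a < 1 / 2 -> 3 < r -> 1 <= L -> 0 <= h -> 0 < A ->
  wr r y -> csup L y -> nr r y <= N ->
  nrm lb (fun xi => tw r A xi * estep a L h y xi) ^+ 2 <=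
  nrm lb (fun xi => tw r A xi * y xi) ^+ 2 * (1 + h * (24 * Kr r ^+ 2 * (crs r * N))) +
  h * (h * rhoL r L ^+ 2 * (Cb a r * N ^+ 2) ^+ 2).
Proof.
move=> Ha Hr L1 h0 A0 wy cy Ny.
have r1 : 1 < r by apply: lt_trans Hr; rewrite ltr1n.
have A2 : 0 < A ^+ 2 by rewrite exprn_gt0.
have [I E] := energy_step Ha Hr L1 h0 wy cy (measurable_tw r A0) (fun xi => tw_le r xi A0).
have WF : (fun p : plane R * plane R => Wt r (A ^+ 2) 0 (enorm p.1)) = (fun p => tw r A p.1 ^+ 2).
  by apply/funext => p; rewrite sqr_tw.
have l00 := lexx (0 : R).
have B := @tame_estimate _ a (Kr r) (Wt r (A ^+ 2) 0) Ha (Kr_ge1 r1)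
  (fun (x : R) _ => Wt_ge0 r A2 l00 x) (Wt_mono r1 A2 l00 (ltW A2)) (Wt_double r1 A2 l00)
  (Wt_diff r1 A2 l00 (ltW A2)) y.
have [J0 b0] := wr_itg0 Hr wy; have [J1 b1] := wr_itg1 Hr wy.
have a1 : 0 <= 2 * a <= 1 by case/andP: Ha => ? ?; apply/andP; split; lra.
have [a10 a11] := andP a1.
have Is : itg lb (fun xi => (1 + 2 * a * enorm xi) * y xi).
  have -> : (fun xi => (1 + 2 * a * enorm xi) * y xi) =
    (fun xi => y xi + 2 * a * (enorm xi * y xi)) by apply/funext => z; ring.
  by apply: itgD => //; apply: itgZ.
rewrite WF in B; have {B}B := B (wr_sq (measurable_tw r A0) (fun xi => tw_le r xi A0) wy).1 Is I.
have J1' := itg_wabs (@enorm_ge0 R) J1.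
have cN : crs r * nr r y <= crs r * N by rewrite ler_wpM2l ?crs_ge0.
have L1' : Int lb (fun xi => (1 + 2 * a * enorm xi) * `|y xi|) <= 2 * (crs r * N).
  have -> : Int lb (fun xi => (1 + 2 * a * enorm xi) * `|y xi|) =
     Int lb (fun xi => `|y xi|) + 2 * a * Int lb (fun xi => enorm xi * `|y xi|).
    rewrite -IntZ// -IntD; [|exact: itg_abs|exact: itgZ].
    by apply: eq_Int => xi; ring.
  have -> : 2 * (crs r * N) = crs r * N + crs r * N by ring.
  apply: lerD; first exact: le_trans b0 cN.
  apply: le_trans (le_trans b1 cN); apply: ler_piMl => //.
  by apply: Int_ge0 => z; rewrite mulr_ge0 ?enorm_ge0.
set W := nrm lb (fun xi => tw r A xi * y xi) ^+ 2 in E *.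
have W0 : 0 <= W by exact: sqr_ge0.
set II := Int _ (tform _ _ _ _) in B E.
have B' : 2 * II <= W * (24 * Kr r ^+ 2 * (crs r * N)).
  have h1 : II <= 6 * Kr r ^+ 2 * (2 * (crs r * N)) * W.
    apply: (le_trans (ler_norm _)); apply: (le_trans B); rewrite ler_wpM2r//.
    by apply: ler_wpM2l => //; rewrite mulr_ge0 ?sqr_ge0.
  by apply: (le_trans (ler_wpM2l (ler0n _ 2) h1)); apply: eq_lexx; ring.
have e1 : eng_err a r L h y <= h * rhoL r L ^+ 2 * (Cb a r * N ^+ 2) ^+ 2.
  have -> : h * rhoL r L ^+ 2 * (Cb a r * N ^+ 2) ^+ 2 =
    h * (rhoL r L * (Cb a r * N ^+ 2)) ^+ 2 by ring.
  have C0 : 0 <= Cb a r by rewrite mulr_ge0 ?sqr_ge0.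
  have P0 (u : R) : 0 <= rhoL r L * (Cb a r * u ^+ 2).
    by apply: mulr_ge0; [exact: powR_ge0|apply: mulr_ge0 => //; exact: sqr_ge0].
  apply: ler_wpM2l => //; rewrite ler_pXn2r ?nnegrE//.
  apply: ler_wpM2l; first exact: powR_ge0.
  by apply: ler_wpM2l => //; rewrite ler_pXn2r ?nnegrE ?nr_ge0// (le_trans (nr_ge0 _ _) Ny).
apply: (le_trans E); apply: (le_trans (lerD (lexx _) (ler_wpM2l h0 (lerD B' e1)))).
by apply: eq_lexx; ring.
Qed.

(** Lower semicontinuity of a weighted norm under L^2 convergence. On a disc the weight is at most a
    constant C, and the tolerance e / (1 + C) absorbs it; [sq_sup] removes the disc. *)
Lemma lsc_weight (r X : R) (w f : plane R -> R) : 3 < r -> 0 <= X -> measurable_fun setT w ->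
  (forall xi, `|w xi| <= rho r xi) -> sq lb f ->
  (forall e, 0 < e -> exists g, [/\ sq lb g, sq lb (fun xi => w xi * g xi),
     nrm lb (fun xi => f xi - g xi) <= e & nrm lb (fun xi => w xi * g xi) <= X + e]) ->
  sq lb (fun xi => w xi * f xi) /\ nrm lb (fun xi => w xi * f xi) <= X.
Proof.
move=> Hr X0 mw wle sf H; have [mf _] := sf.
apply: sq_sup => //; first exact: measurable_funM.
move=> n u su; pose A : R := n.+1%:R; have A1 : 1 <= A by rewrite ler1n.
pose C := rhoL r A; have C0 : 0 <= C by exact: powR_ge0.
apply/ler_addgt0Pr => e e0.
have d0 : 0 < 1 + C by rewrite ltr_wpDr.
have [|g [sg swg fg wg]] := H (e / (1 + C)); first exact: divr_gt0.
have [sa _] := sq_weight_cut Hr A1 wle mw sf.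
have [sb _] := sq_weight_cut Hr A1 wle mw sg.
have [sc nc] := sq_weight_cut Hr A1 wle mw (sqB sf sg).
apply: (@le_trans _ _ (nrm lb (fun xi => w xi * (bnl A xi * f xi)))).
  apply: le_nrm => //; first by case: su.
  move=> xi; rewrite /u mulrCA; set F := w xi * f xi.
  rewrite (normrM (F * _)) (normrM F) (normrM (bnl A xi)) [leRHS]mulrC -mulrA; apply: ler_wpM2l => //.
  case: (`|F| <= _)%R => /=; rewrite ?normr1 ?mulr1 ?normr0 ?mulr0//.
  by rewrite !ger0_norm ?bnl_ge0//; apply: bnl_mono; rewrite ler_nat.
have -> : nrm lb (fun xi => w xi * (bnl A xi * f xi)) =
    nrm lb (fun xi => w xi * (bnl A xi * g xi) + w xi * (bnl A xi * (f xi - g xi))).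
  by apply: eq_nrm => xi; ring.
apply: (le_trans (nrmD sb sc)).
have b1 : nrm lb (fun xi => w xi * (bnl A xi * g xi)) <= X + e / (1 + C).
  apply: le_trans wg; apply: le_nrm => //; first by case: sb.
  move=> xi; rewrite mulrCA normrM; apply: ler_piMl => //.
  by rewrite ger0_norm ?bnl_ge0// bnl_le1.
have b2 : nrm lb (fun xi => w xi * (bnl A xi * (f xi - g xi))) <= C * (e / (1 + C)).
  by apply: (le_trans nc); rewrite ler_wpM2l.
apply: (le_trans (lerD b1 b2)); apply: eq_lexx; field.
by rewrite gt_eqF.
Qed.

End tail.

(** * Choice of cutoffs and steps *)

Section levels.
Context {R : realType}.

Lemma le_half_pow (x y K : R) : (forall n : nat, x <= y + K / 2 ^+ n) -> x <= y.
Proof.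
move=> H; apply/ler_addgt0Pr => e e0.
pose n := Num.bound (`|K| / e).
have b := archi_boundP (divr_ge0 (normr_ge0 K) (ltW e0)).
have nb : `|K| <= e * 2 ^+ n.
  rewrite mulrC -ler_pdivrMr//; apply: (le_trans (ltW b)).
  by rewrite -natrX ler_nat ltnW// ltn_expl.
apply: (le_trans (H n)); rewrite lerD2l ler_pdivrMr ?exprn_gt0//.
exact: le_trans (ler_norm K) nb.
Qed.

(** L doubles and h is divided by 2^q at each level, so the grids are nested. With p >= r, the
    square of [rhoL r L] is at most 2^p L^(2 p), and q = 2 p + 2 leaves L^-2 to spare; the shift n0
    enforces the bounds by delta from the first level on. *)
Lemma levels (r T delta : R) : 0 <= r -> 0 < T -> 0 < delta ->
  exists (L h : nat -> R) (D : R), [/\ 0 <= D, forall n, 1 <= L n, forall n, 0 < h n &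
   forall n, [/\ (L n)^-1 <= delta, h n * rhoL r (L n) ^+ 2 <= delta &
    [/\ (L n)^-1 <= (2 ^+ n)^-1, h n * rhoL r (L n) ^+ 2 <= D * ((2 ^+ n)^-1) ^+ 2,
     L n <= L n.+1 & exists2 m : nat, (0 < m)%N & h n = m%:R * h n.+1]]].
Proof.
move=> r0 T0 d0.
pose p := Num.bound r; have rp : r <= p%:R by exact: ltW (archi_boundP r0).
pose q := (2 * p + 2)%N; pose D : R := T * 2 ^+ p.
have D0 : 0 <= D by rewrite mulr_ge0// ltW.
pose n0 := Num.bound ((1 + D) / delta).
have d2 : (1 + D) / delta <= 2 ^+ n0.
  have x0 : 0 <= (1 + D) / delta by rewrite divr_ge0 ?addr_ge0// ltW.
  by apply: (le_trans (ltW (archi_boundP x0))); rewrite -natrX ler_nat ltnW// ltn_expl.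
have p2 (n : nat) : 0 < 2 ^+ n :> R by rewrite exprn_gt0.
pose L n : R := 2 ^+ (n + n0); pose h n : R := T / 2 ^+ (q * (n + n0)).
have L1 n : 1 <= L n by rewrite exprn_ege1// ler1n.
have B n : h n * rhoL r (L n) ^+ 2 <= D * ((L n)^-1) ^+ 2.
  have -> : rhoL r (L n) ^+ 2 = (1 + L n ^+ 2) `^ r.
    by rewrite /rhoL -powR_mulrn ?powR_ge0// -powRrM; congr (_ `^ _); field.
  have s1 : 1 <= 1 + L n ^+ 2 by rewrite lerDl sqr_ge0.
  have e1 : (1 + L n ^+ 2) `^ r <= (2 * L n ^+ 2) ^+ p.
    apply: (@le_trans _ _ ((1 + L n ^+ 2) `^ p%:R)); first exact: ler_powR.
    have s2 : 1 <= L n ^+ 2 by apply: exprn_ege1.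
    have s3 : 0 <= 1 + L n ^+ 2 by exact: le_trans ler01 s1.
    rewrite (powR_mulrn _ s3); apply: lerXn2r; rewrite ?nnegrE//.
      by apply: mulr_ge0 => //; exact: sqr_ge0.
    by rewrite [leRHS]mulr_natl mulr2n lerD2r.
  apply: (le_trans (ler_wpM2l _ e1)); first by rewrite divr_ge0 ?ltW.
  apply: eq_lexx; rewrite /h /D mulnC exprM -/(L n) /q exprD exprM.
  have l0 : L n ^+ 2 != 0 by rewrite expf_neq0// gt_eqF// p2.
  rewrite exprVn; move: (L n ^+ 2) l0 => l l0; rewrite exprMn.
  by field; rewrite l0 expf_neq0.
have Ln n : (L n)^-1 <= (2 ^+ n)^-1.
  by rewrite lef_pV2 ?posrE ?p2// ler_eXn2l ?ltr1n// leq_addr.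
have Ln0 n : (L n)^-1 <= (2 ^+ n0)^-1.
  by rewrite lef_pV2 ?posrE ?p2// ler_eXn2l ?ltr1n// leq_addl.
have Li n : 0 <= (L n)^-1 by rewrite invr_ge0 ltW// p2.
have dd : (1 + D) * (2 ^+ n0)^-1 <= delta.
  by rewrite ler_pdivrMr// mulrC -ler_pdivrMr.
have i0 : 0 <= (2 ^+ n0)^-1 :> R by rewrite invr_ge0 ltW.
exists L, h, D; split => // [n|n]; first exact: divr_gt0.
split.
- apply: (le_trans (Ln0 n)); apply: le_trans dd; by apply: ler_peMl => //; rewrite lerDl.
- apply: (le_trans (B n)); apply: le_trans dd.
  apply: ler_pM; [by []|exact: sqr_ge0|by rewrite lerDr|apply: le_trans (Ln0 n)].
  by rewrite expr2; apply: ler_piMr => //; rewrite invf_le1// p2.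
split => //.
- by apply: (le_trans (B n)); rewrite ler_wpM2l//; apply: lerXn2r; rewrite ?nnegrE// invr_ge0 ltW.
- by rewrite ler_eXn2l ?ltr1n// addSn.
exists (2 ^ q)%N; first by rewrite expn_gt0.
by rewrite /h addSn mulnS exprD natrX; field; rewrite !expf_neq0.
Qed.

Lemma truncn_divn (x : R) (m : nat) : 0 <= x -> (0 < m)%N ->
  Num.truncn (x / m%:R) = (Num.truncn x %/ m)%N.
Proof.
move=> x0 m0; have mr : 0 < m%:R :> R by rewrite ltr0n.
have /andP[t1 t2] := truncn_itv x0; apply: truncn_def; apply/andP; split.
  by rewrite ler_pdivlMr// -natrM; apply: le_trans t1; rewrite ler_nat leq_trunc_div.
rewrite ltr_pdivrMr// -natrM; apply: (lt_le_trans t2); rewrite ler_nat.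
by rewrite -ltn_divLR.
Qed.

End levels.

(** * Convergence of the scheme *)

Section euler_limit.
Context {R : realType}.
Let lb := @lb2 R.
Implicit Types (x xi : R * R) (t s : R) (n j k : nat).
Variables (a r T N D : R) (v : R * R -> R) (L h : nat -> R).
Hypotheses (Ha : 0 < a < 1 / 2) (Hr : 3 < r) (T0 : 0 < T) (wv : wr r v) (D0 : 0 <= D).
Hypotheses (L1 : forall n, 1 <= L n) (h0 : forall n, 0 < h n)
  (HL : forall n, (L n)^-1 <= (2 ^+ n)^-1)
  (Hh : forall n, h n * rhoL r (L n) ^+ 2 <= D * ((2 ^+ n)^-1) ^+ 2)
  (LL : forall n, L n <= L n.+1)
  (hm : forall n, exists2 m : nat, (0 < m)%N & h n = m%:R * h n.+1).
Let Y n := euler a (L n) (h n) v.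
Hypothesis Hb : forall n j, j%:R * h n <= T ->
  [/\ wr r (Y n j), csup (L n) (Y n j) & nr r (Y n j) <= N].

Let r0 : 0 <= r. Proof. by apply/ltW/(lt_trans _ Hr). Qed.
Let T00 := ltW T0.
Let i0 n : 0 <= (2 ^+ n)^-1 :> R. Proof. by rewrite invr_ge0 exprn_ge0. Qed.
Let i1 n : (2 ^+ n)^-1 <= 1 :> R.
Proof. by rewrite invf_le1 ?exprn_gt0// exprn_ege1// ler1n. Qed.
Let C := Cb a r.
Let C0 : 0 <= C. Proof. by rewrite mulr_ge0 ?sqr_ge0. Qed.
Let N0 : 0 <= N.
Proof. have [|_ _] := Hb (n := 0) (j := 0); first by rewrite mul0r. exact: le_trans (nr_ge0 _ _). Qed.
Let CN0 : 0 <= C * N ^+ 2. Proof. by rewrite mulr_ge0 ?sqr_ge0. Qed.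

(** The iterate at the last grid time not after t; on nested grids the index at one level is the
    integer quotient of the index at the next, by [truncn_divn]. *)
Definition ztime n t := euler a (L n) (h n) v (Num.truncn (t / h n)).
Let Z := ztime.

Lemma ztime_index n t : 0 <= t <= T -> (Num.truncn (t / h n))%:R * h n <= T.
Proof.
move=> /andP[t0 tT]; apply: le_trans tT; rewrite -ler_pdivlMr//.
by have /andP[] := truncn_itv (divr_ge0 t0 (ltW (h0 n))).
Qed.

Lemma mesh_le n : h n <= D * (2 ^+ n)^-1 ^+ 2.
Proof.
apply: le_trans (Hh n); apply: ler_peMr; first exact: ltW.
by have R1 := rhoL_ge1 (L n) r0; rewrite expr2; have := ler_pM ler01 ler01 R1 R1; rewrite mulr1.
Qed.

Let hR n : h n * rhoL r (L n) <= D * (2 ^+ n)^-1 ^+ 2.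
Proof.
have R1 := rhoL_ge1 (L n) r0; apply: le_trans (Hh n); rewrite ler_wpM2l ?(ltW (h0 n))//.
by rewrite expr2; apply: ler_peMr => //; exact: powR_ge0.
Qed.

Let sqi n : (2 ^+ n)^-1 ^+ 2 <= (2 ^+ n)^-1 :> R.
Proof. by rewrite expr2; apply: ler_piMr. Qed.

Let A0 := nr r v.
Let E1 := (C * N ^+ 2 + 2 * (C * N * (D * (C * N ^+ 2)))) ^+ 2 + D * (2 * (C * N ^+ 2)) ^+ 2.
Let C1 := Num.sqrt ((A0 ^+ 2 + T * E1) * expR ((2 * (C * N) + 1) * T)) + D * (C * N ^+ 2).

(** Every error in [refinement_bound] is of order 2^-n: 1 / L, h times the weight, and the square
    root of h, which is why h was taken of order 4^-n. *)
Lemma ztime_cauchy n t : 0 <= t <= T ->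
  nrm lb (fun xi => ztime n.+1 t xi - ztime n t xi) <= C1 / 2 ^+ n.
Proof.
move=> tT; have [t0 _] := andP tT; have [m m0 E] := hm n.
have K : Num.truncn (t / h n) = (Num.truncn (t / h n.+1) %/ m)%N.
  rewrite -truncn_divn//; last by rewrite divr_ge0// ltW.
  by rewrite E invfM mulrA -mulrA (mulrC _^-1) mulrA.
have := refinement_bound Ha Hr (L1 n) (LL n) (ltW (h0 n.+1)) m0 E T00 wv (Hb (n := n))
  (Hb (n := n.+1)) (ztime_index n.+1 tT).
rewrite -K => /le_trans; apply.
set eta := h n * _; set i := (2 ^+ n)^-1.
have be : eta <= D * (C * N ^+ 2) * i.
  rewrite /eta mulrA; apply: (@le_trans _ _ (D * i ^+ 2 * (C * N ^+ 2))).
    by rewrite ler_wpM2r.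
  rewrite mulrAC; apply: ler_wpM2l; [exact: mulr_ge0|exact: sqi].
have eta0 : 0 <= eta.
  by apply: mulr_ge0; [exact: ltW|apply: mulr_ge0; [exact: powR_ge0|exact: CN0]].
have c0 : 0 <= expR ((2 * (C * N) + 1) * T) by exact: expR_ge0.
rewrite /C1 [leRHS]mulrDl; apply: lerD => //.
rewrite -[X in _ <= _ * X](ger0_norm (i0 n)) -sqrtr_sqr -sqrtrM; last first.
  by rewrite mulr_ge0// addr_ge0 ?sqr_ge0// mulr_ge0// addr_ge0 ?sqr_ge0// mulr_ge0 ?sqr_ge0.
apply: ler_wsqrtr; rewrite [leRHS]mulrAC; apply: ler_wpM2r => //.
rewrite [leRHS]mulrDl -/i; apply: lerD.
  rewrite -/A0 [leLHS]exprMn; apply: ler_wpM2l; first exact: sqr_ge0.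
  by apply: lerXn2r; rewrite ?nnegrE ?invr_ge0 ?(le_trans ler01 (L1 n)).
rewrite -[leRHS]mulrA; apply: ler_wpM2l => //; rewrite /E1 [leRHS]mulrDl; apply: lerD; last first.
  rewrite [leRHS]mulrAC; apply: ler_wpM2r; first exact: sqr_ge0.
  apply: (le_trans (mesh_le n.+1)); apply: ler_wpM2l => //; apply: lerXn2r; rewrite ?nnegrE ?(i0 n)//.
  by rewrite /i lef_pV2 ?posrE ?exprn_gt0// ler_eXn2l ?ltr1n.
rewrite -[leRHS]exprMn; apply: lerXn2r; rewrite ?nnegrE.
- by rewrite addr_ge0// ?divr_ge0 ?(le_trans ler01 (L1 n))// mulr_ge0// mulr_ge0// mulr_ge0.
- apply: mulr_ge0; last exact: i0.
  apply: addr_ge0; first exact: CN0.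
  by apply: mulr_ge0 => //; apply: mulr_ge0; apply: mulr_ge0.
rewrite [leRHS]mulrDl; apply: lerD; first exact: ler_wpM2l.
have -> : 2 * (C * N * (D * (C * N ^+ 2))) * i = 2 * (C * N * (D * (C * N ^+ 2) * i)) by ring.
by apply: ler_wpM2l => //; apply: ler_wpM2l => //; exact: mulr_ge0.
Qed.

Lemma ztime_props n t : 0 <= t <= T ->
  [/\ wr r (ztime n t), csup (L n) (ztime n t) & nr r (ztime n t) <= N].
Proof. by move=> tT; apply: Hb; exact: ztime_index. Qed.

Lemma ztime_cvg : exists V : R -> plane R -> R, forall t, 0 <= t <= T -> sq lb (V t) /\
  forall n, nrm lb (fun xi => V t xi - ztime n t xi) <= 2 * C1 / 2 ^+ n.
Proof.
have H t : exists F : plane R -> R, 0 <= t <= T -> sq lb F /\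
    forall n, nrm lb (fun xi => F xi - ztime n t xi) <= 2 * C1 / 2 ^+ n.
  case: (pselect (0 <= t <= T)) => tT; last by exists (fun=> 0) => /tT.
  have sz n : sq lb (ztime n t) by have [wz _ _] := ztime_props n tT; exact: (wr_sq0 r0 wz).1.
  have [F sF HF] := riesz_fischer sz (fun n => ztime_cauchy n tT).
  by exists F.
by have [V HV] := choice H; exists V.
Qed.

Variables (V : R -> plane R -> R) (K : R).
Hypothesis HV : forall t, 0 <= t <= T -> sq lb (V t) /\
  forall n, nrm lb (fun xi => V t xi - ztime n t xi) <= K / 2 ^+ n.

Let close t (e : R) : 0 <= t <= T -> 0 < e ->
  exists n, nrm lb (fun xi => V t xi - ztime n t xi) <= e /\ (2 ^+ n)^-1 <= e.
Proof.
move=> tT e0; pose n := Num.bound ((`|K| + 1) / e).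
have k1 : 0 <= `|K| + 1 by rewrite addr_ge0.
have b : (`|K| + 1) <= e * 2 ^+ n.
  rewrite mulrC -ler_pdivrMr//; apply: (le_trans (ltW (archi_boundP (divr_ge0 k1 (ltW e0))))).
  by rewrite -natrX ler_nat ltnW// ltn_expl.
exists n; have [_ H] := HV tT; split.
  apply: (le_trans (H n)); rewrite ler_pdivrMr ?exprn_gt0//; apply: le_trans b.
  by apply: (le_trans (ler_norm _)); rewrite lerDl.
by rewrite -[leLHS]mul1r ler_pdivrMr ?exprn_gt0//; apply: le_trans b; rewrite lerDr.
Qed.

Lemma limit_wr t : 0 <= t <= T -> wr r (V t) /\ nr r (V t) <= N.
Proof.
move=> tT; have [sV _] := HV tT; apply: (lsc_weight Hr N0 (measurable_rho r)) => //.
  by move=> xi; rewrite ger0_norm// ltW// rho_gt0.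
move=> e e0; have [n [Hn _]] := close tT e0; have [wz _ nz] := ztime_props n tT.
exists (ztime n t); split => //; first exact: (wr_sq0 r0 wz).1.
by apply: (le_trans nz); rewrite lerDl ltW.
Qed.

Let c := 24 * Kr r ^+ 2 * (crs r * N).
Let c_ge0 : 0 <= c.
Proof.
by apply: mulr_ge0; apply: mulr_ge0 => //; [exact: sqr_ge0|exact: crs_ge0].
Qed.

Let ztime_tail n t A : 0 < A -> 0 <= t <= T ->
  nrm lb (fun xi => tw r A xi * ztime n t xi) ^+ 2 <=
  (nrm lb (fun xi => tw r A xi * v xi) ^+ 2 + T * (D * (C * N ^+ 2) ^+ 2 * (2 ^+ n)^-1)) *
  expR (c * T).
Proof.
move=> A00 tT; rewrite /ztime; set k := Num.truncn _; have kt : k%:R * h n <= T := ztime_index n tT.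
pose u j := nrm lb (fun xi => tw r A xi * Y n j xi) ^+ 2.
pose E := D * (C * N ^+ 2) ^+ 2 * (2 ^+ n)^-1.
have E0 : 0 <= E by rewrite mulr_ge0// mulr_ge0 ?sqr_ge0.
have step j : (j < k)%N -> u j.+1 <= u j * (1 + h n * c) + h n * E.
  move=> jk; have jT : j%:R * h n <= T.
    by apply: le_trans kt; rewrite ler_wpM2r ?(ltW (h0 n))// ler_nat ltnW.
  have [wy cy ny] := Hb jT.
  apply: (le_trans (tail_step Ha Hr (L1 n) (ltW (h0 n)) A00 wy cy ny)); rewrite lerD2l.
  apply: ler_wpM2l; first exact: ltW.
  rewrite /E [leRHS]mulrAC; apply: ler_wpM2r; first exact: sqr_ge0.
  by apply: (le_trans (Hh n)); rewrite ler_wpM2l.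
have := discrete_gronwall (ltW (h0 n)) c_ge0 E0 (sqr_ge0 _) step (leqnn k).
rewrite {1}/u => /le_trans; apply; apply: ler_pM; rewrite ?expR_ge0//.
- by rewrite addr_ge0 ?sqr_ge0// mulr_ge0// mulr_ge0// ltW.
- apply: lerD; last by rewrite -/E ler_wpM2r.
  rewrite /u ler_pXn2r ?nnegrE ?nrm_ge0//; have [sv _] := wr_sq (measurable_tw r A00) (fun xi => tw_le r xi A00) wv.
  apply: le_nrm => //.
    apply: measurable_funM; first exact: measurable_tw.
    by apply: measurable_funM; [exact: measurable_bnl|exact: wr_meas wv].
  move=> xi; rewrite mulrCA normrM; apply: ler_piMl => //.
  by rewrite ger0_norm ?bnl_ge0// bnl_le1.
by rewrite ler_expR ler_wpM2l.
Qed.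

(** A discrete Gronwall estimate for the tail weight along the scheme, then semicontinuity. The tail
    at any time is controlled by that of the initial datum, uniformly in t. *)
Lemma limit_tail t A : 0 < A -> 0 <= t <= T ->
  nrm lb (fun xi => tw r A xi * V t xi) <=
  nrm lb (fun xi => tw r A xi * v xi) * Num.sqrt (expR (c * T)).
Proof.
move=> A00 tT; have [sV _] := HV tT; set X := nrm _ _ * _.
have X0 : 0 <= X by rewrite mulr_ge0 ?nrm_ge0 ?sqrtr_ge0.
have mt := measurable_tw r A00; have tl xi := tw_le r xi A00.
have [] // := lsc_weight Hr X0 mt tl sV _.
move=> e e0.
pose Q := T * (D * (C * N ^+ 2) ^+ 2) * expR (c * T).
have Q0 : 0 <= Q.
  apply: mulr_ge0; last exact: expR_ge0.
  by apply: mulr_ge0 => //; apply: mulr_ge0 => //; exact: sqr_ge0.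
pose d := Num.min e (e ^+ 2 / (Q + 1)).
have d0 : 0 < d by rewrite lt_min e0 divr_gt0 ?exprn_gt0// ltr_wpDl.
have [n [Hn Hi]] := close tT d0; have [wz _ nz] := ztime_props n tT.
exists (ztime n t); split; first exact: (wr_sq0 r0 wz).1.
- exact: (wr_sq mt tl wz).1.
- by apply: (le_trans Hn); rewrite ge_min lexx.
rewrite -(ler_pXn2r (ltn0Sn 1)) ?nnegrE ?nrm_ge0 ?addr_ge0 ?(ltW e0)//.
apply: (le_trans (ztime_tail n A00 tT)).
have -> : (X + e) ^+ 2 = nrm lb (fun xi => tw r A xi * v xi) ^+ 2 * expR (c * T) + e ^+ 2 + 2 * (X * e).
  by rewrite -[in RHS](sqr_sqrtr (expR_ge0 (c * T))) /X; ring.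
rewrite mulrDl -addrA lerD2l; apply: (@le_trans _ _ (e ^+ 2)); last first.
  by rewrite lerDl mulr_ge0// mulr_ge0// ltW.
have -> : T * (D * (C * N ^+ 2) ^+ 2 * (2 ^+ n)^-1) * expR (c * T) = Q * (2 ^+ n)^-1.
  by rewrite /Q; ring.
apply: (@le_trans _ _ (Q * (e ^+ 2 / (Q + 1)))).
  by rewrite ler_wpM2l//; apply: (le_trans Hi); rewrite ge_min lexx orbT.
rewrite mulrA ler_pdivrMr ?ltr_wpDl// mulrC ler_wpM2l ?sqr_ge0// lerDl//.
Qed.

Let step_nrm n j : j%:R * h n <= T -> nrm lb (fun xi => Y n j.+1 xi - Y n j xi) <= h n * (C * N ^+ 2).
Proof.
move=> jT; have [wy _ ny] := Hb jT; have hn0 := ltW (h0 n).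
have [sB nB] := bil_sq Ha Hr wy wy.
have -> : (fun xi => Y n j.+1 xi - Y n j xi) = (fun xi => h n * (bnl (L n) xi * bil a (Y n j) (Y n j) xi)).
  apply/funext => xi; have -> : Y n j.+1 xi = estep a (L n) (h n) (Y n j) xi by [].
  by rewrite /estep; ring.
have [mB _] := sB.
have m : measurable_fun setT (fun xi : plane R => bnl (L n) xi * bil a (Y n j) (Y n j) xi).
  by apply: measurable_funM => //; exact: measurable_bnl.
have le xi : `|bnl (L n) xi * bil a (Y n j) (Y n j) xi| <= `|bil a (Y n j) (Y n j) xi|.
  by rewrite normrM; apply: ler_piMl => //; rewrite ger0_norm ?bnl_ge0// bnl_le1.
rewrite (nrmZ _ (sq_le m le (sq_abs sB))) ger0_norm//; apply: ler_wpM2l => //.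
apply: (le_trans (le_nrm m le sB)); apply: (le_trans (bil_sq_le2 Ha Hr wy wy)).
by rewrite ler_wpM2l// expr2; apply: ler_pM => //; exact: nr_ge0.
Qed.

Let steps_nrm n j i : (j + i)%:R * h n <= T ->
  nrm lb (fun xi => Y n (j + i) xi - Y n j xi) <= i%:R * h n * (C * N ^+ 2).
Proof.
have sq_Y k : k%:R * h n <= T -> sq lb (Y n k).
  by move=> /Hb[wy _ _]; exact: (wr_sq0 r0 wy).1.
have less k : k.+1%:R * h n <= T -> k%:R * h n <= T.
  by apply: le_trans; rewrite ler_wpM2r ?(ltW (h0 n))// ler_nat.
elim: i => [|i IH] jT.
  rewrite addn0 !mul0r; have -> : (fun xi => Y n j xi - Y n j xi) = (fun=> 0).
    by apply/funext => xi; rewrite subrr.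
  by rewrite /nrm; under eq_Int do rewrite expr0n; rewrite Int0 sqrtr0.
rewrite addnS in jT *; have jT' := less _ jT.
have jT0 : j%:R * h n <= T.
  by apply: le_trans jT'; rewrite ler_wpM2r ?(ltW (h0 n))// ler_nat leq_addr.
apply: (le_trans (nrm_dist (sq_Y _ jT) (sq_Y _ jT') (sq_Y _ jT0))).
apply: (le_trans (lerD (step_nrm jT') (IH jT'))).
by rewrite -natr1; apply: eq_lexx; ring.
Qed.

(** One step moves the iterate by at most h C N^2 in L^2; the grid times differ from s and t by less
    than the mesh, which disappears in the limit. *)
Lemma limit_lip s t : 0 <= s -> s <= t -> t <= T ->
  nrm lb (fun xi => V t xi - V s xi) <= C * N ^+ 2 * (t - s).
Proof.
move=> s0 st tT; have sI : 0 <= s <= T by rewrite s0 (le_trans st).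
have tI : 0 <= t <= T by rewrite (le_trans s0)//.
have [sVt Ht] := HV tI; have [sVs Hs] := HV sI.
apply: (@le_half_pow _ _ _ (2 * K + C * N ^+ 2 * D)) => n.
have [wt _ _] := ztime_props n tI; have [ws _ _] := ztime_props n sI.
have st' := (wr_sq0 r0 wt).1; have ss' := (wr_sq0 r0 ws).1.
have hn := h0 n.
set j := Num.truncn (s / h n); set k := Num.truncn (t / h n).
have jk : (j <= k)%N by apply: le_truncn; rewrite ler_wpM2r ?invr_ge0 ?(ltW hn).
have B := @steps_nrm n j (k - j); rewrite subnKC// in B.
have {B}B := B (ztime_index n tI); rewrite -/(ztime n t) -/(ztime n s) in B.
have gap : (k - j)%:R * h n <= (t - s) + h n.
  have /andP[k1 _] := truncn_itv (divr_ge0 (le_trans s0 st) (ltW hn)).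
  have /andP[_ j2] := truncn_itv (divr_ge0 s0 (ltW hn)).
  rewrite -/k ler_pdivlMr// in k1; rewrite -/j ltr_pdivrMr// -natr1 mulrDl mul1r in j2.
  by rewrite natrB// mulrBl; move: k1 j2; lra.
have b1 : nrm lb (fun xi => V t xi - V s xi) <= K / 2 ^+ n +
    (nrm lb (fun xi => ztime n t xi - ztime n s xi) + K / 2 ^+ n).
  apply: (le_trans (nrm_dist sVt st' sVs)); apply: lerD => //.
  apply: (le_trans (nrm_dist st' ss' sVs)); rewrite lerD2l.
  apply: le_trans (Hs n); rewrite -nrmN; apply: eq_lexx; apply: eq_nrm => xi; exact: opprB.
have b2 : nrm lb (fun xi => ztime n t xi - ztime n s xi) <=
    ((t - s) + D / 2 ^+ n) * (C * N ^+ 2).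
  apply: (le_trans B); rewrite ler_wpM2r//; apply: (le_trans gap); rewrite lerD2l.
  by apply: (le_trans (mesh_le n)); rewrite ler_wpM2l.
apply: (le_trans b1); apply: (le_trans (lerD (lexx _) (lerD b2 (lexx _)))).
by apply: eq_lexx; ring.
Qed.

Lemma limit_init : nrm lb (fun xi => V 0 xi - v xi) = 0.
Proof.
have I0 : 0 <= (0 : R) <= T by rewrite lexx T00.
have [sV HV0] := HV I0; have sv := (wr_sq0 r0 wv).1; have mv := wr_meas wv.
apply/eqP; rewrite eq_le nrm_ge0 andbT; apply: (@le_half_pow _ _ _ (K + A0)) => n.
rewrite add0r mulrDl; have [wz _ _] := ztime_props n I0; have sz := (wr_sq0 r0 wz).1.
apply: (le_trans (nrm_dist sV sz sv)); apply: lerD => //.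
have L0 : 0 < L n by exact: lt_le_trans (L1 n).
have [se ne] := wr_enorm_sq Hr wv.
apply: (@le_trans _ _ (nrm lb (fun xi => (L n)^-1 * (enorm xi * v xi)))); last first.
  rewrite nrmZ// ger0_norm ?invr_ge0 ?(ltW L0)// mulrC.
  by apply: ler_pM; rewrite ?nrm_ge0 ?invr_ge0 ?(ltW L0).
apply: le_nrm; last exact: sqZ.
  by apply: measurable_funB => //; case: sz.
move=> xi; rewrite distrC /ztime mul0r truncn0 /euler /=.
apply: (le_trans (bnl_tail xi (v xi) L0)).
by rewrite !normrM (ger0_norm (enorm_ge0 _)) ger0_norm ?invr_ge0 ?(ltW L0).
Qed.

Let tw_cvg0 : nrm lb (fun xi => tw r n.+1%:R xi * v xi) @[n --> \oo] --> (0 : R).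
Proof.
have n0 n : 0 < n.+1%:R :> R by rewrite ltr0n.
apply: (@nrm_cvg0 _ _ _ lb _ (fun xi => rho r xi * v xi)).
- by move=> n; exact: (wr_sq (measurable_tw r (n0 n)) (fun xi => tw_le r xi (n0 n)) wv).1.
- exact: wv.
- move=> n xi; rewrite !normrM ler_wpM2r// (le_trans (tw_le _ _ _))// ler_norm//.
move=> xi; pose q := rho r xi * enorm xi.
have le n : `|tw r n.+1%:R xi| <= q * harmonic n.
  have q0 : 0 <= q by rewrite mulr_ge0 ?enorm_ge0// ltW// rho_gt0.
  rewrite ger0_norm ?sqrtr_ge0// -(ler_pXn2r (ltn0Sn 1)) ?nnegrE ?sqrtr_ge0 ?(mulr_ge0 q0) ?invr_ge0//.
  rewrite sqr_tw// /Wt add0r /q exprMn exprMn sqr_rho /jap -mulrA; apply: ler_wpM2l; first exact: powR_ge0.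
  apply: ler_wpM2l; first exact: sqr_ge0.
  rewrite exprVn lef_pV2 ?posrE ?exprn_gt0// ?lerDl ?sqr_ge0//.
  by rewrite ltr_wpDr ?sqr_ge0// exprn_gt0.
have hq : q * harmonic n @[n --> \oo] --> q * 0 by apply: cvgM; [exact: cvg_cst|exact: cvg_harmonic].
rewrite mulr0 in hq.
have t0 : tw r n.+1%:R xi @[n --> \oo] --> (0 : R).
  apply/norm_cvg0P; apply: (squeeze_cvgr _ (cvg_cst 0) hq).
  by apply: nearW => n; rewrite normr_ge0 le.
by rewrite -(mul0r (v xi)); apply: cvgM => //; exact: cvg_cst.
Qed.

(** [rho_tw] splits the weight: the tail is small for A large, uniformly in time, and the rest is
    controlled by the L^2 Lipschitz bound with a constant that is fixed once A is. *)
Lemma limit_cont e : 0 < e -> exists2 d, 0 < d & forall s t, 0 <= s -> s <= t -> t <= T ->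
  t - s <= d -> nr r (fun xi => V t xi - V s xi) <= e.
Proof.
move=> e0; pose g := Num.sqrt (expR (c * T)).
have g0 : 0 <= g by exact: sqrtr_ge0.
have e1 : 0 < e / (4 * (g + 1)) by rewrite divr_gt0// mulr_gt0// ltr_wpDl.
have [n Hn] : exists n, nrm lb (fun xi => tw r n.+1%:R xi * v xi) <= e / (4 * (g + 1)).
  move/cvgr0Pnorm_le : tw_cvg0 => /(_ _ e1)[n _ /(_ n (leqnn n))/= H].
  by exists n; rewrite ger0_norm ?nrm_ge0 in H.
pose A : R := n.+1%:R; have A00 : 0 < A by rewrite ltr0n.
pose Q := (1 + A ^+ 2) `^ r; have Q0 : 0 <= Q by exact: powR_ge0.
pose M := Num.sqrt Q * (C * N ^+ 2).
have M0 : 0 <= M by rewrite mulr_ge0 ?sqrtr_ge0.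
exists (e / (2 * (M + 1))); first by rewrite divr_gt0// mulr_gt0// ltr_wpDl.
move=> s t s0 st tT ts; have sI : 0 <= s <= T by rewrite s0 (le_trans st).
have tI : 0 <= t <= T by rewrite (le_trans s0)//.
have [wt _] := limit_wr tI; have [ws _] := limit_wr sI.
pose f xi := V t xi - V s xi.
have wf : wr r f by have := wrD wt (wrZ (-1) ws); congr wr; apply/funext => xi; rewrite /f; ring.
have [sf _] := wr_sq0 r0 wf; have [mf If] := sf.
have mt := measurable_tw r A00; have tl xi := tw_le r xi A00.
have [stf _] := wr_sq mt tl wf; have [_ Itf] := stf.
have tail : nrm lb (fun xi => tw r A xi * f xi) <= e / 2.
  have [st' _] := wr_sq mt tl wt; have [ss' _] := wr_sq mt tl ws.
  have -> : nrm lb (fun xi => tw r A xi * f xi) =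
    nrm lb (fun xi => tw r A xi * V t xi - tw r A xi * V s xi).
    by apply: eq_nrm => xi; rewrite /f; ring.
  apply: (le_trans (nrmB st' ss')).
  apply: (le_trans (lerD (limit_tail A00 tI) (limit_tail A00 sI))).
  have b : nrm lb (fun xi => tw r A xi * v xi) * g <= e / 4.
    apply: (@le_trans _ _ (e / (4 * (g + 1)) * (g + 1))).
      by apply: ler_pM => //; [exact: nrm_ge0|rewrite lerDl].
    by apply: eq_lexx; field; rewrite gt_eqF// ltr_wpDl.
  by apply: (le_trans (lerD b b)); apply: eq_lexx; field.
have low : Num.sqrt Q * nrm lb f <= e / 2.
  apply: (@le_trans _ _ (M * (e / (2 * (M + 1))))).
    apply: (@le_trans _ _ (Num.sqrt Q * (C * N ^+ 2 * (t - s)))).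
      by rewrite ler_wpM2l ?sqrtr_ge0//; exact: limit_lip.
    by rewrite mulrA ler_wpM2l.
  have -> : M * (e / (2 * (M + 1))) = e / 2 * (M / (M + 1)).
    by field; rewrite gt_eqF// ltr_wpDl.
  by apply: ler_piMr; [rewrite divr_ge0// ltW|rewrite ler_pdivrMr ?ltr_wpDl// mul1r lerDl].
have H : nr r f ^+ 2 <= Q * nrm lb f ^+ 2 + 2 * nrm lb (fun xi => tw r A xi * f xi) ^+ 2.
  have [_ Irf] := wf; rewrite /nr !sqr_nrm -!IntZ// -IntD; [|exact: itgZ|exact: itgZ].
  apply: le_Int => //; first by apply: itgD; exact: itgZ.
  move=> xi; have -> : (rho r xi * f xi) ^+ 2 = rho r xi ^+ 2 * f xi ^+ 2 by ring.
  have -> : Q * f xi ^+ 2 + 2 * (tw r A xi * f xi) ^+ 2 = (Q + 2 * tw r A xi ^+ 2) * f xi ^+ 2 by ring.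
  apply: ler_wpM2r; first exact: sqr_ge0.
  exact: rho_tw.
rewrite -(ler_pXn2r (ltn0Sn 1)) ?nnegrE ?nr_ge0 ?(ltW e0)//; apply: (le_trans H).
have e20 : 0 <= e / 2 by rewrite divr_ge0// ltW.
have h1 : Q * nrm lb f ^+ 2 <= (e / 2) ^+ 2.
  rewrite -(sqr_sqrtr Q0) -exprMn; apply: lerXn2r => //; rewrite nnegrE//.
  by rewrite mulr_ge0 ?sqrtr_ge0 ?nrm_ge0.
have h2 : nrm lb (fun xi => tw r A xi * f xi) ^+ 2 <= (e / 2) ^+ 2.
  by apply: lerXn2r => //; rewrite nnegrE// nrm_ge0.
apply: (le_trans (lerD h1 (ler_wpM2l (ler0n _ 2) h2))).
have -> : (e / 2) ^+ 2 + 2 * (e / 2) ^+ 2 = 3 / 4 * e ^+ 2 by field.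
by apply: ler_piMl; [exact: sqr_ge0|lra].
Qed.

End euler_limit.

(** * Pointwise continuity of the nonlinearity *)

Section velocity_continuity.
Context {R : realType}.
Let lb := @lb2 R.
Implicit Types (x xi z : R * R) (f g : R * R -> R).
Variables (a r : R).
Hypotheses (Ha : 0 < a < 1 / 2) (Hr : 3 < r).

(** One norm that dominates, at every point, the function, its first derivatives and the velocity it
    generates. *)
Definition ln1 f : R := Int lb (fun z => ka a z * `|f z|) + Int lb (fun z => enorm z * `|f z|) +
  Int lb (fun z => `|f z|).

Let r0 : 0 <= r. Proof. by apply/ltW/(lt_trans _ Hr). Qed.
Let a12 : a < 1 / 2. Proof. by case/andP: Ha. Qed.
Let K0 f : 0 <= Int lb (fun z => ka a z * `|f z|).
Proof. by apply: Int_ge0 => z; rewrite mulr_ge0 ?ka_ge0. Qed.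
Let E0 f : 0 <= Int lb (fun z => enorm z * `|f z|).
Proof. by apply: Int_ge0 => z; rewrite mulr_ge0 ?enorm_ge0. Qed.
Let O0 f : 0 <= Int lb (fun z => `|f z|). Proof. exact: Int_ge0. Qed.

Lemma ln1_le f : wr r f -> ln1 f <= (ca a + 3 * crs r) * nr r f.
Proof.
move=> wf; apply: (le_trans (lerD (lerD (wr_ka Ha Hr wf).2 (wr_itg1 Hr wf).2) (wr_itg0 Hr wf).2)).
by apply: eq_lexx; ring.
Qed.

(** An Ehrling-type inequality: Cauchy-Schwarz below frequency A, and above it a factor |xi| / A is
    traded for the H^r norm. Thus L^2 convergence with bounded H^r norms makes the nonlinearity
    converge pointwise. *)
Lemma ln1_interp (e : R) : 0 < e ->
  exists2 C, 0 <= C & forall f, wr r f -> ln1 f <= C * nrm lb f + e * nr r f.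
Proof.
move=> e0; pose A : R := 4 * crs r / e + 1.
have A0 : 0 < A by rewrite ltr_wpDl// divr_ge0 ?(ltW e0)// mulr_ge0 ?crs_ge0.
have Ae : A^-1 * (4 * crs r) <= e.
  rewrite mulrC ler_pdivrMr//; have -> : e * A = 4 * crs r + e by rewrite /A; field; rewrite gt_eqF.
  by rewrite lerDl ltW.
pose Q := Num.sqrt (@cball R) * A; have Q0 : 0 <= Q by rewrite mulr_ge0 ?sqrtr_ge0// ltW.
exists (ca a + 2 * ((1 + A) * Q)).
  by rewrite addr_ge0 ?ca_ge0// mulr_ge0// mulr_ge0// addr_ge0// ltW.
move=> f wf; have [sf _] := wr_sq0 r0 wf; have mf := wr_meas wf.
have [I0 b0] := wr_itg0 Hr wf; have [I1 b1] := wr_itg1 Hr wf.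
have [I2 b2] := @wr_enorm_itg _ _ Hr 2 f erefl wf.
have [_ bk] := itg_ka Ha sf I0.
have J0 := itg_abs I0; have J1 := itg_wabs (@enorm_ge0 R) I1.
have J2 : itg lb (fun z => enorm z ^+ 2 * `|f z|) := itg_wabs (fun z => sqr_ge0 (enorm z)) I2.
have Jb := sqM_itg (sq_bnl A) (sq_abs sf).
set P0 := Int lb (fun z => `|f z|) in bk b0 *.
set P1 := Int lb (fun z => enorm z * `|f z|) in b1 *.
set P2 := Int lb (fun z => enorm z ^+ 2 * `|f z|) in b2.
have bb : Int lb (fun z => bnl A z * `|f z|) <= Q * nrm lb f.
  apply: le_trans (ler_norm _) _; apply: le_trans (cauchy_schwarz (sq_bnl _) (sq_abs sf)) _.
  by rewrite nrm_abs ler_wpM2r ?nrm_ge0// nrm_bnl.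
have t0 : P0 + P1 <= (1 + A) * Int lb (fun z => bnl A z * `|f z|) + A^-1 * (P1 + P2).
  rewrite /P0 /P1 /P2 -IntD// -IntD// -IntZ// -IntZ; last exact: itgD.
  rewrite -IntD; [|exact: itgZ|by apply: itgZ; exact: itgD].
  apply: le_Int; [exact: itgD|by apply: itgD; apply: itgZ => //; exact: itgD|move=> z].
  have -> : `|f z| + enorm z * `|f z| = (1 + enorm z) * `|f z| by ring.
  have -> : (1 + A) * (bnl A z * `|f z|) + A^-1 * (enorm z * `|f z| + enorm z ^+ 2 * `|f z|) =
    ((1 + A) * bnl A z + A^-1 * enorm z * (1 + enorm z)) * `|f z| by ring.
  apply: ler_wpM2r => //; rewrite /bnl; case: (leP (enorm z) A) => H /=.
    rewrite mulr1 -[leLHS]addr0; apply: lerD; first by rewrite lerD2l.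
    apply: mulr_ge0; last by rewrite addr_ge0 ?enorm_ge0.
    by apply: mulr_ge0; [rewrite invr_ge0 ltW|exact: enorm_ge0].
  rewrite mulr0 add0r; apply: ler_peMl; first by rewrite addr_ge0 ?enorm_ge0.
  by rewrite mulrC ler_pdivlMr// mul1r ltW.
have {}t0 : P0 + P1 <= (1 + A) * (Q * nrm lb f) + A^-1 * (2 * (crs r * nr r f)).
  apply: (le_trans t0); apply: lerD.
    by rewrite ler_wpM2l// addr_ge0// ltW.
  rewrite ler_wpM2l ?invr_ge0 ?(ltW A0)//.
  by apply: (le_trans (lerD b1 b2)); apply: eq_lexx; ring.
have Af := ler_wpM2r (nr_ge0 r f) Ae.
rewrite /ln1 -/P0 -/P1.
apply: (@le_trans _ _ (ca a * nrm lb f + 2 * (P0 + P1))).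
  have := O0 f; have := E0 f; rewrite -/P0 -/P1 => p0 p1; move: bk p0 p1.
  by set q := Int _ _; set q' := ca a * _; lra.
apply: (le_trans (lerD (lexx _) (ler_wpM2l (ler0n _ 2) t0))).
have -> : ca a * nrm lb f + 2 * ((1 + A) * (Q * nrm lb f) + A^-1 * (2 * (crs r * nr r f))) =
  (ca a + 2 * ((1 + A) * Q)) * nrm lb f + A^-1 * (4 * crs r) * nr r f by ring.
exact: lerD.
Qed.

Lemma inv_ln1 f x : wr r f -> `|inv f x| <= ln1 f.
Proof.
move=> wf; apply: (le_trans (normr_inv x (wr_itg0 Hr wf).1)).
by rewrite /ln1 lerDr addr_ge0.
Qed.

Let ugb k f x : wr r f -> `|inv (ug a k f) x| <= ln1 f.
Proof.
move=> wf; have [I _] := wr_ka Ha Hr wf; have [Iu Hu] := itg_ug k a12 (wr_meas wf) I.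
by apply: (le_trans (normr_inv x Iu)); apply: (le_trans Hu); rewrite /ln1 -addrA lerDl addr_ge0.
Qed.

Let dvb k f x : wr r f -> `|inv (dv k f) x| <= ln1 f.
Proof.
move=> wf; have [I _] := wr_itg1 Hr wf; have [Id Hd] := itg_dv k (wr_meas wf) I.
apply: (le_trans (normr_inv x Id)); apply: (le_trans Hd).
by rewrite /ln1 (addrC (Int _ _)) -addrA lerDl addr_ge0.
Qed.

Lemma inv_bil_lip f g (N : R) x : wr r f -> wr r g -> nr r f <= N -> nr r g <= N ->
  `|inv (bil a f f) x - inv (bil a g g) x| <=
  4 * ((ca a + 3 * crs r) * N) * ln1 (fun z => f z - g z).
Proof.
move=> wf wg Nf Ng; have wd := wrB wf wg; set M := _ * N; set l := ln1 _.
have M0 : 0 <= ca a + 3 * crs r by rewrite addr_ge0 ?ca_ge0// mulr_ge0 ?crs_ge0.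
have lf : ln1 f <= M by apply: (le_trans (ln1_le wf)); rewrite ler_wpM2l.
have lg : ln1 g <= M by apply: (le_trans (ln1_le wg)); rewrite ler_wpM2l.
have prod k : `|inv (ug a k f) x * inv (dv k f) x - inv (ug a k g) x * inv (dv k g) x| <= 2 * M * l.
  have eu : inv (ug a k f) x - inv (ug a k g) x = inv (ug a k (fun z => f z - g z)) x.
    rewrite -invB; [|exact: (wr_ug Ha Hr wf)|exact: (wr_ug Ha Hr wg)].
    by congr inv; apply/funext => z; rewrite /ug; ring.
  have ed : inv (dv k f) x - inv (dv k g) x = inv (dv k (fun z => f z - g z)) x.
    rewrite -invB; [|exact: (wr_dv Hr wf)|exact: (wr_dv Hr wg)].
    by congr inv; apply/funext => z; rewrite /dv; ring.
  have -> : inv (ug a k f) x * inv (dv k f) x - inv (ug a k g) x * inv (dv k g) x =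
    (inv (ug a k f) x - inv (ug a k g) x) * inv (dv k f) x +
    inv (ug a k g) x * (inv (dv k f) x - inv (dv k g) x) by ring.
  rewrite eu ed; apply: (le_trans (ler_normD _ _)).
  have -> : 2 * M * l = l * M + M * l by ring.
  rewrite (normrM (inv (ug a k _) x)) (normrM (inv (ug a k g) x)).
  by apply: lerD; apply: ler_pM => //; rewrite ?ugb ?dvb//;
    [exact: (le_trans (dvb k x wf))|exact: (le_trans (ugb k x wg))].
rewrite !(inv_bil Ha Hr)//.
have -> (p q p' q' : R) : - (p + q) - - (p' + q') = - ((p - p') + (q - q')) by ring.
rewrite normrN; apply: (le_trans (ler_normD _ _)); apply: (le_trans (lerD (prod true) (prod false))).
by apply: eq_lexx; ring.
Qed.

End velocity_continuity.

(** * Time derivative of the limit *)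

Section time_derivative.
Context {R : realType}.
Let lb := @lb2 R.
Implicit Types (x xi : R * R) (t s : R) (n j k : nat).

Lemma le_scaled_eps (x y c : R) : 0 <= c -> (forall e, 0 < e -> x <= y + c * e) -> x <= y.
Proof.
move=> c0 H; apply/ler_addgt0Pr => e e0.
apply: (le_trans (H (e / (c + 1)) _)); first by rewrite divr_gt0// ltr_wpDl.
by rewrite lerD2l mulrA ler_pdivrMr ?ltr_wpDl// mulrC ler_pM2l// lerDl.
Qed.

Lemma small_o_derive (f : R -> R) t (d : R) :
  (forall e, 0 < e -> exists2 del, 0 < del &
     forall h, `|h| < del -> `|f (t + h) - f t - h * d| <= `|h| * e) ->
  is_derive t 1 f d.
Proof.
move=> H.
have D : h^-1 *: (f (h *: 1 + t) - f t) @[h --> 0^'] --> d.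
  apply/cvgrPdist_le => e e0; have [del d0 Hd] := H e e0; near=> h.
  have h0 : h != 0 by near: h; exact: nbhs_dnbhs_neq.
  have hn : 0 < `|h| by rewrite normr_gt0.
  have -> : d - h^-1 *: (f (h *: 1 + t) - f t) = - h^-1 * (f (t + h) - f t - h * d).
    by rewrite /GRing.scale /= mulr1 (addrC h); field.
  rewrite normrM normrN normfV ler_pdivrMl//; apply: Hd.
  by near: h; exact: dnbhs0_lt.
by apply: DeriveDef; [apply/cvg_ex; exists d|apply: cvg_lim].
Unshelve. all: by end_near. Qed.

Variables (a r T N D K : R) (v : R * R -> R) (L h : nat -> R) (V : R -> plane R -> R).
Hypotheses (Ha : 0 < a < 1 / 2) (Hr : 3 < r) (T0 : 0 < T) (wv : wr r v) (D0 : 0 <= D).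
Hypotheses (L1 : forall n, 1 <= L n) (h0 : forall n, 0 < h n)
  (HL : forall n, (L n)^-1 <= (2 ^+ n)^-1)
  (Hh : forall n, h n * rhoL r (L n) ^+ 2 <= D * ((2 ^+ n)^-1) ^+ 2).
Let Y n := euler a (L n) (h n) v.
Let Z := ztime a v L h.
Hypothesis Hb : forall n j, j%:R * h n <= T ->
  [/\ wr r (Y n j), csup (L n) (Y n j) & nr r (Y n j) <= N].
Hypothesis HV : forall t, 0 <= t <= T -> sq lb (V t) /\
  forall n, nrm lb (fun xi => V t xi - Z n t xi) <= K / 2 ^+ n.

Let r0 : 0 <= r. Proof. by apply/ltW/(lt_trans _ Hr). Qed.
Let wV t : 0 <= t <= T -> wr r (V t) /\ nr r (V t) <= N.
Proof. exact: (limit_wr Hr T0 h0 Hb HV). Qed.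
Let pZ n t : 0 <= t <= T -> [/\ wr r (Z n t), csup (L n) (Z n t) & nr r (Z n t) <= N].
Proof. exact: ztime_props. Qed.
Let C := Cb a r.
Let C0 : 0 <= C. Proof. by rewrite mulr_ge0 ?sqr_ge0. Qed.
Let N0 : 0 <= N.
Proof. have [|_ _] := Hb (n := 0) (j := 0); first by rewrite mul0r ltW. exact: le_trans (nr_ge0 _ _). Qed.
Let M := 4 * ((ca a + 3 * crs r) * N).
Let M0 : 0 <= M.
Proof. by rewrite /M mulr_ge0// mulr_ge0// addr_ge0 ?ca_ge0// mulr_ge0 ?crs_ge0. Qed.
Let bt f x := inv (bil a f f) x.

(** Sum the Euler increments between the grid times of s and t; each one is h b up to h times Om and
    the errors of level n, which vanish in the end. The grid time of s can precede s by nearly one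
    step, whence the margin p. *)
Lemma limit_increment s t x (b Om p : R) : 0 <= s -> s <= t -> t <= T -> 0 < p ->
  (forall u, 0 <= u <= T -> s - p <= u <= t -> `|bt (V u) x - b| <= Om) ->
  `|inv (V t) x - inv (V s) x - (t - s) * b| <= (t - s) * Om.
Proof.
move=> s0 st tT p0 HO.
have sI : 0 <= s <= T by rewrite s0 (le_trans st).
have tI : 0 <= t <= T by rewrite (le_trans s0)//.
have Om0 : 0 <= Om.
  by apply: le_trans (HO s sI _); rewrite ?normr_ge0// st andbT gerBl ltW.
pose k2 := 1 + 2 * N; have k20 : 0 <= k2 by rewrite addr_ge0// mulr_ge0.
apply: (@le_scaled_eps _ _ (2 * k2 + 2 + T * (1 + M * k2))).
  by rewrite addr_ge0 ?addr_ge0// mulr_ge0 ?(ltW T0)// addr_ge0// mulr_ge0.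
move=> e e0; have [Ce Ce0 HC] := ln1_interp Ha Hr e0.
pose Q := Ce * `|K| + C * N ^+ 2 + D * (1 + `|b| + Om).
have CN0 : 0 <= C * N ^+ 2 by rewrite mulr_ge0 ?sqr_ge0.
have CK0 : 0 <= Ce * `|K| by rewrite mulr_ge0.
have DQ0 : 0 <= D * (1 + `|b| + Om) by rewrite mulr_ge0// !addr_ge0.
have Q0 : 0 <= Q by rewrite !addr_ge0.
pose m := Num.min e p; have m0 : 0 < m by rewrite lt_min e0.
have [n Hn] : exists n, Q * (2 ^+ n)^-1 <= m.
  exists (Num.bound (Q / m)); rewrite ler_pdivrMr ?exprn_gt0// mulrC -ler_pdivrMr//.
  apply: (le_trans (ltW (archi_boundP (divr_ge0 Q0 (ltW m0))))).
  by rewrite -natrX ler_nat ltnW// ltn_expl.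
have i0 : 0 <= (2 ^+ n)^-1 :> R by rewrite invr_ge0 exprn_ge0.
have Qe q : 0 <= q -> q <= Q -> q * (2 ^+ n)^-1 <= m.
  by move=> q0 qQ; apply: le_trans Hn; rewrite ler_wpM2r.
have me : m <= e by rewrite ge_min lexx.
have mp : m <= p by rewrite ge_min lexx orbT.
have hn := h0 n; have hD : h n <= D * (2 ^+ n)^-1.
  apply: (le_trans (mesh_le Hr h0 Hh n)); rewrite ler_wpM2l// expr2; apply: ler_piMr => //.
  by rewrite invf_le1 ?exprn_gt0// exprn_ege1// ler1n.
have hb q : 0 <= q -> q <= 1 + `|b| + Om -> h n * q <= m.
  move=> q0 qb; apply: (le_trans (ler_wpM2r q0 hD)); rewrite mulrAC; apply: Qe; first exact: mulr_ge0.
  by apply: (@le_trans _ _ (D * (1 + `|b| + Om))); [rewrite ler_wpM2l|rewrite /Q lerDr addr_ge0].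
have close u : 0 <= u <= T -> ln1 a (fun z => V u z - Z n u z) <= k2 * e.
  move=> uT; have [wVu NVu] := wV uT; have [wZ _ NZ] := pZ n uT; have [_ Hu] := HV uT.
  apply: (le_trans (HC _ (wrB wVu wZ))).
  have -> : k2 * e = e + e * (2 * N) by rewrite /k2; ring.
  apply: lerD.
    apply: (le_trans (ler_wpM2l Ce0 (Hu n))); apply: le_trans me.
    apply: (@le_trans _ _ (Ce * `|K| * (2 ^+ n)^-1)).
      by rewrite mulrA ler_wpM2r// ler_wpM2l// ler_norm.
    by apply: Qe => //; rewrite /Q -addrA lerDl addr_ge0.
  rewrite ler_wpM2l ?(ltW e0)//; apply: (le_trans (nrB wVu wZ)).
  by rewrite mulr_natl mulr2n lerD.
pose j := Num.truncn (s / h n); pose k := Num.truncn (t / h n).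
have /andP[k1 k1'] := truncn_itv (divr_ge0 (le_trans s0 st) (ltW hn)).
have /andP[j1 j1'] := truncn_itv (divr_ge0 s0 (ltW hn)).
rewrite -/k ler_pdivlMr// in k1; rewrite -/k ltr_pdivrMr// -natr1 mulrDl mul1r in k1'.
rewrite -/j ler_pdivlMr// in j1; rewrite -/j ltr_pdivrMr// -natr1 mulrDl mul1r in j1'.
have jk : (j <= k)%N by apply: le_truncn; rewrite ler_wpM2r ?invr_ge0 ?(ltW hn).
pose e' := e + M * (k2 * e).
have he0 : 0 <= e' by rewrite addr_ge0 ?(ltW e0)// mulr_ge0// mulr_ge0// ltW.
have hp : h n <= p by apply: le_trans mp; have := hb 1 ler01; rewrite mulr1; apply; rewrite -addrA lerDl addr_ge0.
have step l : (j <= l < k)%N -> `|inv (Y n l.+1) x - inv (Y n l) x - h n * b| <= h n * (Om + e').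
  move=> /andP[jl lk].
  have lt : l%:R * h n <= t by apply: le_trans k1; rewrite ler_wpM2r ?(ltW hn)// ler_nat ltnW.
  have sl : s - p <= l%:R * h n.
    rewrite lerBlDr; apply: (le_trans (ltW j1')); apply: lerD => //.
    by rewrite ler_wpM2r ?(ltW hn)// ler_nat.
  have lT := le_trans lt tT; have [wY _ NY] := Hb lT.
  have uI : 0 <= l%:R * h n <= T by rewrite lT andbT mulr_ge0// ltW.
  have [wVu NVu] := wV uI.
  have ZY : Z n (l%:R * h n) = Y n l by rewrite /Z /ztime mulfK ?gt_eqF// natrK.
  have -> : Y n l.+1 = estep a (L n) (h n) (Y n l) by [].
  rewrite (@inv_step _ a r (L n) (h n) _ Ha Hr wY).
  have -> (p' q' : R) : q' + h n * p' - q' - h n * b = h n * (p' - b) by ring.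
  rewrite (normrM (h n)) (ger0_norm (ltW hn)).
  rewrite ler_wpM2l ?(ltW hn)//.
  have IB := (bil_L1 Ha Hr wY wY).1.
  have IbB : itg lb (fun xi => bnl (L n) xi * bil a (Y n l) (Y n l) xi).
    by apply: sqM_itg; [exact: sq_bnl|exact: (bil_sq Ha Hr wY wY).1].
  have c1 := bil_cut Ha Hr (L1 n) wY x; rewrite (invB x IB IbB) in c1.
  have c2 := inv_bil_lip Ha Hr x wVu wY NVu NY; rewrite -ZY in c2.
  have c3 := HO _ uI; rewrite sl lt in c3; have {}c3 := c3 isT.
  have c1' : C * nr r (Y n l) ^+ 2 / L n <= e.
    apply: le_trans me; apply: (@le_trans _ _ (C * N ^+ 2 * (2 ^+ n)^-1)).
      apply: ler_pM => //; rewrite ?invr_ge0 ?(le_trans ler01 (L1 n))//.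
        by apply: mulr_ge0 => //; exact: sqr_ge0.
      by rewrite ler_wpM2l// ler_pXn2r ?nnegrE ?nr_ge0.
    by apply: Qe => //; rewrite /Q addrAC lerDr addr_ge0.
  have c2' : `|inv (bil a (V (l%:R * h n)) (V (l%:R * h n))) x - inv (bil a (Y n l) (Y n l)) x| <= M * (k2 * e).
    by rewrite -ZY; apply: (le_trans c2); rewrite ler_wpM2l// close.
  set B1 := inv (fun xi => bnl _ _ * _) x in c1 *; set B2 := inv (bil a (Y n l) (Y n l)) x in c1 c2' *.
  set B3 := inv (bil a (V _) _) x in c2'; rewrite /bt -/B3 in c3.
  have -> : B1 - b = - (B2 - B1) + (- (B3 - B2) + (B3 - b)) by ring.
  apply: (le_trans (ler_normD _ _)); rewrite normrN.
  apply: (le_trans (lerD (le_trans c1 c1') (ler_normD _ _))); rewrite normrN.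
  by apply: (le_trans (lerD (lexx e) (lerD c2' c3))); rewrite /e'; apply: eq_lexx; ring.
have steps i : (j + i <= k)%N ->
   `|inv (Y n (j + i)) x - inv (Y n j) x - i%:R * h n * b| <= i%:R * h n * (Om + e').
  elim: i => [|i IH] ik; first by rewrite addn0 subrr !mul0r subr0 normr0.
  have ik' : (j + i <= k)%N by apply: leq_trans ik; rewrite addnS.
  have := step (j + i)%N; rewrite leq_addr -addnS ik => /(_ isT) s1.
  have -> : inv (Y n (j + i.+1)) x - inv (Y n j) x - i.+1%:R * h n * b =
     (inv (Y n (j + i.+1)) x - inv (Y n (j + i)) x - h n * b) +
     (inv (Y n (j + i)) x - inv (Y n j) x - i%:R * h n * b) by rewrite -natr1; ring.
  apply: (le_trans (ler_normD _ _)); apply: (le_trans (lerD s1 (IH ik'))).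
  by rewrite -natr1; apply: eq_lexx; ring.
have := steps (k - j)%N; rewrite subnKC// => /(_ (leqnn _)).
have -> : Y n k = Z n t by []. have -> : Y n j = Z n s by [].
set w := (k - j)%:R * h n.
have wE : w = k%:R * h n - j%:R * h n by rewrite /w natrB// mulrBl.
have w1 : w <= t - s + h n by rewrite wE; move: k1 j1'; lra.
have w2 : t - s - h n <= w by rewrite wE; move: k1' j1; lra.
have w3 : w <= T.
  rewrite wE; apply: (@le_trans _ _ (k%:R * h n)); first by rewrite gerBl mulr_ge0// ltW.
  exact: le_trans k1 tT.
move=> S.
have dV u : 0 <= u <= T -> `|inv (V u) x - inv (Z n u) x| <= k2 * e.
  move=> uT; have [wVu _] := wV uT; have [wZ _ _] := pZ n uT.
  rewrite -(invB x (wr_itg0 Hr wVu).1 (wr_itg0 Hr wZ).1).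
  exact: le_trans (inv_ln1 a Hr x (wrB wVu wZ)) (close _ uT).
have S1 : `|(w - (t - s)) * b| <= e.
  rewrite normrM; apply: le_trans me; apply: (@le_trans _ _ (h n * `|b|)).
    by apply: ler_wpM2r => //; rewrite ler_norml; apply/andP; split; move: w1 w2; lra.
  by apply: hb => //; rewrite addrAC lerDr addr_ge0.
have S2 : w * (Om + e') <= (t - s) * Om + (e + T * e').
  have hOm : h n * Om <= e by apply: le_trans me; apply: hb => //; rewrite lerDr addr_ge0.
  rewrite mulrDr; apply: (le_trans (lerD (ler_wpM2r Om0 w1) (ler_wpM2r he0 w3))).
  by rewrite mulrDl -addrA lerD2l lerD2r.
have -> : inv (V t) x - inv (V s) x - (t - s) * b =
   (inv (V t) x - inv (Z n t) x) + (- (inv (V s) x - inv (Z n s) x)) +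
   (inv (Z n t) x - inv (Z n s) x - w * b) + (w - (t - s)) * b by ring.
apply: (le_trans (ler_normD _ _)).
apply: (le_trans (lerD (le_trans (ler_normD _ _) (lerD (le_trans (ler_normD _ _) (lerD (dV _ tI) (lexx _))) (le_trans S S2))) S1)).
rewrite normrN; apply: (le_trans (lerD (lerD (lerD (lexx _) (dV _ sI)) (lexx _)) (lexx _))).
by apply: eq_lexx; rewrite /e'; ring.
Qed.

Let lip s t : 0 <= s <= T -> 0 <= t <= T ->
  nrm lb (fun xi => V t xi - V s xi) <= C * N ^+ 2 * `|t - s|.
Proof.
have LL u w : 0 <= u -> u <= w -> w <= T -> nrm lb (fun xi => V w xi - V u xi) <= C * N ^+ 2 * (w - u).
  exact: (limit_lip Ha Hr D0 h0 Hh Hb HV).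
move=> /andP[s0 sT] /andP[t0 tT]; have [st|/ltW ts] := leP s t.
  by rewrite ger0_norm ?subr_ge0// LL.
rewrite distrC ger0_norm ?subr_ge0//; apply: le_trans (LL _ _ t0 ts sT).
by rewrite -nrmN; apply: eq_lexx; apply: eq_nrm => xi; rewrite opprB.
Qed.

(** Take for b the nonlinearity at time t: its oscillation over a short interval is small by
    [ln1_interp] and the L^2 Lipschitz bound in time. *)
Lemma limit_derive t x : 0 < t < T -> is_derive t 1 (fun s => inv (V s) x) (inv (bil a (V t) (V t)) x).
Proof.
move=> /andP[t0 tT]; apply: small_o_derive => e e0.
have tI : 0 <= t <= T by rewrite !ltW.
have e1 : 0 < e / (M * (1 + 2 * N) + 1) by rewrite divr_gt0// ltr_wpDl// mulr_ge0// addr_ge0// mulr_ge0.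
have [Ce Ce0 HC] := ln1_interp Ha Hr e1; move: e1 HC; set ee := e / _ => e1 HC.
pose Q := Ce * (C * N ^+ 2); have Q0 : 0 <= Q by rewrite mulr_ge0// mulr_ge0 ?sqr_ge0.
pose p := Num.min (ee / (Q + 1)) (Num.min t (T - t)).
have p0 : 0 < p by rewrite !lt_min t0 subr_gt0 tT andbT divr_gt0// ltr_wpDl.
have pt : p <= t by rewrite !ge_min lexx orbT.
have pT : p <= T - t by rewrite !ge_min lexx !orbT.
have near_b u : 0 <= u <= T -> `|u - t| <= p -> `|bt (V u) x - bt (V t) x| <= e.
  move=> uI ut; have [wu Nu] := wV uI; have [wt Nt] := wV tI.
  apply: (le_trans (inv_bil_lip Ha Hr x wu wt Nu Nt)); rewrite -/M.
  have b : ln1 a (fun z => V u z - V t z) <= (1 + 2 * N) * ee.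
    apply: (le_trans (HC _ (wrB wu wt))); rewrite mulrDl mul1r; apply: lerD.
      apply: (le_trans (ler_wpM2l Ce0 (lip tI uI))); rewrite mulrA -/Q.
      apply: (@le_trans _ _ (Q * (ee / (Q + 1)))).
        by rewrite ler_wpM2l//; apply: (le_trans ut); rewrite ge_min lexx.
      by rewrite mulrA ler_pdivrMr ?ltr_wpDl// mulrC ler_wpM2l ?(ltW e1)// lerDl.
    rewrite mulrC ler_wpM2r ?(ltW e1)//; apply: (le_trans (nrB wu wt)).
    by rewrite mulr_natl mulr2n lerD.
  apply: (le_trans (ler_wpM2l M0 b)); rewrite mulrA /ee.
  have q0 : 0 <= M * (1 + 2 * N) by rewrite mulr_ge0// addr_ge0// mulr_ge0.
  by rewrite mulrA ler_pdivrMr ?ltr_wpDl// mulrC ler_wpM2l ?(ltW e0)// lerDl.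
exists (p / 2); first by rewrite divr_gt0.
move=> d; rewrite ltr_norml => /andP[d1 d2].
have [d0|/ltW d0] := leP 0 d.
  have := @limit_increment t (t + d) x (bt (V t) x) e (p / 2) (ltW t0).
  have tE : t + d - t = d by ring.
  rewrite tE (ger0_norm d0); apply; rewrite ?lerDl//.
  - by move: d2 pT; lra.
  - by rewrite divr_gt0.
  move=> u uI /andP[u1 u2]; apply: near_b => //.
  by rewrite ler_norml; apply/andP; split; move: u1 u2 d2 p0; lra.
have := @limit_increment (t + d) t x (bt (V t) x) e (p / 2).
have -> : t - (t + d) = - d by ring.
move=> H; rewrite (ler0_norm d0).
have -> : inv (V (t + d)) x - inv (V t) x - d * inv (bil a (V t) (V t)) x =
  - (inv (V t) x - inv (V (t + d)) x - - d * bt (V t) x) by rewrite /bt; ring.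
rewrite normrN; apply: H; rewrite ?(ltW tT) ?gerDl//.
- by move: d1 pt p0; lra.
- by rewrite divr_gt0.
move=> u uI /andP[u1 u2]; apply: near_b => //.
by rewrite ler_norml; apply/andP; split; move: u1 u2 d1 p0; lra.
Qed.

End time_derivative.

(** * The solution on the Hartley side *)

Section solution.
Context {R : realType}.
Let lb := @lb2 R.

Lemma hartley_solution (r T : R) (v : R * R -> R) : 3 < r -> 0 < T -> wr r v ->
  exists2 a0, 0 < a0 <= 1 / 2 & forall a, 0 < a < a0 -> exists V : R -> R * R -> R,
  [/\ forall t, 0 <= t <= T -> wr r (V t), nrm lb (fun xi => V 0 xi - v xi) = 0,
    forall e, 0 < e -> exists2 d, 0 < d & forall s t, 0 <= s -> s <= t -> t <= T -> t - s <= d ->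
      nr r (fun xi => V t xi - V s xi) <= e &
    forall t x, 0 < t < T ->
      is_derive t 1 (fun s => inv (V s) x) (inv (bil a (V t) (V t)) x)].
Proof.
move=> Hr T0 wv; have r0 : 0 <= r by apply/ltW/(lt_trans _ Hr).
have [N [a0 [_ a00 a02 HB]]] := euler_bound Hr (ltW T0) wv.
exists a0 => [|a aI]; first by rewrite a00.
have Ha : 0 < a < 1 / 2 by case/andP: aI => -> /lt_le_trans ->.
have [delta d0 Hd] := HB a aI.
have [L [h [D [D0 L1 h0 Hn]]]] := levels r0 T0 d0.
have Hb n : forall j : nat, j%:R * h n <= T -> [/\ wr r (euler a (L n) (h n) v j),
    csup (L n) (euler a (L n) (h n) v j) & nr r (euler a (L n) (h n) v j) <= N].
  by have [l1 l2 _] := Hn n; apply: Hd => //; exact: ltW.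
have HL n : (L n)^-1 <= (2 ^+ n)^-1 by have [_ _ []] := Hn n.
have Hh n : h n * rhoL r (L n) ^+ 2 <= D * (2 ^+ n)^-1 ^+ 2 by have [_ _ []] := Hn n.
have LL n : L n <= L n.+1 by have [_ _ []] := Hn n.
have hm n : exists2 m : nat, (0 < m)%N & h n = m%:R * h n.+1 by have [_ _ []] := Hn n.
have [V HV] := ztime_cvg Ha Hr T0 wv D0 L1 h0 HL Hh LL hm Hb.
exists V; split.
- by move=> t tI; exact: (limit_wr Hr T0 h0 Hb HV tI).1.
- exact: (limit_init Hr T0 wv L1 h0 HL Hb HV).
- exact: (limit_cont Ha Hr T0 wv D0 L1 h0 Hh Hb HV).
exact: (limit_derive Ha Hr T0 D0 L1 h0 HL Hh Hb HV).
Qed.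

End solution.

(** * The Fourier transform in terms of the Hartley transform *)

Lemma ge0_int_le2 d (T : measurableType d) (R : realType) (mu : {measure set T -> \bar R})
    (u v w : T -> R) : measurable_fun setT u -> measurable_fun setT v ->
  measurable_fun setT w -> (forall x, 0 <= u x) -> (forall x, 0 <= v x) -> (forall x, 0 <= w x) ->
  (forall x, u x <= 2 * v x + 2 * w x) ->
  (\int[mu]_x (u x)%:E <= 2%:E * \int[mu]_x (v x)%:E + 2%:E * \int[mu]_x (w x)%:E)%E.
Proof.
move=> /measurable_EFinP mu_ /measurable_EFinP mv /measurable_EFinP mw u0 v0 w0 H.
have m2 (f : T -> R) : measurable_fun setT (EFin \o f) ->
    measurable_fun setT (fun x => 2%:E * (f x)%:E)%E.
  by move=> mf; exact: measurable_funeM.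
have p1 (f : T -> R) : (forall x, 0 <= f x) -> forall x, setT x -> (0 <= (f x)%:E)%E.
  by move=> f0 x _; rewrite lee_fin.
have p2 (f : T -> R) : (forall x, 0 <= f x) -> forall x, setT x -> (0 <= 2%:E * (f x)%:E)%E.
  by move=> f0 x _; rewrite -EFinM lee_fin mulr_ge0.
rewrite -!ge0_integralZl_EFin//; [|exact: p1|exact: p1].
rewrite -ge0_integralD//; [|exact: p2|exact: m2|exact: p2|exact: m2].
apply: ge0_le_integral => //; [exact: p1|by apply: emeasurable_funD; exact: m2|].
by move=> x _; rewrite -!EFinM -EFinD lee_fin.
Qed.

Section fourier_hartley.
Context {R : realType}.
Let lb := @lb2 R.
Implicit Types (f g : R * R -> R) (x xi : R * R).

Let Lnorm_sqr f : ('N[@leb2 R]_2%:E [EFin \o f] `^ 2%R = \int[leb2]_x (f x ^+ 2)%:E)%E.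
Proof.
rewrite (powR_Lnorm _ _ (lt0r_neq0 (ltr0Sn R 1))); apply: eq_integral => x _.
by rewrite /= powR_mulrn// real_normK// num_real.
Qed.

Lemma Lnorm_nrm f : sq lb f -> ('N[@leb2 R]_2%:E [EFin \o f])%E = (nrm lb f)%:E.
Proof.
move=> [mf If]; have := Lnorm_sqr f; rewrite -lb2E (IntE If) => E.
have : (('N[@leb2 R]_2%:E [EFin \o f] `^ 2%R) `^ 2^-1 = ('N[@leb2 R]_2%:E [EFin \o f]))%E.
  by rewrite -poweRrM mulfV// poweRe1// Lnorm_ge0.
rewrite -lb2E E => <-; rewrite poweR_EFin powR12_sqrt// Int_ge0// => x; exact: sqr_ge0.
Qed.

Lemma L2P f : L2 f <-> sq lb f.
Proof.
split=> [H|sf].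
  have mf : measurable_fun setT (f : plane R -> R).
    by move: H => /sub_Lfun_mfun; rewrite inE.
  split => //; apply: itg_ltyP; first exact: (measurable_funX 2).
    by move=> x; exact: sqr_ge0.
  have : ('N[@leb2 R]_2%:E [EFin \o f] < +oo)%E.
    by move: H => /sub_Lfun_finLfun; rewrite inE.
  by move=> /(@poweR_lty _ _ 2); rewrite Lnorm_sqr.
rewrite /L2 inE; apply/andP; split; first by rewrite inE; case: sf.
by rewrite inE /= /finite_norm Lnorm_nrm// ltry.
Qed.

(* [cas = cos + sin], so the Fourier transform of a real function is the even part of
   its Hartley transform minus [i] times the odd part. *)
Definition cplx_of_hart g xi : R[i] := ((g xi + g (- xi)) / 2 +i* ((g (- xi) - g xi) / 2))%C.

Lemma truncated_fourierE f (n : nat) xi : sq lb f ->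
  truncated_fourier f n xi = cplx_of_hart (hart (trn f n)) xi.
Proof.
move=> sf; have It := itg_trn n sf; have C1 := itg_cas xi It; have C2 := itg_cas (- xi) It.
have D (u : R -> R) :
    (\int[leb2]_(x in [set x : plane R | enorm x <= n%:R]) (f x * u (dot x xi)) =
    Int lb (fun x => trn f n x * u (dot x xi)))%R.
  rewrite /Int /Rintegral integral_mkcond; congr fine; apply: eq_integral => x _.
  rewrite patchE /trn /bnl; case: ifPn => [/set_mem /= ->|h]; first by rewrite /= mulr1.
  have /negbTE -> : ~~ (enorm x <= n%:R) by apply: contra h => e; exact: mem_set.
  by rewrite /= mulr0 mul0r.
have dN x : dot x (- xi) = - dot x xi by rewrite /dot /=; ring.
rewrite /truncated_fourier /Cintegral /cplx_of_hart /=; congr (_ +i* _)%C.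
  transitivity (Int lb (fun x => trn f n x * cos (dot x xi))).
    rewrite -(D cos).
    by apply: eq_Rintegral => x _; rewrite /expi /= cosN mul0r subr0.
  rewrite /hart -IntD// -IntZr//; last exact: itgD.
  by apply: eq_Int => x; rewrite dN /cas cosN sinN; field.
transitivity (Int lb (fun x => trn f n x * - sin (dot x xi))).
  rewrite -(D (fun t => - sin t)).
  by apply: eq_Rintegral => x _; rewrite /expi /= sinN mul0r addr0.
rewrite /hart -IntB// -IntZr//; last exact: itgB.
by apply: eq_Int => x; rewrite dN /cas cosN sinN; field.
Qed.

Lemma cplxB g h xi : cplx_of_hart g xi - cplx_of_hart h xi = cplx_of_hart (fun z => g z - h z) xi.
Proof. by rewrite /cplx_of_hart; congr (_ +i* _)%C; field. Qed.

Lemma sqr_normc (z : R[i]) : Normc.normc z ^+ 2 = complex.Re z ^+ 2 + complex.Im z ^+ 2.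
Proof. by case: z => p q /=; rewrite sqr_sqrtr// addr_ge0 ?sqr_ge0. Qed.

Lemma measurable_cplx g : measurable_fun setT (g : plane R -> R) ->
  measurable_fun setT (fun xi : plane R => complex.Re (cplx_of_hart g xi)) /\
  measurable_fun setT (fun xi : plane R => complex.Im (cplx_of_hart g xi)).
Proof.
move=> mg; have mo := measurable_comp_opp mg.
by split; apply: measurable_funM => //; [exact: measurable_funD|exact: measurable_funB].
Qed.

Lemma int_sqr_cplx g : sq lb g ->
  (\int[leb2]_xi ((Normc.normc (cplx_of_hart g xi)) ^+ 2)%:E)%E = (nrm lb g ^+ 2)%:E.
Proof.
move=> sg; have [mg Ig] := sg; have [mo Io] := mpres_sq (@mpres_opp R) sg.
have I1 : itg lb (fun xi => 2^-1 * (g xi ^+ 2 + g (- xi) ^+ 2)).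
  by apply: itgZ; exact: itgD.
have E : (fun xi => ((Normc.normc (cplx_of_hart g xi)) ^+ 2)%:E) =
    (fun xi => (2^-1 * (g xi ^+ 2 + g (- xi) ^+ 2))%:E).
  by apply/funext => xi; rewrite sqr_normc /=; congr EFin; field.
rewrite E (IntE I1) IntZ; last exact: itgD.
rewrite (IntD Ig Io) (mpres_Int (@mpres_opp R) Ig) sqr_nrm; congr EFin.
by set q := Int _ _; field.
Qed.

Lemma is_fourier_hart f g : hrel f g -> is_fourier f (cplx_of_hart g).
Proof.
move=> hfg; have [sf sg _] := hfg; have [mg _] := sg; have [m1 m2] := measurable_cplx mg.
split => //.
have E n : (\int[leb2]_xi ((Normc.normc (cplx_of_hart g xi - truncated_fourier f n xi)) ^+ 2)%:E)%E =
    (nrm lb (fun xi => g xi - hart (trn f n) xi) ^+ 2)%:E.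
  rewrite -int_sqr_cplx; last by apply: sqB => //; exact: (plancherel (itg_trn n sf) (sq_trn n sf)).1.
  by apply: eq_integral => xi _; rewrite truncated_fourierE// cplxB.
have -> : (fun n => \int[leb2]_xi ((Normc.normc (cplx_of_hart g xi - truncated_fourier f n xi)) ^+ 2)%:E)%E =
   EFin \o (fun n => nrm lb (fun xi => g xi - hart (trn f n) xi) ^+ 2) by apply/funext => n; rewrite E.
apply: cvg_EFin; first by apply: nearW.
have H := hrel_cvg hfg; have := cvgM H H; rewrite mulr0; exact.
Qed.

(** Both are L^2 limits of the same truncated transforms, so the integral of the squared modulus of
    their difference is 0. *)
Lemma is_fourier_ae f (G H : R * R -> R[i]) : sq lb f -> is_fourier f G -> is_fourier f H ->
  {ae lb, forall xi, G xi = H xi}.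
Proof.
move=> sf [mG1 mG2 cG] [mH1 mH2 cH].
pose d (A B : R * R -> R[i]) xi := Normc.normc (A xi - B xi) ^+ 2.
pose tf n := truncated_fourier f n.
have mtf n : measurable_fun setT (fun xi : plane R => complex.Re (tf n xi)) /\
    measurable_fun setT (fun xi : plane R => complex.Im (tf n xi)).
  have [[mh _] _] := plancherel (itg_trn n sf) (sq_trn n sf).
  have [h1 h2] := measurable_cplx mh.
  by rewrite /tf; split; under eq_fun do rewrite truncated_fourierE//.
have md A B : measurable_fun setT (fun xi : plane R => complex.Re (A xi)) ->
    measurable_fun setT (fun xi : plane R => complex.Im (A xi)) ->
    measurable_fun setT (fun xi : plane R => complex.Re (B xi)) ->
    measurable_fun setT (fun xi : plane R => complex.Im (B xi)) ->
    measurable_fun setT (d A B : plane R -> R).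
  move=> a1 a2 b1 b2.
  have -> : d A B = (fun xi => (complex.Re (A xi) - complex.Re (B xi)) ^+ 2 +
      (complex.Im (A xi) - complex.Im (B xi)) ^+ 2).
    by apply/funext => xi; rewrite /d sqr_normc; case: (A xi) (B xi) => [? ?] [? ?].
  by apply: measurable_funD; apply: (measurable_funX 2); exact: measurable_funB.
have d0 A B xi : 0 <= d A B xi by exact: sqr_ge0.
have mGH : measurable_fun setT (d G H : plane R -> R) by exact: md.
have le n : (\int[leb2]_xi (d G H xi)%:E <=
    2%:E * \int[leb2]_xi (d G (tf n) xi)%:E + 2%:E * \int[leb2]_xi (d H (tf n) xi)%:E)%E.
  have [t1 t2] := mtf n.
  have m1 : measurable_fun setT (d G (tf n) : plane R -> R) by exact: md.
  have m2 : measurable_fun setT (d H (tf n) : plane R -> R) by exact: md.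
  apply: ge0_int_le2 => // x; rewrite /d !sqr_normc.
  case: (G x) (H x) (tf n x) => [g1 g2] [h1 h2] [t3 t4] /=.
  by have := sqr_ge0 (g1 - t3 + (h1 - t3)); have := sqr_ge0 (g2 - t4 + (h2 - t4)); nra.
have z : (\int[leb2]_xi (d G H xi)%:E <= 0)%E.
  have c : (2%:E * \int[leb2]_xi (d G (tf n) xi)%:E + 2%:E * \int[leb2]_xi (d H (tf n) xi)%:E)%E
      @[n --> \oo] --> (2%:E * 0 + 2%:E * 0)%E.
    by apply: cvgeD; rewrite ?mule0//; rewrite -[X in _ --> X](mule0 2%:E); apply: cvgeZl.
  rewrite mule0 adde0 in c.
  rewrite -[X in (_ <= X)%E](cvg_lim _ c)//; apply: lime_ge; [exact: cvgP c|exact: nearW].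
have Id : itg lb (d G H) by apply: itg_ltyP => //; exact: (le_lt_trans z).
have E0 : Int lb (d G H) = 0.
  by apply/eqP; rewrite eq_le; apply/andP; split; [rewrite -lee_fin -IntE|exact: Int_ge0].
have := Int_eq0 Id (d0 G H) E0; apply: filterS => xi /eqP.
rewrite /d sqr_normc paddr_eq0 ?sqr_ge0// !sqrf_eq0 => /andP[/eqP e1 /eqP e2].
by move: e1 e2; case: (G xi) (H xi) => [? ?] [? ?] /= /subr0_eq -> /subr0_eq ->.
Qed.

(** [fourier] is an arbitrary choice among the limits; the existence of one built from [g] makes the
    choice legitimate, and uniqueness identifies it almost everywhere. *)
Lemma fourier_hart f g : hrel f g -> [/\
  measurable_fun setT (fun xi : plane R => complex.Re (fourier f xi)),
  measurable_fun setT (fun xi : plane R => complex.Im (fourier f xi)) &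
  {ae lb, forall xi, fourier f xi = cplx_of_hart g xi}].
Proof.
move=> hfg; have [sf _ _] := hfg; have F := is_fourier_hart hfg.
have X : is_fourier f (fourier f) by exact: (xgetPex (fun=> 0) (ex_intro _ _ F)).
by have [m1 m2 _] := X; split => //; exact: is_fourier_ae X F.
Qed.

End fourier_hartley.

(** * Sobolev norm, velocity and derivatives in terms of the Hartley transform *)

Section sobolev_hartley.
Context {R : realType}.
Let lb := @lb2 R.
Implicit Types (f g F V : R * R -> R) (x xi z : R * R) (r a : R).

Let aeF := ae_filter_ringOfSetsType lb.
Let pi2 : 0 < 2 * pi :> R. Proof. by rewrite mulr_gt0 ?pi_gt0. Qed.

Lemma hrel_scale_inv F g : hrel F g -> hrel (fun x => c0 * g x) F.
Proof.
move=> /hrel_inv/(hrelZ c0); congr (hrel _ _); apply/funext => x.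
by rewrite mulrA mulVf ?mul1r// expf_neq0// gt_eqF.
Qed.

(** The weight is real and even, so multiplication by it commutes with the passage from Hartley to
    Fourier; the norm follows from the isometry up to 2 pi. *)
Lemma bessel_hart r f F : hrel f F -> wr r F ->
  exists2 g, bessel r f g & ('N[@leb2 R]_2%:E [EFin \o g])%E = (nr r F / (2 * pi))%:E.
Proof.
move=> hf wF; have [G hG] := hrel_ex wF; have hg := hrel_scale_inv hG.
set g := fun x => c0 * G x in hg; have [sf _ _] := hf; have [sg _ _] := hg.
exists g; last first.
  by rewrite (Lnorm_nrm sg) /nr (hrel_nrm hg) mulrAC divff ?mul1r// gt_eqF.
split; [exact/L2P|exact/L2P|].
have [_ _ a1] := fourier_hart hf; have [_ _ a2] := fourier_hart hg.
rewrite -lb2E.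
apply: (@filterS2 _ _ aeF _ _ _ _ a1 a2) => xi -> ->; rewrite -/(jap xi) -/(rho r xi) /cplx_of_hart.
have -> : rho r (- xi) = rho r xi by rewrite /rho /jap enormN.
by apply/eqP; rewrite eq_complex /=; apply/andP; split; apply/eqP; field.
Qed.

(** The Hartley transform is the real part minus the imaginary part of the Fourier transform, so the
    relation defining [bessel] transfers to it almost everywhere. *)
Lemma sobolev_hart r f : sobolev r f -> exists2 F, hrel f F & wr r F.
Proof.
move=> [g [/L2P sf /L2P sg E]]; have [F hf] := hrel_ex sf; have [G hg] := hrel_ex sg.
exists F => //; have [_ [mF _] _] := hf; have [_ [mG IG] _] := hg.
have [_ _ a1] := fourier_hart hf; have [_ _ a2] := fourier_hart hg.
have m : measurable_fun setT (fun xi : plane R => rho r xi * F xi).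
  by apply: measurable_funM => //; exact: measurable_rho.
split => //; apply: itg_ae_eq IG; first exact: (measurable_funX 2).
have H3 : {ae lb, forall xi, G xi = rho r xi * F xi}.
  rewrite -lb2E in E; apply: (@filterS3 _ _ aeF _ _ _ _ _ a1 a2 E) => xi e1 e2; rewrite e1 e2 -/(jap xi) -/(rho r xi) => /eqP.
  rewrite eq_complex /= => /andP[/eqP p1 /eqP p2].
  have -> : G xi = (G xi + G (- xi)) / 2 - (G (- xi) - G xi) / 2 by field.
  by rewrite p1 p2; field.
by apply: (@filterS _ _ aeF _ _ _ H3) => xi ->.
Qed.

Lemma sobolev_norm_hart r f F : hrel f F -> wr r F ->
  (0 <= sobolev_norm r f <= (nr r F / (2 * pi))%:E)%E.
Proof.
move=> hf wF; apply/andP; split.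
  by apply: le_ereal_inf_tmp => _ [g _ <-]; exact: Lnorm_ge0.
have [g bg <-] := bessel_hart hf wF; apply: ereal_inf_lbound; exists g => //.
Qed.

Lemma Re_velocity (c t : R) (z : R[i]) : complex.Re ('i * c%:C%C * z * expi t) =
  - c * (complex.Re z * sin t + complex.Im z * cos t).
Proof. by case: z => A B; rewrite /expi /=; ring. Qed.

(** The integrand of the real part of the inverse Fourier integral is the average over xi and - xi
    of the Hartley integrand; [perp xi] is - [sg], and the factor i turns this sign around. *)
Lemma velocity_hart a r f V x : 0 < a < 1 / 2 -> 3 < r -> hrel f V -> wr r V ->
  velocity a f x = (inv (ug a true V) x, inv (ug a false V) x).
Proof.
move=> Ha Hr hf wV; have [m1 m2 ae1] := fourier_hart hf.
have mx : measurable_fun setT (fun xi : plane R => dot x xi) := measurable_dotl x.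
have msym : measurable_fun setT (fun xi : plane R => enorm xi `^ (- 2 + 2 * a)).
  by apply: measurable_powRl; exact: measurable_enorm.
have K k (m : R * R -> R) : (forall xi, m xi = - sg k xi) ->
    (2 * pi) ^- 2 * complex.Re (Cintegral setT (fun xi => 'i * (m xi * enorm xi `^ (- 2 + 2 * a))%:C%C *
      fourier f xi * expi (dot x xi))) = inv (ug a k V) x.
  move=> mE; rewrite /inv /c0; congr (_ * _); rewrite /Cintegral /= /hart.
  have Iu := itg_cas x (wr_ug Ha Hr wV k).
  have Io : itg lb (fun xi => ug a k V (- xi) * cas (dot (- xi) x)).
    exact: (mpres_itg (@mpres_opp R) Iu).
  have E2 := mpres_Int (@mpres_opp R) Iu.
  transitivity (Int lb (fun xi => sg k xi * enorm xi `^ (- 2 + 2 * a) *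
     (complex.Re (cplx_of_hart V xi) * sin (dot x xi) + complex.Im (cplx_of_hart V xi) * cos (dot x xi)))).
    have [_ [mV _] _] := hf; have [h1 h2] := measurable_cplx mV.
    have tr A B : measurable_fun setT (A : plane R -> R) -> measurable_fun setT (B : plane R -> R) ->
        measurable_fun setT (fun xi : plane R => sg k xi * enorm xi `^ (- 2 + 2 * a) *
          (A xi * sin (dot x xi) + B xi * cos (dot x xi))).
      move=> mA mB; apply: measurable_funM.
        by apply: measurable_funM => //; exact: measurable_sg.
      apply: measurable_funD; apply: measurable_funM => //.
        exact: (measurableT_comp (@measurable_sin R)).
      exact: (measurableT_comp (@measurable_cos R)).
    rewrite -/(Int _ _); transitivity (Int lb (fun xi => sg k xi * enorm xi `^ (- 2 + 2 * a) *
       (complex.Re (fourier f xi) * sin (dot x xi) + complex.Im (fourier f xi) * cos (dot x xi)))).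
      by apply: eq_Int => xi; rewrite Re_velocity mE; ring.
    by apply: Int_ae_eq; [exact: tr|exact: tr|apply: (@filterS _ _ aeF _ _ _ ae1) => xi ->].
  transitivity (Int lb (fun xi => 2^-1 * (ug a k V xi * cas (dot xi x) +
      ug a k V (- xi) * cas (dot (- xi) x)))).
    apply: eq_Int => xi; rewrite /cplx_of_hart /ug /cas /= sgN enormN opprK dotC.
    have -> : dot (- xi) x = - dot x xi by rewrite /dot /=; ring.
    by rewrite cosN sinN dotC; field.
  rewrite IntZ; last exact: itgD.
  by rewrite IntD// E2; field.
rewrite /velocity; congr pair; apply: K => xi; rewrite /sg /=; first by [].
by rewrite opprK.
Qed.

(** The remainder in [inv_taylor] is quadratic in the increment, which gives the differential itself
    and not only the partial derivatives. *)
Lemma inv_differentiable r V x : 3 < r -> wr r V ->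
  [/\ differentiable (inv V) x, 'D_((1, 0) : R * R) (inv V) x = inv (dv true V) x &
    'D_((0, 1) : R * R) (inv V) x = inv (dv false V) x].
Proof.
move=> Hr wV; set p := inv (dv true V) x; set q := inv (dv false V) x.
pose df (k : R * R) : R := k.1 * p + k.2 * q.
have lin : linear df by move=> c [u1 u2] [w1 w2]; rewrite /df /= /GRing.scale /=; ring.
pose dM := GRing.isLinear.Build _ _ _ _ _ lin.
pose L : {linear _ -> _} := HB.pack df dM.
have cL : continuous L.
  move=> k; apply: cvgD; apply: cvgM; [exact: cvg_fst|exact: cvg_cst|exact: cvg_snd|exact: cvg_cst].
have [I0 _] := wr_itg0 Hr wV; have [I1 _] := wr_itg1 Hr wV.
have [I2 _] := @wr_enorm_itg _ _ Hr 2 V erefl wV.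
pose Q : R := Int lb (fun z => enorm z ^+ 2 * `|V z|).
have Q0 : 0 <= Q by apply: Int_ge0 => z; rewrite mulr_ge0 ?sqr_ge0.
have tay k : `|inv V (k + x) - inv V x - df k| <= 10 * Q * `|k| ^+ 2.
  have := inv_taylor x (- k) I0 I1 I2; rewrite opprK (addrC x) enormN.
  have -> : inv V (k + x) - inv V x + ((- k).1 * p + (- k).2 * q) = inv V (k + x) - inv V x - df k.
    by rewrite /df /=; ring.
  move=> /le_trans; apply; rewrite -/Q.
  have e2 : enorm k ^+ 2 <= 2 * `|k| ^+ 2.
    have k1 : `|k.1| <= `|k| by rewrite prod_normE le_max lexx.
    have k2 : `|k.2| <= `|k| by rewrite prod_normE le_max lexx orbT.
    have n2 (u : R) : `|u| <= `|k| -> u ^+ 2 <= `|k| ^+ 2.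
      by move=> h; rewrite -(real_normK (num_real u)) ler_pXn2r ?nnegrE.
    by rewrite sqr_enorm mulr_natl mulr2n; apply: lerD; exact: n2.
  apply: (le_trans (ler_wpM2r Q0 (ler_wpM2l (ler0n _ 5) e2))); apply: eq_lexx; ring.
have small e : 0 < e -> \forall k \near (0 : R * R), `|inv V (k + x) - inv V x - df k| <= e * `|k|.
  move=> e0; have d0 : 0 < e / (10 * Q + 1) by rewrite divr_gt0// ltr_wpDl// mulr_ge0.
  have : \forall k \near (0 : R * R), `|k| < e / (10 * Q + 1).
    by move: (nbhs0_lt (V := (R * R)%type) d0).
  apply: filterS => k /ltW hk.
  apply: (le_trans (tay k)); rewrite expr2 mulrA ler_wpM2r//.
  apply: (le_trans (ler_wpM2l _ hk)); first by rewrite mulr_ge0.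
  by rewrite mulrA ler_pdivrMr ?ltr_wpDl ?mulr_ge0// mulrC ler_wpM2l ?(ltW e0)// lerDl.
have loc : inv V \o shift x = cst (inv V x) + L +o_ (0 : R * R) id.
  apply/eqaddoP => e e0; apply: filterS (small e e0) => k.
  have -> : (inv V \o shift x - (cst (inv V x) + L)) k = inv V (k + x) - inv V x - df k.
    by rewrite -addrA -opprD.
  by [].
have D : 'd (inv V) x = L :> (R * R -> R).
  exact: diff_unique.
have dV : differentiable (inv V) x by apply/diff_locallyP; rewrite D; split.
by split => //; rewrite deriveE// D /= /df /=; ring.
Qed.

End sobolev_hartley.

Theorem corollary1p5 (R : realType) (s : R) (omega0 : R * R -> R) :
  2 < s -> sobolev (s + 1) omega0 ->
  limf_esup (fun alpha : R => max_existence_time (s + 1) omega0 alpha) (0^'+)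
    = +oo%E.
Proof.
move=> s2 S0; set r := s + 1 in S0 *.
have Hr : 3 < r by rewrite /r; lra.
have [v hv wv] := sobolev_hart S0.
have pi2 : 0 < 2 * pi :> R by rewrite mulr_gt0 ?pi_gt0.
have sol (T : R) : 0 < T -> exists2 a0, 0 < a0 & forall a, 0 < a < a0 ->
    (T%:E <= max_existence_time r omega0 a)%E.
  move=> T0; have [a0 /andP[a00 a02] H] := hartley_solution Hr T0 wv.
  exists a0 => // a aI; have Ha : 0 < a < 1 / 2 by case/andP: aI => -> /lt_le_trans ->.
  have [V [wV V0 VC VD]] := H a aI.
  have hV t : 0 <= t <= T -> hrel (inv (V t)) (V t).
    move=> /wV w; apply: hrel_scale_inv; apply: hrel_L1; first exact: (wr_itg0 Hr w).1.
    by apply: (wr_sq0 _ w).1; apply/ltW/(lt_trans _ Hr).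
  apply: ereal_sup_ubound; exists T => //; split => //; exists (fun t => inv (V t)); split.
  - move=> t; rewrite in_itv /= => tI; split.
      by have [g bg _] := bessel_hart (hV t tI) (wV t tI); exists g.
    have bd e : 0 < e -> \forall t' \near within [set` `[0, T]] (nbhs t),
        (0 <= sobolev_norm r (inv (V t') \- inv (V t))%R <= e%:E)%E.
      move=> e0; have [d d0 Hd] := VC _ (mulr_gt0 e0 pi2).
      have : \forall t' \near t, `|t - t'| < d by exists d.
      apply: filterS => t' td; rewrite /= in_itv /= => tI'.
      have wd := wrB (wV t' tI') (wV t tI).
      have /andP[-> h] := sobolev_norm_hart (hrelB (hV t' tI') (hV t tI)) wd.
      rewrite /=; apply: (le_trans h); rewrite lee_fin ler_pdivrMr//.
      have [t0 tT] := andP tI; have [t0' tT'] := andP tI'.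
      have [le|/ltW le] := leP t t'.
        by apply: Hd => //; apply/ltW; rewrite distrC ger0_norm ?subr_ge0 in td.
      rewrite /nr -nrmN; have := Hd t' t t0' le tT.
      rewrite ger0_norm ?subr_ge0// in td => /(_ (ltW td)).
      by congr (_ <= _); apply: eq_nrm => xi; ring.
    (* Convergence in the extended reals: the norm is finite near t, and then its real value tends
       to 0. *)
    apply/fine_cvgP; split.
      apply: filterS (bd 1 ltr01) => t' /andP[b0 b1].
      by rewrite ge0_fin_numE// (le_lt_trans b1)// ltry.
    apply/cvgrPdist_le => e e0; apply: filterS (bd e e0) => t' /andP[b0 b1].
    have ff : sobolev_norm r (inv (V t') \- inv (V t)) \is a fin_num.
      by rewrite ge0_fin_numE// (le_lt_trans b1)// ltry.
    by rewrite sub0r normrN /= ger0_norm ?fine_ge0// -lee_fin fineK.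
  - have I0 : 0 <= (0 : R) <= T by rewrite lexx ltW.
    have hd := hrelB (hV 0 I0) hv; have [sd _ _] := hd.
    have : nrm (@lb2 R) (fun x => inv (V 0) x - omega0 x) = 0.
      (* By the isometry, equality of the transforms in L^2 becomes equality of the functions in
         L^2, hence almost everywhere. *)
      by apply/eqP; have := hrel_nrm hd; rewrite V0 => /esym/eqP; rewrite mulf_eq0 gt_eqF.
    move=> /(nrm_eq0 sd); apply: (@filterS _ _ (ae_filter_ringOfSetsType (@lb2 R))) => x.
    exact: subr0_eq.
  move=> t x tI; rewrite in_itv /= in tI; have tI' : 0 <= t <= T by case/andP: tI => /ltW -> /ltW ->.
  have D := VD t x tI; have [df D1 D2] := inv_differentiable x Hr (wV t tI').
  split; [exact: ex_derive|exact: df|].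
  rewrite derive_val (velocity_hart x Ha Hr (hV t tI') (wV t tI')) D1 D2 /=.
  by rewrite (inv_bil Ha Hr (wV t tI')) -addrA addNr.
(* The upper limit is the infimum, over the right neighbourhoods of 0, of suprema; each
   neighbourhood contains some alpha below the threshold attached to M. *)
rewrite /limf_esup; apply/eqP; rewrite -leye_eq; apply: le_ereal_inf_tmp => _ [A A0 <-].
rewrite leye_eq; apply/eqP; apply/eqyP => M M0.
have [a0 a00 H] := sol M M0.
have [a aA aI] : exists2 a, A a & 0 < a < a0.
  have [e e0 He] := A0.
  pose a := Num.min (e / 2) (a0 / 2).
  have a1 : 0 < a by rewrite lt_min !divr_gt0.
  exists a.
    apply: He => //=; rewrite sub0r normrN gtr0_norm// gt_min.
    by apply/orP; left; rewrite ltr_pdivrMr// mulr_natr mulr2n ltrDl.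
  rewrite a1 gt_min; apply/orP; right; by rewrite ltr_pdivrMr// mulr_natr mulr2n ltrDl.
apply: (le_trans (H a aI)); apply: ereal_sup_ubound; exists a => //.
Qed.
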